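(* Let $\boldsymbol{C}=\{C_{xy}\}_{(x,y)\in\mathcal{Z}}$ and $R$ satisfy Assumptions A and B of the context. Let $K$ be a closed subset of $\mathcal{P}(\mathcal{X})$ with $K=\overline{K^\circ}\neq\emptyset$ (closure and interior relative to $\mathcal{P}(\mathcal{X})$). Assume that on every compact subset of $K^c=\mathcal{P}(\mathcal{X})\setminus K$ the function $R$ is bounded from below by a positive constant. Then the sequence of functions $V_K^n$ converges uniformly to $V_K$, i.e. $$\lim_{n\to\infty}\ \sup_{\boldsymbol{m}\in\mathcal{P}^n(\mathcal{X})}\big|V_K^n(\boldsymbol{m})-V_K(\boldsymbol{m})\big|=0 .$$
   Context: State space. $\mathcal{X}=\{e_1,\dots,e_d\}$ is the set of standard unit vectors of $\mathbb{R}^d$; $\boldsymbol{\gamma}=\{\gamma_{xy}\}$ are the jump rates of an ergodic Markov jump process on $\mathcal{X}$; $\mathcal{Z}=\{(x,y)\in\mathcal{X}\times\mathcal{X}:\gamma_{xy}>0\}$; $\boldsymbol{v}_{xy}=y-x$. $\mathcal{P}(\mathcal{X})$ is the simplex of probability vectors $\boldsymbol{m}=(m_x)_{x\in\mathcal{X}}$ with the Euclidean topology, and $\mathcal{P}^n(\mathcal{X})=\mathcal{P}(\mathcal{X})\cap\frac1n\mathbb{Z}^d$. Assumption A. $R:\mathcal{P}(\mathcal{X})\to[0,\infty)$ is continuous, and for every $(x,y)\in\mathcal{Z}$, $C_{xy}:[0,\infty)\to[0,\infty]$ is convex, with (1) $u\mapsto uC_{xy}'(u)-u$ increasing (in the weak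 sense) on the maximal open interval where $C_{xy}$ is finite, and (2) $C_{xy}(1)=0$. Assumption B. For all $(x,y)\in\mathcal{Z}$: (1) there exists $p>0$ such that $\lim_{u\to0}u^{p+1}C_{xy}'(u)=-\infty$; (2) $\liminf_{u\to\infty}\{uC_{xy}'(u)-u\}\ge0$. Transformed cost. $\ell(q)=q\log q-q+1$ for $q\ge0$ ($\ell(0)=1$), and $F_{xy}(q)=\sup_{u\in(0,\infty)}\big[u\,\ell(q/u)-\gamma_{xy}C_{xy}(u/\gamma_{xy})\big]$, $q\ge0$. Stochastic problem. On the canonical probability space let $N^n_{xy}$, $(x,y)\in\mathcal{Z}$, be independent Poisson random measures on $[0,\infty)^2$ (time $s$, mark $r$) with intensity $n$ times Lebesgue measure, with the completed filtration generated by their values on sets $(0,s]\times A$, $s\le t$. $\mathcal{A}_b^{n,|\mathcal{Z}|}$ is the set of predictable $[0,\infty)^{|\mathcal{Z}|}$-valued processes each of whose components is uniformly bounded above and below by strictly positive constants. For $\boldsymbol{q}\in\mathcal{A}_b^{n,|\mathcal{Z}|}$ and $\boldsymbol{m}\in\mathcal{P}^n(\mathcal{X})$ let $\boldsymbol{\mu}$ be the unique càdlàg $\mathcal{P}^n(\mathcal{X})$-valued solution of $$\boldsymbol{\mu}(t)=\boldsymbol{m}+\sum_{(x,y)\in\mathcal{Z}}\boldsymbol{v}_{xy}\int_{(0,t]}\int_{[0,\infty)}1_{[0,\mu_x(s-)q_{xy}(s)]}(r)\,\frac1nN^n_{xy}(ds\,dr).$$ With $T_K=\inf\{t\ge0:\boldsymbol{\mu}(t)\in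 K\}$, $$V_K^n(\boldsymbol{m})=\inf_{\boldsymbol{q}\in\mathcal{A}_b^{n,|\mathcal{Z}|}}\mathbb{E}_{\boldsymbol{m}}\Big[\int_0^{T_K}\Big(\sum_{(x,y)\in\mathcal{Z}}\mu_x(t)F_{xy}(q_{xy}(t))+R(\boldsymbol{\mu}(t))\Big)dt\Big].$$ Deterministic problem. For $\boldsymbol{m}\in\mathcal{P}(\mathcal{X})$ let $\mathcal{T}_{\boldsymbol{m}}$ be the set of pairs $(\boldsymbol{\mu},\boldsymbol{q})$ with $\boldsymbol{\mu}:[0,\infty)\to\mathcal{P}(\mathcal{X})$ càdlàg, $\boldsymbol{q}:[0,\infty)\to[0,\infty)^{\mathcal{Z}}$ measurable, $\mu_xq_{xy}$ locally integrable for all $(x,y)\in\mathcal{Z}$, and $$\boldsymbol{\mu}(t)=\boldsymbol{m}+\sum_{(x,y)\in\mathcal{Z}}\boldsymbol{v}_{xy}\int_{[0,t)}\mu_x(s)q_{xy}(s)\,ds,\quad t\ge0.$$ Then, with $T_K=\inf\{t\in[0,\infty]:\boldsymbol{\mu}(t)\in K\}$, $$V_K(\boldsymbol{m})=\inf_{(\boldsymbol{\mu},\boldsymbol{q})\in\mathcal{T}_{\boldsymbol{m}}}\int_0^{T_K}\Big(\sum_{(x,y)\in\mathcal{Z}}\mu_x(t)F_{xy}(q_{xy}(t))+R(\boldsymbol{\mu}(t))\Big)dt.$$ Convention: $0\cdot\infty=0$. *)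

(* Defs.v *)
From HB Require Import structures.
From mathcomp Require Import all_boot all_order all_algebra.
From mathcomp Require Import all_classical all_reals all_analysis measurable_realfun.

Set Implicit Arguments.
Unset Strict Implicit.
Unset Printing Implicit Defensive.

Import Order.TTheory GRing.Theory Num.Theory.
Import numFieldNormedType.Exports.

Local Open Scope classical_set_scope.
Local Open Scope ring_scope.

(** The state e_x is identified with its index x : 'I_d; families indexed by
    pairs of states are functions on 'I_d * 'I_d of which only the values on
    [jumps gamma] (the set Z) matter. *)

Definition jumps (R : realType) (d : nat) (gamma : 'I_d -> 'I_d -> R) :
  pred ('I_d * 'I_d) := fun e => 0 < gamma e.1 e.2.

Definition jump_vector (R : realType) (d : nat) (e : 'I_d * 'I_d) : 'rV[R]_d :=
  delta_mx ord0 e.2 - delta_mx ord0 e.1.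

(** For a Markov jump process on a finite set, ergodicity is irreducibility.
    The condition on the diagonal allows both usual conventions,
    gamma x x = 0 and gamma x x = - \sum_(y != x) gamma x y. *)
Definition ergodic_rates (R : realType) (d : nat) (gamma : 'I_d -> 'I_d -> R) :=
  [/\ forall x y, x != y -> 0 <= gamma x y,
      forall x, gamma x x <= 0 &
      forall x y, connect (fun a b => 0 < gamma a b) x y].

Definition prob_simplex (R : realType) (d : nat) : set 'rV[R]_d :=
  [set m | (forall x, 0 <= m ord0 x) /\ \sum_x m ord0 x = 1].

Definition prob_grid (R : realType) (d n : nat) : set 'rV[R]_d :=
  [set m | prob_simplex m /\ forall x, n%:R * m ord0 x \is a Num.int].

(** The derivative C' of a convex C : [0,oo) -> [0,oo] with C 1 = 0. It is the
    right derivative, which always exists and is C'(u) wherever C is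
    differentiable; outside the (convex) set where C is finite, which contains
    1, it is extended by -oo to the left and by +oo to the right. *)
Definition cost_derive (R : realType) (C : R -> \bar R) (u : R) : \bar R :=
  if C u \is a fin_num then
    lim ((fun h : R => (h^-1)%:E * (C (u + h)%R - C u))%E @ 0^'+)
  else if u < 1 then -oo%E else +oo%E.

Definition convex_cost (R : realType) (C : R -> \bar R) : Prop :=
  (forall u, 0 <= u -> (0 <= C u)%E) /\
  (forall u v t : R, 0 <= u -> 0 <= v -> 0 <= t <= 1 ->
    (C (t * u + (1 - t) * v)%R <= t%:E * C u + (1 - t)%:E * C v)%E).

Definition cost_dom (R : realType) (C : R -> \bar R) : set R :=
  [set u | 0 <= u /\ (C u < +oo)%E].

Definition assumptionA (R : realType) (d : nat) (gamma : 'I_d -> 'I_d -> R)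
    (C : 'I_d * 'I_d -> R -> \bar R) (r : 'rV[R]_d -> R) : Prop :=
  [/\ {within @prob_simplex R d, continuous r},
      forall m, prob_simplex m -> 0 <= r m &
      forall e, jumps gamma e ->
        [/\ convex_cost (C e),
            forall u v, (cost_dom (C e))° u -> (cost_dom (C e))° v -> u <= v ->
              (u%:E * cost_derive (C e) u - u%:E
               <= v%:E * cost_derive (C e) v - v%:E)%E &
            C e 1 = 0%E]].

Definition assumptionB (R : realType) (d : nat) (gamma : 'I_d -> 'I_d -> R)
    (C : 'I_d * 'I_d -> R -> \bar R) : Prop :=
  forall e, jumps gamma e ->
    (exists2 p : R, 0 < p &
      (fun u : R => ((u `^ (p + 1))%:E * cost_derive (C e) u)%E) @ 0^'+
        --> -oo%E) /\
    (0 <= limf_einf (fun u : R => u%:E * cost_derive (C e) u - u%:E)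
                    (+oo%R : set_system R))%E.

(** [ln 0 = 0], so [ell 0 = 1]. *)
Definition ell (R : realType) (q : R) : R := q * ln q - q + 1.

Definition transformed_cost (R : realType) (g : R) (C : R -> \bar R) (q : R) :
    \bar R :=
  ereal_sup [set ((u * ell (q / u))%:E - g%:E * C (u / g)%R)%E
            | u in [set u : R | 0 < u]].

(** The convention 0 * +oo = 0 is that of [\bar R]. *)
Definition running_cost (R : realType) (d : nat) (gamma : 'I_d -> 'I_d -> R)
    (C : 'I_d * 'I_d -> R -> \bar R) (r : 'rV[R]_d -> R)
    (m : 'rV[R]_d) (q : 'I_d * 'I_d -> R) : \bar R :=
  (\sum_(e | jumps gamma e)
     (m ord0 e.1)%:E * transformed_cost (gamma e.1 e.2) (C e) (q e)
   + (r m)%:E)%E.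

(** Paths are functions on R of which only the values on [0,oo) matter. *)
Definition cadlag (R : realType) (d : nat) (mu : R -> 'rV[R]_d) : Prop :=
  (forall t, 0 <= t -> mu s @[s --> t^'+] --> mu t) /\
  (forall t, 0 < t -> cvg (mu s @[s --> t^'-])).

Definition hitting_time (R : realType) (d : nat) (K : set 'rV[R]_d)
    (mu : R -> 'rV[R]_d) : \bar R :=
  ereal_inf [set t%:E | t in [set t : R | 0 <= t /\ K (mu t)]].

Definition total_cost (R : realType) (d : nat) (gamma : 'I_d -> 'I_d -> R)
    (C : 'I_d * 'I_d -> R -> \bar R) (r : 'rV[R]_d -> R) (K : set 'rV[R]_d)
    (mu : R -> 'rV[R]_d) (q : 'I_d * 'I_d -> R -> R) : \bar R :=
  (\int[lebesgue_measure]_(t in [set t : R | (0 <= t)%R /\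
                                   t%:E < hitting_time K mu])
     running_cost gamma C r (mu t) (fun e => q e t))%E.

Definition controlled_path (R : realType) (d : nat) (gamma : 'I_d -> 'I_d -> R)
    (m : 'rV[R]_d) (mu : R -> 'rV[R]_d) (q : 'I_d * 'I_d -> R -> R) : Prop :=
  [/\ cadlag mu /\ forall t, 0 <= t -> prob_simplex (mu t),
      forall e, jumps gamma e ->
        measurable_fun (`[0, +oo[ : set (measurableTypeR R)) (q e) /\
        forall t, 0 <= t -> 0 <= q e t,
      forall e, jumps gamma e -> forall T, 0 <= T ->
        lebesgue_measure.-integrable `[0, T]
          (fun s => (mu s ord0 e.1 * q e s)%:E) &
      forall t, 0 <= t ->
        mu t = m + \sum_(e | jumps gamma e)
          (\int[lebesgue_measure]_(s in `[0, t[) (mu s ord0 e.1 * q e s))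
            *: jump_vector R e].

Definition value (R : realType) (d : nat) (gamma : 'I_d -> 'I_d -> R)
    (C : 'I_d * 'I_d -> R -> \bar R) (r : 'rV[R]_d -> R) (K : set 'rV[R]_d)
    (m : 'rV[R]_d) : \bar R :=
  ereal_inf [set c | exists mu q, controlled_path gamma m mu q /\
                       c = total_cost gamma C r K mu q].

Definition plane (R : realType) := (measurableTypeR R * measurableTypeR R)%type.

(** The first coordinate is time, the second one is the mark. *)
Definition quadrant (R : realType) : set (plane R) :=
  `[0, +oo[ `*` `[0, +oo[.

Definition poisson_random_measure (R : realType) (disp : measure_display)
    (Omega : measurableType disp) (P : probability Omega R)
    (nu : set (plane R) -> \bar R)
    (N : Omega -> {measure set (plane R) -> \bar R}) : Prop :=
  [/\ forall B, measurable B -> B `<=` @quadrant R ->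
        measurable_fun setT (N ^~ B),
      forall B, measurable B -> B `<=` @quadrant R -> (nu B < +oo)%E ->
        forall k : nat, P [set w | N w B = k%:R%:E] =
          (expR (- fine (nu B)) * fine (nu B) ^+ k / k`!%:R)%:E,
      forall B, measurable B -> B `<=` @quadrant R -> nu B = +oo%E ->
        P [set w | N w B = +oo%E] = 1%E &
      forall (k : nat) (B : 'I_k -> set (plane R)) (Y : 'I_k -> set (\bar R)),
        (forall i, measurable (B i) /\ B i `<=` @quadrant R) ->
        trivIset setT B -> (forall i, measurable (Y i)) ->
        P (\bigcap_i [set w | Y i (N w (B i))]) =
          (\prod_(i < k) P [set w | Y i (N w (B i))])%E].

Definition sigma_noise (R : realType) (disp : measure_display)
    (Omega : measurableType disp)
    (N : Omega -> {measure set (plane R) -> \bar R}) : set (set Omega) :=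
  <<s [set A | exists B Y, [/\ measurable B, B `<=` @quadrant R,
        measurable Y & A = [set w | Y (N w B)]]] >>.

Definition poisson_noise (R : realType) (d n : nat)
    (gamma : 'I_d -> 'I_d -> R) (disp : measure_display)
    (Omega : measurableType disp) (P : probability Omega R)
    (N : 'I_d * 'I_d -> Omega -> {measure set (plane R) -> \bar R}) : Prop :=
  (forall e, jumps gamma e ->
     poisson_random_measure P
       (fun B => (n%:R%:E * (lebesgue_measure \x lebesgue_measure) B)%E)
       (N e)) /\
  (forall A : 'I_d * 'I_d -> set Omega,
     (forall e, jumps gamma e -> sigma_noise (N e) (A e)) ->
     P (\bigcap_(e in [set e | jumps gamma e]) A e) =
       (\prod_(e | jumps gamma e) P (A e))%E).

Definition noise_filtration (R : realType) (d : nat)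
    (gamma : 'I_d -> 'I_d -> R) (disp : measure_display)
    (Omega : measurableType disp) (P : probability Omega R)
    (N : 'I_d * 'I_d -> Omega -> {measure set (plane R) -> \bar R})
    (t : R) : set (set Omega) :=
  <<s [set A | exists e (s : R) (B : set (measurableTypeR R)) Y,
        [/\ jumps gamma e, 0 <= s <= t,
            measurable B /\ B `<=` `[0, +oo[,
            measurable Y & A = [set w | Y (N e w (`]0, s] `*` B))]]]
      `|` [set A | P.-negligible A] >>.

Definition predictable_sigma (R : realType) (T : Type)
    (F : R -> set (set T)) : set (set (R * T)) :=
  <<s [set u : R * T | 0 <= u.1],
      [set D | exists2 A, F 0 A & D = [set 0] `*` A]
      `|` [set D | exists (s t : R) A,
             [/\ 0 <= s <= t, F s A & D = `]s, t] `*` A]] >>.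

Definition predictable (R : realType) (T : Type) (F : R -> set (set T))
    (q : R -> T -> R) : Prop :=
  forall Y : set (measurableTypeR R), measurable Y ->
    predictable_sigma F [set u | 0 <= u.1 /\ Y (q u.1 u.2)].

Definition bounded_control (R : realType) (d : nat)
    (gamma : 'I_d -> 'I_d -> R) (T : Type) (F : R -> set (set T))
    (q : 'I_d * 'I_d -> R -> T -> R) : Prop :=
  forall e, jumps gamma e ->
    predictable F (q e) /\
    exists a b : R, 0 < a /\ forall t w, 0 <= t -> a <= q e t w <= b.

(** A solution of the controlled equation: a cadlag adapted process with values
    in the grid which satisfies the equation almost surely. It is unique up to
    indistinguishability, so that the cost in [value_n] depends on q only. *)
Definition controlled_process (R : realType) (d n : nat)
    (gamma : 'I_d -> 'I_d -> R) (disp : measure_display)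
    (Omega : measurableType disp) (P : probability Omega R)
    (N : 'I_d * 'I_d -> Omega -> {measure set (plane R) -> \bar R})
    (m : 'rV[R]_d) (q : 'I_d * 'I_d -> R -> Omega -> R)
    (mu : R -> Omega -> 'rV[R]_d) : Prop :=
  [/\ forall w, cadlag (fun t => mu t w),
      forall t w, 0 <= t -> prob_grid n (mu t w),
      forall t x (Y : set (measurableTypeR R)), 0 <= t -> measurable Y ->
        noise_filtration gamma P N t [set w | Y (mu t w ord0 x)] &
      {ae P, forall w, forall t, 0 <= t ->
        mu t w = m + \sum_(e | jumps gamma e)
          (\int[N e w]_(z in `]0, t] `*` `[0, +oo[)
             (n%:R^-1 *
              \1_(`[0, (lim (mu s w @[s --> z.1^'-])) ord0 e.1 * q e z.1 w])
                 z.2))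
            *: jump_vector R e}].

(** Negligible sets need not be measurable, so the inner integral is a
    measurable function of w only up to a P-negligible set; [\int[P]] of a
    nonnegative function is a supremum over simple functions below it and does
    not see such a set. *)
Definition value_n (R : realType) (d n : nat) (gamma : 'I_d -> 'I_d -> R)
    (C : 'I_d * 'I_d -> R -> \bar R) (r : 'rV[R]_d -> R) (K : set 'rV[R]_d)
    (disp : measure_display) (Omega : measurableType disp)
    (P : probability Omega R)
    (N : 'I_d * 'I_d -> Omega -> {measure set (plane R) -> \bar R})
    (m : 'rV[R]_d) : \bar R :=
  ereal_inf [set c | exists q mu,
    [/\ bounded_control gamma (noise_filtration gamma P N) q,
        controlled_process n gamma P N m q mu &
        c = (\int[P]_w total_cost gamma C r K
               (fun t => mu t w) (fun e t => q e t w))%E]].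

(* Main.v *)
(** By Dynkin's formula for the controlled chain, the grid value is bounded below
    by every [f >= 0] vanishing on [K] with [cost + generator f >= 0] off [K], and
    above by every [f >= 0] with [cost + generator f <= 0] off [K] for some
    feedback control. The deterministic value is Hoelder, as straight lines
    through the interior of the simplex are cheap, and satisfies the limiting
    inequalities when tested with quadratic functions. Its sup- and
    inf-convolutions, centered at [(1 - l) m + l / d] so that the optimizer stays
    off the boundary, are then discrete sub- and supersolutions up to an error;
    the latter is corrected near the boundary by [A * \sum_x (1 - sqrt m_x)],
    which decreases fast under the rates [gamma]. The error is absorbed by scaling
    the subsolution by [1 - kappa], as [R] is positive off [K], and by adding
    [kappa] to [R] and shrinking [K] for the supersolution. *)
Require Import Defs.
From HB Require Import structures.
From mathcomp Require Import all_boot all_order all_algebra.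
From mathcomp Require Import all_classical all_reals all_analysis measurable_realfun.
From mathcomp Require Import ring lra zify.
Set Implicit Arguments.
Unset Strict Implicit.
Unset Printing Implicit Defensive.
Import Order.TTheory GRing.Theory Num.Theory.
Import numFieldNormedType.Exports.
Local Open Scope classical_set_scope.
Local Open Scope ring_scope.

(** Controls enter through the fluxes [w = m_x * q]. In these variables the running cost is a
    perspective [m_x * F (w / m_x)], jointly convex in [(m, w)], so that it can be averaged in time
    along a path and mixed between two points. A grid point and the optimizer of its convolution are
    related by a convex combination of weight [l] with a point that charges every state, where the
    natural rates [gamma] run at bounded cost; this transports controls between the two. It needs
    the optimizer within order [l] of the centre, while [l] times the gradient of the penalty has to
    be small. The lower bound must hold for every control, and its second order error, proportional
    to the total jump rate, is absorbed by the growth of the cost. The upper bound needs one control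
    only, but near the boundary nothing can be transported, whence the barrier. Dynkin's formula
    rests on two facts: predictable random regions carry on average [n] times their area of marks,
    and almost surely the marks are sparse on a fine dyadic partition, which reduces pathwise
    identities to single jumps. *)

Local Notation mR R := (measurableTypeR R).
Local Notation halfline R := (`[0%R, +oo[%classic : set (measurableTypeR R)).
Local Notation leb := lebesgue_measure.
Local Notation edge d := ('I_d * 'I_d)%type.
Local Notation noise R := {measure set (plane R) -> \bar R}.

(** * Means of functions that are measurable up to a negligible set; independence *)

Section has_mean.
Context (R : realType) (disp : measure_display) (T : measurableType disp)
  (P : probability T R).
Local Open Scope ereal_scope.
Implicit Types f g : T -> \bar R.

(** The filtration contains all negligible sets, so mark counts of adapted regions are measurable in
    [w] only up to a negligible set; the witness [g] carries the measurability. *)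
Definition has_mean f (v : \bar R) := exists2 g,
  [/\ measurable_fun setT g, forall w, 0 <= g w & {ae P, forall w, f w = g w}]
  & \int[P]_w g w = v.

Lemma has_mean_ge0 f v : has_mean f v -> 0 <= v.
Proof. by move=> [g [mg g0 _] <-]; apply: integral_ge0. Qed.

Lemma has_mean_measurable f : measurable_fun setT f -> (forall w, 0 <= f w) ->
  has_mean f (\int[P]_w f w).
Proof. by move=> mf f0; exists f => //; split => //; apply: aeW. Qed.

Lemma has_mean_ae f g v : {ae P, forall w, f w = g w} -> has_mean g v ->
  has_mean f v.
Proof.
move=> fg [h [mh h0 gh] hv]; exists h => //; split => //.
by apply: filterS2 fg gh => w -> ->.
Qed.

Lemma has_mean_le f1 v1 f2 v2 : {ae P, forall w, f1 w <= f2 w} ->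
  has_mean f1 v1 -> has_mean f2 v2 -> v1 <= v2.
Proof.
move=> f12 [g1 [mg1 g10 fg1] <-] [g2 [mg2 g20 fg2] <-].
apply: ae_ge0_le_integral => //.
by apply: filterS3 f12 fg1 fg2 => w + <- <-.
Qed.

Lemma has_meanD f1 v1 f2 v2 : has_mean f1 v1 -> has_mean f2 v2 ->
  has_mean (fun w => f1 w + f2 w) (v1 + v2).
Proof.
move=> [g1 [mg1 g10 fg1] <-] [g2 [mg2 g20 fg2] <-].
exists (fun w => g1 w + g2 w); last by rewrite ge0_integralD.
split; first exact: emeasurable_funD.
  by move=> w; rewrite adde_ge0.
by apply: filterS2 fg1 fg2 => w -> ->.
Qed.

Lemma has_mean_cst (c : R) : (0 <= c)%R -> has_mean (fun=> c%:E) c%:E.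
Proof.
move=> c0; have := @has_mean_measurable (cst c%:E) (measurable_cst _).
rewrite integral_cst// [X in _ * X](_ : _ = 1) ?mule1; last exact: probability_setT.
by apply=> w; rewrite lee_fin.
Qed.

Lemma has_meanZ f v (c : R) : (0 <= c)%R -> has_mean f v ->
  has_mean (fun w => c%:E * f w) (c%:E * v).
Proof.
move=> c0 [g [mg g0 fg] <-]; exists (fun w => c%:E * g w).
  split; first exact: measurable_funeM.
    by move=> w; rewrite mule_ge0// lee_fin.
  by apply: filterS fg => w ->.
by rewrite ge0_integralZl_EFin.
Qed.

Lemma has_mean_sum (I : Type) (s : seq I) (Q : pred I) (f : I -> T -> \bar R)
    (v : I -> \bar R) :
  (forall i, Q i -> has_mean (f i) (v i)) ->
  has_mean (fun w => \sum_(i <- s | Q i) f i w) (\sum_(i <- s | Q i) v i).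
Proof.
move=> fv; elim: s => [|i s ih].
  have -> : (fun w => \sum_(i <- [::] | Q i) f i w) = (fun=> 0%:E).
    by apply/funext => w; rewrite big_nil.
  by rewrite big_nil; apply: has_mean_cst.
case Qi : (Q i); last first.
  rewrite big_cons Qi; have -> // : (fun w => \sum_(i <- i :: s | Q i) f i w) =
    (fun w => \sum_(i <- s | Q i) f i w).
  by apply/funext => w; rewrite big_cons Qi.
rewrite big_cons Qi; have -> // : (fun w => \sum_(i <- i :: s | Q i) f i w) =
    (fun w => f i w + \sum_(i <- s | Q i) f i w).
  by apply/funext => w; rewrite big_cons Qi.
by apply: has_meanD => //; exact: fv.
Qed.

Lemma has_mean_nd (f : nat -> T -> \bar R) F (v : nat -> \bar R) :
  (forall k, has_mean (f k) (v k)) ->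
  {ae P, forall w, (forall k, f k w <= f k.+1 w) /\
     F w = ereal_sup (range (fun k => f k w))} ->
  has_mean F (ereal_sup (range v)).
Proof.
move=> fv FF; have /choice[g gP] : forall k, exists g,
  [/\ measurable_fun setT g, forall w, 0 <= g w & {ae P, forall w, f k w = g w}]
   /\ \int[P]_w g w = v k.
  by move=> k; have [g ? ?] := fv k; exists g.
(* The versions [g k] increase only almost everywhere; their running maxima increase everywhere. *)
pose h := fix h k w := if k is k'.+1 then maxe (h k' w) (g k w) else g 0%N w.
have mh k : measurable_fun setT (h k).
  elim: k => [|k ih]; first by have [[]] := gP 0%N.
  by apply: measurable_maxe => //; have [[]] := gP k.+1.
have h0 k w : 0 <= h k w.
  elim: k => [|k ih]; first by case: (gP 0%N) => -[_ /(_ w)].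
  by rewrite /= le_max ih.
have ndh w : {homo (fun k => h k w) : a b / (a <= b)%N >-> a <= b}.
  by apply/nondecreasing_seqP => k /=; rewrite le_max lexx.
have aeh : {ae P, forall w, forall k, h k w = f k w}.
  have fg : {ae P, forall w, forall k, f k w = g k w}.
    by apply/ae_foralln => k; have [[]] := gP k.
  apply: filterS2 fg FF => w fg [fnd _].
  have f0 k : 0 <= f k w by rewrite fg; have [[]] := gP k.
  elim=> [|k ih] /=; first by rewrite fg.
  by rewrite ih -fg; apply/max_idPr.
have hcvg w : h ^~ w @ \oo --> ereal_sup (range (fun k => h k w)).
  exact: ereal_nondecreasing_cvgn.
exists (fun w => ereal_sup (range (fun k => h k w))).
  split.
  - exact: (emeasurable_fun_cvg h).
  - by move=> w; apply: (le_trans (h0 0%N w)); apply: ereal_sup_ubound; exists 0%N.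
  - apply: filterS2 aeh FF => w hf [_ ->]; congr (ereal_sup _).
    by rewrite (_ : (fun k => f k w) = (fun k => h k w))//; apply/funext => k.
have -> : \int[P]_w ereal_sup (range (fun k => h k w)) =
    limn (fun k => \int[P]_w h k w).
  rewrite -(@monotone_convergence _ _ _ P setT measurableT h)//.
  by apply: eq_integral => w _; apply/esym/cvg_lim => //; exact: hcvg.
have -> : (fun k => \int[P]_w h k w) = v.
  apply/funext => k.
  have [[mg g0 fg] <-] := gP k.
  apply: ae_eq_integral => //.
  by apply: filterS2 aeh fg => w hf fg _; rewrite hf fg.
apply/cvg_lim => //; apply: ereal_nondecreasing_cvgn.
apply/nondecreasing_seqP => k.
by apply: has_mean_le (fv k) (fv k.+1); apply: filterS FF => w [].
Qed.

(* [\int[P]] of a nonnegative, possibly nonmeasurable, function is the supremum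
   of the integrals of the simple functions below it. *)
Lemma le_nonmeasurable_integral (f F : T -> \bar R) :
  (forall w, 0 <= f w) -> (forall w, f w <= F w) ->
  \int[P]_w f w <= \int[P]_w F w.
Proof.
move=> f0 fF; have F0 w : 0 <= F w by apply: le_trans (f0 w) (fF w).
rewrite !ge0_integralTE//; apply: le_ereal_sup => _ /= [g gf <-]; exists g => //.
by move=> w; apply: le_trans (gf w) (fF w).
Qed.

Lemma has_mean_lower f v F : has_mean f v -> (forall w, 0 <= F w) ->
  {ae P, forall w, f w <= F w} -> v <= \int[P]_w F w.
Proof.
move=> [g [mg g0 fg] <-] F0 fF.
have [B [mB PB Bs]] : {ae P, forall w, g w <= F w}.
  by apply: filterS2 fg fF => w <-.
(* Cutting [g] down to 0 on the exceptional set makes the bound hold everywhere, as the supremum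
   over simple functions demands. *)
pose gB w := g w * (\1_(~` B) w)%:E.
have mgB : measurable_fun setT gB.
  apply: emeasurable_funM => //; apply/measurable_EFinP.
  by apply: measurable_indic; exact: measurableC.
have gB0 w : 0 <= gB w by rewrite /gB mule_ge0// lee_fin.
have -> : \int[P]_w g w = \int[P]_w gB w.
  apply: ae_eq_integral => //; exists B; split => // w /= nw.
  apply: contrapT => nB; apply: nw => _; rewrite /gB indicE mem_set//= mule1//.
apply: le_nonmeasurable_integral => // w; rewrite /gB indicE.
have [/set_mem|/negP] := boolP (w \in ~` B) => wB.
  rewrite mule1; apply: contrapT => /negP gF; apply: wB; apply: Bs => /= h.
  by rewrite h in gF.
by rewrite mule0.
Qed.

Lemma has_mean_upper f v F : has_mean f v -> (forall w, 0 <= F w) ->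
  {ae P, forall w, F w <= f w} -> \int[P]_w F w <= v.
Proof.
move=> [g [mg g0 fg] <-] F0 fF.
have [B [mB PB Bs]] : {ae P, forall w, F w <= g w}.
  by apply: filterS2 fg fF => w <-.
(* Raising [g] to [+oo] on the exceptional set makes the bound hold everywhere without changing the
   integral. *)
pose gB w := g w + +oo * (\1_B w)%:E.
have mgB : measurable_fun setT gB.
  apply: emeasurable_funD => //; apply: emeasurable_funM => //.
  by apply/measurable_EFinP; exact: measurable_indic.
have gB0 w : 0 <= gB w by rewrite /gB adde_ge0// mule_ge0// lee_fin.
have -> : \int[P]_w g w = \int[P]_w gB w.
  apply: ae_eq_integral => //; exists B; split => // w /= nw.
  apply: contrapT => nB; apply: nw => _; rewrite /gB indicE memNset//= mule0 adde0//.
apply: le_nonmeasurable_integral => // w; rewrite /gB indicE.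
have [/set_mem|/negP] := boolP (w \in B) => wB.
  by rewrite mule1 addey ?leey// -ltNye (lt_le_trans _ (g0 w))// ltNyr.
rewrite mule0 adde0; apply: contrapT => /negP gF; apply: wB; apply/mem_set/Bs => /= h.
by rewrite h in gF.
Qed.

(** [F] need not be measurable, so it is tested from below with the positive part of the difference
    of measurable versions of [B] and [A]; the difference makes sense because [A] has a finite
    mean. *)
Lemma has_mean_lower2 A B a b F : has_mean A a%:E -> has_mean B b%:E ->
  (forall w, 0 <= F w) -> {ae P, forall w, B w <= F w + A w} ->
  b%:E <= \int[P]_w F w + a%:E.
Proof.
move=> [A' [mA A0 AA] hA] [B' [mB B0 BB] hB] F0 BFA.
have [IA IB] : P.-integrable setT A' /\ P.-integrable setT B'.
  split; apply/integrableP; split => //.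
    under eq_integral do rewrite gee0_abs//; by rewrite hA ltry.
  under eq_integral do rewrite gee0_abs//; by rewrite hB ltry.
have Afin : {ae P, forall w, A' w \is a fin_num}.
  by apply: filterS (integrable_ae _ IA) => // w; apply.
have mBA : measurable_fun setT (fun w => maxe (B' w - A' w) 0).
  by apply: measurable_maxe => //; exact: emeasurable_funB.
have BA0 w : 0 <= maxe (B' w - A' w) 0 by rewrite le_max lexx orbT.
have h := has_mean_measurable mBA BA0.
have : \int[P]_w maxe (B' w - A' w) 0 <= \int[P]_w F w.
  apply: (has_mean_lower h F0).
  have AB : {ae P, forall w, A w = A' w /\ B w = B' w} by apply: filterS2 AA BB.
  apply: filterS3 AB BFA Afin => w [<- <-] h1 h2.
  by rewrite ge_max F0 andbT leeBlDr.
have : b%:E <= \int[P]_w maxe (B' w - A' w) 0 + a%:E.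
  rewrite -hA -hB -ge0_integralD//; apply: ae_ge0_le_integral => //.
  - by move=> w _; rewrite adde_ge0.
  - exact: emeasurable_funD.
  apply: filterS Afin => w h2 _.
  by rewrite -leeBlDr// le_max lexx.
by move=> /le_trans + h2; apply; rewrite leeD2r.
Qed.

Lemma has_mean_fin (f : T -> \bar R) v : v < +oo -> has_mean f v ->
  {ae P, forall w, f w \is a fin_num}.
Proof.
move=> voo [g [mg g0 fg] gv].
have IA : P.-integrable setT g.
  apply/integrableP; split => //; under eq_integral do rewrite gee0_abs//.
  by rewrite gv.
by apply: filterS2 (integrable_ae measurableT IA) fg => w /(_ I) + ->.
Qed.

Lemma has_meanB (f1 f2 f : T -> \bar R) v1 v2 : v1 < +oo ->
  has_mean f1 v1 -> has_mean f2 v2 ->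
  {ae P, forall w, 0 <= f w /\ f1 w = f2 w + f w} ->
  has_mean f (v1 - v2) /\ v2 <= v1.
Proof.
move=> v1oo h1 h2 hf.
have v21 : v2 <= v1.
  by apply: (has_mean_le _ h2 h1); apply: filterS hf => w [f0 ->]; rewrite leeDl.
split => //; have v2oo := le_lt_trans v21 v1oo.
have f1fin := has_mean_fin v1oo h1; have f2fin := has_mean_fin v2oo h2.
case: h1 => g1 [mg1 g10 fg1] gv1; case: h2 => g2 [mg2 g20 fg2] gv2.
pose g w := maxe (g1 w - g2 w) 0.
have mg : measurable_fun setT g.
  by apply: measurable_maxe => //; exact: emeasurable_funB.
have g0 w : 0 <= g w by rewrite le_max lexx orbT.
have hfg : {ae P, forall w, f w = g w}.
  have fin12 : {ae P, forall w, f1 w \is a fin_num /\ f2 w \is a fin_num}.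
    by apply: filterS2 f1fin f2fin.
  have e12 : {ae P, forall w, f1 w = g1 w /\ f2 w = g2 w} by apply: filterS2 fg1 fg2.
  apply: filterS3 hf fin12 e12 => w [f0 f12] [F1 F2] [e1 e2].
  have ff : f w = f1 w - f2 w by rewrite f12 addeAC subee// add0e.
  by rewrite /g -e1 -e2 -ff; apply/esym/max_idPl.
exists g => //.
have : \int[P]_w (g2 w + g w) = v1.
  rewrite -gv1; apply: ae_eq_integral => //; first exact: emeasurable_funD.
  have e12 : {ae P, forall w, f1 w = g1 w /\ f2 w = g2 w} by apply: filterS2 fg1 fg2.
  by apply: filterS3 hf hfg e12 => w [_ ->] -> [<- ->].
rewrite ge0_integralD// gv2 => <-; rewrite addeAC subee ?add0e//.
by rewrite ge0_fin_numE// -gv2 integral_ge0.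
Qed.

Implicit Types (A E : set T) (G : set (set T)).

Definition indep_of E A := measurable A /\ P (A `&` E) = P A * P E.

Lemma indep_lambda E : measurable E -> lambda_system setT (indep_of E).
Proof.
move=> mE; split => //.
- by split=> //; rewrite setTI probability_setT mul1e.
- move=> A B BA [mA IA] [mB IB]; split; first exact: measurableD.
  have fin C : measurable C -> P C \is a fin_num by move=> ?; exact: fin_num_measure.
  have -> : (A `\` B) `&` E = (A `&` E) `\` (B `&` E).
    apply/seteqP; split => [x [[Ax nBx] Ex]|x [[Ax Ex] nBx]].
      by split => //; case.
    by split => //; split => // Bx; apply: nBx.
  have mAE := measurableI _ _ mA mE; have mBE := measurableI _ _ mB mE.
  rewrite !measureD//= ?ltry ?ltey_eq ?fin//.
  have -> : A `&` E `&` (B `&` E) = B `&` E.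
    by rewrite setIACA setIid (setIidr BA).
  rewrite (setIidr BA) IA IB -(fineK (fin _ mA)) -(fineK (fin _ mB)) -(fineK (fin _ mE)).
  by rewrite muleBl// -!EFinM.
- move=> F ndF IF; split; first by apply: bigcupT_measurable => i; case: (IF i).
  have mF i : measurable (F i) by case: (IF i).
  have h1 : P (F k) @[k --> \oo] --> P (\bigcup_k F k).
    by apply: nondecreasing_cvg_mu => //; exact: bigcupT_measurable.
  have h2 : P (F k `&` E) @[k --> \oo] --> P (\bigcup_k F k `&` E).
    rewrite setI_bigcupl; apply: nondecreasing_cvg_mu.
    - by move=> k; exact: measurableI.
    - by apply: bigcupT_measurable => k; exact: measurableI.
    - move=> i j ij; apply/subsetPset; apply: setSI; exact/subsetPset/ndF.
  have h3 : P (F k) * P E @[k --> \oo] --> P (\bigcup_k F k) * P E.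
    by apply: cvgeZr => //; exact: fin_num_measure.
  have eqF : (fun k => P (F k `&` E)) = (fun k => P (F k) * P E).
    by apply/funext => k; case: (IF k).
  by rewrite eqF in h2; exact: (cvg_unique (@ereal_hausdorff R) h2 h3).
Qed.

Lemma indep_sigma E G : measurable E -> setI_closed G ->
  G `<=` indep_of E -> <<s G>> `<=` indep_of E.
Proof.
by move=> mE GI Gi; apply: lambda_system_subset => //; exact: indep_lambda.
Qed.

End has_mean.

(** * The Poisson law and the counts of a Poisson random measure *)

Section poisson_series.
Context (R : realType).
Local Open Scope ereal_scope.
Implicit Types a : R.

Definition pmf a k : R := (expR (- a) * a ^+ k / k`!%:R)%R.

Lemma pmf_ge0 a k : (0 <= a)%R -> (0 <= pmf a k)%R.
Proof. by move=> a0; rewrite /pmf divr_ge0// mulr_ge0// ?expR_ge0// exprn_ge0. Qed.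

Lemma pmf_sum a : (0 <= a)%R -> \sum_(k <oo) (pmf a k)%:E = 1.
Proof.
move=> a0; rewrite [RHS](_ : _ = (expR (- a))%:E * (expR a)%:E); last first.
  by rewrite -EFinM expRN mulVf ?gt_eqF ?expR_gt0.
under eq_eseriesr do rewrite /pmf -mulrA EFinM.
rewrite /= nneseriesZl/=; last first.
  by move=> k _; rewrite lee_fin divr_ge0// exprn_ge0.
congr *%E; rewrite expRE -EFin_lim; last first.
  rewrite /pseries/=; under eq_fun do rewrite mulrC.
  exact: is_cvg_series_exp_coeff.
apply/congr_lim/funext => n/=; rewrite /pseries/= /series/= -sumEFin//.
by under [in RHS]eq_bigr do rewrite mulrC.
Qed.

Lemma pmf_mean a : (0 <= a)%R -> \sum_(k <oo) (k%:R * pmf a k)%:E = a%:E.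
Proof.
move=> a0; rewrite nneseries_recl//; last first.
  by move=> k _; rewrite lee_fin mulr_ge0// pmf_ge0.
rewrite mul0r add0e -[RHS]mule1 -(pmf_sum a0) -nneseriesZl; last first.
  by move=> k _; rewrite lee_fin pmf_ge0.
rewrite -(@nneseries_addn _ (fun k => (k%:R * pmf a k)%:E)); last first.
  by move=> k; rewrite lee_fin mulr_ge0// pmf_ge0.
apply: eq_eseriesr => k _; rewrite -EFinM addn1; congr (_ %:E).
rewrite /pmf exprS factS natrM invfM.
have : (k.+1%:R : R)%R != 0%R by rewrite pnatr_eq0.
by move: k.+1%:R (k`!%:R^-1)%R (a ^+ k)%R (expR _) => x y z t x0; field.
Qed.

(** [(1 + a) * expR (- a) >= (1 + a) * (1 - a)]: a Poisson variable exceeds 1 with a probability of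
    second order in its mean. *)
Lemma pmf01_ge a : (0 <= a)%R -> (1 - a ^+ 2 <= pmf a 0 + pmf a 1)%R.
Proof.
move=> a0; rewrite /pmf !fact0 /= expr0 expr1 factS fact0 !divr1 mulr1.
have : (1 - a <= expR (- a))%R by exact: expR_ge1Dx.
by have := expR_gt0 (- a)%R; nra.
Qed.

End poisson_series.

Section poisson_measure_mean.
Context (R : realType) (disp : measure_display) (T : measurableType disp)
  (P : probability T R) (nu : set (plane R) -> \bar R)
  (N : T -> noise R).
Hypothesis HN : poisson_random_measure P nu N.
Variable (B : set (plane R)).
Hypotheses (mB : measurable B) (BQ : B `<=` @quadrant R).
Hypotheses (nuB0 : (0 <= nu B)%E) (nuB : (nu B < +oo)%E).
Local Open Scope ereal_scope.

Let a := fine (nu B).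
Let a0 : (0 <= a)%R. Proof. exact: fine_ge0. Qed.
Let aE : a%:E = nu B.
Proof. by rewrite /a fineK// ge0_fin_numE. Qed.

Lemma prm_measurable : measurable_fun setT (fun w => N w B).
Proof. by case: HN => + _ _ _; apply. Qed.

Lemma prm_measurable_set (Y : set (\bar R)) : measurable Y ->
  measurable [set w | Y (N w B)].
Proof. by move=> mY; have := prm_measurable measurableT mY; rewrite setTI. Qed.

Lemma prm_pmf k : P [set w | N w B = k%:R%:E] = (pmf a k)%:E.
Proof. by case: HN => _ + _ _; apply. Qed.

Let nat_set (k : nat) := [set w | N w B = (k%:R : R)%:E].

Let mnat k : measurable (nat_set k).
Proof. exact: (@prm_measurable_set [set k%:R%:E]). Qed.

Let pE k : P (nat_set k) = (pmf a k)%:E.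
Proof. exact: prm_pmf. Qed.

Lemma prm_ae_nat : {ae P, forall w, exists k, N w B = k%:R%:E}.
Proof.
exists (~` \bigcup_k nat_set k); split.
- by apply: measurableC; apply: bigcupT_measurable.
- rewrite probability_setC; last exact: bigcupT_measurable.
  rewrite measure_semi_bigcup//; last exact: bigcupT_measurable.
    by rewrite (@eq_eseriesr _ _ (fun k => (pmf a k)%:E)) ?pmf_sum ?subee// => k _; exact: pE.
  apply/trivIsetP => i j _ _ ij; apply/seteqP; split=> // w []; rewrite /nat_set /= => -> /eqP.
  by rewrite eqe eqr_nat (negbTE ij).
- move=> w /= nw [k _] wk; apply: nw; exists k; exact: wk.
Qed.

(** Almost surely the count is a natural number, so it is the series of [k] times the indicators of
    its level sets, and each of these splits off the factor [P A]. *)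
Lemma prm_mean_indep A : measurable A ->
  (forall k, P (A `&` [set w | N w B = k%:R%:E]) =
             P A * P [set w | N w B = k%:R%:E]) ->
  has_mean P (fun w => (\1_A w)%:E * N w B) (P A * nu B).
Proof.
move=> mA ind.
pose g w : \bar R := \sum_(k <oo) (k%:R * \1_(A `&` nat_set k) w)%:E.
have g0 k w : 0 <= ((k%:R : R) * \1_(A `&` nat_set k) w)%:E.
  by rewrite lee_fin mulr_ge0.
have mg k : measurable_fun setT (fun w => ((k%:R : R) * \1_(A `&` nat_set k) w)%:E).
  apply/measurable_EFinP; apply: measurable_funM => //.
  by apply: measurable_indic; exact: measurableI.
exists g.
  split.
  - by apply: ge0_emeasurable_sum.
  - by move=> w; apply: nneseries_ge0.
  - apply: filterS prm_ae_nat => w [k kw]; rewrite /g (@nneseriesD1 _ _ k)//.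
    rewrite eseries0 ?adde0; last first.
      move=> i _ /= ik; rewrite indicE memNset ?mulr0// => -[_].
      by rewrite /nat_set /= kw => -[] /eqP; rewrite eqr_nat eq_sym (negbTE ik).
    rewrite kw -EFinM mulrC; congr (_ * _)%:E.
    rewrite !indicE; congr ((_ : bool)%:R); apply/idP/idP => /set_mem.
      by move=> Aw; apply/mem_set; split.
    by move=> [Aw _]; apply/mem_set.
have PA : P A \is a fin_num by exact: fin_num_measure.
have indE k : P (A `&` nat_set k) = (fine (P A) * pmf a k)%:E.
  by apply: etrans (ind k) _; rewrite EFinM fineK//; congr (_ * _); exact: pE.
rewrite integral_nneseries//.
rewrite (@eq_eseriesr _ _ (fun k => (fine (P A))%:E * (k%:R * pmf a k)%:E)); last first.
  move=> k _; under eq_integral do rewrite EFinM.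
  rewrite ge0_integralZl_EFin//; last first.
    by apply/measurable_EFinP; apply: measurable_indic; exact: measurableI.
  rewrite integral_indic ?setIT; [|exact: measurableT|exact: measurableI].
  transitivity (k%:R%:E * (fine (P A) * pmf a k)%:E); first by congr (_ * _); exact: indE.
  by rewrite -!EFinM mulrCA.
rewrite nneseriesZl ?pmf_mean ?aE ?fineK// => k _.
by rewrite lee_fin mulr_ge0// pmf_ge0.
Qed.

Lemma prm_mean : has_mean P (fun w => N w B) (nu B).
Proof.
have := @prm_mean_indep setT measurableT.
rewrite probability_setT mul1e.
have -> : (fun w => (\1_(@setT T) w)%:E * N w B) = (fun w => N w B).
  by apply/funext => w; rewrite indicT mul1e.
by apply => k; rewrite setTI mul1e.
Qed.

Lemma prm_many : P [set w | ~ (N w B = 0 \/ N w B = 1)] <= (a ^+ 2)%:E.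
Proof.
have -> : [set w | ~ (N w B = 0 \/ N w B = 1)] = ~` (nat_set 0 `|` nat_set 1).
  by apply/seteqP; split.
rewrite probability_setC; last by apply: measurableU.
have -> : P (nat_set 0 `|` nat_set 1) = (pmf a 0 + pmf a 1)%:E.
  rewrite measureU//; first by rewrite EFinD; congr (_ + _); exact: pE.
  apply/seteqP; split=> // w []; rewrite /nat_set /= => -> /eqP.
  by rewrite eqe eq_sym oner_eq0.
rewrite -EFinB lee_fin.
by have := pmf01_ge a0; lra.
Qed.

Lemma prm_pos : P [set w | ~ (N w B = 0)] <= a%:E.
Proof.
have -> : [set w | ~ (N w B = 0)] = ~` (nat_set 0) by apply/seteqP; split.
rewrite probability_setC// pE -EFinB lee_fin.
rewrite /pmf expr0 fact0 divr1 mulr1.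
have : (1 - a <= expR (- a))%R by exact: expR_ge1Dx.
lra.
Qed.

End poisson_measure_mean.

Lemma measure_bigcup_fintype (R : realType) (disp : measure_display)
    (T : measurableType disp) (m : {measure set T -> \bar R}) (J : finType)
    (Q : pred J) (F : J -> set T) :
  (forall i, measurable (F i)) -> trivIset setT F ->
  m (\bigcup_(i in [set i | Q i]) F i) = (\sum_(i | Q i) m (F i))%E.
Proof.
move=> mF tF.
have h (s : seq J) : uniq s ->
    m (\bigcup_(i in [set i | (i \in s) && Q i]) F i) = (\sum_(i <- s | Q i) m (F i))%E.
  elim: s => [_|i s ih /= /andP[nis us]].
    by rewrite big_nil (_ : bigcup _ _ = set0) ?measure0// bigcup0.
  rewrite big_cons -ih//; case: ifPn => Qi; last first.
    congr (m _); apply/seteqP; split => x [j /= /andP[]].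
      rewrite inE => /predU1P[->|js] Qj Fj; first by rewrite Qj in Qi.
      by exists j => //=; rewrite js.
    by move=> js Qj Fj; exists j => //=; rewrite inE js orbT.
  rewrite -measureU//.
  - congr (m _); apply/seteqP; split => x.
      move=> [j /= /andP[]]; rewrite inE => /predU1P[->|js] Qj Fj; [by left|right].
      by exists j => //=; rewrite js.
    move=> [Fi|[j /= /andP[js Qj] Fj]]; first by exists i => //=; rewrite mem_head.
    by exists j => //=; rewrite inE js orbT.
  - apply: fin_bigcup_measurable => //; apply: (sub_finite_set (@subsetT _ _)).
    exact: finite_finset.
  - apply/seteqP; split => // x [Fi [j /= /andP[js _] Fj]].
    move/trivIsetP : tF => /(_ i j Logic.I Logic.I).
    have ij : i != j by apply: contraNneq nis => ->.
    by move=> /(_ ij) h; rewrite -[False]/(set0 x) -h.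
rewrite -[RHS](h _ (index_enum_uniq J)); congr (m _); congr bigcup.
by apply/seteqP; split => i /=; rewrite mem_index_enum.
Qed.

(** * Independence of the noise on disjoint regions *)

Section poisson_measure_independence.
Context (R : realType) (disp : measure_display) (T : measurableType disp)
  (P : probability T R) (nu : set (plane R) -> \bar R)
  (N : T -> noise R).
Hypothesis HN : poisson_random_measure P nu N.
Local Open Scope ereal_scope.

Definition noise_gen (U : set (plane R)) : set (set T) :=
  [set A | exists B Y, [/\ measurable B, B `<=` U, measurable Y &
     A = [set w | Y (N w B)]]].

Lemma noise_gen_measurable : <<s noise_gen (@quadrant R)>> `<=` measurable.
Proof.
apply: smallest_sub; first exact: sigma_algebra_measurable.
move=> A [B [Y [mB BU mY ->]]].
by have := prm_measurable HN mB BU measurableT mY; rewrite setTI.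
Qed.

Lemma prm_indep_fin (J : finType) (B : J -> set (plane R)) (Y : J -> set (\bar R)) :
  (forall j, measurable (B j) /\ B j `<=` @quadrant R) -> trivIset setT B ->
  (forall j, measurable (Y j)) ->
  P (\bigcap_j [set w | Y j (N w (B j))]) = \prod_j P [set w | Y j (N w (B j))].
Proof.
move=> hB tB hY; case: HN => _ _ _ /(_ #|J| (B \o enum_val) (Y \o enum_val)).
rewrite (reindex (@enum_val _ J)); last first.
  by apply: onW_bij; exact: enum_val_bij.
have hB' (i : 'I_#|J|) : measurable ((B \o enum_val) i) /\
    (B \o enum_val) i `<=` @quadrant R.
  exact: hB.
have tB' : trivIset [set: 'I_#|J|] (B \o enum_val).
  move/trivIsetP : tB => tB; apply/trivIsetP => i j _ _ ij /=.
  by apply: tB => //; apply: contra ij => /eqP/enum_val_inj ->.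
have hY' (i : 'I_#|J|) : measurable ((Y \o enum_val) i) by exact: hY.
move=> /(_ hB' tB' hY') <-; congr (P _); apply/seteqP; split => w /= h.
  by move=> i _; exact: (h (enum_val i)).
by move=> j _; have := h (enum_rank j) I; rewrite /= enum_rankK.
Qed.

(** Independence is given for disjoint sets only, whereas the generators of the sigma-algebra
    overlap. Finitely many of them are cut into the disjoint atoms of the algebra they generate, and
    their counts are sums of the counts of atoms. *)
Lemma noise_indep (U D : set (plane R)) (Y : set (\bar R)) :
  measurable U -> U `<=` @quadrant R ->
  measurable D -> D `<=` @quadrant R -> U `&` D = set0 -> measurable Y ->
  <<s noise_gen U>> `<=` indep_of P [set w | Y (N w D)].
Proof.
move=> mU UQ mD DQ UD mY.
pose G : set (set T) := [set A | exists k (C : 'I_k -> set (plane R)) (Z : 'I_k -> set (\bar R)),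
  [/\ forall i, measurable (C i) /\ C i `<=` U, forall i, measurable (Z i) &
     A = \bigcap_i [set w | Z i (N w (C i))]]].
have mE : measurable [set w | Y (N w D)].
  by have := prm_measurable HN mD DQ measurableT mY; rewrite setTI.
have GI : setI_closed G.
  move=> _ _ [k [C [Z [hC hZ ->]]]] [k' [C' [Z' [hC' hZ' ->]]]].
  exists (k + k')%N, (fun i => match fintype.split i with inl a => C a | inr b => C' b end),
    (fun i => match fintype.split i with inl a => Z a | inr b => Z' b end); split.
  - by move=> i; case: fintype.split.
  - by move=> i; case: fintype.split.
  - apply/seteqP; split => w.
      by move=> [h h'] i _ /=; case: fintype.split => a; [exact: h|exact: h'].
    move=> h; split => i _ /=.
      by have := h (lshift k' i) I; rewrite /= (unsplitK (inl i : 'I_k + 'I_k')).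
    by have := h (rshift k i) I; rewrite /= (unsplitK (inr i : 'I_k + 'I_k')).
have sG : noise_gen U `<=` G.
  move=> _ [B [Z [mB BU mZ ->]]]; exists 1%N, (fun=> B), (fun=> Z); split => //.
  by apply/seteqP; split => w /= h; [move=> i _|have := h ord0 I].
apply: (@subset_trans _ <<s G>>); first exact: sub_smallest2r.
apply: indep_sigma => // _ [k [C [Z [hC hZ ->]]]].
pose atom (J : {set 'I_k}) := [set z | U z /\ [set i | `[< C i z >] ]%SET = J].
have atomE J : atom J = U `&` \bigcap_i (if i \in J then C i else ~` C i).
  apply/seteqP; split => z [Uz].
    move=> <-; split => // i _; rewrite inE; case: asboolP => //.
  move=> h; split => //; apply/setP => i; rewrite inE.
  by have := h i I; case: ifP => _ hi; apply/asboolP.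
have matom J : measurable (atom J).
  rewrite atomE; apply: measurableI => //; apply: fin_bigcap_measurable => // i _.
  by case: ifP => _; [|apply: measurableC]; case: (hC i).
have tatom : trivIset setT atom.
  apply/trivIsetP => J J' _ _ /eqP JJ'; apply/seteqP; split => // z [[_ h] [_ h']].
  by apply: JJ'; rewrite -h -h'.
pose H : set (set T) := [set A | exists Z' : {set 'I_k} -> set (\bar R),
  (forall J, measurable (Z' J)) /\ A = \bigcap_J [set w | Z' J (N w (atom J))]].
have HI : setI_closed H.
  move=> _ _ [Z1 [mZ1 ->]] [Z2 [mZ2 ->]]; exists (fun J => Z1 J `&` Z2 J); split.
    by move=> J; exact: measurableI.
  apply/seteqP; split => w; first by move=> [h1 h2] J _; split; [exact: h1|exact: h2].
  by move=> h; split => J _; have [] := h J I.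
have Hind : <<s H>> `<=` indep_of P [set w | Y (N w D)].
  apply: indep_sigma => // _ [Z' [mZ' ->]].
  have atomQ J : measurable (atom J) /\ atom J `<=` @quadrant R.
    by split => // z [/UQ].
  (* [None] stands for [D], so that the atoms and [D] form a single disjoint family. *)
  pose B (j : option {set 'I_k}) := if j is Some J then atom J else D.
  pose YY W (j : option {set 'I_k}) := if j is Some J then Z' J else W.
  have hB j : measurable (B j) /\ B j `<=` @quadrant R by case: j.
  have tB : trivIset setT B.
    apply/trivIsetP => -[J|] [J'|] _ _ // JJ'.
    - by move/trivIsetP : tatom; apply => //; apply: contra JJ' => /eqP ->.
    - by apply/seteqP; split => // z [[Uz _] Dz]; rewrite -UD.
    - by apply/seteqP; split => // z [Dz [Uz _]]; rewrite -UD.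
  have key W : measurable W ->
      P (\bigcap_J [set w | Z' J (N w (atom J))] `&` [set w | W (N w D)]) =
      P [set w | W (N w D)] * \prod_(j | j != None) P [set w | YY setT j (N w (B j))].
    move=> mW; have := @prm_indep_fin _ B (YY W) hB tB.
    rewrite (bigD1 None)//= => h.
    rewrite (_ : \bigcap_J _ `&` _ = \bigcap_j [set w | YY W j (N w (B j))]).
      rewrite h; last by case.
      by congr (_ * _); apply: eq_bigr => -[].
    apply/seteqP; split => w.
      by move=> [h1 h2] [J|] _ //; exact: h1.
    by move=> h1; split; [move=> J _; exact: (h1 (Some J))|exact: (h1 None)].
  (* With [W = setT] the formula identifies the product over the atoms with the probability of their
     joint event. *)
  have kT := key setT measurableT; have kY := key Y mY.
  split.
    apply: fin_bigcap_measurable => // J _; have [m1 q1] := atomQ J.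
    by have := prm_measurable HN m1 q1 measurableT (mZ' J); rewrite setTI.
  rewrite kY muleC; congr (_ * _).
  move: kT; rewrite (_ : [set w | setT (N w D)] = setT); last by apply/seteqP; split.
  by rewrite setIT probability_setT mul1e => ->.
apply: Hind.
have mN i : @measurable_fun _ _ (g_sigma_algebraType H) _ setT (fun w => N w (C i)).
  have -> : (fun w => N w (C i)) = (fun w => \sum_(J : {set 'I_k} | i \in J) N w (atom J)).
    apply/funext => w.
    rewrite -measure_bigcup_fintype//; congr (N w _); apply/seteqP; split => z.
      move=> Cz; exists [set i | `[< C i z >] ]%SET => /=.
        by rewrite inE; apply/asboolP.
      by split => //; exact: (hC i).2.
    by move=> [J /= iJ [_ JE]]; move: iJ; rewrite -JE inE => /asboolP.
  under eq_fun do rewrite big_mkcond.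
  apply: (@emeasurable_sum _ (g_sigma_algebraType H)) => J.
  case iJ : (i \in J); last exact: measurable_cst.
  move=> _ W mW; rewrite setTI.
  apply: sub_sigma_algebra.
  exists (fun J' => if J' == J then W else setT); split; first by move=> J'; case: ifP.
  apply/seteqP; split => w /=.
    by move=> h J' _ /=; case: ifP => // /eqP ->.
  by move=> /(_ J I) /=; rewrite eqxx.
have : @measurable _ (g_sigma_algebraType H) (\bigcap_i [set w | Z i (N w (C i))]).
  apply: fin_bigcap_measurable => // i _.
  by have := mN i measurableT (Z i) (hZ i); rewrite setTI.
by [].
Qed.

End poisson_measure_independence.

Section sigma_algebra_facts.
Context (T : Type).

Lemma sigmaI (D : set T) (G : set (set T)) A B : (forall X, <<s D, G>> X -> X `<=` D) ->
  <<s D, G>> A -> <<s D, G>> B -> <<s D, G>> (A `&` B).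
Proof.
move=> GD; have := smallest_sigma_algebra D G.
by move=> /(sigma_algebraP GD)[_ _ _]; apply.
Qed.

Lemma sigma_sub (D : set T) (G : set (set T)) : (forall X, G X -> X `<=` D) ->
  forall X, <<s D, G>> X -> X `<=` D.
Proof.
move=> GD; apply: smallest_sub => //; split => //.
by move=> F FD; apply: bigcup_sub => i _; exact: FD.
Qed.

Lemma sigmaU (D : set T) (G : set (set T)) A B :
  <<s D, G>> A -> <<s D, G>> B -> <<s D, G>> (A `|` B).
Proof.
move=> GA GB; have [G0 _ GU] := smallest_sigma_algebra D G.
by rewrite -bigcup2E; apply: GU => -[|[|i]].
Qed.

Lemma sigma_count_bigcup (D : set T) (G : set (set T)) (I : countType) (F : I -> set T) :
  (forall i, <<s D, G>> (F i)) -> <<s D, G>> (\bigcup_i F i).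
Proof.
move=> GF; have [G0 _ GU] := smallest_sigma_algebra D G.
have -> : \bigcup_i F i = \bigcup_n (if @unpickle I n is Some i then F i else set0).
  apply/seteqP; split => x [i _ Fx]; first by exists (pickle i); rewrite ?pickleK.
  by move: Fx; case: unpickle => // j; exists j.
by apply: GU => n; case: unpickle.
Qed.

End sigma_algebra_facts.

(** * Past and future of the noise; the compensation formula *)

Section noise_events.
Context (R : realType) (d n : nat) (gamma : 'I_d -> 'I_d -> R)
  (disp : measure_display) (T : measurableType disp)
  (P : probability T R)
  (N : edge d -> T -> noise R).
Notation jump := (jumps gamma).
Hypothesis HN : poisson_noise n gamma P N.
Local Open Scope ereal_scope.
Notation leb2 := (leb \x leb)%E.
Notation F := (noise_filtration gamma P N).

(** The filtration before completion: independence of the future is proved for it and carried over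
    to the completion by [filtration_raw]. *)
Definition raw_filtration (s : R) : set (set T) :=
  <<s [set A | exists e (t : R) (B : set (mR R)) Y,
        [/\ jump e, (0 <= t <= s)%R, measurable B /\ B `<=` `[0%R, +oo[,
            measurable Y & A = [set w | Y (N e w (`]0%R, t] `*` B))]]] >>.

Definition past (s : R) : set (plane R) := `]0%R, s] `*` `[0%R, +oo[.

Lemma past_quadrant s : past s `<=` @quadrant R.
Proof.
move=> z [/= h1 h2]; split => //=; move: h1; rewrite !in_itv/= => /andP[h _].
by rewrite andbT ltW.
Qed.

Lemma measurable_past s : measurable (past s).
Proof. by apply: measurableX. Qed.

(** Two independences combine: for one edge between the disjoint regions before and after [s], and
    across distinct edges. Intersections of one past event per edge form a generator stable under
    intersection. *)
Lemma raw_filtration_indep e s (D : set (plane R)) Y : jump e ->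
  measurable D -> D `<=` `]s, +oo[ `*` `[0%R, +oo[ -> (0 <= s)%R -> measurable Y ->
  raw_filtration s `<=` indep_of P [set w | Y (N e w D)].
Proof.
move=> je mD Ds s0 mY; have [HP HI] := HN.
have DQ : D `<=` @quadrant R.
  move=> z /Ds [/= h1 h2]; split => //=; move: h1; rewrite !in_itv/= !andbT => h.
  by rewrite ltW// (le_lt_trans s0).
have mE : measurable [set w | Y (N e w D)] by exact: (prm_measurable_set (HP e je)).
pose E := [set w | Y (N e w D)].
pose loc e' := <<s noise_gen (N e') (past s)>>.
have loc_noise e' : loc e' `<=` sigma_noise (N e').
  apply: sub_sigma_algebra2 => A [B [Z [mB BU mZ ->]]]; exists B, Z; split => //.
  by apply: subset_trans BU _; exact: past_quadrant.
have locm e' : jump e' -> loc e' `<=` measurable.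
  by move=> je'; apply: subset_trans (loc_noise e') _; exact: (noise_gen_measurable (HP e' je')).
have locE A : loc e A -> P (A `&` E) = P A * P E.
  move=> lA; have [] // := noise_indep (HP e je) (measurable_past s)
    (@past_quadrant s) mD DQ _ mY lA.
  apply/seteqP; split => // z [[/= h1 _] /Ds [/= h2 _]]; move: h1 h2.
  by rewrite !in_itv/= andbT => /andP[_ h] /(le_lt_trans h); rewrite ltxx.
pose G : set (set T) := [set A | exists Ae : edge d -> set T,
  (forall e', jump e' -> loc e' (Ae e')) /\
  A = \bigcap_(e' in [set e' | jump e']) Ae e'].
have GI : setI_closed G.
  move=> _ _ [A1 [h1 ->]] [A2 [h2 ->]]; exists (fun e' => A1 e' `&` A2 e'); split.
    by move=> e' je'; apply: sigmaI; [|exact: h1|exact: h2].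
  by rewrite bigcapI.
apply: (@subset_trans _ <<s G>>).
  rewrite /raw_filtration; apply: sub_sigma_algebra2 => _ [e' [t [B [Z [je' /andP[t0 ts] [mB B0] mZ ->]]]]].
  exists (fun e'' => if e'' == e' then [set w | Z (N e' w (`]0%R, t] `*` B))] else setT).
  split.
    move=> e'' je''; case: eqP => [->|_].
      apply: sub_sigma_algebra; exists (`]0%R, t] `*` B), Z; split => //.
        by apply: measurableX.
      move=> [x y] [/= h1 /B0 h2]; split => //=; move: h1; rewrite !in_itv/=.
      by move=> /andP[-> xt]; rewrite (le_trans xt).
    by rewrite -setC0; apply: sigma_algebraC; exact: sigma_algebra0.
  apply/seteqP; split => w /= h; first by move=> e'' _; case: eqP.
  by have := h e' je'; rewrite eqxx.
apply: indep_sigma => // _ [Ae [hA ->]].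
split.
  apply: fin_bigcap_measurable; last by move=> e' je'; exact: (locm e' je' _ (hA e' je')).
  by apply: (sub_finite_set (@subsetT _ _)); exact: finite_finset.
have h1 := HI Ae (fun e' je' => loc_noise e' _ (hA e' je')).
(* The future event is attached to the factor of [e], so that independence across edges applies a
   second time. *)
pose Ae' e' := if e' == e then Ae e `&` E else Ae e'.
have hA' e' : jump e' -> sigma_noise (N e') (Ae' e').
  rewrite /Ae' => je'; case: eqP => [->|_]; last exact: (loc_noise _ _ (hA _ je')).
  apply: sigmaI => //; first exact: (loc_noise _ _ (hA _ je)).
  by apply: sub_sigma_algebra; exists D, Y.
have h2 := HI Ae' hA'.
rewrite h1 (_ : _ `&` _ = \bigcap_(e' in [set e' | jump e']) Ae' e'); last first.
  apply/seteqP; split => w.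
    by move=> [h Ew] e' je'; rewrite /Ae'; case: eqP => [|_]; [split => //|]; exact: h.
  move=> h; split; last by have := h e je; rewrite /Ae' eqxx => -[].
  by move=> e' je'; have := h e' je'; rewrite /Ae'; case: eqP => [-> []|].
rewrite h2 (bigD1 e)//= [in RHS](bigD1 e)//= /Ae' eqxx locE; last exact: hA.
rewrite -muleA [P E * _]muleC muleA; congr (_ * _ * _).
by apply: eq_bigr => e' /andP[_ /negbTE ->].
Qed.

(** The events that agree almost everywhere with a raw one form a sigma-algebra, and it contains the
    negligible sets. *)
Lemma filtration_raw s A : F s A -> exists2 A', raw_filtration s A' &
  {ae P, forall w, A w <-> A' w}.
Proof.
move: A; apply: smallest_sub.
  split.
  - by exists set0; [exact: sigma_algebra0|exact: aeW].
  - move=> A [A' rA AA]; exists (~` A'); first exact: sigma_algebraC.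
    apply: filterS AA => w AA; split; first by move=> [_ nA] /AA.
    by move=> nA; split => // /AA.
  - move=> A h.
    have /choice[A' hA'] : forall i, exists A', raw_filtration s A' /\
        {ae P, forall w, A i w <-> A' w}.
      by move=> i; have [A' ? ?] := h i; exists A'.
    exists (\bigcup_i A' i).
      by apply: sigma_algebra_bigcup => i; case: (hA' i).
    have : {ae P, forall w, forall i, A i w <-> A' i w}.
      by apply/ae_foralln => i; case: (hA' i).
    by apply: filterS => w hw; split => -[i _ /hw]; exists i.
move=> A [h|nA].
  by exists A; [exact: sub_sigma_algebra|exact: aeW].
exists set0; first exact: sigma_algebra0.
by apply: negligibleS nA => w /= h; apply: contrapT => nAw; apply: h; split.
Qed.

Lemma filtration_le s t : (s <= t)%R -> F s `<=` F t.
Proof.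
move=> st; rewrite /noise_filtration; apply: sub_sigma_algebra2 => A [|]; last by right.
move=> [e [u [B [Y [je /andP[u0 us] hB mY ->]]]]]; left.
by exists e, u, B, Y; split => //; rewrite u0 (le_trans us).
Qed.

Lemma filtrationT s : F s setT.
Proof. by rewrite -setC0; apply: sigma_algebraC; exact: sigma_algebra0. Qed.

Lemma filtrationI s A B : F s A -> F s B -> F s (A `&` B).
Proof. exact: sigmaI. Qed.

Section compensation.
Variable e : edge d.
Hypothesis je : jump e.

Let HP := (proj1 HN) e je.

(** A random region of the plane is encoded as a set of triples (time, realization, mark). *)
Definition slice (D : set ((R * T) * R)) (w : T) : set (plane R) :=
  [set z | D ((z.1, w), z.2)].

Definition box (t b : R) : set (plane R) := `]0%R, t] `*` `[0%R, b].

Lemma measurable_box t b : measurable (box t b).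
Proof. by apply: measurableX. Qed.

Lemma box_quadrant t b : box t b `<=` @quadrant R.
Proof.
move=> z [/= h1 h2]; split => //=; move: h1 h2; rewrite !in_itv/= !andbT.
  by move=> /andP[/ltW].
by move=> _ /andP[].
Qed.

Lemma leb2X (A B : set (mR R)) : measurable A -> measurable B ->
  leb2 (A `*` B) = leb A * leb B.
Proof. by move=> mA mB; rewrite product_measure1E. Qed.

Lemma leb2_box t b : (0 <= t)%R -> (0 <= b)%R -> leb2 (box t b) = (t * b)%:E.
Proof.
move=> t0 b0; rewrite leb2X// !lebesgue_measure_itv/= !lte_fin.
rewrite EFinM !oppr0 !adde0.
have := t0; rewrite le_eqVlt => /predU1P[<-|t1]; first by rewrite ltxx !mul0e.
have := b0; rewrite le_eqVlt => /predU1P[<-|b1]; first by rewrite ltxx !mule0.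
by rewrite t1 b1.
Qed.

Lemma leb2_sub_box t b A : measurable A -> A `<=` box t b -> leb2 A < +oo.
Proof.
move=> mA Ab.
have h : leb2 A <= leb2 (box (Num.max t 0%R) (Num.max b 0%R)).
  apply: le_measure; rewrite ?inE//; first exact: measurable_box.
  apply: subset_trans Ab _ => z [/= h1 h2]; split; move: h1 h2; rewrite /= !in_itv/=.
    by move=> /andP[-> h]; rewrite le_max h.
  by move=> _ /andP[-> h]; rewrite le_max h.
by rewrite (le_lt_trans h)// leb2_box ?ltry// le_max lexx orbT.
Qed.

Lemma nu_lty t b A : measurable A -> A `<=` box t b -> n%:R%:E * leb2 A < +oo.
Proof.
move=> mA Ab; have h := leb2_sub_box mA Ab.
by apply: lte_mul_pinfty; rewrite ?lee_fin.
Qed.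

Lemma nu_ge0 (A : set (plane R)) : 0 <= n%:R%:E * leb2 A.
Proof. by rewrite mule_ge0// lee_fin. Qed.

Lemma noise_box_fin t b : {ae P, forall w, N e w (box t b) < +oo}.
Proof.
have h := prm_mean HP (measurable_box t b) (@box_quadrant t b) (nu_ge0 _)
  (nu_lty (measurable_box t b) (@subset_refl _ _)).
have := has_mean_fin (nu_lty (measurable_box t b) (@subset_refl _ _)) h.
by apply: filterS => w; rewrite ge0_fin_numE.
Qed.

Section fixed_box.
Variables (t b : R).
Hypotheses (t0 : (0 <= t)%R) (b0 : (0 <= b)%R).

Definition BOX : set ((R * T) * R) := [set u | box t b (u.1.1, u.2)].

(** The compensation formula for a random region: the expected number of its marks is [n] times its
    expected area. The fixed box keeps both means finite, which makes proper differences harmless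
    and leads to a lambda-system. *)
Definition compensated (D : set ((R * T) * R)) :=
  [/\ D `<=` BOX, forall w, measurable (slice D w) & exists v,
     has_mean P (fun w => leb2 (slice D w)) v /\
     has_mean P (fun w => N e w (slice D w)) (n%:R%:E * v)].

Lemma slice_BOX w : slice BOX w = box t b.
Proof. by apply/seteqP; split => -[]. Qed.

Lemma compensated_fin D v : D `<=` BOX -> (forall w, measurable (slice D w)) ->
  has_mean P (fun w => leb2 (slice D w)) v -> v <= (t * b)%:E.
Proof.
move=> DB mD h; apply: (has_mean_le _ h (has_mean_cst P _)); last exact: mulr_ge0.
apply: aeW => w; rewrite -leb2_box//; apply: le_measure; rewrite ?inE//.
  exact: measurable_box.
by move=> z /DB.
Qed.

Lemma compensatedB A B : B `<=` A -> compensated A -> compensated B ->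
  compensated (A `\` B).
Proof.
move=> BA [AB mA [v [h1 h2]]] [BB mB [v' [h1' h2']]].
have sl w : slice (A `\` B) w = slice A w `\` slice B w by [].
have vfin := le_lt_trans (compensated_fin AB mA h1) (ltry _).
have nv : n%:R%:E * v < +oo.
  by apply: lte_mul_pinfty; rewrite ?lee_fin//; exact: has_mean_ge0 h1.
have decomp (m : noise R) w : m (slice A w) =
    m (slice B w) + m (slice (A `\` B) w).
  rewrite -measureU//.
  - rewrite sl setDUK//; exact: (fun z => BA _).
  - by rewrite sl; exact: measurableD.
  - by rewrite sl setDIK.
have [k1 v'v] := has_meanB vfin h1 h1' (aeW _ (fun w => conj (measure_ge0 _ _) (decomp leb2 w))).
have [k2 _] := has_meanB nv h2 h2' (aeW _ (fun w => conj (measure_ge0 _ _) (decomp (N e w) w))).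
split.
- by apply: subset_trans AB; exact: subDsetl.
- by move=> w; rewrite sl; exact: measurableD.
- exists (v - v'); split => //; move: k2.
  have v0 := has_mean_ge0 h1; have v0' := has_mean_ge0 h1'.
  have vf : v \is a fin_num by rewrite ge0_fin_numE.
  have vf' : v' \is a fin_num by rewrite ge0_fin_numE// (le_lt_trans v'v).
  by rewrite -(fineK vf) -(fineK vf') muleBr// -!EFinM.
Qed.

Lemma compensated_BOX : compensated BOX.
Proof.
split => //; first by move=> w; rewrite slice_BOX; exact: measurable_box.
exists (leb2 (box t b)); split.
  apply: (has_mean_ae (g := cst (t * b)%:E)).
    by apply: aeW => w; rewrite slice_BOX leb2_box.
  by rewrite leb2_box//; apply: has_mean_cst; exact: mulr_ge0.
apply: (has_mean_ae (g := fun w => N e w (box t b))).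
  by apply: aeW => w; rewrite slice_BOX.
exact: (prm_mean HP (measurable_box t b) (@box_quadrant t b) (nu_ge0 _)
  (nu_lty (measurable_box t b) (@subset_refl _ _))).
Qed.

Lemma compensated_lambda : lambda_system BOX compensated.
Proof.
split.
- by move=> A [].
- exact: compensated_BOX.
- by move=> A B BA cA cB; exact: compensatedB.
- move=> D ndD cD.
  have /choice[v hv] : forall k, exists v,
     has_mean P (fun w => leb2 (slice (D k) w)) v /\
     has_mean P (fun w => N e w (slice (D k) w)) (n%:R%:E * v).
    by move=> k; case: (cD k).
  have mD k w : measurable (slice (D k) w) by case: (cD k).
  have DB k : D k `<=` BOX by case: (cD k).
  have sl w : slice (\bigcup_k D k) w = \bigcup_k slice (D k) w by [].
  have lim (m : noise R) w :
      (forall k, m (slice (D k) w) <= m (slice (D k.+1) w)) /\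
      m (slice (\bigcup_k D k) w) = ereal_sup (range (fun k => m (slice (D k) w))).
    have nd : nondecreasing_seq (fun k => slice (D k) w).
      by move=> i j /ndD/subsetPset h; apply/subsetPset => z; exact: h.
    have nm k : m (slice (D k) w) <= m (slice (D k.+1) w).
      by apply: le_measure; rewrite ?inE//; apply/subsetPset; exact: nd.
    split => //.
    have c1 : m (slice (D k) w) @[k --> \oo] --> m (slice (\bigcup_k D k) w).
      by rewrite sl; apply: nondecreasing_cvg_mu => //; exact: bigcupT_measurable.
    have c2 := ereal_nondecreasing_cvgn ((nondecreasing_seqP _).1 nm).
    exact: (cvg_unique (@ereal_hausdorff R) c1 c2).
  split.
  - by apply: bigcup_sub => k _.
  - by move=> w; rewrite sl; exact: bigcupT_measurable.
  - exists (ereal_sup (range v)); split.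
      by apply: (has_mean_nd (fun k => (hv k).1)); apply: aeW => w; exact: lim.
    have nv k : v k <= v k.+1.
      by apply: (has_mean_le _ (hv k).1 (hv k.+1).1); apply: aeW => w; exact: (lim leb2 w).1.
    have -> : n%:R%:E * ereal_sup (range v) = ereal_sup (range (fun k => n%:R%:E * v k)).
      have c1 := ereal_nondecreasing_cvgn ((nondecreasing_seqP _).1 nv).
      have nv' k : n%:R%:E * v k <= n%:R%:E * v k.+1.
        by apply: lee_pmul => //; rewrite ?lee_fin//; exact: has_mean_ge0 (hv k).1.
      have c2 := ereal_nondecreasing_cvgn ((nondecreasing_seqP _).1 nv').
      have c3 : n%:R%:E * v k @[k --> \oo] --> n%:R%:E * ereal_sup (range v) by exact: cvgeZl.
      exact: (cvg_unique (@ereal_hausdorff R) c3 c2).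
    by apply: (has_mean_nd (fun k => (hv k).2)); apply: aeW => w; exact: lim.
Qed.

(** The only probabilistic input: an event known at time [s] is independent of the marks in a fixed
    region after [s]. *)
Lemma compensated_rect (s s' : R) A (B : set (mR R)) :
  (0 <= s)%R -> F s A -> measurable B ->
  compensated (BOX `&` [set u | [/\ (s < u.1.1 <= s')%R, A u.1.2 & B u.2]]).
Proof.
move=> s0 FA mB; set D := _ `&` _.
have [A' rA AA] := filtration_raw FA.
pose C : set (plane R) := box t b `&` (`]s, s'] `*` B).
have mC : measurable C.
  by apply: measurableI; [exact: measurable_box|exact: measurableX].
have sl w : slice D w = if w \in A then C else set0.
  apply/seteqP; split => -[x y].
    by move=> [h1 [/= h2 h3 h4]]; rewrite mem_set.
  have [/set_mem Aw|//] := boolP (w \in A); move=> [h1 [/= h2 h3]]; split => //.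
have Cbox : C `<=` box t b by exact: subIsetl.
have CQ : C `<=` @quadrant R by apply: subset_trans Cbox _; exact: box_quadrant.
have Cs : C `<=` `]s, +oo[ `*` `[0%R, +oo[.
  move=> z [h1 [/= h2 h3]]; split => /=.
    by move: h2; rewrite !in_itv/= andbT => /andP[].
  by case: h1 => _ /=; rewrite !in_itv/= andbT => /andP[].
have ind (k : nat) : P (A' `&` [set w | N e w C = k%:R%:E]) =
    P A' * P [set w | N e w C = k%:R%:E].
  by have [] := raw_filtration_indep je mC Cs s0 (emeasurable_set1 k%:R%:E) rA.
have mA' : measurable A'.
  by have [] := raw_filtration_indep je mC Cs s0 (emeasurable_set1 0) rA.
have h := prm_mean_indep HP mC CQ (nu_ge0 _) (nu_lty mC Cbox) mA' ind.
have eqm (m : T -> noise R) :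
   {ae P, forall w, m w (slice D w) = (\1_A' w)%:E * m w C}.
  apply: filterS AA => w AA; rewrite sl indicE.
  rewrite (_ : (w \in A) = (w \in A')); last first.
    by apply/idP/idP => /set_mem/AA/mem_set.
  by case: ifP; rewrite ?mul1e// mul0e measure0.
split.
- exact: subIsetl.
- by move=> w; rewrite sl; case: ifP.
- exists (P A' * leb2 C); split.
    apply: (has_mean_ae (eqm (fun=> leb2))).
    have Cfin : leb2 C \is a fin_num by rewrite ge0_fin_numE//; exact: leb2_sub_box mC Cbox.
    have mind : has_mean P (fun w => (\1_A' w)%:E) (P A').
      have := @has_mean_measurable _ _ _ P (fun w => (\1_A' w)%:E).
      rewrite integral_indic// setIT; apply; last by move=> w; rewrite lee_fin.
      by apply/measurable_EFinP; exact: measurable_indic.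
    rewrite -(fineK Cfin) muleC.
    apply: (has_mean_ae (g := fun w => (fine (leb2 C))%:E * (\1_A' w)%:E)).
      by apply: aeW => w; rewrite muleC fineK.
    by apply: has_meanZ => //; exact: fine_ge0.
  by rewrite muleCA; apply: (has_mean_ae (eqm (N e))).
Qed.

Lemma compensated_predictable (A : set (R * T)) (B : set (mR R)) :
  predictable_sigma F A -> measurable B ->
  compensated (BOX `&` [set u | A u.1 /\ B u.2]).
Proof.
move=> + mB; pose D0 : set (R * T) := [set u | (0 <= u.1)%R].
pose G : set (set (R * T)) := ([set D | exists2 A, F 0 A & D = [set 0%R] `*` A]
  `|` [set D | exists (s t : R) A,
         [/\ (0 <= s <= t)%R, F s A & D = `]s, t] `*` A]]).
have G0 X : G X -> X `<=` D0.
  move=> [[A' _ ->] [x w] [/= -> _]|[s [t' [A' [/andP[s0 _] _ ->]]]] [x w] []].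
    by rewrite /D0 /=.
  by rewrite /= in_itv/= => /andP[/ltW /(le_trans s0)].
have GI : setI_closed G.
  move=> X Y [[A1 F1 ->]|[s1 [t1 [A1 [/andP[s10 st1] F1 ->]]]]]
    [[A2 F2 ->]|[s2 [t2 [A2 [/andP[s20 st2] F2 ->]]]]].
  - by left; exists (A1 `&` A2); [exact: filtrationI|rewrite -setXI setIid].
  - left; exists set0; first exact: sigma_algebra0.
    apply/seteqP; split => -[x w] [] //= [-> _].
    by rewrite in_itv/= ltNge s20 => -[].
  - left; exists set0; first exact: sigma_algebra0.
    apply/seteqP; split => -[x w] [] //= [h _] [x0 _].
    by move: h; rewrite x0 in_itv/= ltNge s10.
  (* Generators require ordered end-points; clamping the upper one turns disjoint intervals into an
     empty []s, s]]. *)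
  - right; exists (Num.max s1 s2), (Num.max (Num.max s1 s2) (Num.min t1 t2)), (A1 `&` A2).
    split.
    + by rewrite le_max s10/= le_max lexx.
    + apply: filtrationI; [apply: filtration_le F1|apply: filtration_le F2];
        by rewrite le_max lexx ?orbT.
    + apply/seteqP; split => -[x w] /=; rewrite !in_itv/=.
        move=> [[/andP[a1 a2] a3] [/andP[a4 a5] a6]]; split => //.
        by rewrite gt_max a1 a4/= le_max le_min a2 a5 orbT.
      rewrite gt_max => -[/andP[/andP[a1 a2]]].
      rewrite le_max => /orP[|]; first by rewrite le_max leNgt a1 leNgt a2.
      by rewrite le_min => /andP[a3 a4] [a5 a6]; rewrite a1 a2 a3 a4.
pose H (A : set (R * T)) := A `<=` D0 /\
  compensated (BOX `&` [set u | A u.1 /\ B u.2]).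
suff : <<s D0, G>> `<=` H by move=> h /h[].
have cset0 : compensated set0.
  rewrite -(setDv BOX); apply: compensatedB => //; exact: compensated_BOX.
have full : compensated (BOX `&` [set u | D0 u.1 /\ B u.2]).
  rewrite (_ : BOX `&` _ =
      BOX `&` [set u | [/\ (0 < u.1.1 <= t)%R, setT u.1.2 & B u.2]]).
    by apply: compensated_rect => //; exact: filtrationT.
  apply/seteqP; split => -[[x w] y] [h1 h2]; split => //; case: h1 => /=; rewrite in_itv/=.
    by move=> h _; split => //; case: h2.
  by move=> /andP[/ltW h _] _; split => //; case: h2.
apply: lambda_system_subset => //.
- split => //.
  + by move=> A' [].
  + by split.
  + move=> A1 A2 A21 [A1D c1] [A2D c2]; split; first exact: subset_trans (@subDsetl _ _ _) A1D.
    have -> : BOX `&` [set u | (A1 `\` A2) u.1 /\ B u.2] =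
      (BOX `&` [set u | A1 u.1 /\ B u.2]) `\` (BOX `&` [set u | A2 u.1 /\ B u.2]).
      apply/seteqP; split => u.
        by move=> [h1 [[h2 h3] h4]]; split => // -[_ []].
      by move=> [[h1 [h2 h3]] h4]; split => //; split => //; split => // h5; exact: h4.
    apply: compensatedB => // u [h1 [h2 h3]]; split => //; split => //; exact: A21.
  + move=> A' ndA hA; split; first by apply: bigcup_sub => i _; case: (hA i).
    have [_ _ _ nd] := compensated_lambda.
    have -> : BOX `&` [set u | (\bigcup_i A' i) u.1 /\ B u.2] =
      \bigcup_i (BOX `&` [set u | A' i u.1 /\ B u.2]).
      apply/seteqP; split => u.
        by move=> [h1 [[i _ h2] h3]]; exists i.
      by move=> [i _ [h1 [h2 h3]]]; split => //; split => //; exists i.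
    apply: nd => [i j ij|i]; last by case: (hA i).
    apply/subsetPset => u [h1 [h2 h3]]; split => //; split => //.
    by move: h2; apply/subsetPset/ndA.
- move=> A' GA; split; first exact: G0.
  case: GA => [[A1 F1 ->]|[s [t' [A1 [/andP[s0 _] F1 ->]]]]].
    rewrite (_ : BOX `&` _ = set0)//; apply/seteqP; split => // -[[x w] y].
    by move=> [[/= h _] [[/= x0 _] _]]; move: h; rewrite x0 in_itv/= ltxx.
  rewrite (_ : BOX `&` _ =
     BOX `&` [set u | [/\ (s < u.1.1 <= t')%R, A1 u.1.2 & B u.2]]).
    exact: compensated_rect.
  apply/seteqP; split => -[[x w] y] [h1 h2]; split => //; move: h2 => /=; rewrite in_itv/=.
    by move=> [[]].
  by move=> [].
- exact: sigma_sub.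
Qed.

(** Points above the graph of [c * q] are separated from it by a rational level, so the complement
    of the region is a countable union of products of a predictable set with a half-line of
    marks. *)
Lemma compensation (A : set (R * T)) (q : R -> T -> R) (c : R) :
  predictable_sigma F A -> predictable F q -> (0 <= c)%R ->
  (forall s w, (0 <= s)%R -> (0 <= q s w)%R /\ (c * q s w <= b)%R) ->
  let D := [set u : (R * T) * R | [/\ (0 < u.1.1 <= t)%R, A u.1 &
     (0 <= u.2 <= c * q u.1.1 u.1.2)%R]] in
  compensated D.
Proof.
move=> pA pq c0 hq D.
pose D0 : set (R * T) := [set u | (0 <= u.1)%R].
pose Pi : set (set ((R * T) * R)) := [set X | exists A (B : set (mR R)),
  [/\ predictable_sigma F A, measurable B & X = BOX `&` [set u | A u.1 /\ B u.2]]].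
have predsub X : predictable_sigma F X -> X `<=` D0.
  apply: sigma_sub => Y [[A' _ ->] [x w] [/= -> _]|[s [t' [A' [/andP[s0 _] _ ->]]]] [x w] []].
    by rewrite /D0 /=.
  by rewrite /= in_itv/= => /andP[/ltW /(le_trans s0)].
have PiI : setI_closed Pi.
  move=> _ _ [A1 [B1 [p1 m1 ->]]] [A2 [B2 [p2 m2 ->]]].
  exists (A1 `&` A2), (B1 `&` B2); split.
  - exact: sigmaI.
  - exact: measurableI.
  - apply/seteqP; split => u; first by move=> [[h1 [h2 h3]] [_ [h4 h5]]].
    by move=> [h1 [[h2 h3] [h4 h5]]].
have sPi : <<s BOX, Pi>> `<=` compensated.
  apply: lambda_system_subset => //; first exact: compensated_lambda.
    by move=> _ [A1 [B1 [p1 m1 ->]]]; exact: compensated_predictable.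
  by apply: sigma_sub => _ [A1 [B1 [p1 m1 ->]]]; exact: subIsetl.
apply: sPi.
pose bad (rho : rat) : set ((R * T) * R) := BOX `&` [set u |
  [set v | (0 <= v.1)%R /\ (q v.1 v.2 < ratr rho)%R] u.1 /\
  [set y | (c * ratr rho < y)%R] u.2].
have -> : D = (BOX `&` [set u | A u.1 /\ setT u.2]) `&` (BOX `\` \bigcup_rho bad rho).
  apply/seteqP; split => -[[s w] y].
    move=> [/= h1 h2 /andP[h3 h4]].
    have s0 : (0 <= s)%R by case/andP: h1 => /ltW.
    have hB : BOX (s, w, y).
      split => /=; rewrite in_itv/= ?h1// h3 (le_trans h4)//.
      by have [_] := hq s w s0.
    split => //; split => // -[rho _ [_ [[_ /= h5] /= h6]]].
    have : (c * q s w <= c * ratr rho)%R by rewrite ler_wpM2l// ltW.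
    by move=> /(le_trans h4); rewrite leNgt h6.
  move=> [[[/= h1 h2] [/= h3 _]] [_ h4]]; move: h1 h2; rewrite !in_itv/= => h1 /andP[h2 h5].
  split => //=; rewrite h2/= leNgt; apply/negP => h6; apply: h4.
  have s0 : (0 <= s)%R by case/andP: h1 => /ltW.
  have [rho qr ry] : exists2 rho : rat, (q s w < ratr rho)%R & (c * ratr rho < y)%R.
    have := c0; rewrite le_eqVlt => /predU1P[c00|cp].
      have : (q s w < q s w + 1)%R by rewrite ltrDl.
      move=> /rat_in_itvoo[rho]; rewrite in_itv/= => /andP[r1 r2].
      by exists rho => //; move: h6; rewrite -c00 !mul0r.
    have : (q s w < y / c)%R by rewrite ltr_pdivlMr// mulrC.
    move=> /rat_in_itvoo[rho]; rewrite in_itv/= => /andP[r1 r2].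
    by exists rho => //; rewrite mulrC -ltr_pdivlMr.
  exists rho => //; split => //=.
  by split; rewrite /= in_itv/= ?h1 ?h2.
have sBOX X : <<s BOX, Pi>> X -> X `<=` BOX.
  by apply: sigma_sub => _ [A1 [B1 [p1 m1 ->]]]; exact: subIsetl.
apply: sigmaI => //.
  by apply: sub_sigma_algebra; exists A, setT.
apply: sigma_algebraCD; apply: sigma_count_bigcup => rho.
apply: sub_sigma_algebra; exists [set v | (0 <= v.1)%R /\ (q v.1 v.2 < ratr rho)%R],
  [set y | (c * ratr rho < y)%R]; split => //.
  have := pq [set y | (y < ratr rho)%R]; apply.
  rewrite (_ : [set y | _] = `]-oo, (ratr rho)[%classic)//.
rewrite (_ : [set y | _] = `](c * ratr rho)%R, +oo[%classic)//.
by apply/seteqP; split => y /=; rewrite in_itv/= andbT.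
Qed.

End fixed_box.
End compensation.

(** * Sparsity of the marks on fine dyadic slabs *)

Lemma prob_bigcup_fintype (J : finType) (F : J -> set T) (c : \bar R) :
  (forall j, measurable (F j)) -> (forall j, P (F j) <= c) ->
  P (\bigcup_j F j) <= \sum_(j : J) c.
Proof.
move=> mF Fc.
have h (s : seq J) : P (\bigcup_(j in [set j | j \in s]) F j) <= \sum_(j <- s) c.
  elim: s => [|j s ih].
    by rewrite big_nil (_ : bigcup _ _ = set0) ?measure0// bigcup0.
  rewrite big_cons (_ : bigcup _ _ = F j `|` \bigcup_(j in [set j | j \in s]) F j).
    have mU : measurable (\bigcup_(j in [set j | j \in s]) F j).
      apply: fin_bigcup_measurable; last by move=> *; exact: mF.
      by apply: (sub_finite_set (@subsetT _ _)); exact: finite_finset.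
    have h1 : P (F j `|` \bigcup_(j in [set j | j \in s]) F j) <=
      P (F j) + P (\bigcup_(j in [set j | j \in s]) F j) by exact: measureU2.
    by rewrite (le_trans h1)//; exact: leeD.
  apply/seteqP; split => x.
    by move=> [i /=]; rewrite inE => /predU1P[->|is_]; [left|right; exists i].
  by move=> [Fj|[i /= is_ Fi]]; [exists j|exists i] => //=; rewrite inE ?eqxx ?is_ ?orbT.
rewrite (_ : \bigcup_j F j = \bigcup_(j in [set j | j \in index_enum J]) F j)//.
by congr bigcup; apply/seteqP; split => j //= _; rewrite mem_index_enum.
Qed.

(** All edges together have at most one mark here, so at most one jump can occur during the slab. *)
Definition sparse_slab (m : edge d -> noise R)
    (b a c : R) :=
  (forall e, jump e -> m e (`]a, c] `*` `[0%R, b]) = 0) \/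
  exists e0, [/\ jump e0, m e0 (`]a, c] `*` `[0%R, b]) = 1 &
    forall e, jump e -> e != e0 -> m e (`]a, c] `*` `[0%R, b]) = 0].

Definition sparse_level m (b t : R) (k : nat) :=
  forall i : nat, (i < 2 ^ k)%N ->
    sparse_slab m b (t * (i%:R / 2 ^+ k)) (t * (i.+1%:R / 2 ^+ k)).

Definition slab (a c b : R) : set (plane R) := `]a, c] `*` `[0%R, b].

Lemma measurable_slab a c b : measurable (slab a c b).
Proof. by apply: measurableX. Qed.

Lemma slab_quadrant a c b : (0 <= a)%R -> slab a c b `<=` @quadrant R.
Proof.
move=> a0 z [/= h1 h2]; split => //=; move: h1 h2; rewrite !in_itv/= !andbT.
  by move=> /andP[/ltW/(le_trans a0)].
by move=> _ /andP[].
Qed.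

Lemma leb2_slab a c b : (a <= c)%R -> (0 <= b)%R ->
  leb2 (slab a c b) = ((c - a) * b)%:E.
Proof.
move=> ac b0; rewrite leb2X//= !lebesgue_measure_itv/= !lte_fin.
rewrite EFinM !oppr0 !adde0.
have := ac; rewrite le_eqVlt => /predU1P[<-|t1]; first by rewrite ltxx subrr !mul0e.
have := b0; rewrite le_eqVlt => /predU1P[<-|b1]; first by rewrite ltxx !mule0.
by rewrite t1 b1 EFinB.
Qed.

(** The two ways to violate sparsity, indexed uniformly by pairs: a diagonal pair stands for several
    marks of one edge, any other pair for marks of two edges. *)
Definition crowded (b a c : R) (p : (edge d) * (edge d)) : set T :=
  if ~~ (jump p.1 && jump p.2) then set0 else
  if p.1 == p.2 then [set w | ~ (N p.1 w (slab a c b) = 0 \/ N p.1 w (slab a c b) = 1)]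
  else [set w | ~ (N p.1 w (slab a c b) = 0)] `&` [set w | ~ (N p.2 w (slab a c b) = 0)].

Lemma sparse_slabP w b a c : (forall p, ~ crowded b a c p w) ->
  sparse_slab (N ^~ w) b a c.
Proof.
move=> h.
have h1 e : jump e -> N e w (slab a c b) = 0 \/ N e w (slab a c b) = 1.
  move=> je; have := h (e, e); rewrite /crowded /= je /= eqxx => h0.
  by apply: contrapT => h'; apply: h0.
have [h2|] := pselect (forall e, jump e -> N e w (slab a c b) = 0); first by left.
move=> /existsNP[e0 /not_implyP[je0 ne0]]; right; exists e0; split => //.
  by have [] := h1 _ je0.
move=> e je ee0; have := h (e, e0); rewrite /crowded /= je je0 (negbTE ee0) /= => h0.
by apply: contrapT => h'; apply: h0; split.
Qed.

Lemma measurable_noise_slab e a c b (Y : set (\bar R)) : jump e ->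
  (0 <= a)%R -> measurable Y -> measurable [set w | Y (N e w (slab a c b))].
Proof.
move=> je a0 mY; apply: (prm_measurable_set ((proj1 HN) e je)) => //.
  exact: measurable_slab.
exact: slab_quadrant.
Qed.

Lemma measurable_crowded b a c p : (0 <= a)%R -> measurable (crowded b a c p).
Proof.
move=> a0; rewrite /crowded; case: ifPn => // /negPn/andP[j1 j2].
have m1 e (x : \bar R) : jump e -> measurable [set w | N e w (slab a c b) = x].
  by move=> je; exact: (@measurable_noise_slab e a c b [set x] je a0).
case: ifPn => _.
  by apply: measurableC; apply: measurableU; exact: m1.
by apply: measurableI; apply: measurableC; exact: m1.
Qed.

Lemma prob_crowded b a c p : (0 <= a <= c)%R -> (0 <= b)%R ->
  P (crowded b a c p) <= ((n%:R * ((c - a) * b)) ^+ 2)%:E.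
Proof.
move=> /andP[a0 ac] b0; rewrite /crowded; case: ifPn => [_|/negPn/andP[j1 j2]].
  by rewrite measure0 lee_fin sqr_ge0.
set x := (n%:R * _)%R.
have nuE : n%:R%:E * leb2 (slab a c b) = x%:E by rewrite leb2_slab.
have nu0 : 0 <= n%:R%:E * leb2 (slab a c b).
  by rewrite nuE lee_fin !mulr_ge0// subr_ge0.
have nuoo : n%:R%:E * leb2 (slab a c b) < +oo by rewrite nuE ltry.
have ms := measurable_slab a c b; have qs := @slab_quadrant a c b a0.
case: eqP => [_|/eqP p12].
  by have := prm_many ((proj1 HN) _ j1) ms qs nu0 nuoo; rewrite nuE.
have pos e : jump e -> P [set w | ~ (N e w (slab a c b) = 0)] <= x%:E.
  by move=> je; have := prm_pos ((proj1 HN) _ je) ms qs nuoo; rewrite nuE.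
pose A e := if (e == p.1) || (e == p.2) then [set w | ~ (N e w (slab a c b) = 0)] else setT.
have hA e : jump e -> sigma_noise (N e) (A e).
  move=> je; rewrite /A; case: ifP => _.
    by apply: sub_sigma_algebra; exists (slab a c b), (~` [set 0]); split => //; exact: measurableC.
  by rewrite -setC0; apply: sigma_algebraC; exact: sigma_algebra0.
have := (proj2 HN) A hA.
rewrite (_ : \bigcap_(e in _) _ = [set w | ~ (N p.1 w (slab a c b) = 0)] `&`
  [set w | ~ (N p.2 w (slab a c b) = 0)]); last first.
  apply/seteqP; split => w.
    move=> h; split.
      by have := h p.1 j1; rewrite /A eqxx.
    by have := h p.2 j2; rewrite /A eqxx orbT.
  by move=> [h1 h2] e _; rewrite /A; case: ifPn => // /orP[/eqP ->|/eqP ->].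
move=> ->; rewrite (bigD1 p.1)//= (bigD1 p.2)/=; last by rewrite j2 eq_sym.
rewrite big1 ?mule1; last first.
  move=> e /andP[/andP[_ e1] e2]; rewrite /A (negbTE e1) (negbTE e2)/=.
  by rewrite probability_setT.
rewrite /A eqxx eqxx orbT expr2 EFinM.
by apply: lee_pmul => //; exact: pos.
Qed.

(** Level [k] has [2 ^ k] slabs, each crowded with a probability of order [4 ^ (- k)], so it fails
    with probability at most [C / 2 ^ k]. One good level is asked for, hence the intersection of the
    failures has to be null. *)
Lemma sparse_ae (b t : R) : (0 <= b)%R -> (0 <= t)%R ->
  {ae P, forall w, exists k, sparse_level (N ^~ w) b t k}.
Proof.
move=> b0 t0.
pose lft k (i : nat) : R := (t * (i%:R / 2 ^+ k))%R.
have p2 k : (0 < 2 ^+ k :> R)%R by rewrite exprn_gt0.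
have lft0 k i : (0 <= lft k i)%R by rewrite !mulr_ge0// invr_ge0 ltW.
have lftS k i : (lft k i.+1 - lft k i = t / 2 ^+ k)%R.
  by rewrite /lft -mulrBr -mulrBl -natrB// subSnn mul1r.
pose bad k := \bigcup_(x : 'I_(2 ^ k) * ((edge d) * (edge d)))
  crowded b (lft k x.1) (lft k x.1.+1) x.2.
pose M := #|{: (edge d) * (edge d)}|.
pose C : R := (M%:R * (n%:R * (t * b)) ^+ 2)%R.
have mbad k : measurable (bad k).
  apply: fin_bigcup_measurable; first exact: finite_finset.
  by move=> x _; apply: measurable_crowded.
have Pbad k : P (bad k) <= (C / 2 ^+ k)%:E.
  have := @prob_bigcup_fintype _ (fun x : 'I_(2 ^ k) * ((edge d) * (edge d)) =>
    crowded b (lft k x.1) (lft k x.1.+1) x.2) ((n%:R * (t / 2 ^+ k * b)) ^+ 2)%:E.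
  move=> /(_ (fun x => measurable_crowded _ _ _ (lft0 k _))) h.
  apply: (le_trans (h _)).
    move=> x; rewrite -(lftS k x.1); apply: prob_crowded => //.
    by rewrite lft0/= -subr_ge0 lftS divr_ge0// ltW.
  rewrite sumEFin lee_fin sumr_const (_ : #|_| = (2 ^ k * M)%N); last first.
    by rewrite card_prod card_ord.
  rewrite -[X in (X <= _)%R]mulr_natl natrM.
  rewrite natrX /C le_eqVlt; apply/orP; left; apply/eqP.
  by field; rewrite gt_eqF.
exists (\bigcap_k bad k); split.
- exact: bigcapT_measurable.
- apply/eqP; rewrite eq_le measure_ge0 andbT.
  apply/lee_addgt0Pr => x x0; rewrite add0e.
  have C0 : (0 <= C)%R by rewrite mulr_ge0// sqr_ge0.
  have [k hk] : exists k, (C / 2 ^+ k <= x)%R.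
    have [k] := archi_boundP (divr_ge0 C0 (ltW x0)).
    exists (Num.bound (C / x)); rewrite ler_pdivrMr// mulrC -ler_pdivrMr//.
    have := archi_boundP (divr_ge0 C0 (ltW x0)) => /ltW/le_trans; apply.
    by rewrite -natrX ler_nat ltnW// ltn_expl.
  apply: (le_trans _ (le_trans (Pbad k) _)); last by rewrite lee_fin.
  by apply: le_measure; rewrite ?inE//; [exact: bigcapT_measurable|exact: bigcap_inf].
- move=> w /= nw k _; apply: contrapT => nb; apply: nw; exists k => i i2.
  apply: sparse_slabP => p hp; apply: nb.
  by exists (Ordinal i2, p).
Qed.

End noise_events.

(** * Counts in time strips, jump times and the pathwise chain rule *)

Section strips.
Context (R : realType) (m : noise R) (t b : R).
Hypothesis finb : (m (box t b) < +oo)%E.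

Definition strip (a c : R) : set (plane R) := [set z | a < z.1 <= c].

Lemma stripE a c : strip a c = `]a, c] `*` setT.
Proof. by apply/seteqP; split => -[x y]; rewrite /strip /= in_itv //= => -[]. Qed.

Lemma measurable_strip a c : measurable (strip a c).
Proof. by rewrite stripE; apply: measurableX. Qed.

Lemma fin_sub_box A : measurable A -> A `<=` box t b -> m A \is a fin_num.
Proof.
move=> mA Ab; rewrite ge0_fin_numE//; apply: le_lt_trans finb.
by apply: le_measure; rewrite ?inE//; exact: measurable_box.
Qed.

Lemma fine_measureU A B : measurable A -> measurable B -> A `<=` box t b ->
  B `<=` box t b -> A `&` B = set0 ->
  fine (m (A `|` B)) = fine (m A) + fine (m B).
Proof.
by move=> mA mB Ab Bb AB; rewrite measureU// fineD// fin_sub_box.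
Qed.

Lemma fine_le_measure A B : measurable A -> measurable B -> B `<=` box t b ->
  A `<=` B -> fine (m A) <= fine (m B).
Proof.
move=> mA mB Bb AB; apply: fine_le; rewrite ?fin_sub_box//.
  exact: subset_trans Bb.
by apply: le_measure; rewrite ?inE.
Qed.

Variable D : set (plane R).
Hypotheses (mD : measurable D) (Db : D `<=` box t b).

Lemma mDstrip a c : measurable (D `&` strip a c).
Proof. by apply: measurableI => //; exact: measurable_strip. Qed.

Lemma Dstripb a c : D `&` strip a c `<=` box t b.
Proof. by apply: subset_trans Db; exact: subIsetl. Qed.

Lemma fine_stripD a s c : a <= s -> s <= c ->
  fine (m (D `&` strip a c)) = fine (m (D `&` strip a s)) + fine (m (D `&` strip s c)).
Proof.
move=> as_ sc; rewrite -fine_measureU; try exact: mDstrip; try exact: Dstripb.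
  congr (fine (m _)); apply/seteqP; split => z.
    move=> [Dz /andP[h1 h2]]; have [h3|h3] := leP z.1 s; [left|right]; split => //.
      by rewrite /strip /= h1.
    by rewrite /strip /= h3.
  move=> [[Dz /andP[h1 h2]]|[Dz /andP[h1 h2]]]; split => //; rewrite /strip /=.
    by rewrite h1 (le_trans h2).
  by rewrite h2 (le_lt_trans as_).
apply/seteqP; split => // z [[_ /andP[_ h1]] [_ /andP[h2 _]]].
by move: h2; rewrite ltNge h1.
Qed.

Lemma fine_strip_empty a c : c <= a -> fine (m (D `&` strip a c)) = 0.
Proof.
move=> ca; rewrite (_ : _ `&` _ = set0) ?measure0//.
by apply/seteqP; split => // z [_ /andP[h1 /le_trans/(_ ca)]]; rewrite leNgt h1.
Qed.

Lemma fine_strip0 a c : fine (m (D `&` strip a c)) = 0 ->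
  forall B, measurable B -> B `<=` D `&` strip a c -> fine (m B) = 0.
Proof.
move=> h B mB BD; apply/le_anti/andP; split; last by rewrite fine_ge0.
rewrite -h; apply: fine_le_measure => //; first exact: mDstrip.
exact: Dstripb.
Qed.

Lemma fine_strip_mono a s s' : s <= s' ->
  fine (m (D `&` strip a s)) <= fine (m (D `&` strip a s')).
Proof.
move=> ss'; apply: fine_le_measure; try exact: mDstrip; first exact: Dstripb.
by move=> z [Dz /andP[h1 h2]]; split => //; rewrite /strip /= h1 (le_trans h2).
Qed.

(** The count of []a, s]] is right-continuous in [s]; a counting function with values 0 and 1 jumps
    at the supremum of its zeros. *)
Lemma jump_time a c : a <= c ->
  (forall s, a <= s <= c -> fine (m (D `&` strip a s)) = 0 \/ fine (m (D `&` strip a s)) = 1) ->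
  fine (m (D `&` strip a c)) = 1 ->
  exists2 sigma, a <= sigma <= c & [/\
    forall s, a <= s < sigma -> fine (m (D `&` strip a s)) = 0,
    fine (m (D `&` strip a sigma)) = 1 &
    fine (m (D `&` strip sigma c)) = 0].
Proof.
move=> ac h01 h1.
pose S := [set s | a <= s <= c /\ fine (m (D `&` strip a s)) = 0].
have Sa : S a by split; rewrite ?lexx ?fine_strip_empty.
have ubS : ubound S c by move=> s [/andP[]].
have supS : has_sup S by split; [exists a | exists c].
have aS : a <= sup S by exact: (sup_upper_bound supS).
have Sc : sup S <= c by apply: ge_sup => //; exists a.
(* Past [sup S] the count is already 1, so every strip that starts strictly later is null, and so is
   their countable union. *)
have null : fine (m (D `&` strip (sup S) c)) = 0.
  have -> : D `&` strip (sup S) c =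
      \bigcup_i (D `&` strip (sup S + i.+1%:R^-1) c).
    apply/seteqP; split => z.
      move=> [Dz /andP[z1 z2]]; have [i hi] := ltr_add_invr z1.
      by exists i => //; split => //; rewrite /strip /= hi.
    move=> [i _ [Dz /andP[z1 z2]]]; split => //; rewrite /strip /= z2 andbT.
    by apply: lt_trans z1; rewrite ltrDl invr_gt0.
  rewrite (_ : m _ = 0%E)//.
  have mF i : measurable (D `&` strip (sup S + i.+1%:R^-1) c) by exact: mDstrip.
  apply: measure_negligible; first exact: bigcupT_measurable.
  apply: negligible_bigcup => i; apply/negligibleP => //.
  have fz : fine (m (D `&` strip (sup S + i.+1%:R^-1) c)) = 0.
    have [ic|/ltW ic] := leP (sup S + i.+1%:R^-1) c; last exact: fine_strip_empty.
    have ai : a <= sup S + i.+1%:R^-1 by rewrite ler_wpDr.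
    have := fine_stripD ai ic; rewrite h1.
    have [h0|->] := h01 (sup S + i.+1%:R^-1) (introT andP (conj ai ic)); last first.
      by rewrite -[X in X = _]addr0 => /addrI.
    have : sup S + i.+1%:R^-1 <= sup S.
      by apply: (sup_upper_bound supS); split => //; rewrite ai ic.
    by rewrite gerDl leNgt invr_gt0 ltr0n.
  rewrite -[LHS]fineK ?fz//; apply: fin_sub_box => //; exact: Dstripb.
exists (sup S); first by rewrite aS Sc.
split => //.
  move=> s /andP[as_ sS].
  have sS0 : 0 < sup S - s by rewrite subr_gt0.
  have [s' [s'1 s'2]] := sup_adherent sS0 supS; rewrite opprB addrC subrK => ss'.
  apply/le_anti/andP; split; last by rewrite fine_ge0.
  by rewrite -s'2; apply: fine_strip_mono; exact: ltW.
by have := fine_stripD aS Sc; rewrite h1 null addr0.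
Qed.

End strips.

Section chain_rule.
Context (R : realType) (d n : nat) (gamma : 'I_d -> 'I_d -> R)
  (m : edge d -> noise R)
  (t b : R) (k : nat) (X Xm : R -> 'rV[R]_d) (D : edge d -> set (plane R))
  (J : finType) (pt : J -> 'rV[R]_d).
Notation jump := (jumps gamma).
Hypotheses (n0 : (0 < n)%N) (gd : forall x, gamma x x <= 0) (t0 : 0 <= t).
Hypothesis mD : forall e, jump e -> measurable (D e) /\ D e `<=` box t b.
Hypothesis finb : forall e, jump e -> (m e (box t b) < +oo)%E.
Hypothesis sp : sparse_level gamma m b t k.
Hypothesis eqX : forall s, 0 <= s <= t -> X s = X 0 +
  \sum_(e | jump e) (n%:R^-1 * fine (m e (D e `&` strip 0 s))) *: jump_vector R e.
Hypothesis gridX : forall s, 0 <= s <= t -> forall x, n%:R * X s ord0 x \is a Num.int.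
Hypothesis ptX : forall s, 0 <= s <= t -> exists j, X s = pt j.
Hypothesis pt_inj : injective pt.
Hypothesis HL : forall e z u j, jump e -> D e z -> 0 <= u < z.1 ->
  (forall s, u <= s < z.1 -> X s = pt j) -> Xm z.1 = pt j.
Let Dj e j := D e `&` [set z | Xm z.1 = pt j].
Hypothesis mDj : forall e j, jump e -> measurable (Dj e j).
Variable f : 'rV[R]_d -> R.

Let mu e A := fine (m e A).
Let v e : 'rV[R]_d := jump_vector R e.
Let dif e j := f (pt j + n%:R^-1 *: v e) - f (pt j).

Let increment a s : 0 <= a -> a <= s -> s <= t -> X s = X a +
  \sum_(e | jump e) (n%:R^-1 * mu e (D e `&` strip a s)) *: v e.
Proof.
move=> a0 as_ st; rewrite (eqX (s := s)) ?(le_trans a0 as_)// (eqX (s := a)) ?a0 ?(le_trans as_)//.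
rewrite -addrA -big_split/=; congr (_ + _); apply: eq_bigr => e je.
have [mDe Deb] := mD je.
by rewrite -scalerDl -mulrDr (fine_stripD (finb je) mDe Deb a0 as_).
Qed.

Let sub_slab e a s c : jump e -> s <= c -> D e `&` strip a s `<=` `]a, c] `*` `[0, b].
Proof.
move=> je sc z [Dz /andP[h1 h2]]; have [_ /(_ z Dz)[_ h3]] := mD je.
by split => //=; rewrite in_itv/= h1 (le_trans h2).
Qed.

Let mu_slab0 e a s c B : jump e -> s <= c -> m e (`]a, c] `*` `[0, b]) = 0%E ->
  measurable B -> B `<=` D e `&` strip a s -> mu e B = 0.
Proof.
move=> je sc h mB BD; rewrite /mu (_ : m e B = 0%E)//.
apply/eqP; rewrite eq_le measure_ge0 andbT -h; apply: le_measure; rewrite ?inE//.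
  exact: measurable_slab.
by apply: subset_trans BD _; exact: sub_slab.
Qed.

Let mDjs e j a s : jump e -> measurable (Dj e j `&` strip a s).
Proof. by move=> je; apply: measurableI; [exact: mDj|exact: measurable_strip]. Qed.

Let Djs e j a s : Dj e j `&` strip a s `<=` D e `&` strip a s.
Proof. by move=> z [[]]. Qed.

(** Only the edge [e0] with a mark in the slab can contribute. Up to the jump time the path rests at
    its initial value [pt j0], so this is the left value seen by the mark, and the increment of [f]
    is [dif e0 j0]. *)
Let step a c : 0 <= a -> a <= c -> c <= t -> sparse_slab gamma m b a c ->
  f (X c) = f (X a) + \sum_(e | jump e) \sum_j
    dif e j * mu e (Dj e j `&` strip a c).
Proof.
move=> a0 ac ct [all0|[e0 [je0 m1 others]]].
  have -> : X c = X a.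
    rewrite (increment a0 ac ct) big1 ?addr0// => e je.
    rewrite (mu_slab0 je (lexx c) (all0 e je)) ?mulr0 ?scale0r//.
    by have [mDe _] := mD je; exact: mDstrip.
  rewrite big1 ?addr0// => e je; rewrite big1// => j _.
  rewrite (mu_slab0 je (lexx c) (all0 e je)) ?mulr0//; first [exact: mDjs | exact: Djs].
have [mDe Deb] := mD je0; have fb := finb je0.
pose phi s := mu e0 (D e0 `&` strip a s).
have hX s : a <= s <= c -> X s = X a + (n%:R^-1 * phi s) *: v e0.
  move=> /andP[as_ sc]; rewrite (increment a0 as_ (le_trans sc ct)) (bigD1 e0)//=.
  rewrite big1 ?addr0// => e /andP[je ee0].
  rewrite (mu_slab0 je sc (others e je ee0)) ?mulr0 ?scale0r//.
  by have [mDe' _] := mD je; exact: mDstrip.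
have e12 : e0.1 != e0.2.
  by apply/negP => /eqP h; move: je0; rewrite /jumps h ltNge gd.
have vE : v e0 ord0 e0.2 = 1.
  by rewrite /v /jump_vector !mxE !eqxx/= eq_sym (negbTE e12) subr0.
(* The count is an integer by the equation itself, since [n * X] is integer valued, and the mass 1
   of the slab bounds it. *)
have phi01 s : a <= s <= c -> phi s = 0 \/ phi s = 1.
  move=> sac; have /andP[as_ sc] := sac.
  have phi_int : phi s \is a Num.int.
    have -> : phi s = n%:R * X s ord0 e0.2 - n%:R * X a ord0 e0.2.
      rewrite (hX s sac) 2!mxE vE mulr1 mulrDr mulrA mulfV ?mul1r ?pnatr_eq0 ?gt_eqF//.
      by rewrite addrAC subrr add0r.
    by rewrite rpredB// gridX// ?a0 ?(le_trans a0 as_)//= ?(le_trans ac)// (le_trans sc).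
  have phi0 : 0 <= phi s by rewrite fine_ge0.
  have phi1 : phi s <= 1.
    rewrite -[1]/(fine 1%E) -m1; apply: fine_le.
    - by apply: fin_sub_box fb _ _ _; [exact: mDstrip|exact: Dstripb].
    - by rewrite m1.
    - apply: le_measure; rewrite ?inE; [exact: mDstrip|exact: measurable_slab|exact: sub_slab].
  have : phi s \is a Num.nat by rewrite natrEint phi_int.
  move=> /natrP[i iE]; move: phi1; rewrite iE -[1]/(1%:R) ler_nat.
  by case: i {iE} => [|[|//]] _; [left|right].
rewrite (bigD1 e0)//= [X in _ + (_ + X)]big1 ?addr0; last first.
  move=> e /andP[je ee0]; rewrite big1// => j _.
  rewrite (mu_slab0 je (lexx c) (others e je ee0)) ?mulr0//; first [exact: mDjs | exact: Djs].
have cac : a <= c <= c by rewrite ac lexx.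
have [phi0|phi1] := phi01 c cac.
  rewrite (hX c cac) phi0 mulr0 scale0r addr0 big1 ?addr0// => j _.
  rewrite /mu (fine_strip0 fb mDe Deb phi0) ?mulr0//; first [exact: mDjs | exact: Djs].
have [j0 Xa] := ptX (s := a) (introT andP (conj a0 (le_trans ac ct))).
have [sigma /andP[asig sigc] [h0 h1 h2]] := jump_time fb mDe Deb ac phi01 phi1.
have Xmz z : D e0 z -> strip a sigma z -> Xm z.1 = pt j0.
  move=> Dz /andP[z1 z2]; apply: (HL (u := a) je0 Dz); first by rewrite a0.
  move=> s /andP[as_ sz]; have ssig := lt_le_trans sz z2.
  have p0 : phi s = 0 by apply: h0; rewrite as_ ssig.
  rewrite (hX s (introT andP (conj as_ (le_trans (ltW ssig) sigc)))) p0.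
  by rewrite mulr0 scale0r addr0.
rewrite (bigD1 j0)//= big1 ?addr0; last first.
  move=> j jj0; rewrite /mu (fine_strip0 fb mDe Deb h2) ?mulr0//.
    exact: mDjs.
  move=> z [[Dz Xz] /andP[z1 z2]]; split => //; rewrite /strip /= z2 andbT ltNge.
  apply/negP => zs; have := Xmz z Dz (introT andP (conj z1 zs)).
  by rewrite Xz => /pt_inj jj; rewrite jj eqxx in jj0.
have -> : mu e0 (Dj e0 j0 `&` strip a c) = 1.
  rewrite /mu (fine_stripD fb (mDj j0 je0) _ asig sigc); last first.
    by apply: subset_trans Deb; exact: subIsetl.
  have -> : fine (m e0 (Dj e0 j0 `&` strip sigma c)) = 0.
    by apply: (fine_strip0 fb mDe Deb h2); [exact: mDjs|exact: Djs].
  rewrite addr0 -h1; congr (fine (m e0 _)); apply/seteqP; split => z [].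
    by move=> [Dz _] ?; split.
  by move=> Dz sz; split => //; split => //; exact: Xmz.
by rewrite (hX c cac) phi1 mulr1 Xa mulr1 /dif [RHS]addrC subrK.
Qed.

(** The increments over the cells of a sparse dyadic partition telescope; [Xm] plays the role of the
    left limit, characterized by [HL]. *)
Lemma chain_rule : f (X t) = f (X 0) + \sum_(e | jump e) \sum_j
  (f (pt j + n%:R^-1 *: jump_vector R e) - f (pt j)) *
  fine (m e (D e `&` [set z | Xm z.1 = pt j])).
Proof.
pose s (i : nat) := t * (i%:R / 2 ^+ k).
have p2 : 0 < 2 ^+ k :> R by rewrite exprn_gt0.
have s0 i : 0 <= s i by rewrite !mulr_ge0// invr_ge0 ltW.
have sS i : s i <= s i.+1.
  by rewrite ler_wpM2l// ler_wpM2r ?invr_ge0 ?ler_nat// ltW.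
have st i : (i <= 2 ^ k)%N -> s i <= t.
  move=> i2; rewrite -[leRHS]mulr1 ler_wpM2l// ler_pdivrMr// mul1r -natrX.
  by rewrite ler_nat.
have key i : (i <= 2 ^ k)%N -> f (X (s i)) = f (X 0) + \sum_(e | jump e) \sum_j
    dif e j * mu e (Dj e j `&` strip 0 (s i)).
  elim: i => [_|i ih i2].
    rewrite /s mul0r mulr0 big1 ?addr0// => e je; rewrite big1// => j _.
    rewrite /mu (_ : _ `&` _ = set0) ?measure0 ?mulr0//.
    by apply/seteqP; split => // z [_ /andP[h1]]; rewrite leNgt h1.
  rewrite (step (s0 i) (sS i) (st _ i2)); last exact: sp.
  rewrite ih 1?ltnW// -addrA -big_split/=; congr (_ + _); apply: eq_bigr => e je.
  rewrite -big_split/=; apply: eq_bigr => j _; rewrite -mulrDr; congr (_ * _).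
  have [mDe Deb] := mD je.
  rewrite /mu (fine_stripD (finb je) (mDj j je) _ (s0 i) (sS i))//.
  by apply: subset_trans Deb; exact: subIsetl.
have s2 : s (2 ^ k)%N = t by rewrite /s natrX mulfV ?mulr1// gt_eqF.
have := key _ (leqnn _); rewrite s2 => ->; congr (_ + _).
apply: eq_bigr => e je; apply: eq_bigr => j _; congr (_ * fine (m e _)).
apply/seteqP; split => z; first by move=> [].
move=> [Dz h]; split => //; have [_ /(_ z Dz)[/= + _]] := mD je.
by rewrite in_itv.
Qed.

End chain_rule.

(** * The grid as a finite type of occupation numbers *)

Section grid_states.
Context (R : realType) (d n : nat).
Hypothesis n0 : (0 < n)%N.

(** Occupation numbers of the [d] states by [n] particles. A finite type allows sums over all
    positions of a path and makes events of paths countable unions. *)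
Definition state := {k : {ffun 'I_d -> 'I_n.+1} | \sum_x (k x : nat) == n}%N.

Definition pt (j : state) : 'rV[R]_d := \row_x ((val j x : nat)%:R / n%:R).

Let nR0 : n%:R != 0 :> R. Proof. by rewrite pnatr_eq0 -lt0n. Qed.

Lemma pt_grid j : prob_grid n (pt j).
Proof.
split; last first.
  by move=> x; rewrite mxE mulrCA mulfV// mulr1 rpred_nat.
split; first by move=> x; rewrite mxE divr_ge0.
under eq_bigr do rewrite mxE.
by rewrite -mulr_suml -natr_sum (eqP (valP j)) mulfV.
Qed.

Lemma pt_inj : injective pt.
Proof.
move=> j j' /rowP h; apply/val_inj/ffunP => x; apply/val_inj.
have := h x; rewrite !mxE => /(mulIf (invr_neq0 nR0)) /eqP.
by rewrite eqr_nat => /eqP.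
Qed.

Lemma grid_pt m : prob_grid n m -> exists j, pt j = m.
Proof.
move=> [[m0 m1] mint].
have /choice[k hk] : forall x, exists k : nat, n%:R * m ord0 x = k%:R.
  move=> x; have : n%:R * m ord0 x \is a Num.nat by rewrite natrEint mint mulr_ge0.
  by move=> /natrP[k ->]; exists k.
have sk : (\sum_x k x = n)%N.
  apply/eqP; rewrite -(eqr_nat R) natr_sum; under eq_bigr do rewrite -hk.
  by rewrite -mulr_sumr m1 mulr1.
have kn x : (k x < n.+1)%N by rewrite ltnS -sk (bigD1 x)//= leq_addr.
pose K := [ffun x => Ordinal (kn x)].
have sK : (\sum_x (K x : nat) == n)%N.
  by under eq_bigr do rewrite ffunE /=; rewrite sk.
exists (exist _ K sK); apply/rowP => x; rewrite mxE /= ffunE /= -hk.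
by rewrite mulrC mulKf.
Qed.

(** The default [j] is harmless: by [nxtP] a jump out of an occupied state never meets it. *)
Definition nxt (j : state) (e : edge d) : state :=
  odflt j [pick j' | pt j' == pt j + n%:R^-1 *: jump_vector R e].

Lemma jump_sum (e : edge d) : \sum_x (jump_vector R e) ord0 x = 0.
Proof.
rewrite /jump_vector; under eq_bigr do rewrite !mxE eqxx /=.
rewrite big_split/= sumrN.
have h y : \sum_x ((x == y)%:R : R) = 1.
  rewrite (bigD1 y)//= eqxx big1 ?addr0// => x /negbTE ->.
  by [].
by rewrite !h subrr.
Qed.

Lemma grid_jump m (e : edge d) : prob_grid n m -> e.1 != e.2 ->
  0 < m ord0 e.1 -> prob_grid n (m + n%:R^-1 *: jump_vector R e).
Proof.
move=> [[m0 m1] mint] e12 me.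
have vE x : n%:R * (m + n%:R^-1 *: jump_vector R e) ord0 x =
    n%:R * m ord0 x + ((x == e.2)%:R - (x == e.1)%:R).
  by rewrite !mxE eqxx /= mulrDr mulrA mulfV// mul1r.
have vint x : n%:R * (m + n%:R^-1 *: jump_vector R e) ord0 x \is a Num.int.
  by rewrite vE rpredD// rpredB// rpred_nat.
split => //; split; last first.
  under eq_bigr do rewrite mxE [X in _ + X]mxE.
  by rewrite big_split/= m1 -mulr_sumr jump_sum mulr0 addr0.
move=> x; have n0R : 0 < n%:R :> R by rewrite ltr0n.
rewrite -(pmulr_rge0 _ n0R) vE.
have [->|xe1] := eqVneq x e.1; last by rewrite subr0 addr_ge0// mulr_ge0.
rewrite (negbTE e12) sub0r subr_ge0.
have : n%:R * m ord0 e.1 \is a Num.nat by rewrite natrEint mint mulr_ge0.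
move=> /natrP[k kE]; rewrite kE -[1%:R]/(1%:R) ler_nat lt0n.
by apply/eqP => k0; move: kE; rewrite k0 => /eqP; rewrite mulf_eq0 (negbTE nR0) (gt_eqF me).
Qed.

Lemma nxtP j (e : edge d) : e.1 != e.2 -> 0 < pt j ord0 e.1 ->
  pt (nxt j e) = pt j + n%:R^-1 *: jump_vector R e.
Proof.
move=> e12 je; rewrite /nxt; case: pickP => [j' /eqP //|h].
have [j' hj'] := grid_pt (grid_jump (pt_grid j) e12 je).
by have := h j'; rewrite hj' eqxx.
Qed.

End grid_states.

(** * Pathwise construction of the feedback process by dyadic refinement *)

Section euler.
Context (R : realType) (d n : nat) (gamma : 'I_d -> 'I_d -> R) (b : R)
  (c : edge d -> state d n -> R) (j0 : state d n).
Notation jump := (jumps gamma).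
Implicit Type m : edge d -> noise R.
Hypotheses (n0 : (0 < n)%N) (gd : forall x, gamma x x <= 0).
Hypothesis c0 : forall e j, 0 <= c e j <= b.
Hypothesis c00 : forall e j, pt R j ord0 e.1 = 0 -> c e j = 0.

(** A difference of counts of slabs anchored at time 0, because the noise filtration is generated by
    counts on sets []0, s] * B]; for regular noise it equals the mass of [slab u s r]. *)
Definition euler_inc m (e : edge d) (u s r : R) : R :=
  fine (m e (slab 0 s r)) - fine (m e (slab 0 u r)).

(** On a sparse slab at most one edge qualifies, so the choice made by [pick] is immaterial
    there. *)
Definition euler_step m (x : state d n) (u s : R) : state d n :=
  if [pick e | jump e && (euler_inc m e u s (c e x) == 1)] is Some e
  then nxt R x e else x.

Fixpoint euler m (k i : nat) : state d n :=
  if i is i'.+1 then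
    euler_step m (euler m k i') (i'%:R / 2 ^+ k) (i'.+1%:R / 2 ^+ k)
  else j0.

Definition euler_path m (k : nat) (t : R) : state d n :=
  let i := Num.truncn (t * 2 ^+ k) in euler_step m (euler m k i) (i%:R / 2 ^+ k) t.

(* The dyadic refinements are eventually constant on a regular realization of
   the noise. *)
Definition euler_limit m (t : R) : state d n :=
  if pselect (exists j k0, forall k, (k0 <= k)%N -> euler_path m k t = j) is left h
  then projT1 (cid h) else j0.

(** Countably many almost sure conditions: integer horizons, rational times, and the finitely many
    thresholds [c e j], with [None] for the full height [b]. The last condition excludes marks of
    height 0, which would move a particle out of an empty state. *)
Definition regular_noise m :=
  [/\ forall e (T : nat), jump e -> (m e (box T%:R b) < +oo)%E,
      forall a : nat, exists k, sparse_level gamma m b (2 ^+ a) k,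
      forall e (q1 q2 : rat) (j : option (state d n)), jump e -> 0 <= q1 ->
        exists i : nat, m e (slab (ratr q1) (ratr q2) (oapp (c e) b j)) = i%:R%:E &
      forall e (T : nat), jump e -> m e (slab 0 T%:R 0) = 0%E].

Section regular.
Variable m : edge d -> noise R.
Hypothesis reg : regular_noise m.

Let finb e T : jump e -> (m e (box T%:R b) < +oo)%E.
Proof. by case: reg => + _ _ _; apply. Qed.

Definition mass e u s r := fine (m e (slab u s r)).

Lemma slab_box (u s r T : R) : 0 <= u -> s <= T -> r <= b -> slab u s r `<=` box T b.
Proof.
move=> u0 sT rb z [/= h1 h2]; split => /=; move: h1 h2; rewrite !in_itv/=.
  by move=> /andP[/(le_lt_trans u0) -> /le_trans ->].
by move=> _ /andP[-> /le_trans ->].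
Qed.

Let slab_in u s r : 0 <= u -> r <= b -> exists T : nat, s <= T%:R /\ slab u s r `<=` box T%:R b.
Proof.
move=> u0 rb; have [T hT] : exists T : nat, s <= T%:R.
  by exists (Num.truncn s).+1; rewrite ltW// truncnS_gt.
by exists T; split => //; exact: slab_box.
Qed.

Lemma slab_fin e (u s r : R) : jump e -> 0 <= u -> r <= b -> m e (slab u s r) \is a fin_num.
Proof.
move=> je u0 rb; have [T [_ sT]] := slab_in s u0 rb.
exact: (fin_sub_box (finb T je) (measurable_slab _ _ _) sT).
Qed.

Lemma slab_strip (u s r : R) : slab u s r = slab u s r `&` strip u s.
Proof.
apply/seteqP; split => z; last by move=> [].
by move=> h; split => //; case: h => /=; rewrite in_itv.
Qed.

Lemma massD e (u v s r : R) : jump e -> 0 <= u -> u <= v -> v <= s -> r <= b ->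
  mass e u s r = mass e u v r + mass e v s r.
Proof.
move=> je u0 uv vs rb; have [T [_ sT]] := slab_in s u0 rb.
have h := fine_stripD (finb T je) (measurable_slab u s r) sT uv vs.
rewrite /mass [in LHS]slab_strip h; congr (fine (m e _) + fine (m e _));
  apply/seteqP; split => z.
- by move=> [[h1 h2] h3]; split => //=; rewrite in_itv.
- move=> [/= h1 h2]; split; last by move: h1; rewrite in_itv.
  by split => //=; move: h1; rewrite !in_itv/= => /andP[-> /le_trans ->].
- by move=> [[h1 h2] h3]; split => //=; rewrite in_itv.
- move=> [/= h1 h2]; split; last by move: h1; rewrite in_itv.
  by split => //=; move: h1; rewrite !in_itv/= => /andP[/(le_lt_trans uv) -> ->].
Qed.

Lemma mass_ge0 e (u s r : R) : 0 <= mass e u s r.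
Proof. by rewrite fine_ge0. Qed.

Lemma mass_le e (u s r : R) : jump e -> 0 <= u -> r <= b -> mass e u s r <= mass e u s b.
Proof.
move=> je u0 rb; have [T [_ sT]] := slab_in s u0 (lexx b).
apply: (fine_le_measure (finb T je)) => //; try exact: measurable_slab.
move=> z [h1 /=]; rewrite !in_itv/= => /andP[h2 h3]; split => //=.
by rewrite in_itv/= h2 (le_trans h3).
Qed.

Lemma mass_empty e (u s r : R) : s <= u -> mass e u s r = 0.
Proof.
move=> su; rewrite /mass (_ : slab u s r = set0) ?measure0//.
apply/seteqP; split => // z [/= + _]; rewrite in_itv/= => /andP[h /le_trans/(_ su)].
by rewrite leNgt h.
Qed.

Lemma euler_incE e (u s r : R) : jump e -> 0 <= u -> u <= s -> r <= b ->
  euler_inc m e u s r = mass e u s r.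
Proof.
move=> je u0 us rb; rewrite /euler_inc -!/(mass _ _ _ _).
by rewrite (massD je (lexx 0) u0 us rb) addrAC subrr add0r.
Qed.

(** Integrality is known for rational end-points. For a real [s], rationals decrease to [s], and the
    mass of the shrinking remainder tends to 0; being eventually constant, it vanishes. *)
Lemma mass_nat e (q : rat) s (j : option (state d n)) : jump e -> 0 <= q ->
  exists i : nat, mass e (ratr q) s (oapp (c e) b j) = i%:R.
Proof.
move=> je q0.
have rb : oapp (c e) b j <= b by case: j => //= j; case/andP: (c0 e j).
move: rb; set r := oapp _ _ _ => rb.
have u0 : 0 <= ratr q :> R by rewrite ler0q.
have [su|us] := leP s (ratr q); first by exists 0%N; rewrite mass_empty.
have hq i : exists2 x : rat, s < ratr x & ratr x < s + i.+1%:R^-1.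
  have : s < s + i.+1%:R^-1 by rewrite ltrDl invr_gt0.
  by move=> /rat_in_itvoo[x]; rewrite in_itv/= => /andP[? ?]; exists x.
have [q' hq'] := choice (fun i => let: ex_intro2 x h1 h2 := hq i in ex_intro
  (fun x => s < ratr x /\ ratr x < s + i.+1%:R^-1) x (conj h1 h2)).
have nat_q i : exists a : nat, mass e (ratr q) (ratr (q' i)) r = a%:R.
  case: reg => _ _ /(_ e q (q' i) j je q0)[a ha] _; exists a.
  by rewrite /mass ha.
have tail : \bigcap_i slab s (s + i.+1%:R^-1) r = set0.
  apply/seteqP; split => // z h.
  have : s < z.1 by have [/= + _] := h 0%N I; rewrite in_itv/= => /andP[].
  move=> /ltr_add_invr[i hi]; have [/= + _] := h i I.
  by rewrite in_itv/= leNgt hi andbF.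
have cvg0 : m e (slab s (s + i.+1%:R^-1) r) @[i --> \oo] --> 0%E.
  rewrite -(measure0 (m e)) -tail; apply: nonincreasing_cvg_mu => //.
  - rewrite -ge0_fin_numE//; apply: slab_fin => //; exact: le_trans u0 (ltW us).
  - by move=> i; exact: measurable_slab.
  - by rewrite tail.
  - move=> i i' ii'; apply/subsetPset => z [/= h1 h2]; split => //=.
    move: h1; rewrite !in_itv/= => /andP[-> /le_trans]; apply.
    by rewrite lerD2l lef_pV2 ?posrE// ler_nat.
have [i hi] : exists i, mass e s (s + i.+1%:R^-1) r < 1.
  have /fine_cvgP[_ /cvgrPdist_lt/(_ 1 ltr01)[i _ hi]] := cvg0.
  exists i; have := hi i (leqnn i).
  by rewrite /= sub0r normrN ger0_norm ?fine_ge0.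
have s0 : 0 <= s by exact: le_trans u0 (ltW us).
have [a ha] := nat_q i.
(* the fractional part of the mass of the slab is less than 1 for every
   rational end-point, hence it vanishes *)
have small x : s <= x -> x <= s + i.+1%:R^-1 -> mass e s x r < 1.
  move=> sx xi; apply: le_lt_trans hi.
  by rewrite (massD (s := s + i.+1%:R^-1) je s0 sx xi rb) lerDl mass_ge0.
have [h1 h2] := hq' i.
have mE := massD je u0 (ltW us) (ltW h1) rb.
have [i2 hi2] : exists i2, mass e s (ratr (q' i2)) r = 0.
  apply: contrapT => /forallNP nz.
  have one i2 : (i <= i2)%N -> mass e (ratr q) (ratr (q' i2)) r = a%:R.
    move=> ii2; have [a' ha'] := nat_q i2; rewrite ha'.
    have [k1 k2] := hq' i2.
    have k3 : s + i2.+1%:R^-1 <= s + i.+1%:R^-1 by rewrite lerD2l lef_pV2 ?posrE// ler_nat.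
    have := massD je u0 (ltW us) (ltW k1) rb; rewrite ha'.
    move: mE; rewrite ha => mE mE'.
    have s1 := small _ (ltW h1) (ltW h2).
    have s2 := small _ (ltW k1) (le_trans (ltW k2) k3).
    have p1 := mass_ge0 e s (ratr (q' i)) r; have p2 := mass_ge0 e s (ratr (q' i2)) r.
    have e1 : a'%:R < (a + 1)%:R :> R by rewrite natrD; lra.
    have e2 : a%:R < (a' + 1)%:R :> R by rewrite natrD; lra.
    move: e1 e2; rewrite !ltr_nat !addn1 !ltnS => e1 e2.
    by congr _%:R; apply/eqP; rewrite eqn_leq e1 e2.
  have cst i2 : (i <= i2)%N -> mass e s (ratr (q' i2)) r = mass e s (ratr (q' i)) r.
    move=> ii2; have [k1 k2] := hq' i2.
    have := massD je u0 (ltW us) (ltW k1) rb; rewrite one//.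
    by move: mE; rewrite ha => -> /addrI.
  have pos : 0 < mass e s (ratr (q' i)) r.
    by rewrite lt_neqAle mass_ge0 andbT eq_sym; apply/eqP; exact: nz.
  have /fine_cvgP[_ /cvgrPdist_lt/(_ _ pos)[i3 _ hi3]] := cvg0.
  have := hi3 (maxn i i3) (leq_maxr _ _).
  rewrite /= sub0r normrN ger0_norm ?fine_ge0// -/(mass _ _ _ _).
  have [k1 k2] := hq' (maxn i i3).
  rewrite (massD je s0 (ltW k1) (ltW k2) rb) cst ?leq_maxl//.
  by rewrite ltNge lerDl mass_ge0.
have [a2 ha2] := nat_q i2; exists a2; have [k1 _] := hq' i2.
by have := massD je u0 (ltW us) (ltW k1) rb; rewrite hi2 addr0 -ha2.
Qed.

Lemma euler_step0 x (u s : R) : 0 <= u -> u <= s ->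
  (forall e, jump e -> mass e u s (c e x) = 0) -> euler_step m x u s = x.
Proof.
move=> u0 us h; rewrite /euler_step; case: pickP => [e /andP[je]|//].
rewrite euler_incE//; last by case/andP: (c0 e x).
by rewrite h// eq_sym oner_eq0.
Qed.

Lemma euler_step1 x (u s : R) e0 : 0 <= u -> u <= s -> jump e0 ->
  mass e0 u s (c e0 x) = 1 ->
  (forall e, jump e -> e != e0 -> mass e u s (c e x) = 0) ->
  euler_step m x u s = nxt R x e0.
Proof.
move=> u0 us je0 h0 h; have cb e : c e x <= b by case/andP: (c0 e x).
rewrite /euler_step; case: pickP => [e /andP[je]|/(_ e0)].
  rewrite euler_incE//; have [->//|ee0] := eqVneq e e0.
  by rewrite (h e je ee0) eq_sym oner_eq0.
by rewrite je0 euler_incE// h0 eqxx.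
Qed.

Lemma mass_sub e (u s u' s' r : R) : jump e -> 0 <= u -> u <= u' -> s' <= s -> r <= b ->
  mass e u s b = 0 -> mass e u' s' r = 0.
Proof.
move=> je u0 uu' ss' rb h; have [T [_ sT]] := slab_in s u0 (lexx b).
apply/le_anti/andP; split; last exact: mass_ge0.
rewrite -h; apply: (fine_le_measure (finb T je)) => //; try exact: measurable_slab.
move=> z [/= h1 h2]; split => /=; move: h1 h2; rewrite !in_itv/=.
  by move=> /andP[/(le_lt_trans uu') -> /le_trans ->].
by move=> _ /andP[-> /le_trans ->].
Qed.

Lemma sparse_mass (u s : R) : sparse_slab gamma m b u s ->
  (forall e, jump e -> mass e u s b = 0) \/
  exists e0, [/\ jump e0, mass e0 u s b = 1 &
    forall e, jump e -> e != e0 -> mass e u s b = 0].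
Proof.
move=> [h|[e0 [je0 h1 h]]]; [left => e je|right; exists e0; split => //].
- by rewrite /mass /slab h.
- by rewrite /mass /slab h1.
- by move=> e je ee0; rewrite /mass /slab h.
Qed.

Lemma mass_sparse (u s : R) : 0 <= u ->
  (forall e, jump e -> mass e u s b = 0) \/
  (exists e0, [/\ jump e0, mass e0 u s b = 1 &
    forall e, jump e -> e != e0 -> mass e u s b = 0]) ->
  sparse_slab gamma m b u s.
Proof.
move=> u0; have E e : jump e -> m e (slab u s b) = (mass e u s b)%:E.
  by move=> je; rewrite fineK// slab_fin.
move=> [h|[e0 [je0 h1 h]]]; [left => e je|right; exists e0; split => //].
- by rewrite -[LHS]/(m e (slab u s b)) E// h.
- by rewrite -[LHS]/(m e0 (slab u s b)) E// h1.
- by move=> e je ee0; rewrite -[LHS]/(m e (slab u s b)) E// h.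
Qed.

Lemma nat01 (x : R) : (exists i : nat, x = i%:R) -> x <= 1 -> x = 0 \/ x = 1.
Proof.
by move=> [i ->]; rewrite -[1]/(1%:R) ler_nat; case: i => [|[|//]] _; [left|right].
Qed.

(** A part of a sparse slab has mass at most 1 on the edge with the mark, and integrality, available
    for a rational left end, makes it 0 or 1. *)
Lemma sparse_sub (u s s' : R) (q : rat) : 0 <= u -> u <= ratr q -> s' <= s ->
  sparse_slab gamma m b u s -> sparse_slab gamma m b (ratr q) s'.
Proof.
move=> u0 uq ss' /sparse_mass sp.
have q0 : 0 <= ratr q :> R by exact: le_trans uq.
have q0' : 0 <= q by rewrite -(ler0q R).
apply: mass_sparse => //.
case: sp => [h|[e0 [je0 h1 h]]].
  by left => e je; apply: (mass_sub je u0 uq ss' (lexx b)); exact: h.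
have [qs'|/ltW s'q] := leP (ratr q) s'; last first.
  by left => e je; rewrite mass_empty.
have h2 : mass e0 (ratr q) s' b <= 1.
  rewrite -h1 (massD (s := s) je0 u0 uq (le_trans qs' ss') (lexx b)).
  rewrite (massD (s := s) je0 q0 qs' ss' (lexx b)).
  by rewrite addrCA lerDl addr_ge0 ?mass_ge0.
have [z|o] := nat01 (mass_nat s' None je0 q0') h2.
  left => e je; have [->//|ee0] := eqVneq e e0.
  by apply: (mass_sub je u0 uq ss' (lexx b)); exact: h.
right; exists e0; split => // e je ee0.
by apply: (mass_sub je u0 uq ss' (lexx b)); exact: h.
Qed.

(** The mark lies in one of the two pieces and the step over the other piece is the identity, so
    splitting a sparse slab changes nothing. *)
Lemma euler_step_refine x (q q' : rat) (s : R) : 0 <= q -> q <= q' -> ratr q' <= s ->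
  sparse_slab gamma m b (ratr q) s ->
  euler_step m (euler_step m x (ratr q) (ratr q')) (ratr q') s = euler_step m x (ratr q) s.
Proof.
move=> q0 qq' q's /sparse_mass sp.
have u0 : 0 <= ratr q :> R by rewrite ler0q.
have uv : ratr q <= ratr q' :> R by rewrite ler_rat.
have v0 := le_trans u0 uv; have us := le_trans uv q's.
have cb e y : c e y <= b by case/andP: (c0 e y).
case: sp => [h|[e0 [je0 h1 h]]].
  have z e y u' s' : jump e -> ratr q <= u' -> s' <= s -> mass e u' s' (c e y) = 0.
    by move=> je uu' ss'; apply: (mass_sub je u0 uu' ss' (cb _ _)); exact: h.
  rewrite !euler_step0//; move=> e je; exact: z.
have z e y u' s' : jump e -> e != e0 -> ratr q <= u' -> s' <= s ->
    mass e u' s' (c e y) = 0.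
  by move=> je ee0 uu' ss'; apply: (mass_sub je u0 uu' ss' (cb _ _)); exact: h.
have eq_step y u1 s1 u2 s2 : 0 <= u1 -> 0 <= u2 -> u1 <= s1 -> u2 <= s2 ->
    ratr q <= u1 -> ratr q <= u2 -> s1 <= s -> s2 <= s ->
    mass e0 u1 s1 (c e0 y) = mass e0 u2 s2 (c e0 y) ->
    mass e0 u1 s1 (c e0 y) = 0 \/ mass e0 u1 s1 (c e0 y) = 1 ->
    euler_step m y u1 s1 = euler_step m y u2 s2.
  move=> u10 u20 us1 us2 uu1 uu2 ss1 ss2 E [h0|h0].
    rewrite !euler_step0// => e je; have [->|ee0] := eqVneq e e0; rewrite -?E//;
      exact: z.
  rewrite !(euler_step1 (e0 := e0)) -?E// => e je ee0; exact: z.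
have c01 y : mass e0 (ratr q) s (c e0 y) = 0 \/ mass e0 (ratr q) s (c e0 y) = 1.
  apply: nat01; first exact: (mass_nat s (Some y) je0 q0).
  by rewrite -h1; apply: mass_le.
have DD y := massD je0 u0 uv q's (cb e0 y).
have Db := massD je0 u0 uv q's (lexx b).
have h2 : mass e0 (ratr q) (ratr q') b <= 1.
  by rewrite -h1 Db lerDl mass_ge0.
have [i0|i1] := nat01 (mass_nat (ratr q') None je0 q0) h2.
  have z1 y : mass e0 (ratr q) (ratr q') (c e0 y) = 0.
    exact: (mass_sub je0 u0 (lexx _) (lexx _) (cb _ _) i0).
  rewrite (_ : euler_step m x _ (ratr q') = x).
    apply: eq_step => //; first by rewrite DD z1 add0r.
    by have := c01 x; rewrite DD z1 add0r.
  apply: euler_step0 => // e je; have [->//|ee0] := eqVneq e e0; exact: z.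
have i2 : mass e0 (ratr q') s b = 0.
  by move: Db; rewrite h1 i1 -[X in X = _]addr0 => /addrI.
have z2 y : mass e0 (ratr q') s (c e0 y) = 0.
  exact: (mass_sub je0 v0 (lexx _) (lexx _) (cb _ _) i2).
rewrite (euler_step0 (u := ratr q'))//; last first.
  move=> e je; have [->//|ee0] := eqVneq e e0; exact: z.
apply: eq_step => //; first by rewrite DD z2 addr0.
by have := c01 x; rewrite DD z2 addr0.
Qed.

Definition dyadic (k i : nat) : R := i%:R / 2 ^+ k.

Lemma dyadicE k i : dyadic k i = ratr (i%:R / 2 ^+ k).
Proof. by rewrite /dyadic rmorphM/= fmorphV rmorphXn/= !ratr_nat. Qed.

Lemma dyadic_ge0 k i : 0 <= (i%:R / 2 ^+ k : rat).
Proof. by rewrite divr_ge0// exprn_ge0. Qed.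

Let p2 k : 0 < 2 ^+ k :> R. Proof. by rewrite exprn_gt0. Qed.

Lemma ler_dyadic k i i' : (i <= i')%N -> dyadic k i <= dyadic k i'.
Proof. by move=> ii'; rewrite /dyadic ler_pM2r ?ler_nat// invr_gt0. Qed.

Lemma dyadicS k i : dyadic k.+1 (2 * i) = dyadic k i.
Proof. by rewrite /dyadic exprS natrM -mulf_div divff ?mul1r// pnatr_eq0. Qed.

Definition sparse_dyadic a k := forall i, (i < 2 ^ a * 2 ^ k)%N ->
  sparse_slab gamma m b (dyadic k i) (dyadic k i.+1).

Lemma sparse_dyadicP a : exists k, forall k', (k <= k')%N -> sparse_dyadic a k'.
Proof.
case: reg => _ /(_ a)[k sp] _ _; exists k => k' kk' i ilt.
(* [w] cells of length [2 ^ (- k')] make up one cell of the sparse partition of [[0, 2 ^ a]]. *)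
pose w := (2 ^ (a + (k' - k)))%N.
have w0 : (0 < w)%N by rewrite expn_gt0.
have wk : (2 ^ a * 2 ^ k' = w * 2 ^ k)%N.
  by rewrite /w -!expnD -addnA subnK.
pose i0 := (i %/ w)%N.
have i0k : (i0 < 2 ^ k)%N by rewrite ltn_divLR// mulnC -wk.
have wkR : (2 ^+ a / 2 ^+ k : R) = w%:R / 2 ^+ k'.
  apply/eqP; rewrite eqr_div ?lt0r_neq0//; apply/eqP.
  by rewrite -!natrX -!natrM wk.
have E j : 2 ^+ a * (j%:R / 2 ^+ k) = dyadic k' (j * w).
  by rewrite mulrCA wkR mulrA -natrM.
have := sp i0 i0k; rewrite !E => h; rewrite dyadicE; apply: sparse_sub h.
- by rewrite /dyadic divr_ge0// ltW.
- by rewrite -dyadicE; apply: ler_dyadic; rewrite leq_trunc_div.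
- by apply: ler_dyadic; rewrite -ltn_divLR// ltnSn.
Qed.

Lemma euler_refine a k : sparse_dyadic a k -> forall i, (i <= 2 ^ a * 2 ^ k)%N ->
  euler m k.+1 (2 * i) = euler m k i.
Proof.
move=> sp; elim=> [//|i ih ilt].
rewrite mulnS !addSn add0n /= ih 1?ltnW//.
rewrite -!/(dyadic _ _) -[in RHS]dyadicS -[dyadic k i.+1]dyadicS.
have -> : dyadic k.+1 (2 * i.+1) = dyadic k.+1 (2 * i).+2 by rewrite mulnS.
rewrite (dyadicE k.+1 (2 * i)) (dyadicE k.+1 (2 * i).+1).
apply: euler_step_refine.
- exact: dyadic_ge0.
- by rewrite -(ler_rat R) -!dyadicE; exact: ler_dyadic.
- by rewrite -dyadicE; exact: ler_dyadic.
- have -> : dyadic k.+1 (2 * i).+2 = dyadic k.+1 (2 * i.+1) by rewrite mulnS.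
  by rewrite -dyadicE !dyadicS; exact: sp.
Qed.

Lemma dyadic_floor k (t : R) : 0 <= t ->
  let i := Num.truncn (t * 2 ^+ k) in dyadic k i <= t < dyadic k i.+1.
Proof.
move=> t0 /=; have h : 0 <= t * 2 ^+ k by rewrite mulr_ge0// ltW.
rewrite /dyadic ler_pdivrMr// ltr_pdivlMr//.
by have := truncn_itv h => /andP[-> ->].
Qed.

Lemma dyadic_floor_lt a k (t : R) : 0 <= t -> t < 2 ^+ a ->
  (Num.truncn (t * 2 ^+ k) < 2 ^ a * 2 ^ k)%N.
Proof.
move=> t0 ta; have /andP[h _] := dyadic_floor k t0.
rewrite -(ltr_nat R) natrM !natrX; apply: (@le_lt_trans _ _ (t * 2 ^+ k)).
  by rewrite -ler_pdivrMr.
by rewrite ltr_pM2r.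
Qed.

Lemma euler_path_refine a k (t : R) : sparse_dyadic a k -> 0 <= t < 2 ^+ a ->
  euler_path m k.+1 t = euler_path m k t.
Proof.
move=> sp /andP[t0 ta]; rewrite /euler_path.
set i := Num.truncn (t * 2 ^+ k); set i' := Num.truncn (t * 2 ^+ k.+1).
have ilt : (i < 2 ^ a * 2 ^ k)%N by exact: dyadic_floor_lt.
have /andP[h1 h2] := dyadic_floor k t0; have /andP[h1' h2'] := dyadic_floor k.+1 t0.
rewrite -!/(dyadic _ _) -/i -/i' in h1 h2 h1' h2' *.
have b1 : (2 * i <= i')%N.
  rewrite -ltnS -(ltr_nat R) -(ltr_pM2r (x := (2 ^+ k.+1)^-1)) ?invr_gt0//.
  by rewrite -!/(dyadic _ _) dyadicS; exact: le_lt_trans h2'.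
have b2 : (i' < 2 * i.+1)%N.
  rewrite -(ltr_nat R) -(ltr_pM2r (x := (2 ^+ k.+1)^-1)) ?invr_gt0//.
  by rewrite -!/(dyadic _ _) dyadicS; exact: le_lt_trans h2.
have [->|iE] : i' = (2 * i)%N \/ i' = (2 * i).+1.
  by lia.
  by rewrite (euler_refine sp (ltnW ilt)) dyadicS.
rewrite iE /= (euler_refine sp (ltnW ilt)) -!/(dyadic _ _).
have -> : dyadic k i = dyadic k.+1 (2 * i) by rewrite dyadicS.
rewrite (dyadicE k.+1 (2 * i)) (dyadicE k.+1 (2 * i).+1); apply: euler_step_refine.
- exact: dyadic_ge0.
- by rewrite -(ler_rat R) -!dyadicE; exact: ler_dyadic.
- by rewrite -dyadicE -iE.
- rewrite -dyadicE dyadicS; have := sp i ilt; rewrite dyadicE; apply: sparse_sub => //.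
    by rewrite ler0q; exact: dyadic_ge0.
  exact: ltW.
Qed.

Lemma euler_limitE a k (t : R) : (forall k', (k <= k')%N -> sparse_dyadic a k') ->
  0 <= t < 2 ^+ a -> euler_limit m t = euler_path m k t.
Proof.
move=> sp ta.
have cst k' : (k <= k')%N -> euler_path m k' t = euler_path m k t.
  elim: k' => [|k' ih]; first by rewrite leqn0 => /eqP ->.
  rewrite leq_eqVlt => /predU1P[->//|kk'].
  by rewrite (euler_path_refine (sp k' kk') ta) ih.
rewrite /euler_limit; case: pselect => [h|]; last by case; exists (euler_path m k t), k.
case: cid => j [k0 hj] /=.
by rewrite -(hj (maxn k k0) (leq_maxr _ _)) cst// leq_maxl.
Qed.

Lemma euler_limit_local a k i (t : R) : (forall k', (k <= k')%N -> sparse_dyadic a k') ->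
  0 <= t < 2 ^+ a -> dyadic k i <= t <= dyadic k i.+1 ->
  euler_limit m t = euler_step m (euler m k i) (dyadic k i) t.
Proof.
move=> sp ta /andP[h1 h2]; rewrite (euler_limitE sp ta) /euler_path.
have /andP[t0 _] := ta.
have /andP[f1 f2] := dyadic_floor k t0.
set i' := Num.truncn _ in f1 f2 *.
have b1 : (i <= i')%N.
  rewrite -ltnS -(ltr_nat R) -(ltr_pM2r (x := (2 ^+ k)^-1)) ?invr_gt0//.
  exact: le_lt_trans f2.
have b2 : (i' <= i.+1)%N.
  rewrite -(ler_nat R) -(ler_pM2r (x := (2 ^+ k)^-1)) ?invr_gt0//.
  exact: le_trans f1 h2.
have [->//|iE] : i' = i \/ i' = i.+1 by lia.
(* At the right end-point the floor belongs to the next cell, where no time has elapsed and the step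
   is the identity. *)
have tE : t = dyadic k i.+1.
  by apply/le_anti/andP; split => //; rewrite -iE.
rewrite iE /= -!/(dyadic _ _) -tE euler_step0//.
by move=> e je; rewrite mass_empty.
Qed.

Lemma step_structure x (q : rat) (s : R) : 0 <= q -> ratr q <= s ->
  sparse_slab gamma m b (ratr q) s ->
  (forall e, jump e -> mass e (ratr q) s (c e x) = 0) \/
  exists e0 sigma, [/\ jump e0, ratr q < sigma <= s,
    (forall r, ratr q <= r < sigma -> mass e0 (ratr q) r (c e0 x) = 0),
    mass e0 (ratr q) sigma (c e0 x) = 1 &
    mass e0 sigma s b = 0 /\
    forall e, jump e -> e != e0 -> mass e (ratr q) s b = 0].
Proof.
move=> q0 us /sparse_mass sp; have u0 : 0 <= ratr q :> R by rewrite ler0q.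
have cb e y : c e y <= b by case/andP: (c0 e y).
case: sp => [h|[e0 [je0 h1 h]]].
  by left => e je; apply: (mass_sub je u0 (lexx _) (lexx _) (cb _ _)); exact: h.
have le1 r r' : r <= s -> r' <= b -> mass e0 (ratr q) r r' <= 1.
  move=> rs r'b; have [ur|/ltW ru] := leP (ratr q) r; last by rewrite mass_empty ?ler01.
  apply: le_trans (mass_le r je0 u0 r'b) _.
  by rewrite -h1 (massD je0 u0 ur rs (lexx b)) lerDl mass_ge0.
have c01 r : r <= s -> mass e0 (ratr q) r (c e0 x) = 0 \/ mass e0 (ratr q) r (c e0 x) = 1.
  by move=> rs; apply: nat01; [exact: (mass_nat r (Some x) je0 q0)|exact: le1].
have [z|o] := c01 s (lexx s).
  left => e je; have [->//|ee0] := eqVneq e e0.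
  by apply: (mass_sub je u0 (lexx _) (lexx _) (cb _ _)); exact: h.
right; have [T [_ sT]] := slab_in s u0 (cb e0 x).
have ms := measurable_slab (ratr q) s (c e0 x).
have E r : r <= s -> fine (m e0 (slab (ratr q) s (c e0 x) `&` strip (ratr q) r)) =
    mass e0 (ratr q) r (c e0 x).
  move=> rs; congr (fine (m e0 _)); apply/seteqP; split => z.
    by move=> [[h2 h3] h4]; split => //=; rewrite in_itv.
  move=> [/= h2 h3]; split; last by move: h2; rewrite in_itv.
  by split => //=; move: h2; rewrite !in_itv/= => /andP[-> /le_trans ->].
have [||sigma /andP[us' ss] [k1 k2 k3]] := jump_time (finb T je0) ms sT us.
- by move=> r /andP[_ rs]; rewrite E//; exact: c01.
- by rewrite E.
rewrite E// in k2.
exists e0, sigma; split => //.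
- rewrite ss andbT lt_neqAle us' andbT; apply/eqP => us2.
  by move: k2; rewrite -us2 mass_empty// => /esym/eqP; rewrite oner_eq0.
- by move=> r hr; rewrite -E ?k1//; case/andP: hr => _ /ltW/le_trans; apply.
- split => //; have := massD je0 u0 us' ss (lexx b); rewrite h1.
  have : 1 <= mass e0 (ratr q) sigma b by rewrite -k2; exact: mass_le.
  have := mass_ge0 e0 sigma s b; have := le1 sigma b ss (lexx b).
  lra.
Qed.

Lemma step_structure_value x (q : rat) (s : R) : 0 <= q -> ratr q <= s ->
  sparse_slab gamma m b (ratr q) s ->
  exists sigma y, [/\ ratr q < sigma \/ y = x, sigma <= s &
    forall r, ratr q <= r <= s -> euler_step m x (ratr q) r = if r < sigma then x else y].
Proof.
move=> q0 us sp; have u0 : 0 <= ratr q :> R by rewrite ler0q.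
have cb e y : c e y <= b by case/andP: (c0 e y).
have [z|[e0 [sigma [je0 /andP[us' ss] k1 k2 [k3 k4]]]]] := step_structure x q0 us sp.
  exists (ratr q), x; split => //; first by right.
  move=> r /andP[ur rs]; rewrite if_same; apply: euler_step0 => // e je.
  apply/le_anti/andP; split; last exact: mass_ge0.
  by rewrite -(z e je) (massD je u0 ur rs (cb _ _)) lerDl mass_ge0.
exists sigma, (nxt R x e0); split => //; first by left.
move=> r /andP[ur rs].
have other e : jump e -> e != e0 -> mass e (ratr q) r (c e x) = 0.
  by move=> je ee0; apply: (mass_sub je u0 (lexx _) rs (cb _ _)); exact: k4.
case: ifPn => [rsig|]; last rewrite -leNgt => sigr.
  apply: euler_step0 => // e je; have [->|ee0] := eqVneq e e0; last exact: other.
  by apply: k1; rewrite ur.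
apply: euler_step1 => //.
rewrite (massD je0 u0 (ltW us') sigr (cb _ _)) k2.
have s0 := le_trans u0 (ltW us').
by rewrite (mass_sub je0 s0 (lexx _) rs (cb _ _) k3) addr0.
Qed.

Let horizon (t : R) : exists a : nat, t < 2 ^+ a.
Proof.
exists (Num.truncn t).+1; apply: lt_le_trans (truncnS_gt t) _.
by rewrite -natrX ler_nat ltnW// ltn_expl.
Qed.

Lemma euler_right (t : R) : 0 <= t -> exists2 dlt, 0 < dlt &
  forall s, t <= s < t + dlt -> euler_limit m s = euler_limit m t.
Proof.
move=> t0; have [a ta] := horizon t; have [k sp] := sparse_dyadicP a.
pose i := Num.truncn (t * 2 ^+ k).
have /andP[h1 h2] := dyadic_floor k t0; rewrite -/i in h1 h2.
have ilt : (i < 2 ^ a * 2 ^ k)%N by exact: dyadic_floor_lt.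
have := sp k (leqnn k) i ilt; rewrite dyadicE => spi.
have us : ratr (i%:R / 2 ^+ k) <= dyadic k i.+1 by rewrite -dyadicE; exact: ler_dyadic.
have [sigma [y [_ ss val]]] := step_structure_value (euler m k i) (dyadic_ge0 k i) us spi.
have loc s : t <= s -> s < 2 ^+ a -> s <= dyadic k i.+1 ->
    euler_limit m s = if s < sigma then euler m k i else y.
  move=> ts sa si; rewrite (euler_limit_local (i := i) sp); last 2 first.
  - by rewrite sa (le_trans t0).
  - by rewrite si (le_trans h1).
  by rewrite dyadicE val// -dyadicE si (le_trans h1).
have locm (e1 : R) : 0 < e1 -> 0 < Num.min e1 (Num.min (2 ^+ a - t) (dyadic k i.+1 - t)).
  by move=> e0; rewrite !lt_min e0 !subr_gt0 ta h2.
have [ts|st] := ltP t sigma.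
  exists (Num.min (sigma - t) (Num.min (2 ^+ a - t) (dyadic k i.+1 - t))).
    by apply: locm; rewrite subr_gt0.
  move=> s /andP[ts']; rewrite -ltrBlDl !lt_min !ltrD2r => /andP[s1 /andP[s2 s3]].
  by rewrite !loc// ?s1 ?ts// ltW.
exists (Num.min 1 (Num.min (2 ^+ a - t) (dyadic k i.+1 - t))); first exact: locm.
move=> s /andP[ts']; rewrite -ltrBlDl !lt_min !ltrD2r => /andP[_ /andP[s2 s3]].
by rewrite (loc s)// ?ltW// (loc t)// ?ltW// !ltNge st (le_trans st ts').
Qed.

Lemma euler_left (t : R) : 0 < t -> exists x dlt, 0 < dlt /\
  forall s, t - dlt <= s < t -> 0 <= s -> euler_limit m s = x.
Proof.
move=> t0; have [a ta] := horizon t; have [k sp] := sparse_dyadicP a.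
have [i [h1 h2 ilt]] : exists i, [/\ dyadic k i < t, t <= dyadic k i.+1 & (i < 2 ^ a * 2 ^ k)%N].
  pose i := Num.truncn (t * 2 ^+ k).
  have /andP[h1 h2] := dyadic_floor k (ltW t0); rewrite -/i in h1 h2.
  have ilt : (i < 2 ^ a * 2 ^ k)%N by exact: dyadic_floor_lt (ltW t0) ta.
  move: h1; rewrite le_eqVlt => /predU1P[tE|h1]; last by exists i; split => //; exact: ltW.
  case: i tE h2 ilt => [|i] tE h2 ilt.
    by move: t0; rewrite -tE /dyadic mul0r ltxx.
  exists i; split; [|by rewrite tE|exact: ltnW].
  by rewrite -tE /dyadic ltr_pM2r ?invr_gt0// ltr_nat.
have := sp k (leqnn k) i ilt; rewrite dyadicE => spi.
have us : ratr (i%:R / 2 ^+ k) <= dyadic k i.+1 by rewrite -dyadicE; exact: ler_dyadic.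
have [sigma [y [_ ss val]]] := step_structure_value (euler m k i) (dyadic_ge0 k i) us spi.
have d0 : 0 <= dyadic k i by rewrite divr_ge0// ltW.
have loc s : dyadic k i <= s -> s < t ->
    euler_limit m s = if s < sigma then euler m k i else y.
  move=> us' st; have si := le_trans (ltW st) h2.
  rewrite (euler_limit_local (i := i) sp); last 2 first.
  - by rewrite (lt_trans st) // (le_trans d0).
  - by rewrite si us'.
  by rewrite dyadicE val// -dyadicE si us'.
have [ts|st] := leP t sigma.
  exists (euler m k i), (t - dyadic k i); split; first by rewrite subr_gt0.
  move=> s /andP[s1 s2] _; rewrite loc//; first by rewrite (lt_le_trans s2 ts).
  by move: s1; rewrite opprB addrC subrK.
exists y, (Num.min (t - sigma) (t - dyadic k i)); split.
  by rewrite lt_min !subr_gt0 st.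
move=> s /andP[s1 s2] _.
have s3 : t - s <= Num.min (t - sigma) (t - dyadic k i) by rewrite lerBlDr -lerBlDl.
move: s3; rewrite le_min !lerD2l !lerN2 => /andP[s3 s4].
by rewrite loc// ltNge s3.
Qed.

Section equation.
Variables (stm : R -> state d n) (T0 : R) (D : edge d -> set (plane R)).
Hypothesis stmP : forall (t v : R) x, 0 <= v < t ->
  (forall r, v <= r < t -> euler_limit m r = x) -> stm t = x.
Hypothesis DE : forall e, D e = [set z | 0 < z.1 <= T0 /\ 0 <= z.2 <= c e (stm z.1)].
Hypothesis mD : forall e, jump e -> measurable (D e).

Let Db e (T : nat) : T0 <= T%:R -> D e `<=` box T%:R b.
Proof.
move=> T0T z; rewrite DE => -[/andP[h1 h2] /andP[h3 h4]]; split => /=; rewrite in_itv/=.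
  by rewrite h1 (le_trans h2).
by rewrite h3 (le_trans h4)//; case/andP: (c0 e (stm z.1)).
Qed.

Let horizonN : exists T : nat, T0 <= T%:R.
Proof. by exists (Num.truncn T0).+1; rewrite ltW// truncnS_gt. Qed.

Let vec (u r : R) : 'rV[R]_d := \sum_(e | jump e)
  (n%:R^-1 * fine (m e (D e `&` strip u r))) *: jump_vector R e.

Let vecD u s r : u <= s -> s <= r -> vec u r = vec u s + vec s r.
Proof.
move=> us sr; rewrite /vec -big_split/=; apply: eq_bigr => e je.
have [T hT] := horizonN.
by rewrite (fine_stripD (finb T je) (mD je) (Db hT) us sr) mulrDr scalerDl.
Qed.

Let sub_mass0 e (u s r : R) : jump e -> 0 <= u -> u <= r -> r <= s -> mass e u s b = 0 ->
  fine (m e (D e `&` strip u r)) = 0.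
Proof.
move=> je u0 ur rs h; have [T hT] := horizonN.
apply/le_anti/andP; split; last by rewrite fine_ge0.
have [T' [_ sT']] := slab_in s u0 (lexx b).
rewrite -h; apply: (fine_le_measure (finb T' je)) => //.
- by apply: measurableI; [exact: mD|exact: measurable_strip].
- exact: measurable_slab.
- move=> z [/(Db hT)[_ h2] /andP[h3 h4]]; split => //=.
  by rewrite in_itv/= h3 (le_trans h4).
Qed.

(** The scheme uses the state at the left end of the cell, the equation the left limit [stm] at the
    mark. They agree up to and including the first relevant mark, and after it the cell has no mark
    left. *)
Lemma equation_step a k i : (forall k', (k <= k')%N -> sparse_dyadic a k') ->
  (i < 2 ^ a * 2 ^ k)%N -> forall r, dyadic k i <= r <= dyadic k i.+1 -> r < 2 ^+ a ->
  r <= T0 -> pt R (euler_limit m r) = pt R (euler m k i) + vec (dyadic k i) r.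
Proof.
move=> sp ilt r /andP[ur rs] ra rT0.
have d0 : 0 <= dyadic k i by rewrite divr_ge0// ltW.
have := sp k (leqnn k) i ilt; rewrite dyadicE => spi.
have us : ratr (i%:R / 2 ^+ k) <= dyadic k i.+1 by rewrite -dyadicE; exact: ler_dyadic.
set x := euler m k i.
have loc s : dyadic k i <= s -> s <= r -> euler_limit m s = euler_step m x (dyadic k i) s.
  move=> us' sr; apply: euler_limit_local sp _ _.
    by rewrite (le_trans d0)//= (le_lt_trans sr).
  by rewrite us' (le_trans sr).
have cb e y : c e y <= b by case/andP: (c0 e y).
have Dslab e s : jump e -> dyadic k i <= s -> s <= r ->
    (forall s', dyadic k i <= s' < s -> euler_limit m s' = x) ->
    fine (m e (D e `&` strip (dyadic k i) s)) = mass e (dyadic k i) s (c e x).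
  move=> je us' sr hs; congr (fine (m e _)).
  have stmE z : dyadic k i < z -> z <= s -> stm z = x.
    move=> uz zs; apply: (stmP (v := dyadic k i)); first by rewrite d0.
    by move=> s' /andP[s1 s2]; apply: hs; rewrite s1 (lt_le_trans s2).
  rewrite DE; apply/seteqP; split => z.
    move=> [[/andP[h1 h2] /andP[h3 h4]] /andP[h5 h6]]; split => /=; rewrite in_itv/=.
      by rewrite h5 h6.
    by rewrite h3 -(stmE z.1 h5 h6).
  move=> [/= + +]; rewrite !in_itv/= => /andP[h5 h6] /andP[h3 h4].
  split; last by rewrite /strip /= h5 h6.
  split; first by rewrite (le_lt_trans d0 h5) (le_trans h6)// (le_trans sr).
  by rewrite h3 (stmE z.1 h5 h6).
have := step_structure x (dyadic_ge0 k i) us spi; rewrite -!dyadicE.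
move=> [z|[e0 [sigma [je0 /andP[us' ss] k1 k2 [k3 k4]]]]].
  have z' e s : jump e -> dyadic k i <= s -> s <= r -> mass e (dyadic k i) s (c e x) = 0.
    move=> je u1 s1; apply/le_anti/andP; split; last exact: mass_ge0.
    rewrite -(z e je) (massD (v := s) je d0 u1 (le_trans s1 rs) (cb _ _)).
    by rewrite lerDl mass_ge0.
  have lx s : dyadic k i <= s -> s <= r -> euler_limit m s = x.
    move=> u1 s1; rewrite loc// euler_step0// => e je; exact: z'.
  rewrite lx// /vec big1 ?addr0// => e je; rewrite Dslab// ?z' ?mulr0 ?scale0r//.
  by move=> s' /andP[s1 /ltW s2]; exact: lx.
have other e s : jump e -> e != e0 -> dyadic k i <= s -> s <= r ->
    mass e (dyadic k i) s (c e x) = 0.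
  by move=> je ee0 u1 s1; apply: (mass_sub je d0 (lexx _) (le_trans s1 rs) (cb _ _)); exact: k4.
have otherD e s : jump e -> e != e0 -> dyadic k i <= s -> s <= r ->
    fine (m e (D e `&` strip (dyadic k i) s)) = 0.
  by move=> je ee0 u1 s1; apply: (sub_mass0 je d0 u1 (le_trans s1 rs)); exact: k4.
have before s : dyadic k i <= s -> s <= r -> s < sigma -> euler_limit m s = x.
  move=> u1 s1 s2; rewrite loc// euler_step0// => e je.
  by have [->|ee0] := eqVneq e e0; [apply: k1; rewrite u1|exact: other].
have vecE : vec (dyadic k i) r =
    (n%:R^-1 * fine (m e0 (D e0 `&` strip (dyadic k i) r))) *: jump_vector R e0.
  rewrite /vec (bigD1 e0)//= big1 ?addr0// => e /andP[je ee0].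
  by rewrite otherD ?mulr0 ?scale0r.
rewrite vecE; have [rsig|sigr] := ltP r sigma.
  rewrite before// Dslab//; first by rewrite k1 ?ur// mulr0 scale0r addr0.
  by move=> s' /andP[s1 s2]; apply: before => //; [exact: ltW|exact: lt_trans rsig].
have sig0 := le_trans d0 (ltW us').
have [T hT] := horizonN.
rewrite (fine_stripD (finb T je0) (mD je0) (Db hT) (ltW us') sigr).
rewrite (sub_mass0 je0 sig0 sigr rs k3) addr0 Dslab//; last 2 first.
- exact: ltW.
- by move=> s' /andP[s1 s2]; apply: before => //; apply: (le_trans (ltW s2)).
rewrite k2 mulr1 loc// (euler_step1 (e0 := e0))//; last 2 first.
- rewrite (massD je0 d0 (ltW us') sigr (cb _ _)) k2.
  by rewrite (mass_sub je0 sig0 (lexx _) rs (cb _ _) k3) addr0.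
- by move=> e je ee0; exact: other.
apply: nxtP => //.
  by apply/negP => /eqP h; move: je0; rewrite /jumps h ltNge gd.
(* The source is occupied: otherwise the threshold is 0 and the mark has height 0, against
   regularity. *)
rewrite lt_neqAle eq_sym mxE divr_ge0// andbT; apply/eqP => p0.
have ce0 : c e0 x = 0 by apply: c00; rewrite mxE.
have [T' sT'] : exists T' : nat, sigma <= T'%:R.
  by exists (Num.truncn sigma).+1; rewrite ltW// truncnS_gt.
move: k2; rewrite ce0 /mass => k2.
have b0 : 0 <= b by case/andP: (c0 e0 x); exact: le_trans.
have : fine (m e0 (slab (dyadic k i) sigma 0)) <= fine (m e0 (slab 0 T'%:R 0)).
  apply: (fine_le_measure (finb T' je0)); try exact: measurable_slab.
    exact: slab_box.
  move=> z [/= h1 h2]; split => //=; move: h1; rewrite !in_itv/=.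
  by move=> /andP[/(le_lt_trans d0) -> /le_trans ->].
by case: reg => _ _ _ ->//; rewrite k2 /= leNgt ltr01.
Qed.

Lemma euler_equation t : 0 <= t <= T0 ->
  pt R (euler_limit m t) = pt R j0 + \sum_(e | jump e)
    (n%:R^-1 * fine (m e (D e `&` strip 0 t))) *: jump_vector R e.
Proof.
move=> /andP[t0 tT0]; have [a ta] := horizon t; have [k sp] := sparse_dyadicP a.
rewrite -/(vec 0 t).
have key i : (i <= 2 ^ a * 2 ^ k)%N -> dyadic k i <= t -> pt R (euler m k i) = pt R j0 + vec 0 (dyadic k i).
  elim: i => [_ _|i ih ilt it].
    rewrite /vec big1 ?addr0// => e je; rewrite fine_strip_empty ?mulr0 ?scale0r//.
    by rewrite /dyadic mul0r.
  have ii := ler_dyadic k (leqnSn i).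
  have d0 : 0 <= dyadic k i by rewrite divr_ge0// ltW.
  have := equation_step sp ilt (r := dyadic k i.+1).
  rewrite ii lexx (le_lt_trans it ta) (le_trans it tT0) => /(_ isT isT isT).
  rewrite (ih (ltnW ilt) (le_trans ii it)) -addrA -vecD// => <-; congr (pt R _).
  rewrite (euler_limit_local (i := i) sp)//.
    by rewrite (le_trans d0 ii) (le_lt_trans it ta).
  by rewrite ii lexx.
pose i := Num.truncn (t * 2 ^+ k).
have /andP[h1 h2] := dyadic_floor k t0; rewrite -/i in h1 h2.
have ilt : (i < 2 ^ a * 2 ^ k)%N by exact: dyadic_floor_lt.
have d0 : 0 <= dyadic k i by rewrite divr_ge0// ltW.
rewrite (equation_step sp ilt (r := t)) ?h1 ?(ltW h2)//.
by rewrite (key i (ltnW ilt) h1) -addrA -vecD.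
Qed.

End equation.

End regular.
End euler.

(** * Left limits of step paths; predictable sets *)

Section left_state.
Context (R : realType) (S : Type).
Implicit Types (g : R -> S) (t : R).

(** The left limit of a piecewise constant map, taken as an eventual value because [S] has no
    topology; at time 0 it is [g 0]. *)
Definition left_state g t : S :=
  if pselect (exists x v, 0 <= v < t /\ forall r, v <= r < t -> g r = x) is left h
  then projT1 (cid h) else g 0.

Lemma left_stateE g t x v : 0 <= v < t -> (forall r, v <= r < t -> g r = x) ->
  left_state g t = x.
Proof.
move=> /andP[v0 vt] h; rewrite /left_state; case: pselect => [h'|[]]; last first.
  by exists x, v; split => //; rewrite v0.
case: (cid h') => x' /= [v' [/andP[v'0 v't] h2]].
pose r := Num.max v v'.
have rt : r < t by rewrite gt_max vt.
by rewrite -(h2 r) ?rt ?le_max ?lexx ?orbT// h// rt le_max lexx.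
Qed.

Lemma left_state0 g : left_state g 0 = g 0.
Proof.
rewrite /left_state; case: pselect => // h; exfalso.
case: h => x [v [/andP[v0 v1] _]].
by move: v1; rewrite ltNge v0.
Qed.

Definition step_right g := forall t, 0 <= t ->
  exists2 dlt, 0 < dlt & forall s, t <= s < t + dlt -> g s = g t.
Definition step_left g := forall t, 0 < t ->
  exists x v, 0 <= v < t /\ forall r, v <= r < t -> g r = x.

Lemma left_stateP g t : step_left g -> 0 < t -> exists2 v, 0 <= v < t &
  forall r, v <= r < t -> g r = left_state g t.
Proof.
move=> gl /gl[x [v [vt h]]]; exists v => // r rt.
by rewrite (left_stateE vt h) h.
Qed.

(** Choose a rational in an interval of constancy that follows the time [t]. It determines a jump
    time, since a second jump time with the same rational would lie inside the interval of constancy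
    of the first. *)
Lemma jumps_countable g : step_right g -> step_left g ->
  countable [set t | 0 <= t /\ g t <> left_state g t].
Proof.
move=> gr gl; have [dl dlP] : exists dl : R -> R, forall t, 0 <= t ->
    0 < dl t /\ forall s, t <= s < t + dl t -> g s = g t.
  have : forall t : R, exists dl : R, 0 <= t -> 0 < dl /\ forall s, t <= s < t + dl -> g s = g t.
    move=> t; have [/gr[x x0 h]|t0] := leP 0 t; first by exists x.
    by exists 0.
  by move=> /choice[dl h]; exists dl.
have [q qP] : exists q : R -> rat, forall t, 0 <= t -> t < ratr (q t) < t + dl t.
  have : forall t : R, exists q : rat, 0 <= t -> t < ratr q < t + dl t.
    move=> t; have [t0|t0] := leP 0 t; last by exists 0.
    have [d0 _] := dlP t t0.
    have : t < t + dl t by rewrite ltrDl.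
    by move=> /rat_in_itvoo[x]; rewrite in_itv/= => ?; exists x.
  by move=> /choice[q h]; exists q.
apply/countable_injP; exists (pickle \o q) => t s.
rewrite !inE /= => -[t0 ht] [s0 hs] /(pcan_inj pickleK) qq.
have key a b : 0 <= a -> 0 <= b -> g b <> left_state g b -> q a = q b -> ~ a < b.
  move=> a0 b0 hb qab ab; apply: hb.
  have [_ ga] := dlP a a0; have /andP[_ qa] := qP a a0; have /andP[qb _] := qP b b0.
  have bd : b < a + dl a by rewrite (lt_trans qb)// -qab.
  rewrite (@left_stateE _ _ (g a) a)//; first by rewrite ga// bd ltW.
    by rewrite a0.
  by move=> r /andP[ar rb]; apply: ga; rewrite ar (lt_trans rb).
case: (ltgtP t s) => // h.
  by case: (key t s).
by case: (key s t).
Qed.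

End left_state.

Section predictable_sets.
Context (R : realType) (T : Type) (F : R -> set (set T)).

Lemma predictable_sub A : predictable_sigma F A -> A `<=` [set u | 0 <= u.1].
Proof.
apply: sigma_sub => X [[B _ ->]|[s [t [B [/andP[s0 _] _ ->]]]]] u [/=].
  by move=> ->.
by rewrite in_itv/= => /andP[/(le_lt_trans s0)/ltW].
Qed.

Lemma predictableI A B : predictable_sigma F A -> predictable_sigma F B ->
  predictable_sigma F (A `&` B).
Proof. by apply: sigmaI; exact: predictable_sub. Qed.

Lemma predictableC A : predictable_sigma F A ->
  predictable_sigma F ([set u | 0 <= u.1] `\` A).
Proof. exact: sigma_algebraCD. Qed.

Lemma predictableT : predictable_sigma F [set u | 0 <= u.1].
Proof. by rewrite -[X in predictable_sigma F X]setD0; apply: predictableC; exact: sigma_algebra0. Qed.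

Lemma predictable_slab (s : R) A : 0 <= s -> F s A ->
  predictable_sigma F [set u | s < u.1 /\ A u.2].
Proof.
move=> s0 FA; rewrite (_ : mkset _ = \bigcup_(k : nat) (`]s, s + k%:R] `*` A)).
  apply: sigma_algebra_bigcup => k; apply: sub_gen_smallest; right.
  by exists s, (s + k%:R), A; split => //; rewrite s0 lerDl ler0n.
apply/seteqP; split => u; last by move=> [k _ [/=]]; rewrite in_itv/= => /andP[].
move=> [su Au]; exists (Num.truncn (u.1 - s)).+1 => //; split => //=.
by rewrite in_itv/= su -lerBlDl ltW// truncnS_gt.
Qed.

Lemma predictable_section A w : predictable_sigma F A ->
  measurable ([set s | A (s, w)] : set (mR R)).
Proof.
pose G := [set A : set (R * T) | A `<=` [set u | 0 <= u.1] /\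
  measurable ([set s | A (s, w)] : set (mR R))].
move=> /(_ G)[]//; split.
- split; first by split => //; rewrite (_ : mkset _ = set0)//.
  + move=> X [Xs mX]; split; first by move=> u [].
    rewrite (_ : mkset _ = `[0, +oo[ `\` [set s | X (s, w)]); first exact: measurableD.
    by apply/seteqP; split => s [h1 h2]; split => //; move: h1; rewrite /= in_itv/= andbT.
  + move=> X hX; split; first by move=> u [k _ /(proj1 (hX k))].
    rewrite (_ : mkset _ = \bigcup_k [set s | X k (s, w)]); last by apply/seteqP; split.
    by apply: bigcup_measurable => k _; case: (hX k).
- move=> X [[B _ ->]|[s [t [B [/andP[s0 _] _ ->]]]]]; split.
  + by move=> u [/= ->].
  + have [Bw|Bw] := pselect (B w).
      rewrite (_ : mkset _ = [set 0]); first exact: measurable_set1.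
      by apply/seteqP; split => r //= [].
    rewrite (_ : mkset _ = set0)//.
    by apply/seteqP; split => r //= [].
  + by move=> u [/=]; rewrite in_itv/= => /andP[/(le_lt_trans s0)/ltW].
  + have [Bw|Bw] := pselect (B w).
      rewrite (_ : mkset _ = `]s, t]%classic); first exact: measurable_itv.
      by apply/seteqP; split => r //= [].
    rewrite (_ : mkset _ = set0)//.
    by apply/seteqP; split => r //= [].
Qed.

Lemma predictable_measurable (q : R -> T -> R) w : predictable F q ->
  measurable_fun (halfline R) (q^~ w).
Proof.
move=> pq _ Y mY; have := predictable_section w (pq Y mY).
congr measurable.
by apply/seteqP; split => s [h1 h2]; split => //; move: h1; rewrite /= in_itv/= andbT.
Qed.

Section state_process.
Context (S : Type) (st : R -> T -> S).
Hypothesis Fmono : forall s t, s <= t -> F s `<=` F t.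
Hypothesis st_right : forall w, step_right (st^~ w).
Hypothesis st_left : forall w, step_left (st^~ w).
Hypothesis st_adapted : forall t (B : set S), 0 <= t -> F t [set w | B (st t w)].

Definition prev_state (t : R) (w : T) : S := left_state (st^~ w) t.

Lemma prev_state_predictable (B : set S) :
  predictable_sigma F [set u | 0 <= u.1 /\ B (prev_state u.1 u.2)].
Proof.
pose E (k i : nat) : set (R * T) :=
  `](i%:R / 2 ^+ k), (i.+1%:R / 2 ^+ k)] `*` [set w | B (st (i%:R / 2 ^+ k) w)].
have pE k i : predictable_sigma F (E k i).
  apply: sub_gen_smallest; right; exists (i%:R / 2 ^+ k), (i.+1%:R / 2 ^+ k).
  exists [set w | B (st (i%:R / 2 ^+ k) w)]; split => //; last first.
    by apply: st_adapted; rewrite divr_ge0.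
  by rewrite divr_ge0//= ler_pM2r ?invr_gt0 ?exprn_gt0// ler_nat.
have pE0 : predictable_sigma F ([set 0] `*` [set w | B (st 0 w)]).
  apply: sub_gen_smallest; left; exists [set w | B (st 0 w)] => //.
  exact: st_adapted.
have pI : forall X : nat -> set (R * T), (forall k, predictable_sigma F (X k)) ->
    predictable_sigma F (\bigcap_k X k).
  move=> X pX.
  rewrite (_ : \bigcap_k X k = [set u | 0 <= u.1] `\`
      \bigcup_k ([set u | 0 <= u.1] `\` X k)).
    by apply: predictableC; apply: sigma_algebra_bigcup => k; exact: predictableC.
  apply/seteqP; split => u.
    move=> h; split; first exact: (predictable_sub (pX 0%N) (h 0%N I)).
    by move=> [k _ [_ /(_ (h k I))]].
  move=> [u0 h] k _; apply: contrapT => hk; apply: h; exists k => //.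
rewrite (_ : mkset _ = [set 0] `*` [set w | B (st 0 w)] `|`
   \bigcup_k0 \bigcap_k \bigcup_i E (k0 + k)%N i).
  apply: sigmaU => //; apply: sigma_algebra_bigcup => k0; apply: pI => k.
  by apply: sigma_algebra_bigcup => i; exact: pE.
have p2 k : 0 < 2 ^+ k :> R by rewrite exprn_gt0.
(* the left endpoint of the dyadic interval containing [t > 0] *)
have floor k (t : R) : 0 < t -> exists i : nat, i%:R / 2 ^+ k < t <= i.+1%:R / 2 ^+ k.
  move=> t0; have tk : 0 < t * 2 ^+ k by rewrite mulr_gt0.
  have : exists i : nat, t <= i.+1%:R / 2 ^+ k.
    exists (Num.truncn (t * 2 ^+ k)); rewrite ler_pdivlMr// ltW// truncnS_gt//.
  move=> ex; case: (ex_minnP ex) => i hi mini; exists i; rewrite hi andbT.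
  case: i hi mini => [|i] hi mini; first by rewrite mul0r.
  by rewrite ltNge; apply/negP => /mini; rewrite ltnn.
have near (u : R * T) : 0 < u.1 -> exists k0, forall k (i : nat),
    i%:R / 2 ^+ (k0 + k) < u.1 <= i.+1%:R / 2 ^+ (k0 + k) ->
    st (i%:R / 2 ^+ (k0 + k)) u.2 = prev_state u.1 u.2.
  move=> u0; have [v /andP[v0 vu] h] := left_stateP (st_left u.2) u0.
  have [k0 hk0] : exists k0 : nat, (u.1 - v)^-1 < 2 ^+ k0.
    exists (Num.truncn ((u.1 - v)^-1)).+1.
    apply: lt_trans (truncnS_gt _) _.
    by rewrite -natrX ltr_nat ltn_expl.
  exists k0 => k i /andP[h1 h2]; apply: h; rewrite h1 andbT.
  have : 2 ^+ (k0 + k) >= (u.1 - v)^-1.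
    by rewrite (le_trans (ltW hk0))// ler_eXn2l ?leq_addr// ltr1n.
  rewrite -lef_pV2 ?posrE ?invr_gt0 ?subr_gt0// invrK => h3.
  move: h2; rewrite -natr1 mulrDl mul1r => h2; lra.
apply/seteqP; split => -[t w] /=.
  move=> [t0 Bt]; have [t1|t1] := eqVneq 0 t.
    by left; move: Bt; rewrite -t1 /prev_state left_state0.
  have tp : 0 < t by rewrite lt_neqAle t1.
  right; have [k0 hk0] := near (t, w) tp; exists k0 => // k _.
  have [i hi] := floor (k0 + k)%N t tp; exists i => //; split => //=.
  by have /= -> := hk0 k i hi.
move=> [[-> Bw]|[k0 _ h]]; first by rewrite lexx /prev_state left_state0.
have tp : 0 < t.
  have [i _ [/= + _]] := h 0%N I; rewrite in_itv/= => /andP[+ _].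
  by apply: le_lt_trans; rewrite divr_ge0// ltW.
split; first exact: ltW.
have [k1 hk1] := near (t, w) tp.
have [i _ [/= hi Bi]] := h k1 I.
have := hk1 k0 i; rewrite addnC => /= <- //.
Qed.

(** Visits strictly before [u.1] are excluded, a visit at [u.1] is not: this makes the set
    predictable. *)
Definition alive (B : set S) : set (R * T) :=
  [set u | 0 <= u.1 /\ forall r, 0 <= r < u.1 -> ~ B (st r u.2)].

(** By constancy to the right, an earlier visit to [B] is also seen at a rational time before
    [u.1]. *)
Lemma alive_predictable B : predictable_sigma F (alive B).
Proof.
rewrite (_ : alive B = [set u | 0 <= u.1] `\`
    \bigcup_(q : rat) [set u | 0 <= (ratr q : R) /\ ratr q < u.1 /\ B (st (ratr q) u.2)]).
  apply: predictableC; apply: (@sigma_count_bigcup _ _ _ rat) => q.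
  have [q0|q0] := pselect (0 <= (ratr q : R)); last first.
    have -> : [set u : R * T | 0 <= (ratr q : R) /\ ratr q < u.1 /\ B (st (ratr q) u.2)] = set0.
      by apply/seteqP; split => // u [].
    exact: sigma_algebra0.
  have -> : [set u : R * T | 0 <= (ratr q : R) /\ ratr q < u.1 /\ B (st (ratr q) u.2)] =
      [set u | ratr q < u.1 /\ B (st (ratr q) u.2)].
    by apply/seteqP; split => u //= -[].
  exact: (predictable_slab q0 (st_adapted B q0)).
apply/seteqP; split => u; move=> [u0 h]; split => //.
  by move=> [q _ [q0 [q1 q2]]]; apply: (h (ratr q)) => //; rewrite q0.
move=> r /andP[r0 ru] Br; apply: h.
have [dl dl0 hdl] := st_right u.2 r0.
have : r < Num.min u.1 (r + dl) by rewrite lt_min ru ltrDl.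
move=> /rat_in_itvoo[q]; rewrite in_itv/= lt_min => /and3P[h1 h2 h3].
exists q => //; split; first by rewrite (le_trans r0)// ltW.
by split => //; rewrite hdl// h3 ltW.
Qed.

End state_process.
End predictable_sets.

(** * Almost sure regularity of the noise and adaptedness of the construction *)

Lemma ae_forall_count (R : realType) (disp : measure_display) (T : measurableType disp)
    (P : {measure set T -> \bar R}) (I : countType) (Q : I -> T -> Prop) :
  (forall i, {ae P, forall w, Q i w}) -> {ae P, forall w, forall i, Q i w}.
Proof.
move=> h; have := @ae_foralln _ _ _ P (fun k w => if unpickle k is Some i then Q i w else True).
move=> H; have {}H := H (fun k => _).
have : {ae P, forall w, forall k : nat, if unpickle k is Some i then Q i w else True}.
  apply: H => k; case: (unpickle k) => [i|]; first exact: h.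
  exact: aeW.
by apply: filterS => w hw i; have := hw (pickle i); rewrite pickleK.
Qed.

Section finite_valued.
Context (T : Type) (G : set (set T)).
Hypotheses (sG : sigma_algebra setT G).

Let G0 : G set0. Proof. by case: sG. Qed.
Let GC A : G A -> G (~` A). Proof. by case: sG => _ + _ => /[apply]; rewrite setTD. Qed.
Let GU (A : (set T)^nat) : (forall i, G (A i)) -> G (\bigcup_i A i).
Proof. by case: sG => _ _; apply. Qed.

Lemma fin_bigcup_sigma (I : countType) (A : I -> set T) : (forall i, G (A i)) -> G (\bigcup_i A i).
Proof.
move=> h; pose A' k := if unpickle k is Some i then A i else set0.
rewrite (_ : \bigcup_i A i = \bigcup_k A' k).
  by apply: GU => k; rewrite /A'; case: (unpickle k).
apply/seteqP; split => w [i _].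
  by move=> Aw; exists (pickle i) => //; rewrite /A' pickleK.
by rewrite /A'; case: (unpickle i) => // j Aw; exists j.
Qed.

Lemma fin_bigcap_sigma (I : countType) (A : I -> set T) : (forall i, G (A i)) -> G (\bigcap_i A i).
Proof.
move=> h; rewrite -(setCK (\bigcap_i A i)) setC_bigcap; apply: GC.
by apply: fin_bigcup_sigma => i; exact: GC.
Qed.

Lemma sigma_and A B : G A -> G B -> G (A `&` B).
Proof.
move=> GA GB; rewrite (_ : A `&` B = \bigcap_(i : bool) if i then A else B).
  by apply: fin_bigcap_sigma => -[].
apply/seteqP; split => w; first by move=> [Aw Bw] [].
by move=> h; split; [exact: (h true)|exact: (h false)].
Qed.

Definition fin_meas (A : countType) (h : T -> A) := forall B : set A, G [set w | B (h w)].

Lemma fin_measP (A : countType) (h : T -> A) : (forall a, G [set w | h w = a]) -> fin_meas h.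
Proof.
move=> hG B; rewrite (_ : mkset _ = \bigcup_(a : A) ([set w | h w = a] `&` [set w | B a])).
  apply: fin_bigcup_sigma => a; apply: sigma_and => //.
  have [Ba|Ba] := pselect (B a).
    rewrite (_ : mkset _ = ~` set0); first exact: GC.
    by apply/seteqP; split => // w _ [].
  rewrite (_ : mkset _ = set0)//.
  by apply/seteqP; split.
by apply/seteqP; split => w /=; [move=> Bw; exists (h w)|move=> [a _ [-> ]]].
Qed.

Lemma fin_meas_cst (A : countType) (a : A) : fin_meas (fun=> a).
Proof.
apply: fin_measP => a'; have [aa|aa] := pselect (a = a').
  rewrite (_ : mkset _ = ~` set0); first exact: GC.
  by apply/seteqP; split => // w _ [].
by rewrite (_ : mkset _ = set0)//; apply/seteqP; split.
Qed.

Lemma fin_meas_bind (A B : countType) (h : T -> A) (k : A -> T -> B) :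
  fin_meas h -> (forall a, fin_meas (k a)) -> fin_meas (fun w => k (h w) w).
Proof.
move=> hm km; apply: fin_measP => b.
rewrite (_ : mkset _ = \bigcup_(a : A) ([set w | h w = a] `&` [set w | k a w = b])).
  apply: fin_bigcup_sigma => a; apply: sigma_and.
    exact: (hm (eq^~ a)).
  exact: (km a (eq^~ b)).
by apply/seteqP; split => w /=; [move=> kw; exists (h w)|move=> [a _ [-> ]]].
Qed.

Lemma fin_meas_ffun (I : finType) (A : countType) (h : I -> T -> A) :
  (forall i, fin_meas (h i)) -> fin_meas (fun w => [ffun i => h i w]).
Proof.
move=> hm; apply: fin_measP => f.
rewrite (_ : mkset _ = \bigcap_i [set w | h i w = f i]).
  by apply: fin_bigcap_sigma => i; exact: (hm i (eq^~ (f i))).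
apply/seteqP; split => w /=; first by move=> <- i _ /=; rewrite ffunE.
by move=> hf; apply/ffunP => i; rewrite ffunE; exact: hf.
Qed.

Lemma fin_meas_comp (A B : countType) (h : T -> A) (k : A -> B) :
  fin_meas h -> fin_meas (fun w => k (h w)).
Proof. by move=> hm X; exact: (hm (fun a => X (k a))). Qed.

End finite_valued.

Section regular_noise_ae.
Context (R : realType) (d n : nat) (gamma : 'I_d -> 'I_d -> R)
  (disp : measure_display) (T : measurableType disp) (P : probability T R)
  (N : edge d -> T -> noise R)
  (b : R) (c : edge d -> state d n -> R) (j0 : state d n).
Notation jump := (jumps gamma).
Hypothesis HN : poisson_noise n gamma P N.
Hypotheses (n0 : (0 < n)%N) (b0 : 0 <= b).
Hypothesis c0 : forall e j, 0 <= c e j <= b.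
Notation F := (noise_filtration gamma P N).
Notation leb2 := (leb \x leb)%E.

Lemma regular_noise_ae : {ae P, forall w, regular_noise gamma b c (N^~ w)}.
Proof.
have G1 : {ae P, forall w, forall e (k : nat), jump e -> (N e w (box k%:R b) < +oo)%E}.
  apply: ae_forall_count => e; apply: ae_forall_count => k.
  have [je|je] := boolP (jump e); last by apply: aeW.
  by have := noise_box_fin HN je k%:R b; apply: filterS.
have G2 : {ae P, forall w, forall a : nat, exists k, sparse_level gamma (N^~ w) b (2 ^+ a) k}.
  by apply: ae_forall_count => a; apply: (sparse_ae HN b0); rewrite exprn_ge0.
have G3 : {ae P, forall w, forall e (q1 q2 : rat) (j : option (state d n)),
    jump e -> 0 <= q1 ->
    exists i : nat, N e w (slab (ratr q1) (ratr q2) (oapp (c e) b j)) = i%:R%:E}.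
  apply: ae_forall_count => e; apply: ae_forall_count => q1.
  apply: ae_forall_count => q2; apply: ae_forall_count => j.
  have [je|je] := boolP (jump e); last by apply: aeW.
  have [q0|q0] := boolP (0 <= q1); last by apply: aeW.
  set B := slab _ _ _; set r := oapp _ _ _ in B *.
  have q10 : (0 <= ratr q1 :> R) by rewrite ler0q.
  have BQ : B `<=` @quadrant R by exact: slab_quadrant.
  have mB : measurable B by exact: measurable_slab.
  have Bb : B `<=` box (ratr q2) r.
    move=> z [/= h1 h2]; split => //=; move: h1; rewrite !in_itv/=.
    by move=> /andP[/(le_lt_trans q10) -> ->].
  have := prm_ae_nat ((proj1 HN) e je) mB BQ (nu_ge0 _ _) (nu_lty _ mB Bb).
  by apply: filterS.
have G4 : {ae P, forall w, forall e (k : nat), jump e -> N e w (slab 0 k%:R 0) = 0%E}.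
  apply: ae_forall_count => e; apply: ae_forall_count => k.
  have [je|je] := boolP (jump e); last by apply: aeW.
  set B := slab _ _ _.
  have BQ : B `<=` @quadrant R by exact: slab_quadrant.
  have mB : measurable B by exact: measurable_slab.
  have h1 := prm_pos ((proj1 HN) e je) mB BQ (nu_lty n mB (@subset_refl _ _)).
  have mN := prm_measurable_set ((proj1 HN) e je) mB BQ.
  exists [set w | ~ (N e w B = 0%E)]; split.
  - rewrite (_ : mkset _ = ~` [set w | N e w B = 0%E])//.
    by apply: measurableC; apply: (mN [set 0%E]); exact: emeasurable_set1.
  - apply/eqP; rewrite eq_le measure_ge0 andbT; apply: (le_trans h1).
    by rewrite /B leb2_slab// mulr0 mule0.
  - by move=> w /= hw hw'; apply: hw => _.
have G34 : {ae P, forall w, (forall e (k : nat), jump e -> N e w (slab 0 k%:R 0) = 0%E) /\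
    (forall a : nat, exists k, sparse_level gamma (N^~ w) b (2 ^+ a) k)}.
  by move: G4 G2; apply: filterS2.
by move: G1 G3 G34; apply: filterS3 => w h1 h3 [h4 h2]; split.
Qed.

Let sF t : sigma_algebra setT (F t). Proof. exact: smallest_sigma_algebra. Qed.

Let F_noise e (s t r : R) Y : jump e -> 0 <= s <= t -> measurable Y ->
  F t [set w | Y (N e w (slab 0 s r))].
Proof.
move=> je st mY; apply: sub_gen_smallest; left; exists e, s, `[0, r]%classic, Y.
split => //; split => // x; rewrite /= !in_itv/= => /andP[->//].
Qed.

Lemma euler_inc_adapted e (u s t r : R) : jump e -> 0 <= u <= t -> 0 <= s <= t ->
  fin_meas (F t) (fun w => euler_inc (N^~ w) e u s r == 1).
Proof.
move=> je ut st; apply: (fin_measP (sF t)) => y.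
pose G : set (set T) := [set A | exists e (s : R) (B : set (mR R)) Y,
        [/\ jump e, 0 <= s <= t,
            measurable B /\ B `<=` `[0, +oo[,
            measurable Y & A = [set w | Y (N e w (`]0, s] `*` B))]]]
      `|` [set A | P.-negligible A].
pose TG := g_sigma_algebraType G.
have mX s' : 0 <= s' <= t -> measurable_fun setT ((fun w => fine (N e w (slab 0 s' r))) : TG -> R).
  move=> s't; apply: measurableT_comp; first exact: fine_measurable.
  by move=> _ Y mY; rewrite setTI; exact: F_noise.
have mB : measurable_fun setT ((fun w => euler_inc (N^~ w) e u s r) : TG -> R).
  by apply: measurable_funB; exact: mX.
have F1 : F t [set w | euler_inc (N^~ w) e u s r = 1].
  by have := mB measurableT [set 1] (measurable_set1 _); rewrite setTI.
case: y.
  by rewrite (_ : mkset _ = [set w | euler_inc (N^~ w) e u s r = 1])//;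
    apply/seteqP; split => w /= /eqP.
rewrite (_ : mkset _ = ~` [set w | euler_inc (N^~ w) e u s r = 1]).
  by have := sigma_algebraC F1.
by apply/seteqP; split => w /=; [move=> /negbT/eqP|move=> /eqP/negbTE].
Qed.

Lemma euler_step_adapted x (u s t : R) : 0 <= u <= t -> 0 <= s <= t ->
  fin_meas (F t) (fun w => euler_step gamma c (N^~ w) x u s).
Proof.
move=> ut st.
pose h e w := jump e && (euler_inc (N^~ w) e u s (c e x) == 1).
have hm e : fin_meas (F t) (h e).
  rewrite /h; have [je|je] := boolP (jump e) => /=; first exact: euler_inc_adapted.
  exact: (fin_meas_cst (sF t) false).
have H := fin_meas_comp (fun f : {ffun edge d -> bool} =>
  if [pick e | f e] is Some e then nxt R x e else x) (fin_meas_ffun (sF t) hm).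
move=> B; have := H B; congr (F t _); apply/seteqP; split => w /=;
  rewrite /euler_step; congr (B _);
  by rewrite (@eq_pick _ (fun e => [ffun i => h i w] e) (h^~ w))// => e; rewrite ffunE.
Qed.

Lemma euler_adapted k i t : 0 <= t -> i%:R / 2 ^+ k <= t ->
  fin_meas (F t) (fun w => euler gamma c j0 (N^~ w) k i).
Proof.
have p2 : 0 < 2 ^+ k :> R by rewrite exprn_gt0.
move=> t0; elim: i => [_|i ih it] /=.
  exact: fin_meas_cst.
have it' : i%:R / 2 ^+ k <= t.
  by apply: le_trans it; rewrite ler_pM2r ?invr_gt0// ler_nat.
apply: (@fin_meas_bind _ _ (sF t) _ _ _ (fun x w => euler_step gamma c (N^~ w) x
  (i%:R / 2 ^+ k) (i.+1%:R / 2 ^+ k)) (ih it')) => x.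
by apply: euler_step_adapted; rewrite divr_ge0//= ltW.
Qed.

Lemma euler_path_adapted k t : 0 <= t ->
  fin_meas (F t) (fun w => euler_path gamma c j0 (N^~ w) k t).
Proof.
move=> t0; have p2 : 0 < 2 ^+ k :> R by rewrite exprn_gt0.
have it : (Num.truncn (t * 2 ^+ k))%:R / 2 ^+ k <= t.
  by rewrite ler_pdivrMr// truncn_le// mulr_ge0// ltW.
apply: (@fin_meas_bind _ _ (sF t) _ _ _ (fun x w => euler_step gamma c (N^~ w) x
  ((Num.truncn (t * 2 ^+ k))%:R / 2 ^+ k) t) (euler_adapted t0 it)) => x.
apply: euler_step_adapted; rewrite ?t0 ?lexx// it andbT divr_ge0// ltW//.
Qed.

(** Right and left constancy are required for every [w], so irregular realizations are frozen at
    [j0]; they are negligible, and the completed filtration keeps the process adapted. *)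
Definition noise_state (t : R) (w : T) : state d n :=
  if pselect (regular_noise gamma b c (N^~ w)) then euler_limit gamma c j0 (N^~ w) t else j0.

Lemma noise_stateE w : regular_noise gamma b c (N^~ w) ->
  noise_state^~ w = euler_limit gamma c j0 (N^~ w).
Proof. by move=> reg; apply/funext => t; rewrite /noise_state; case: pselect. Qed.

Lemma noise_state_irregular w : ~ regular_noise gamma b c (N^~ w) -> noise_state^~ w = fun=> j0.
Proof. by move=> reg; apply/funext => t; rewrite /noise_state; case: pselect. Qed.

Lemma noise_state_right w : step_right (noise_state^~ w).
Proof.
have [reg|reg] := pselect (regular_noise gamma b c (N^~ w)).
  by rewrite noise_stateE// => t t0; exact: (euler_right j0 n0 c0 reg).
by rewrite noise_state_irregular// => t t0; exists 1.
Qed.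

Lemma noise_state_left w : step_left (noise_state^~ w).
Proof.
have [reg|reg] := pselect (regular_noise gamma b c (N^~ w)); last first.
  by rewrite noise_state_irregular// => t t0; exists j0, 0; rewrite lexx t0.
rewrite noise_stateE// => t t0.
have [x [dl [dl0 h]]] := euler_left j0 n0 c0 reg t0.
exists x, (Num.max 0 (t - dl)); rewrite le_max lexx/= gt_max t0 ltrBlDr ltrDl dl0; split => //.
by move=> r; rewrite ge_max => /andP[/andP[r0 r1] r2]; apply: h; rewrite ?r1.
Qed.

Lemma noise_state_adapted t (B : set (state d n)) : 0 <= t -> F t [set w | B (noise_state t w)].
Proof.
move=> t0; apply: (fin_measP (sF t)) => j.
pose Rg := [set w | regular_noise gamma b c (N^~ w)].
have FN A : P.-negligible A -> F t A by move=> nA; apply: sub_gen_smallest; right.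
have FRc : F t (~` Rg) by apply: FN; exact: regular_noise_ae.
have FR : F t Rg by rewrite -(setCK Rg); exact: sigma_algebraC.
pose E := \bigcup_(k0 : nat) \bigcap_(k : nat)
  [set w | euler_path gamma c j0 (N^~ w) (k0 + k)%N t = j].
have FE : F t E.
  apply: fin_bigcup_sigma => // k0; apply: fin_bigcap_sigma => // k.
  exact: (euler_path_adapted _ t0 (eq^~ j)).
rewrite (_ : [set w | noise_state t w = j] = (E `&` Rg) `|` ((~` Rg) `&` [set w | j0 = j])).
  apply: sigmaU; first exact: (sigma_and (sF t) FE FR).
  apply: FN; apply: negligibleS regular_noise_ae.
  by move=> w [].
apply/seteqP; split => w /=; rewrite /noise_state; case: pselect => reg /=.
- move=> jE; left; split => //.
  have [a ta] : exists a : nat, t < 2 ^+ a.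
    exists (Num.truncn t).+1; apply: lt_trans (truncnS_gt _) _.
    by rewrite -natrX ltr_nat ltn_expl.
  have [k sp] := sparse_dyadicP c0 reg a.
  exists k => // k' _ /=; rewrite -jE; apply/esym; apply: (euler_limitE j0 n0 c0 reg (a := a)).
    by move=> k2 h2; apply: sp; rewrite (leq_trans _ h2)// leq_addr.
  by rewrite t0.
- by move=> ->; right.
- move=> [[[k0 _ h] _]|[]//].
  have [a ta] : exists a : nat, t < 2 ^+ a.
    exists (Num.truncn t).+1; apply: lt_trans (truncnS_gt _) _.
    by rewrite -natrX ltr_nat ltn_expl.
  have [k sp] := sparse_dyadicP c0 reg a.
  rewrite (euler_limitE j0 n0 c0 reg (a := a) (k := (k0 + k)%N)) ?t0//.
    exact: h.
  by move=> k2 h2; apply: sp; rewrite (leq_trans _ h2)// leq_addl.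
- by move=> [[_ /reg//]|[]].
Qed.

End regular_noise_ae.

Lemma cvg_left_state (R : realType) (d n : nat) (mu : R -> 'rV[R]_d) (g : R -> state d n) t :
  (forall s, 0 <= s -> mu s = pt R (g s)) -> step_left g -> 0 < t ->
  mu s @[s --> t^'-] --> pt R (left_state g t).
Proof.
move=> mug gl t0; have [v /andP[v0 vt] h] := left_stateP gl t0.
apply: cvg_near_cst; near=> s.
rewrite mug; first by rewrite h//; apply/andP; split; near: s; [exact: nbhs_left_ge|exact: nbhs_left_lt].
near: s; exact: nbhs_left_ge.
Unshelve. all: by end_near.
Qed.

Lemma lim_left_state (R : realType) (d n : nat) (mu : R -> 'rV[R]_d) (g : R -> state d n) t :
  (forall s, 0 <= s -> mu s = pt R (g s)) -> step_left g -> 0 < t ->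
  lim (mu s @[s --> t^'-]) = pt R (left_state g t).
Proof. by move=> mug gl t0; apply/cvg_lim => //; exact: cvg_left_state. Qed.

Lemma Rintegral_mark (R : realType) (m : noise R) (t a : R)
    (c : R -> R) (D := [set z : plane R | 0 < z.1 <= t /\ 0 <= z.2 <= c z.1]) :
  0 <= a -> measurable D ->
  \int[m]_(z in `]0, t] `*` `[0%R, +oo[) (a * \1_(`[0, c z.1]) z.2) = a * fine (m D).
Proof.
move=> a0 mD; rewrite /Rintegral -[a]/(fine a%:E).
have mQ : measurable (`]0, t] `*` `[0%R, +oo[ : set (plane R)) by exact: measurableX.
transitivity (fine (\int[m]_(z in (`]0%R, t] `*` `[0%R, +oo[ : set (plane R))) (a%:E * (\1_D z)%:E))%E).
  congr fine; apply: eq_integral => z; rewrite inE => -[/= h1 h2].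
  rewrite EFinM; congr (_ * (_%:R)%:E)%E; congr nat_of_bool.
  move: h1 h2; rewrite !in_itv/= andbT => h1 h2.
  apply/idP/idP => /set_mem.
    by rewrite /= in_itv/= => h; apply/mem_set; rewrite /D /= h1.
  by move=> [_ h]; apply/mem_set; rewrite /= in_itv.
rewrite ge0_integralZl//=; last by apply/measurable_EFinP/measurable_indic.
rewrite integral_indic// setIidl; last first.
  move=> z [/andP[h1 h2] /andP[h3 _]]; split; rewrite /= in_itv/= ?h1 ?h3//.
(* For [m D = +oo] both sides are 0, by the default value of [fine]. *)
have : (0 <= m D)%E by [].
case: (m D) => [x| |]// _ /=.
rewrite mulr0; have [->|an] := eqVneq a 0; first by rewrite mul0e.
by rewrite gt0_muley// lte_fin lt_neqAle eq_sym an.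
Qed.

Lemma countable_measurable (R : realType) (A : set (mR R)) :
  countable A -> measurable A.
Proof.
move=> /countable_injP[f injf].
rewrite (_ : A = \bigcup_k (A `&` [set x | f x = k])); last first.
  by apply/seteqP; split => x; [move=> Ax; exists (f x)|move=> [k _ []]].
apply: bigcup_measurable => k _.
have [->|/set0P[x [Ax fx]]] := eqVneq (A `&` [set x | f x = k]) set0 => //.
rewrite (_ : _ `&` _ = [set x]); first exact: measurable_set1.
apply/seteqP; split => y /=; last by move=> ->.
by move=> [Ay fy]; apply: injf; rewrite ?inE ?fy.
Qed.

Lemma countableU (T : Type) (A B : set T) : countable A -> countable B -> countable (A `|` B).
Proof.
move=> cA cB; rewrite (_ : A `|` B = \bigcup_(b in [set: bool]) if b then A else B).
  by apply: bigcup_countable => //; case.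
apply/seteqP; split => x; first by move=> [Ax|Bx]; [exists true|exists false].
by move=> [[] _]; [left|right].
Qed.

Section step_cost.
Context (R : realType) (d n : nat) (gamma : 'I_d -> 'I_d -> R)
  (C : edge d -> R -> \bar R) (r : 'rV[R]_d -> R).
Notation jump := (jumps gamma).
Notation tcost e := (transformed_cost (gamma e.1 e.2) (C e)).
Hypothesis mF : forall e, jump e ->
  measurable_fun (halfline R) (tcost e).

Lemma measurable_step (S : finType) (g : R -> S) (h : S -> R) :
  (forall j, measurable ([set s | 0 <= s /\ g s = j] : set (mR R))) ->
  measurable_fun (halfline R) (h \o g).
Proof.
move=> mg _ Y mY; rewrite (_ : _ `&` _ =
    \bigcup_(j in [set j | Y (h j)]) [set s | 0 <= s /\ g s = j]).
  by apply: fin_bigcup_measurable => //; exact: finite_finset.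
apply/seteqP; split => s.
  by move=> [/=]; rewrite in_itv/= andbT => s0 Ys; exists (g s).
move=> [j /= Yj [s0 gj]]; split; first by rewrite /= in_itv/= s0.
by rewrite /= gj.
Qed.

Lemma measurable_step_cost (g : R -> state d n) (qq : edge d -> R -> R) :
  (forall j, measurable ([set s | 0 <= s /\ g s = j] : set (mR R))) ->
  (forall e, jump e ->
    measurable_fun (halfline R) (qq e) /\
    forall s, 0 <= s -> 0 <= qq e s) ->
  measurable_fun (halfline R)
    (fun s => running_cost gamma C r (pt R (g s)) (fun e => qq e s)).
Proof.
move=> mg hq; apply: emeasurable_funD; last first.
  by apply/measurable_EFinP; exact: (measurable_step (fun j => r (pt R j)) mg).
rewrite (_ : (fun s => _) = (fun s => \sum_e if jump e then
    (pt R (g s) ord0 e.1)%:E * tcost e (qq e s) else 0)%E); last first.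
  by apply/funext => s; rewrite big_mkcond.
apply: emeasurable_sum => e; have [je|je] := boolP (jump e); last exact: measurable_cst.
apply: emeasurable_funM.
  by apply/measurable_EFinP; exact: (measurable_step (fun j => pt R j ord0 e.1) mg).
have [mq q0] := hq e je.
apply: (measurable_comp _ _ (mF je) mq); first exact: measurable_itv.
by move=> _ [s /= + <-]; rewrite !in_itv/= !andbT => /q0.
Qed.

End step_cost.

(** * Controlled processes as finite-state jump processes *)

Section jump_processes.
Context (R : realType) (d n : nat) (gamma : 'I_d -> 'I_d -> R)
  (disp : measure_display) (T : measurableType disp) (P : probability T R)
  (N : edge d -> T -> noise R).
Notation jump := (jumps gamma).
Hypothesis HN : poisson_noise n gamma P N.
Hypotheses (n0 : (0 < n)%N) (gd : forall x, gamma x x <= 0).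
Notation F := (noise_filtration gamma P N).
Notation leb2 := (leb \x leb)%E.

Definition mark_set (q : edge d -> R -> T -> R) (st : R -> T -> state d n)
    (e : edge d) (t : R) (w : T) : set (plane R) :=
  [set z | 0 < z.1 <= t /\ 0 <= z.2 <= pt R (prev_state st z.1 w) ord0 e.1 * q e z.1 w].

Definition state_process (st : R -> T -> state d n) : Prop :=
  [/\ forall w, step_right (st^~ w), forall w, step_left (st^~ w) &
      forall t (B : set (state d n)), 0 <= t -> F t [set w | B (st t w)]].

(** The controlled equation with left limits replaced by left states and the stochastic integral by
    the number of marks below the graph of [mu_x * q]. *)
Definition jump_process (m : 'rV[R]_d) q st : Prop :=
  state_process st /\ {ae P, forall w, forall t, 0 <= t ->
        pt R (st t w) = m + \sum_(e | jump e)
          (n%:R^-1 * fine (N e w (mark_set q st e t w))) *: jump_vector R e}.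

Let Fmono (s t : R) : s <= t -> F s `<=` F t.
Proof. exact: filtration_le. Qed.

Lemma pt_ge0 (j : state d n) x : 0 <= pt R j ord0 x.
Proof. by rewrite mxE divr_ge0. Qed.

Lemma pt_le1 (j : state d n) x : pt R j ord0 x <= 1.
Proof.
have [[h <-] _] := pt_grid R n0 j; rewrite (bigD1 x)//= lerDl sumr_ge0//.
Qed.

(** Fixing the left state [j] turns the threshold [mu_x * q] into a constant multiple of the
    predictable [q], the form that [compensation] handles. *)
Lemma compensated_marks q st e (A : set (R * T)) j : bounded_control gamma F q ->
  state_process st -> jump e -> predictable_sigma F A ->
  exists2 b, 0 <= b & (forall s w, 0 <= s -> q e s w <= b) /\
  forall t, 0 <= t -> compensated n P N e t b
    [set u | [/\ 0 < u.1.1 <= t, (A `&` [set u | 0 <= u.1 /\ prev_state st u.1 u.2 = j]) u.1 &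
      0 <= u.2 <= pt R j ord0 e.1 * q e u.1.1 u.1.2]].
Proof.
move=> bq [sr sl ad] je pA; have [pq [a [b [a0 qab]]]] := bq e je.
have [T0|/set0P[w0 _]] := eqVneq [set: T] set0.
  have := probability_setT P; rewrite T0 measure0 => /eqP.
  by rewrite eq_sym onee_eq0.
have b0 : 0 <= b.
  by have /andP[h1 h2] := qab 0 w0 (lexx 0); exact: le_trans (ltW a0) (le_trans h1 h2).
exists b => //; split=> [s w s0|t t0]; first by have /andP[] := qab s w s0.
have pj := predictableI pA (prev_state_predictable sl ad (eq^~ j)).
apply: (compensation HN je t0 b0 pj pq (pt_ge0 j e.1)) => s w s0.
have /andP[h1 h2] := qab s w s0; have q0 := le_trans (ltW a0) h1; split => //.
by rewrite -[b]mul1r ler_pM ?pt_ge0 ?pt_le1.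
Qed.

Lemma measurable_mark_set q st e t w : bounded_control gamma F q ->
  state_process st -> jump e -> 0 <= t ->
  measurable (mark_set q st e t w).
Proof.
move=> bq sp je t0.
have pA := @predictableT R T F.
pose D j := slice [set u : (R * T) * R | [/\ 0 < u.1.1 <= t,
   ([set u | 0 <= u.1] `&` [set u | 0 <= u.1 /\ prev_state st u.1 u.2 = j]) u.1 &
   0 <= u.2 <= pt R j ord0 e.1 * q e u.1.1 u.1.2]] w.
have mD j : measurable (D j).
  have [b _ [_ /(_ t t0)[_ h _]]] := compensated_marks j bq sp je pA.
  exact: h.
rewrite (_ : mark_set q st e t w = \bigcup_(j in [set: state d n]) D j).
  by apply: fin_bigcup_measurable => //; exact: finite_finset.
apply/seteqP; split => z.
  move=> [/andP[h1 h2] h3]; exists (prev_state st z.1 w) => //; split => //=.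
    by rewrite h1.
  by split; [exact: ltW|split; [exact: ltW|]].
by move=> [j _ [/= h1 [_ [_ h2]] h3]]; split => //; rewrite h2.
Qed.

Lemma controlled_of_jump m q st : bounded_control gamma F q -> jump_process m q st ->
  controlled_process n gamma P N m q (fun t w => pt R (st t w)).
Proof.
move=> bq [sp ae]; have [sr sl ad] := sp; split.
- move=> w; split=> t t0.
    have [dl dl0 h] := sr w t t0; apply: cvg_near_cst; near=> s.
    rewrite h//; apply/andP; split; near: s; first exact: nbhs_right_ge.
    by apply: nbhs_right_lt; rewrite ltrDl.
  by apply/cvg_ex; exists (pt R (left_state (st^~ w) t)); exact: cvg_left_state.
- by move=> t w _; exact: pt_grid.
- by move=> t x Y t0 mY; exact: (ad t (fun j => Y (pt R j ord0 x))).
- move: ae; apply: filterS => w h t t0; rewrite h//; congr (_ + _).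
  apply: eq_bigr => e je; congr (_ *: _).
  have E : mark_set q st e t w = [set z | 0 < z.1 <= t /\ 0 <= z.2 <=
      (lim (pt R (st s w) @[s --> z.1^'-])) ord0 e.1 * q e z.1 w].
    apply/seteqP; split => z [/andP[h1 h2] h3]; split => //; rewrite ?h1//.
      by rewrite (lim_left_state _ (sl w)).
    by move: h3; rewrite (lim_left_state _ (sl w)).
  rewrite (@Rintegral_mark _ _ t n%:R^-1 (fun s => (lim (pt R (st r w) @[r --> s^'-])) ord0 e.1
      * q e s w)) -?E//.
  exact: (measurable_mark_set w bq sp je t0).
Unshelve. all: by end_near.
Qed.

(** Distinct grid points differ by at least [1 / n] in some coordinate. Half of this distance turns
    cadlag grid paths into locally constant ones. *)
Lemma pt_discrete (j j' : state d n) (m : 'rV[R]_d) :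
  (forall x, `|m ord0 x - pt R j ord0 x| < (2 * n%:R)^-1) ->
  (forall x, `|m ord0 x - pt R j' ord0 x| < (2 * n%:R)^-1) -> j = j'.
Proof.
have nR0 : 0 < n%:R :> R by rewrite ltr0n.
move=> h h'; apply/val_inj/ffunP => x; apply/val_inj; apply/eqP.
have : `|pt R j ord0 x - pt R j' ord0 x| < n%:R^-1.
  have := h x; have := h' x; rewrite invfM => h1 h2.
  rewrite (_ : pt R j ord0 x - _ = (m ord0 x - pt R j' ord0 x) - (m ord0 x - pt R j ord0 x)); last by ring.
  by apply: le_lt_trans (ler_normB _ _) _; lra.
rewrite !mxE -mulrBl normrM (ger0_norm (ltW (_ : 0 < n%:R^-1))) ?invr_gt0//.
rewrite -ltr_pdivlMr ?invr_gt0// invrK mulVf ?lt0r_neq0//.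
set a : nat := val (val j x); set a' : nat := val (val j' x).
rewrite ltr_norml => /andP[h1 h2].
have k1 : (a < a'.+1)%N by rewrite -(ltr_nat R) -natr1; lra.
have k2 : (a' < a.+1)%N by rewrite -(ltr_nat R) -natr1; lra.
by rewrite -/a -/a' eqn_leq -(ltnS a) -(ltnS a') k1 k2.
Qed.

Lemma process_of_controlled m q mu :
  bounded_control gamma F q -> controlled_process n gamma P N m q mu ->
  exists2 st, jump_process m q st & forall t w, 0 <= t -> mu t w = pt R (st t w).
Proof.
move=> bq [cad gr ad ae].
have /choice[g hg] : forall u : R * T, exists j : state d n, 0 <= u.1 -> mu u.1 u.2 = pt R j.
  move=> u; have [u0|u0] := leP 0 u.1.
    by have [j hj] := grid_pt n0 (gr u.1 u.2 u0); exists j.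
  by have [j hj] := grid_pt n0 (gr 0 u.2 (lexx 0)); exists j.
pose st t w := g (t, w).
have hst t w : 0 <= t -> mu t w = pt R (st t w) by exact: (hg (t, w)).
have e0 : 0 < (2 * n%:R)^-1 :> R by rewrite invr_gt0 mulr_gt0// ltr0n.
have sr w : step_right (st^~ w).
  move=> t t0; have [/(_ t t0)/cvg_ballP/(_ _ e0)[dl /= dl0 h] _] := cad w.
  exists dl => // s /andP[ts sdl]; have [->//|st'] := eqVneq s t.
  have ts' : t < s by rewrite lt_neqAle eq_sym st'.
  have [|_ hb] := h s _ ts'; last first.
    apply: (pt_discrete (m := mu s w)) => x.
      by rewrite hst ?(le_trans t0)// subrr normr0.
    by rewrite -hst//; have := hb ord0 x; rewrite /ball /= distrC.
  by rewrite /ball /= ltr_norml; apply/andP; split; lra.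
have sl w : step_left (st^~ w).
  move=> t t0; have [_ /(_ t t0)/cvg_ballP/(_ _ e0)[dl /= dl0 h]] := cad w.
  pose v := Num.max (t / 2) (t - dl / 2).
  have v0 : 0 <= v by rewrite le_max divr_ge0// ltW.
  have vt : v < t by rewrite gt_max; apply/andP; split; lra.
  have hl r x : v <= r < t ->
      `|(lim (mu s w @[s --> t^'-])) ord0 x - pt R (st r w) ord0 x| < (2 * n%:R)^-1.
    rewrite ge_max => /andP[/andP[r1 r2] rt].
    rewrite -hst ?(le_trans _ r1) ?divr_ge0 ?ltW//.
    have [|_ hb] := h r _ rt; last exact: (hb ord0 x).
    by rewrite /ball /= ltr_norml; apply/andP; split; lra.
  exists (st v w), v; rewrite v0 vt; split => // r rt.
  apply: (pt_discrete (m := lim (mu s w @[s --> t^'-]))) => x; apply: hl => //.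
  by rewrite lexx.
have ad' t (B : set (state d n)) : 0 <= t -> F t [set w | B (st t w)].
  move=> t0; apply: (fin_measP (smallest_sigma_algebra _ _)) => j.
  rewrite (_ : mkset _ = \bigcap_(x : 'I_d) [set w | [set pt R j ord0 x] (mu t w ord0 x)]).
    apply: (fin_bigcap_sigma (smallest_sigma_algebra _ _)) => x.
    by apply: ad => //; exact: measurable_set1.
  apply/seteqP; split => w /=; first by move=> <- x _ /=; rewrite hst.
  move=> h; apply: (@pt_inj R _ _ n0); apply/rowP => x; rewrite -hst//.
  exact: h.
have sp : state_process st by split.
exists st => //; split => //.
move: ae; apply: filterS => w h t t0; rewrite -hst// h//; congr (_ + _).
apply: eq_bigr => e je; congr (_ *: _).
have E : mark_set q st e t w = [set z | 0 < z.1 <= t /\ 0 <= z.2 <=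
    (lim (mu s w @[s --> z.1^'-])) ord0 e.1 * q e z.1 w].
  apply/seteqP; split => z [/andP[h1 h2] h3]; split => //; rewrite ?h1//.
    by rewrite (lim_left_state (fun s => @hst s w) (sl w)).
  by move: h3; rewrite (lim_left_state (fun s => @hst s w) (sl w)).
rewrite (@Rintegral_mark _ _ t n%:R^-1 (fun s => (lim (mu r w @[r --> s^'-])) ord0 e.1
    * q e s w)) -?E//. exact: (measurable_mark_set w bq sp je t0).
Qed.

(** The feedback is read at the left state and hence is predictable. The process is built from the
    thresholds [c e j = m_x * Q e j], which vanish when the source is empty. *)
Lemma feedback_process (Q : edge d -> state d n -> R) (j0 : state d n) :
  (forall e j, 0 < Q e j) ->
  exists st, let q := fun e t w => Q e (prev_state st t w) in
    bounded_control gamma F q /\ jump_process (pt R j0) q st.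
Proof.
move=> Q0; pose b := \sum_e \sum_j Q e j.
have Qb e j : Q e j <= b.
  rewrite /b (bigD1 e)//= (bigD1 j)//= -addrA lerDl addr_ge0//.
    by apply: sumr_ge0 => i _; exact: ltW.
  by apply: sumr_ge0 => i _; apply: sumr_ge0 => k _; exact: ltW.
have b0 : 0 <= b by apply: sumr_ge0 => i _; apply: sumr_ge0 => k _; exact: ltW.
pose c e j := pt R j ord0 e.1 * Q e j.
have c0 e j : 0 <= c e j <= b.
  rewrite mulr_ge0 ?pt_ge0 ?(ltW (Q0 _ _))//= -[b]mul1r ler_pM ?pt_ge0 ?pt_le1//.
  exact: ltW.
have c00 e j : pt R j ord0 e.1 = 0 -> c e j = 0 by rewrite /c => ->; rewrite mul0r.
pose st := noise_state gamma N b c j0.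
have sr w : step_right (st^~ w) by exact: noise_state_right.
have sl w : step_left (st^~ w) by exact: noise_state_left.
have ad t (B : set (state d n)) : 0 <= t -> F t [set w | B (st t w)].
  exact: noise_state_adapted.
have sp : state_process st by split.
exists st => q.
have bq : bounded_control gamma F q.
  move=> e je; split.
    by move=> Y mY; exact: (prev_state_predictable sl ad (fun j => Y (Q e j))).
  (* The inverse of the sum of the inverses is a positive lower bound of the finitely many
     [Q e j]. *)
  exists (\sum_j (Q e j)^-1)^-1, b; split.
    rewrite invr_gt0 (bigD1 j0)//= ltr_wpDr ?invr_gt0//.
    by apply: sumr_ge0 => i _; rewrite invr_ge0 ltW.
  move=> t w _; rewrite Qb andbT -[leRHS]invrK lef_pV2 ?posrE ?invr_gt0//.
    rewrite (bigD1 (prev_state st t w))//= lerDl.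
    by apply: sumr_ge0 => i _; rewrite invr_ge0 ltW.
    rewrite (bigD1 j0)//= ltr_wpDr ?invr_gt0//.
    by apply: sumr_ge0 => i _; rewrite invr_ge0 ltW.
  exact: Q0.
split => //; split => //.
have := regular_noise_ae c HN b0; apply: filterS => w reg t t0.
have stE := noise_stateE j0 reg.
have H := @euler_equation _ _ _ _ _ _ j0 n0 gd c0 c00 _ reg
  (prev_state st ^~ w) t (fun e => mark_set q st e t w).
 rewrite [st t w](congr1 (fun g => g t) stE) H//.
- congr (_ + _); apply: eq_bigr => e je; congr (_ *: _); congr (_ * fine (N e w _)).
  by apply/seteqP; split => z; [move=> []|move=> [h1 h2]; split => //; case: h1].
- move=> s v x sv h; apply: (left_stateE sv) => r rs.
  by rewrite -(h r rs) -stE.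
- by move=> e je; exact: measurable_mark_set.
- by rewrite t0 lexx.
Qed.

(** * Stopping at the target and Dynkin's formula *)

Section dynkin.
Variables (m : 'rV[R]_d) (q : edge d -> R -> T -> R) (st : R -> T -> state d n).
Hypotheses (bq : bounded_control gamma F q) (jp : jump_process m q st).
Variable B : set (state d n).

Let sp := jp.1.
Let sr : forall w, step_right (st^~ w). Proof. by case: sp. Qed.
Let sl : forall w, step_left (st^~ w). Proof. by case: sp. Qed.
Let ad : forall t (B : set (state d n)), 0 <= t -> F t [set w | B (st t w)].
Proof. by case: sp. Qed.

(** Constancy to the right makes the infimum of the visits to [B] itself a visit. *)
Lemma stop_exists t w : 0 <= t -> exists s, [/\ 0 <= s <= t,
  forall r, 0 <= r < s -> ~ B (st r w) & s = t \/ B (st s w)].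
Proof.
move=> t0; pose A := [set r | 0 <= r <= t /\ B (st r w)].
have [A0|/set0P A0] := eqVneq A set0.
  exists t; rewrite t0 lexx; split => //; last by left.
  move=> r /andP[r0 rt] Br; have : A r by split => //; rewrite r0 ltW.
  by rewrite A0.
have infA : has_inf A by split => //; exists 0 => r [/andP[]].
have [r1 [/andP[r10 r1t] Br1]] := A0.
have lb r : A r -> inf A <= r by move=> Ar; apply: ge_inf => //; case: infA.
have i0 : 0 <= inf A by apply: lb_le_inf => // r [/andP[]].
exists (inf A); split.
- by rewrite i0 (le_trans (lb r1 _))//; split => //; rewrite r10.
- move=> r /andP[r0 ri] Br; have : A r.
    split => //; rewrite r0 (le_trans (ltW ri))// (le_trans (lb r1 _))//.
    by split => //; rewrite r10.
  by move=> /lb; rewrite leNgt ri.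
- right; have [dl dl0 h] := sr w i0.
  have [r Ar rd] := inf_adherent dl0 infA.
  by rewrite -(h r); [case: Ar|rewrite lb].
Qed.

Definition stop t w : R :=
  if pselect (0 <= t) is left t0 then projT1 (cid (stop_exists w t0)) else 0.

Lemma stopP t w : 0 <= t -> [/\ 0 <= stop t w <= t,
  forall r, 0 <= r < stop t w -> ~ B (st r w) & stop t w = t \/ B (st (stop t w) w)].
Proof.
move=> t0; rewrite /stop; case: pselect => // t0'; by case: cid.
Qed.

Lemma alive_stop t w s : 0 <= t -> 0 <= s <= t -> alive st B (s, w) <-> s <= stop t w.
Proof.
move=> t0 /andP[s0 s_t]; have [/andP[h1 h2] h3 h4] := stopP w t0; split => /=.
  move=> [_ h]; rewrite leNgt; apply/negP => hs.
  case: h4 => [E|]; first by move: hs; rewrite E ltNge s_t.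
  by apply: h; rewrite h1.
move=> ss; split => // r /= /andP[r0 rs]; apply: h3.
by rewrite r0 (lt_le_trans rs).
Qed.

Definition stopped t w : state d n := st (stop t w) w.

(** The region below the threshold of [e] while the left state is [j] and the process is not yet
    stopped. Its marks are the jumps along [e] out of [j]; multiplied by [n], its mean area is their
    expected number. *)
Definition dwell e j t : set ((R * T) * R) :=
  [set u | [/\ 0 < u.1.1 <= t, (alive st B `&` [set u | 0 <= u.1 /\ prev_state st u.1 u.2 = j]) u.1 &
      0 <= u.2 <= pt R j ord0 e.1 * q e u.1.1 u.1.2]].

Lemma compensated_dwell e j : jump e ->
  exists2 b, 0 <= b & (forall s w, 0 <= s -> q e s w <= b) /\
  forall t, 0 <= t -> compensated n P N e t b (dwell e j t).
Proof.
by move=> je; exact: (compensated_marks j bq sp je (alive_predictable sr ad B)).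
Qed.

Lemma slice_dwell e j t w : 0 <= t -> slice (dwell e j t) w =
  mark_set q st e (stop t w) w `&` [set z | prev_state st z.1 w = j].
Proof.
move=> t0; apply/seteqP; split => z; rewrite /slice /dwell /mark_set /=.
  move=> [/andP[h1 h2] [h3 [_ <-]] h4].
  by rewrite h1; split => //; split => //; apply/alive_stop => //; rewrite (ltW h1).
move=> [[/andP[h1 h2] h3] <-]; have [/andP[_ h4] _ _] := stopP w t0.
have h5 := le_trans h2 h4.
split; [by rewrite h1|split|by []]; last by rewrite (ltW h1).
by apply/(alive_stop w t0); rewrite ?(ltW h1).
Qed.

Let q_bound : exists2 b, 0 <= b & forall e s w, jump e -> 0 <= s -> 0 <= q e s w <= b.
Proof.
have /choice[bb hbb] : forall e, exists b, jump e ->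
    forall s w, 0 <= s -> 0 <= q e s w <= b.
  move=> e; have [je|je] := boolP (jump e); last by exists 0.
  have [_ [a [b [a0 h]]]] := bq je; exists b => _ s w s0.
  by have /andP[h1 ->] := h s w s0; rewrite (le_trans (ltW a0)).
exists (\sum_e `|bb e|); first by apply: sumr_ge0.
move=> e s w je s0; have /andP[-> h2] := hbb e je s w s0; rewrite (le_trans h2)//=.
rewrite (le_trans (ler_norm _))// (bigD1 e)//= lerDl; exact: sumr_ge0.
Qed.

Definition jump_dif (f : 'rV[R]_d -> R) (e : edge d) (j : state d n) : R :=
  f (pt R j + n%:R^-1 *: jump_vector R e) - f (pt R j).

Lemma dynkin_path (f : 'rV[R]_d -> R) t : 0 <= t -> {ae P, forall w,
  f (pt R (stopped t w)) = f m + \sum_(e | jump e) \sum_j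
    jump_dif f e j * fine (N e w (slice (dwell e j t) w))}.
Proof.
move=> t0; have [b b0 qb] := q_bound.
have A1 := sparse_ae HN b0 t0.
have A2 : {ae P, forall w, forall e, jump e -> (N e w (box t b) < +oo)%E}.
  apply: ae_forall_count => e; have [je|je] := boolP (jump e); last by apply: aeW.
  by have := noise_box_fin HN je t b; apply: filterS.
move: A1 A2 jp.2; apply: filterS3 => w [k sk] finb eqn.
have [/andP[tau0 taut] hpre hstop] := stopP w t0.
pose X s := pt R (st (Num.min s (stop t w)) w).
have markb e s : jump e -> s <= t -> mark_set q st e s w `<=` box t b.
  move=> je s_t z [/andP[h1 h2] /andP[h3 h4]]; split; rewrite /= in_itv/= ?h1 ?h3.
    by rewrite (le_trans h2).
  rewrite (le_trans h4)// -[b]mul1r; have /andP[q0 q1] := qb e z.1 w je (ltW h1).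
  by rewrite ler_pM ?pt_ge0 ?pt_le1.
have mmark e s : jump e -> 0 <= s -> measurable (mark_set q st e s w).
  by move=> je s0; exact: (measurable_mark_set w bq sp je s0).
have mark_strip e s : mark_set q st e (stop t w) w `&` strip 0 s =
    mark_set q st e (Num.min s (stop t w)) w.
  apply/seteqP; split => z.
    by move=> [[/andP[h1 h2] h3] /andP[_ h4]]; split => //; rewrite h1 le_min h4.
  move=> [/andP[h1 +] h3]; rewrite le_min => /andP[h4 h5].
  by split; [split => //; rewrite h1|rewrite /strip /= h1].
have X0 : X 0 = m.
  rewrite /X min_l// eqn// big1 ?addr0// => e je.
  rewrite (_ : mark_set _ _ _ _ _ = set0) ?measure0/= ?mulr0 ?scale0r//.
  by apply/seteqP; split => // z [/andP[/lt_le_trans h /h]]; rewrite ltxx.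
have XE s : 0 <= s <= t -> X s = X 0 + \sum_(e | jump e)
    (n%:R^-1 * fine (N e w (mark_set q st e (stop t w) w `&` strip 0 s))) *: jump_vector R e.
  move=> /andP[s0 st']; rewrite X0 /X eqn; last by rewrite le_min s0.
  by congr (_ + _); apply: eq_bigr => e je; rewrite mark_strip.
have := @chain_rule R d n gamma (N^~ w) t b k X (fun s => pt R (prev_state st s w))
  (fun e => mark_set q st e (stop t w) w) (state d n) (@pt R d n) n0 gd t0.
move=> /(_ _ finb sk XE _ _ (@pt_inj R d n n0)) H.
have {}H := H _ _ _ _ _ f.
rewrite X0 in H; rewrite /stopped -{1}(min_r taut) -/(X t) H.
- congr (_ + _); apply: eq_bigr => e je; apply: eq_bigr => j _.
  congr (_ * fine (N e w _)); rewrite slice_dwell//; apply/seteqP; split => z [h1 h2]; split => //.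
    exact: (@pt_inj R d n n0).
  by rewrite /= h2.
- by move=> e je; split; [exact: mmark|exact: markb].
- by move=> s _ x; have [_ ->] := pt_grid R n0 (st (Num.min s (stop t w)) w).
- by move=> s _; exists (st (Num.min s (stop t w)) w).
- move=> e z u j je [/andP[h1 h2] _] /andP[u0 uz] hX; congr (pt R _).
  apply: (@left_stateE _ _ _ _ j u); first by rewrite u0.
  move=> s sz; apply: (@pt_inj R d n n0); rewrite -(hX s sz) /X min_l//.
  by case/andP: sz => _ /ltW /le_trans ->.
- move=> e j je; have := slice_dwell e j w t0.
  have [b' _ [_ /(_ t t0)[_ mD _]]] := compensated_dwell j je.
  rewrite (_ : [set z | pt R (prev_state st z.1 w) = pt R j] = [set z | prev_state st z.1 w = j]).
    by move=> <-; exact: mD.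
  by apply/seteqP; split => z /=; [exact: (@pt_inj R d n n0)|move=> ->].
Qed.

Lemma occupation t : 0 <= t -> exists v : edge d -> state d n -> R,
  forall e j, jump e -> [/\ 0 <= v e j,
    has_mean P (fun w => leb2 (slice (dwell e j t) w)) (v e j)%:E,
    has_mean P (fun w => N e w (slice (dwell e j t) w)) (n%:R * v e j)%:E &
    forall w, leb2 (slice (dwell e j t) w) \is a fin_num].
Proof.
move=> t0; have /choice[v hv] : forall u : (edge d) * state d n, exists v : R,
    jump u.1 -> [/\ 0 <= v,
    has_mean P (fun w => leb2 (slice (dwell u.1 u.2 t) w)) v%:E,
    has_mean P (fun w => N u.1 w (slice (dwell u.1 u.2 t) w)) (n%:R * v)%:E &
    forall w, leb2 (slice (dwell u.1 u.2 t) w) \is a fin_num].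
  move=> [e j] /=; have [je|je] := boolP (jump e); last by exists 0.
  have [b b0 [_ /(_ t t0)[Db mD [v [v1 v2]]]]] := compensated_dwell j je.
  have v0 := has_mean_ge0 v1.
  have vb := compensated_fin t0 b0 Db mD v1.
  have vf : v \is a fin_num by rewrite ge0_fin_numE// (le_lt_trans vb)// ltry.
  exists (fine v) => _; split; rewrite ?EFinM ?fineK//; first by rewrite fine_ge0.
  move=> w; rewrite ge0_fin_numE//; apply: (@leb2_sub_box R t b) => //.
  by move=> z /Db.
by exists (fun e j => v (e, j)) => e j je; exact: (hv (e, j)).
Qed.

Lemma dynkin (f : 'rV[R]_d -> R) t (v : edge d -> state d n -> R) : 0 <= t ->
  (forall j : state d n, 0 <= f (pt R j)) -> 0 <= f m ->
  (forall e j, jump e -> 0 <= v e j /\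
    has_mean P (fun w => N e w (slice (dwell e j t) w)) (n%:R * v e j)%:E) ->
  has_mean P (fun w => (f (pt R (stopped t w)))%:E)
    (f m + \sum_(e | jump e) \sum_j jump_dif f e j * (n%:R * v e j))%:E.
Proof.
move=> t0 f0 fm0 hv.
(* [has_mean] deals with nonnegative functions only, so the increments of [f] are split into
   positive and negative parts and recombined by [has_meanB]. *)
pose dp e j := Num.max (jump_dif f e j) 0; pose dm e j := Num.max (- jump_dif f e j) 0.
have difE e j : jump_dif f e j = dp e j - dm e j.
  by rewrite /dp /dm; case: (lerP (jump_dif f e j) 0) => h;
    case: (lerP (- jump_dif f e j) 0) => h'; lra.
have dp0 e j : 0 <= dp e j by rewrite le_max lexx orbT.
have dm0 e j : 0 <= dm e j by rewrite le_max lexx orbT.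
have mean (c : edge d -> state d n -> R) : (forall e j, 0 <= c e j) ->
    has_mean P (fun w => \sum_(e | jump e) \sum_j (c e j)%:E * N e w (slice (dwell e j t) w))%E
      (\sum_(e | jump e) \sum_j c e j * (n%:R * v e j))%:E.
  move=> c0; rewrite -sumEFin; apply: has_mean_sum => e je.
  rewrite -sumEFin; apply: has_mean_sum => j _; rewrite EFinM.
  by apply: has_meanZ => //; case: (hv e j je).
have fin : {ae P, forall w, forall e, forall j, jump e ->
    N e w (slice (dwell e j t) w) \is a fin_num}.
  apply: ae_forall_count => e; apply: ae_forall_count => j.
  have [je|je] := boolP (jump e); last by apply: aeW.
  have [_ h] := hv e j je; have := has_mean_fin (ltry _) h.
  by apply: filterS.
have h1 := has_meanD (has_mean_cst P fm0) (mean dp dp0).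
have h2 := mean dm dm0.
have [||h _] := @has_meanB _ _ _ P _ _ (fun w => (f (pt R (stopped t w)))%:E) _ _ _ h1 h2.
- by rewrite -EFinD ltry.
- have := dynkin_path f t0; move: fin; apply: filterS2 => w fw fE.
  split; first by rewrite lee_fin.
  have E (c : edge d -> state d n -> R) :
      (\sum_(e | jump e) \sum_j (c e j)%:E * N e w (slice (dwell e j t) w))%E =
      (\sum_(e | jump e) \sum_j c e j * fine (N e w (slice (dwell e j t) w)))%:E.
    rewrite -sumEFin; apply: eq_bigr => e je; rewrite -sumEFin; apply: eq_bigr => j _.
    by rewrite EFinM fineK// fw.
  rewrite !E -!EFinD; congr (_%:E); rewrite fE addrCA; congr (_ + _).
  rewrite -big_split/=; apply: eq_bigr => e _; rewrite -big_split/=; apply: eq_bigr => j _.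
  by rewrite difE mulrBl addrC subrK.
- rewrite (_ : f m + _ = f m + (\sum_(e | jump e) \sum_j dp e j * (n%:R * v e j)) -
    \sum_(e | jump e) \sum_j dm e j * (n%:R * v e j)); first exact: h.
  rewrite -addrA -sumrB; congr (_ + _); apply: eq_bigr => e _.
  by rewrite -sumrB; apply: eq_bigr => j _; rewrite difE mulrBl.
Qed.

End dynkin.

(** * The cost and the compensators as integrals over the lifetime *)

Section occupation_cost.
Variables (C : edge d -> R -> \bar R) (r : 'rV[R]_d -> R) (K : set 'rV[R]_d).
Notation tcost e := (transformed_cost (gamma e.1 e.2) (C e)).
Hypothesis mF : forall e, jump e ->
  measurable_fun (halfline R) (tcost e).
Hypothesis F0 : forall e x, jump e -> 0 <= x -> (0 <= tcost e x)%E.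
Hypothesis r0 : forall j : state d n, 0 <= r (pt R j).
Variables (m : 'rV[R]_d) (q : edge d -> R -> T -> R) (st : R -> T -> state d n).
Hypotheses (bq : bounded_control gamma F q) (jp : jump_process m q st).

Definition target : set (state d n) := [set j | K (pt R j)].
Notation B := target.

Let sp := jp.1.
Let sr : forall w, step_right (st^~ w). Proof. by case: sp. Qed.
Let sl : forall w, step_left (st^~ w). Proof. by case: sp. Qed.
Let ad : forall t (B : set (state d n)), 0 <= t -> F t [set w | B (st t w)].
Proof. by case: sp. Qed.

Lemma q_ge0 e s w : jump e -> 0 <= s -> 0 < q e s w.
Proof.
by move=> je s0; have [_ [a [b [a0 /(_ s w s0)/andP[h _]]]]] := bq je; exact: lt_le_trans h.
Qed.

Lemma q_measurable e w : jump e ->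
  measurable_fun (halfline R) (fun s => q e s w).
Proof. by move=> je; have [pq _] := bq je; exact: (predictable_measurable w pq). Qed.

Definition living (w : T) : set (mR R) := [set s | 0 < s /\ alive st B (s, w)].

Lemma measurable_living w : measurable (living w).
Proof.
rewrite (_ : living w = `]0, +oo[ `&` [set s | alive st B (s, w)]).
  by apply: measurableI => //; apply: predictable_section; exact: (alive_predictable sr ad).
by apply/seteqP; split => s [h1 h2]; split => //; move: h1; rewrite /= in_itv/= andbT.
Qed.

Lemma living_sub w : living w `<=` `[0, +oo[.
Proof. by move=> s [/ltW s0 _]; rewrite /= in_itv/= s0. Qed.

Lemma measurable_prev j w :
  measurable ([set s | 0 <= s /\ prev_state st s w = j] : set (mR R)).
Proof. exact: (predictable_section w (prev_state_predictable sl ad (eq^~ j))). Qed.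

Lemma prev_not_target s w : 0 < s -> alive st B (s, w) -> ~ B (prev_state st s w).
Proof.
move=> s0 [_ al]; have [v /andP[v0 vs] h] := left_stateP (sl w) s0.
rewrite /prev_state -(h v) ?lexx//; apply: al => /=; first by rewrite v0.
Qed.

Definition prev_cost w s : \bar R :=
  running_cost gamma C r (pt R (prev_state st s w)) (fun e => q e s w).

Lemma running_cost_pt_ge0 (j : state d n) (x : edge d -> R) :
  (forall e, jump e -> 0 <= x e) -> (0 <= running_cost gamma C r (pt R j) x)%E.
Proof.
move=> x0; apply: adde_ge0; last by rewrite lee_fin.
apply: sume_ge0 => e je; apply: mule_ge0; first by rewrite lee_fin pt_ge0.
by apply: F0 => //; exact: x0.
Qed.

Lemma prev_cost_ge0 w s : 0 <= s -> (0 <= prev_cost w s)%E.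
Proof. by move=> s0; apply: running_cost_pt_ge0 => e je; exact/ltW/q_ge0. Qed.

Lemma measurable_prev_cost w :
  measurable_fun (halfline R) (prev_cost w).
Proof.
apply: (@measurable_step_cost R d n gamma C r mF (fun s => prev_state st s w) (fun e s => q e s w)).
  by move=> j; exact: measurable_prev.
by move=> e je; split; [exact: q_measurable|move=> s s0; exact/ltW/q_ge0].
Qed.

(** The two integrals differ in their domains and in using current or left states, but only on the
    countable set [Z] of time 0, the jump times and the hitting time. *)
Lemma total_cost_living w :
  total_cost gamma C r K (fun t => pt R (st t w)) (fun e t => q e t w) =
  (\int[leb]_(s in living w) prev_cost w s)%E.
Proof.
rewrite /total_cost; set Dom := [set t : R | _].
pose J := [set s | 0 <= s /\ st s w <> prev_state st s w].
pose Z := [set 0] `|` J `|` [set s | living w s /\ B (st s w)].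
have cJ : countable J by exact: jumps_countable.
have cZ : countable Z.
  rewrite /Z; apply: countableU; first by apply: countableU => //; exact: countable1.
  apply/countable_injP; exists (fun=> 0%N) => s s'; rewrite !inE.
  move=> [[s0 al] Bs] [[s'0 al'] Bs'] _; case: (ltgtP s s') => // h.
    by have [_ /(_ s)] := al'; rewrite /= h (ltW s0) => /(_ isT)[].
  by have [_ /(_ s')] := al; rewrite /= h (ltW s'0) => /(_ isT)[].
have mZ A : A `<=` Z -> measurable (A : set (mR R)).
  by move=> AZ; apply: countable_measurable; exact: sub_countable (subset_card_le AZ) cZ.
have Z0 : leb Z = 0%E by exact: countable_lebesgue_measure0.
have DomZ : Dom `\` Z = living w `\` Z.
  apply/seteqP; split => s [h1 h2]; split => //.
    move: h1 => [/= s0 sT]; have sp0 : 0 < s.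
      by rewrite lt_neqAle s0 andbT; apply/eqP => E; apply: h2; left; left.
    split => //; split => //= r' /andP[r'0 r's] Br.
    move: sT; rewrite ltNge => /negP; apply; apply: (@le_trans _ _ r'%:E).
      by apply: ereal_inf_lbound; exists r'.
    by rewrite lee_fin ltW.
  have [s0 al] := h1; split; first exact: ltW.
  rewrite ltNge; apply/negP => Ts; apply: h2; right; split => //.
  have [dl dl0 hdl] := sr w (ltW s0).
  have [|_ [t [t0 Kt] <-]] := @ereal_inf_lt _ _ (s + dl)%:E (le_lt_trans Ts _).
    by rewrite lte_fin ltrDl.
  rewrite lte_fin => tdl; have [st'|ts] := leP s t.
    by rewrite /target /= -(hdl t) ?st'.
  by have := al.2 t; rewrite /= t0 ts => /(_ isT)[].
(* The original domain, like the level sets of the path below, is measurable because it differs from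
   a section of a predictable set by a countable set. *)
have mDom : measurable (Dom : set (mR R)).
  rewrite (_ : Dom = (living w `\` Z) `|` (Dom `&` Z)).
    by apply: measurableU; [apply: measurableD; [exact: measurable_living|exact: mZ]|
      apply: mZ => s []].
  by rewrite -DomZ setDE -setIUr setUC setUv setIT.
have mst j : measurable ([set s | 0 <= s /\ st s w = j] : set (mR R)).
  rewrite (_ : mkset _ = ([set s | 0 <= s /\ prev_state st s w = j] `\` Z) `|`
      ([set s | 0 <= s /\ st s w = j] `&` Z)).
    by apply: measurableU; [apply: measurableD; [exact: measurable_prev|exact: mZ]|
      apply: mZ => s []].
  apply/seteqP; split => s.
    move=> [s0 sj]; have [Zs|nZ] := pselect (Z s); [by right|left; split => //; split => //].
    by rewrite -sj; apply: contrapT => h; apply: nZ; left; right; split => // /esym.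
  move=> [[[s0 sj] nZ]|[]//]; split => //; rewrite -sj.
  by apply: contrapT => h; apply: nZ; left; right.
transitivity (\int[leb]_(t in Dom `\` Z)
    running_cost gamma C r (pt R (st t w)) (fun e => q e t w))%E.
  apply: ge0_negligible_integral => //; [exact: mZ| |by move=> s [s0 _]; apply: running_cost_pt_ge0 => e je; exact/ltW/q_ge0].
  apply: (@measurable_funS _ _ _ _ (halfline R)) => //.
    by move=> s [/= s0 _]; rewrite in_itv/= s0.
  apply: (@measurable_step_cost R d n gamma C r mF (fun s => st s w) (fun e s => q e s w)) => //.
  by move=> e je; split; [exact: q_measurable|move=> s s0; exact/ltW/q_ge0].
transitivity (\int[leb]_(t in living w `\` Z) prev_cost w t)%E; last first.
  apply/esym; apply: ge0_negligible_integral => //.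
  - exact: mZ.
  - exact: measurable_living.
  - by apply: measurable_funS (measurable_prev_cost w) => //; exact: living_sub.
  - by move=> s [s0 _]; apply: prev_cost_ge0; exact: ltW.
rewrite DomZ; apply: eq_integral => s; rewrite inE => -[[s0 al] nZ].
rewrite /prev_cost; congr running_cost; congr (pt R _).
by apply: contrapT => h; apply: nZ; left; right; split => //; exact: ltW.
Qed.

Definition living_until (t : R) (w : T) : set (mR R) := living w `&` `]0, t].

Lemma measurable_living_until t w : measurable (living_until t w).
Proof. by apply: measurableI => //; exact: measurable_living. Qed.

Lemma leb2_dwell e j t w : jump e -> 0 <= t ->
  leb2 (slice (dwell q st B e j t) w) =
  (\int[leb]_(s in living_until t w)
     ((prev_state st s w == j)%:R * (pt R j ord0 e.1 * q e s w))%:E)%E.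
Proof.
move=> je t0; rewrite [LHS]/(\int[leb]_x _)%E /= [RHS]integral_mkcond.
apply: eq_integral => s _ /=; rewrite /patch.
case: ifPn => [/set_mem [[s0 al]]|sL].
  rewrite /= in_itv/= => /andP[_ st_].
  have c0 : 0 <= pt R j ord0 e.1 * q e s w.
    by rewrite mulr_ge0 ?pt_ge0// ltW// q_ge0// ltW.
  have [E|E] := eqVneq (prev_state st s w) j.
    rewrite mul1r (_ : xsection _ _ = `[0, pt R j ord0 e.1 * q e s w]%classic).
      by rewrite lebesgue_measure_itv/= lte_fin; case: ltP => h; rewrite ?sube0// ?oppr0 ?adde0//;
        congr _%:E; apply/le_anti; rewrite c0.
    apply/seteqP; split => y; rewrite /xsection /= => /mem_set.
      by move=> h; have := set_mem (set_mem h); rewrite /slice /= in_itv/= => -[].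
    move=> h; have := set_mem h; rewrite /= in_itv/= => h'.
    by apply/mem_set; split => //=; [rewrite s0|split => //; split => //; exact: ltW].
  rewrite mul0r (_ : xsection _ _ = set0) ?measure0//.
  apply/seteqP; split => // y; rewrite /xsection /= => /set_mem[_ [_ [_ /= h]] _].
  by move: E; rewrite h eqxx.
rewrite (_ : xsection _ _ = set0) ?measure0//.
apply/seteqP; split => // y; rewrite /xsection /= => /set_mem[/= /andP[s0 st_] [al _] _].
move/negP: sL; apply; apply/mem_set; split; first by split.
by rewrite /= in_itv/= s0.
Qed.

Lemma sum_leb2_dwell (c : edge d -> state d n -> R) t w : 0 <= t -> (forall e j, 0 <= c e j) ->
  (\sum_(e | jump e) \sum_j (c e j)%:E * leb2 (slice (dwell q st B e j t) w) =
  \int[leb]_(s in living_until t w)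
    (\sum_(e | jump e) c e (prev_state st s w) *
       (pt R (prev_state st s w) ord0 e.1 * q e s w))%:E)%E.
Proof.
move=> t0 c0.
have Lsub : living_until t w `<=` `[0, +oo[ by move=> s [/living_sub].
have Ls0 s : living_until t w s -> 0 <= s by move=> [[/ltW]].
have mst j : measurable_fun (living_until t w) (fun s => ((prev_state st s w == j)%:R : R)).
  apply: (@measurable_funS _ _ _ _ (halfline R)) => //.
  exact: (measurable_step (fun i => (i == j)%:R) (fun i => measurable_prev i w)).
have mq e : jump e -> measurable_fun (living_until t w) (fun s => q e s w).
  move=> je; apply: (@measurable_funS _ _ _ _ (halfline R)) => //.
  exact: q_measurable.
have mterm e j a : jump e -> measurable_fun (living_until t w)
    (fun s => (a * ((prev_state st s w == j)%:R * (pt R j ord0 e.1 * q e s w)))%:E).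
  move=> je; apply/measurable_EFinP; apply: measurable_funM => //.
  by apply: measurable_funM => //; apply: measurable_funM => //; exact: mq.
have term0 e j a s : jump e -> 0 <= a -> living_until t w s ->
    (0 <= (a * ((prev_state st s w == j)%:R * (pt R j ord0 e.1 * q e s w)))%:E)%E.
  move=> je a0 Ls; rewrite lee_fin !mulr_ge0// ?pt_ge0//.
  by rewrite ltW// q_ge0// Ls0.
transitivity (\sum_(e | jump e) \sum_j \int[leb]_(s in living_until t w)
   (c e j * ((prev_state st s w == j)%:R * (pt R j ord0 e.1 * q e s w)))%:E)%E.
  apply: eq_bigr => e je; apply: eq_bigr => j _; rewrite leb2_dwell//.
  under [RHS]eq_integral do rewrite EFinM.
  rewrite ge0_integralZl_EFin//.
  - exact: measurable_living_until.
  - by move=> s Ls; have := term0 e j 1 s je ler01 Ls; rewrite mul1r.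
  - by have := mterm e j 1 je; under eq_fun do rewrite mul1r.
pose G e j s := (if jump e then
  c e j * ((prev_state st s w == j)%:R * (pt R j ord0 e.1 * q e s w)) else 0)%:E.
have mG e j : measurable_fun (living_until t w) (G e j).
  rewrite /G; have [je|je] := boolP (jump e); first exact: mterm.
  exact: measurable_cst.
have G0 e j s : living_until t w s -> (0 <= G e j s)%E.
  move=> Ls; rewrite /G; have [je|je] := boolP (jump e) => //; exact: term0.
have mGs e : measurable_fun (living_until t w) (fun s => \sum_j G e j s)%E.
  by apply: emeasurable_sum => j; exact: mG.
transitivity (\sum_e \int[leb]_(s in living_until t w) (\sum_j G e j s))%E.
  rewrite [LHS]big_mkcond/=; apply: eq_bigr => e _.
  rewrite (@ge0_integral_sum _ _ _ _ _ (measurable_living_until t w) _ (G e) (mG e) (G0 e)).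
  rewrite /G; have [je|je] := boolP (jump e) => //.
  by rewrite big1// => j _; rewrite integral0.
have G0s e s : living_until t w s -> (0 <= \sum_j G e j s)%E.
  by move=> Ls; apply: sume_ge0 => j _; exact: G0.
rewrite -(@ge0_integral_sum _ _ _ _ _ (measurable_living_until t w) _ _ mGs G0s).
apply: eq_integral => s _; rewrite -sumEFin [RHS]big_mkcond/=; apply: eq_bigr => e _.
rewrite /G; have [je|je] := boolP (jump e); last by rewrite big1.
rewrite (bigD1 (prev_state st s w))//= eqxx mul1r big1 ?adde0// => j.
by rewrite eq_sym => /negbTE ->; rewrite mul0r mulr0.
Qed.

End occupation_cost.

(** * Verification by discrete sub- and supersolutions *)

Section verification.
Variables (C : edge d -> R -> \bar R) (r : 'rV[R]_d -> R) (K : set 'rV[R]_d).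
Notation tcost e := (transformed_cost (gamma e.1 e.2) (C e)).
Hypothesis mF : forall e, jump e ->
  measurable_fun (halfline R) (tcost e).
Hypothesis F0 : forall e x, jump e -> 0 <= x -> (0 <= tcost e x)%E.
Hypothesis r0 : forall m, prob_grid n m -> 0 <= r m.

Definition generator (f : 'rV[R]_d -> R) (m : 'rV[R]_d) (x : edge d -> R) : R :=
  \sum_(e | jump e) m ord0 e.1 * x e * n%:R *
    (f (m + n%:R^-1 *: jump_vector R e) - f m).

Let r0' (j : state d n) : 0 <= r (pt R j).
Proof. by apply: r0; exact: pt_grid. Qed.

Section along_process.
Variables (m : 'rV[R]_d) (q : edge d -> R -> T -> R) (st : R -> T -> state d n).
Hypotheses (bq : bounded_control gamma F q) (jp : jump_process m q st).
Variables (f : 'rV[R]_d -> R).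
Let B := target K.
Let dp (e : edge d) (j : state d n) := Num.max (jump_dif f e j) 0.
Let dm (e : edge d) (j : state d n) := Num.max (- jump_dif f e j) 0.
Let dp0 e j : 0 <= dp e j. Proof. by rewrite le_max lexx orbT. Qed.
Let dm0 e j : 0 <= dm e j. Proof. by rewrite le_max lexx orbT. Qed.
Let difE e j : jump_dif f e j = dp e j - dm e j.
Proof.
by rewrite /dp /dm; case: (lerP (jump_dif f e j) 0) => h;
  case: (lerP (- jump_dif f e j) 0) => h'; lra.
Qed.

Let S (c : edge d -> state d n -> R) t w :=
  (\sum_(e | jump e) \sum_j (n%:R * c e j)%:E *
     (leb \x leb) (slice (dwell q st B e j t) w))%E.

Lemma S_mean t : 0 <= t -> (forall j : state d n, 0 <= f (pt R j)) -> 0 <= f m ->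
  exists a b : R, [/\ has_mean P (S dp t) a%:E, has_mean P (S dm t) b%:E &
    has_mean P (fun w => (f (pt R (stopped jp B t w)))%:E) (f m + a - b)%:E].
Proof.
move=> t0 f0 fm0; have [v hv] := occupation bq jp B t0.
have mean (c : edge d -> state d n -> R) : (forall e j, 0 <= c e j) ->
    has_mean P (S c t) (\sum_(e | jump e) \sum_j n%:R * c e j * v e j)%:E.
  move=> c0; rewrite -sumEFin; apply: has_mean_sum => e je.
  rewrite -sumEFin; apply: has_mean_sum => j _; rewrite EFinM.
  by rewrite -EFinM [X in has_mean _ _ X]EFinM; apply: has_meanZ; [rewrite mulr_ge0|case: (hv e j je)].
exists (\sum_(e | jump e) \sum_j n%:R * dp e j * v e j).
exists (\sum_(e | jump e) \sum_j n%:R * dm e j * v e j).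
split; [exact: mean|exact: mean|].
have := @dynkin _ _ _ bq jp B f t v t0 f0 fm0.
move=> /(_ (fun e j je => let: And4 h1 _ h2 _ := hv e j je in conj h1 h2)).
congr (has_mean P _ _%:E); rewrite -addrA -sumrB; congr (_ + _).
apply: eq_bigr => e _; rewrite -sumrB; apply: eq_bigr => j _.
by rewrite difE; ring.
Qed.

Let hp (c : edge d -> state d n -> R) w s : R :=
  \sum_(e | jump e) n%:R * c e (prev_state st s w) *
    (pt R (prev_state st s w) ord0 e.1 * q e s w).

Let SE (c : edge d -> state d n -> R) t w : 0 <= t -> (forall e j, 0 <= c e j) ->
  S c t w = (\int[leb]_(s in living_until K st t w) (hp c w s)%:E)%E.
Proof.
move=> t0 c0; have h := sum_leb2_dwell K bq jp w t0 (c := fun e j => n%:R * c e j).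
by rewrite -h// => e j; exact: mulr_ge0.
Qed.

Let L_sub t w : living_until K st t w `<=` `[0, +oo[.
Proof. by move=> s [/living_sub]. Qed.

Let Ls0 t w s : living_until K st t w s -> 0 <= s.
Proof. by move=> [[/ltW]]. Qed.

Let hp_ge0 (c : edge d -> state d n -> R) w s : (forall e j, 0 <= c e j) -> 0 <= s ->
  0 <= hp c w s.
Proof.
move=> c0 s0; apply: sumr_ge0 => e je; rewrite !mulr_ge0 ?pt_ge0//.
by rewrite ltW// (q_ge0 bq).
Qed.

Let measurable_hp c w :
  measurable_fun (halfline R) (hp c w).
Proof.
rewrite /hp (_ : (fun s => _) = (fun s => \sum_e if jump e then
  n%:R * c e (prev_state st s w) * (pt R (prev_state st s w) ord0 e.1 * q e s w) else 0)).
  apply: measurable_sum => e; have [je|je] := boolP (jump e) => //.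
  have mst := fun h => measurable_step h (fun i => measurable_prev jp i w).
  apply: measurable_funM; first exact: (mst (fun j => n%:R * c e j)).
  apply: measurable_funM; first exact: (mst (fun j => pt R j ord0 e.1)).
  exact: (q_measurable bq).
by apply/funext => s; rewrite big_mkcond.
Qed.

Let measurable_hpL c w t : measurable_fun (living_until K st t w) (EFin \o hp c w).
Proof.
apply/measurable_EFinP; apply: (@measurable_funS _ _ _ _ (halfline R)) => //.
Qed.

Let genE w s : generator f (pt R (prev_state st s w)) (fun e => q e s w) = hp dp w s - hp dm w s.
Proof.
rewrite /generator /hp -sumrB; apply: eq_bigr => e _.
rewrite -[f _ - f _]/(jump_dif f e (prev_state st s w)) difE; ring.
Qed.

Let total w := total_cost gamma C r K (fun t => pt R (st t w)) (fun e t => q e t w).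

Let totalE w : total w = (\int[leb]_(s in living K st w) prev_cost C r q st w s)%E.
Proof. exact: (total_cost_living K mF F0 r0' bq jp). Qed.

Let pc0 w s : 0 <= s -> (0 <= prev_cost C r q st w s)%E.
Proof. exact: (prev_cost_ge0 F0 r0' st bq). Qed.

Let total_ge0 w : (0 <= total w)%E.
Proof. by rewrite totalE; apply: integral_ge0 => s [/ltW s0 _]; exact: pc0. Qed.

Let mpc w D : measurable D -> D `<=` (halfline R) ->
  measurable_fun D (prev_cost C r q st w).
Proof.
by move=> mD DS; apply: measurable_funS (measurable_prev_cost r mF bq jp w).
Qed.

Let total_until t w : (\int[leb]_(s in living_until K st t w)
  prev_cost C r q st w s <= total w)%E.
Proof.
rewrite totalE; apply: ge0_subset_integral => //.
- exact: (measurable_living_until K jp).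
- exact: (measurable_living K jp).
- by apply: mpc; [exact: (measurable_living K jp)|exact: living_sub].
- by move=> s [/ltW s0 _]; exact: pc0.
- by move=> s [].
Qed.

Lemma stopped_mean (g : 'rV[R]_d -> R) t : 0 <= t -> (forall j : state d n, 0 <= g (pt R j)) ->
  0 <= g m -> exists y : R, has_mean P (fun w => (g (pt R (stopped jp B t w)))%:E) y%:E.
Proof.
move=> t0 g0 gm0; have [v hv] := occupation bq jp B t0.
eexists; apply: (@dynkin _ _ _ bq jp B g t v t0 g0 gm0).
by move=> e j je; case: (hv e j je).
Qed.

(** Let [p] be the probability that [K] is not reached by time [t]. Dynkin's formula gives
    [f m <= i + M * p], while [r >= c] off [K] gives [c * t * p <= i]; a large [t] removes the
    defect. *)
Lemma process_lower_bound (c : R) : 0 < c -> (forall m, prob_grid n m -> 0 <= f m) ->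
  (forall m, prob_grid n m -> K m -> f m = 0) -> prob_grid n m ->
  (forall m, prob_grid n m -> ~ K m -> c <= r m) ->
  (forall m x, prob_grid n m -> ~ K m -> (forall e, jump e -> 0 < x e) ->
    (0 <= running_cost gamma C r m x + (generator f m x)%:E)%E) ->
  ((f m)%:E <= \int[P]_w total w)%E.
Proof.
move=> c0 f0 fK gm rc hL; set I := (\int[P]_w total w)%E.
have fpt0 (j : state d n) : 0 <= f (pt R j) by exact/f0/pt_grid.
have I0 : (0 <= I)%E by apply: integral_ge0 => w _; exact: total_ge0.
have [->|Iy] := eqVneq I +oo%E; first exact: leey.
have Ifin : I \is a fin_num by rewrite ge0_fin_numE// lt_neqAle Iy leey.
rewrite -(fineK Ifin) lee_fin; set i := fine I; have i0 : 0 <= i by exact: fine_ge0.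
pose M := \sum_(j : state d n) f (pt R j).
have fM (j : state d n) : f (pt R j) <= M.
  by rewrite /M (bigD1 j)//= lerDl; apply: sumr_ge0.
have M0 : 0 <= M by exact: sumr_ge0.
pose g (m : 'rV[R]_d) : R := \1_(~` K) m.
have g0 m' : 0 <= g m' by rewrite /g indicE.
have step t : 0 <= t -> exists p : R, [/\ f m <= i + M * p & c * t * p <= i].
  move=> t0; have [p hp_] := stopped_mean t0 (fun j => g0 (pt R j)) (g0 m).
  exists p; have [a [b [ha hb hf]]] := S_mean t0 fpt0 (f0 m gm); split.
    have h1 : (b%:E <= I + a%:E)%E.
      apply: (has_mean_lower2 ha hb total_ge0); apply: aeW => w.
      rewrite !SE//.
      have mL := measurable_living_until K jp t w.
      have mp : measurable_fun (living_until K st t w) (prev_cost C r q st w).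
        by apply: mpc => //; exact: L_sub.
      have p0 s : living_until K st t w s -> (0 <= prev_cost C r q st w s)%E.
        by move=> /Ls0; exact: pc0.
      have h0 s : living_until K st t w s -> (0 <= (hp dp w s)%:E)%E.
        by move=> /Ls0 s0; rewrite lee_fin; exact: hp_ge0.
      apply: (@le_trans _ _ (\int[leb]_(s in living_until K st t w)
          (prev_cost C r q st w s + (hp dp w s)%:E))%E).
        apply: ge0_le_integral => //.
        - by move=> s /Ls0 s0; rewrite lee_fin; exact: hp_ge0.
        - exact: measurable_hpL.
        - by apply: emeasurable_funD => //; exact: measurable_hpL.
        move=> s [[s0 al] _].
        have nK := prev_not_target jp s0 al.
        have := hL (pt R (prev_state st s w)) (fun e => q e s w) (pt_grid R n0 _) nK.
        move=> /(_ (fun e je => q_ge0 bq w je (ltW s0))).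
        rewrite genE /prev_cost; case: (running_cost _ _ _ _ _) => [x| |]//=.
          by rewrite -!EFinD !lee_fin; lra.
        by move=> _; rewrite addye// leey.
      rewrite ge0_integralD//; last exact: measurable_hpL.
      by rewrite leeD2r// total_until.
    have h2 : f m + a - b <= M * p.
      rewrite -lee_fin EFinM; apply: (has_mean_le _ hf (has_meanZ M0 hp_)).
      apply: aeW => w; rewrite -EFinM lee_fin /g indicE.
      have [Kx|nK] := pselect (K (pt R (stopped jp B t w))).
        by rewrite fK ?mulr_ge0//; exact: pt_grid.
      by rewrite mem_set// mulr1.
    move: h1; rewrite -(fineK Ifin) -/i -EFinD lee_fin => h1; lra.
  have h3 := has_meanZ (mulr_ge0 (ltW c0) t0) hp_.
  rewrite -lee_fin EFinM /i fineK//; apply: (has_mean_lower h3 total_ge0).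
  apply: aeW => w; rewrite -EFinM.
  have [Kx|nK] := pselect (K (pt R (stopped jp B t w))).
    by rewrite /g indicE memNset// mulr0.
  rewrite /g indicE mem_set// mulr1.
  apply: le_trans (total_until t w).
  have [_ h4 h5] := stopP jp B w t0.
  have st_ : stop jp B t w = t by case: h5 => // Bs; case: nK.
  rewrite st_ in h4.
  have LE : living_until K st t w = `]0, t]%classic.
    apply/seteqP; split => s; first by move=> [].
    rewrite /= in_itv/= => /andP[s0 st']; split; last by rewrite /= in_itv/= s0.
    split => //; split; first exact: ltW.
    by move=> r' /= /andP[r1 r2]; apply: h4; rewrite r1 (lt_le_trans r2).
  apply: (@le_trans _ _ (\int[leb]_(s in living_until K st t w) c%:E)%E).
    rewrite integral_cst; last exact: (measurable_living_until K jp).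
    have mE : leb (living_until K st t w) = t%:E.
      rewrite LE lebesgue_measure_itv/= lte_fin; case: ltP => [t1|t1].
        by rewrite oppr0 adde0.
      by congr _%:E; apply/le_anti; rewrite t0.
    by rewrite [X in (_ * X)%E]mE EFinM.
  apply: ge0_le_integral => //.
  - exact: (measurable_living_until K jp).
  - by move=> s _; rewrite lee_fin ltW.
  - by apply: mpc; [exact: (measurable_living_until K jp)|exact: L_sub].
  move=> s [[s0 al] _]; have nKp := prev_not_target jp s0 al.
  apply: (@le_trans _ _ (r (pt R (prev_state st s w)))%:E).
    by rewrite lee_fin rc//; exact: pt_grid.
  rewrite /prev_cost /running_cost leeDr//; apply: sume_ge0 => e je.
  apply: mule_ge0; first by rewrite lee_fin pt_ge0.
  by apply: F0 => //; apply/ltW/(q_ge0 bq) => //; exact: ltW.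
rewrite leNgt; apply/negP => ifm.
have d0 : 0 < f m - i by rewrite subr_gt0.
(* At this time [M * p <= M * i * (f m - i) / (M * i + 1) < f m - i]. *)
have [|p [p1 p2]] := step ((M * i + 1) / (c * (f m - i))).
  by rewrite divr_ge0 ?addr_ge0 ?mulr_ge0// ltW.
have : (M * i + 1) * p <= i * (f m - i).
  rewrite -ler_pdivrMr//; move: p2; congr (_ <= _).
  by field; rewrite !lt0r_neq0.
move=> p3; have : M * ((M * i + 1) * p) <= M * (i * (f m - i)) by rewrite ler_wpM2l.
have : (M * i + 1) * (f m - i) <= (M * i + 1) * (M * p).
  by rewrite ler_wpM2l ?addr_ge0 ?mulr_ge0//; lra.
lra.
Qed.

(** Dynkin's formula and [f >= 0] bound the expected cost up to each time [k] by [f m]; the bound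
    passes to the whole lifetime by monotone convergence. *)
Lemma process_upper_bound : (forall m, prob_grid n m -> 0 <= f m) -> prob_grid n m ->
  (forall w s, 0 < s -> ~ K (pt R (prev_state st s w)) ->
    (prev_cost C r q st w s + (generator f (pt R (prev_state st s w)) (fun e => q e s w))%:E <= 0)%E) ->
  (\int[P]_w total w <= (f m)%:E)%E.
Proof.
move=> f0 gm hU.
have fpt0 (j : state d n) : 0 <= f (pt R j) by exact/f0/pt_grid.
(* Minus the generator along the path. It dominates the cost, and its integrals have means, being
   differences of the compensators [S]. *)
pose ell w s := hp dm w s - hp dp w s.
have ellP t w s : living_until K st t w s -> (0 <= (ell w s)%:E)%E /\
    (prev_cost C r q st w s <= (ell w s)%:E)%E.
  move=> [[s0 al] _]; have := hU w s s0 (prev_not_target jp s0 al).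
  rewrite genE /ell; have := pc0 w (ltW s0).
  case: (prev_cost C r q st w s) => [x| |]// x0.
  by move: x0; rewrite -EFinD !lee_fin => x0 h2; split; lra.
have mell D w : measurable_fun (living_until K st D w) (EFin \o ell w).
  apply/measurable_EFinP; apply: (@measurable_funS _ _ _ _ (halfline R)) => //.
  by apply: measurable_funB; exact: measurable_hp.
have mL t w := measurable_living_until K jp t w.
pose Z (k : nat) w := (\int[leb]_(s in living_until K st k%:R w) (ell w s)%:E)%E.
have SZ k w : S dm k%:R w = (S dp k%:R w + Z k w)%E.
  rewrite !SE// -ge0_integralD//.
  - by apply: eq_integral => s _; rewrite -EFinD /ell addrC subrK.
  - by move=> s /Ls0 s0; rewrite lee_fin; exact: hp_ge0.
  - exact: measurable_hpL.
  - by move=> s /ellP[].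
have Z0 k w : (0 <= Z k w)%E by apply: integral_ge0 => s /ellP[].
have mono k w : living_until K st k%:R w `<=` living_until K st k.+1%:R w.
  move=> s [h1 /=]; rewrite in_itv/= => /andP[h2 h3]; split => //=.
  by rewrite in_itv/= h2 (le_trans h3)// ler_nat.
have [v hv] : exists v : nat -> \bar R, forall k, has_mean P (Z k) (v k) /\ (v k <= (f m)%:E)%E.
  have : forall k : nat, exists v, has_mean P (Z k) v /\ (v <= (f m)%:E)%E.
    move=> k; have [a [b [ha hb hf]]] := S_mean (ler0n R k) fpt0 (f0 m gm).
    exists (b%:E - a%:E)%E; split.
      have [||h _] := @has_meanB _ _ _ P _ _ (Z k) _ _ _ hb ha => //; first by rewrite ltry.
      by apply: aeW => w; rewrite SZ.
    by have := has_mean_ge0 hf; rewrite -EFinB !lee_fin; lra.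
  by move=> /choice[v hv]; exists v.
have hsup : has_mean P (fun w => ereal_sup (range (Z^~ w))) (ereal_sup (range v)).
  apply: (@has_mean_nd _ _ _ P Z) => [k|]; first by case: (hv k).
  apply: aeW => w; split => // k; apply: ge0_subset_integral => //; last by move=> s /ellP[].
have supv : (ereal_sup (range v) <= (f m)%:E)%E.
  by apply: ge_ereal_sup => _ [k _ <-]; case: (hv k).
apply: le_trans supv; apply: (has_mean_upper hsup total_ge0); apply: aeW => w.
rewrite totalE (_ : living K st w = \bigcup_k living_until K st k%:R w); last first.
  apply/seteqP; split => s; last by move=> [k _ []].
  move=> Ls; exists (Num.truncn s).+1 => //; split => //=.
  by rewrite in_itv/=; case: Ls => -> _ /=; rewrite ltW// truncnS_gt.
have cv : (\int[leb]_(s in living_until K st k%:R w) prev_cost C r q st w s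
    @[k --> \oo] --> \int[leb]_(s in \bigcup_k living_until K st k%:R w)
      prev_cost C r q st w s)%E.
  apply: ge0_nondecreasing_set_cvg_integral => //.
  - by apply/nondecreasing_seqP => k; apply/subsetPset; exact: mono.
  - by move=> k; apply: mpc => //; exact: L_sub.
  - by move=> k s /Ls0; exact: pc0.
rewrite -(cvg_lim _ cv)//; apply: lime_le; first by apply/cvg_ex; eexists; exact: cv.
apply: nearW => k; apply: (@le_trans _ _ (Z k w)); last first.
  by apply: ereal_sup_ubound; exists k.
apply: ge0_le_integral => //.
- by move=> s /Ls0; exact: pc0.
- by apply: mpc => //; exact: L_sub.
- by move=> s /ellP[].
Qed.

End along_process.

Lemma value_n_ge (f : 'rV[R]_d -> R) (c : R) m : 0 < c -> (forall m, prob_grid n m -> 0 <= f m) ->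
  (forall m, prob_grid n m -> K m -> f m = 0) -> prob_grid n m ->
  (forall m, prob_grid n m -> ~ K m -> c <= r m) ->
  (forall m x, prob_grid n m -> ~ K m -> (forall e, jump e -> 0 < x e) ->
    (0 <= running_cost gamma C r m x + (generator f m x)%:E)%E) ->
  ((f m)%:E <= value_n n gamma C r K P N m)%E.
Proof.
move=> c0 f0 fK gm rc hL; apply: le_ereal_inf_tmp => _ [q [mu [bq cp ->]]].
have [st jp muE] := process_of_controlled bq cp.
apply: (le_trans (process_lower_bound bq jp c0 f0 fK gm rc hL)).
rewrite (_ : (fun w => total_cost _ _ _ _ (fun t => mu t w) _) =
  fun w => total_cost gamma C r K (fun t => pt R (st t w)) (fun e t => q e t w))//.
apply/funext => w; rewrite /total_cost.
have hE : hitting_time K (fun t => mu t w) = hitting_time K (fun t => pt R (st t w)).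
  rewrite /hitting_time; congr ereal_inf; apply/seteqP; split => x [t [t0 Kt] <-];
    by exists t => //; split => //; move: Kt; rewrite muE.
rewrite hE; apply: eq_integral => t; rewrite inE => -[t0 _].
by rewrite muE.
Qed.

Lemma value_n_le (f : 'rV[R]_d -> R) (Q : 'rV[R]_d -> edge d -> R) m :
  (forall m, prob_grid n m -> 0 <= f m) -> prob_grid n m ->
  (forall m e, prob_grid n m -> 0 < Q m e) ->
  (forall m, prob_grid n m -> ~ K m ->
    (running_cost gamma C r m (Q m) + (generator f m (Q m))%:E <= 0)%E) ->
  (value_n n gamma C r K P N m <= (f m)%:E)%E.
Proof.
move=> f0 gm Q0 hU; have [j0 j0m] := grid_pt n0 gm.
have [|st [bq jp]] := feedback_process (Q := fun e j => Q (pt R j) e) j0.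
  by move=> e j; apply: Q0; exact: pt_grid.
rewrite j0m in jp.
apply: (@le_trans _ _ _ _ _ _ (process_upper_bound bq jp f0 gm _)); last first.
  by move=> w s s0 nK; apply: hU => //; exact: pt_grid.
apply: ereal_inf_lbound.
exists (fun e t w => Q (pt R (prev_state st t w)) e), (fun t w => pt R (st t w)); split => //.
exact: (controlled_of_jump bq jp).
Qed.

End verification.

End jump_processes.

(** * The transformed cost: Fenchel duality and affine minorants *)

Lemma ell_young (R : realType) (q u M : R) : 0 <= q -> 0 < u ->
  M * q - u * (expR M - 1) <= u * ell (q / u).
Proof.
move=> q0 u0; rewrite /ell; have [->|qn] := eqVneq q 0.
  by rewrite !mul0r; have := mulr_gt0 u0 (expR_gt0 M); lra.
have qp : 0 < q by rewrite lt_neqAle eq_sym qn.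
have x0 : 0 < q / u by rewrite divr_gt0.
(* Fenchel's inequality between [ell] and its conjugate [expR M - 1] is the tangent inequality of
   the exponential at 0. *)
have h : 1 + (M - ln (q / u)) <= expR M / (q / u).
  by apply: le_trans (expR_ge1Dx _) _; rewrite expRB lnK.
have : (1 + (M - ln (q / u))) * q <= (expR M / (q / u)) * q by rewrite ler_wpM2r// ltW.
have -> : expR M / (q / u) * q = u * expR M by field; rewrite !lt0r_neq0.
have -> : u * (q / u * ln (q / u) - q / u + 1) = q * ln (q / u) - q + u.
  by field; rewrite lt0r_neq0.
lra.
Qed.

Section transformed_cost_theory.
Context (R : realType) (g : R) (C : R -> \bar R).
Hypothesis g0 : 0 < g.
Hypothesis cC : convex_cost C.
Hypothesis C1 : C 1 = 0%E.
Notation F := (transformed_cost g C).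
Local Open Scope ereal_scope.

Lemma C_ge0 u : (0 <= u)%R -> 0 <= C u. Proof. by case: cC => + _; apply. Qed.

(** Convexity of the transformed cost is handled through its affine minorants, which keeps infinite
    values out of the computations. *)
Definition minorant (a b : R) := forall x : R, (0 <= x)%R -> (a + b * x)%:E <= F x.

(** The choice [u = g] in the supremum, where the cost [C 1] vanishes. The slope [M] is free, whence
    the superlinear growth of the transformed cost. *)
Lemma minorant_exp (M : R) : minorant (- (g * (expR M - 1)))%R M.
Proof.
move=> x x0; apply: (@le_trans _ _ ((g * ell (x / g))%:E - g%:E * C (g / g)%R)).
  rewrite divff ?lt0r_neq0// C1 mule0 sube0 lee_fin.
  by have := ell_young M x0 g0; lra.
by apply: ereal_sup_ubound; exists g.
Qed.

Lemma transformed_cost_ge (M x : R) : (0 <= x)%R ->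
  (M * x - g * (expR M - 1))%:E <= F x.
Proof. by move=> x0; rewrite addrC; exact: minorant_exp. Qed.

Lemma transformed_cost_ge0 x : (0 <= x)%R -> 0 <= F x.
Proof.
by move=> x0; have := transformed_cost_ge 0 x0; rewrite expR0 subrr mulr0 mul0r subrr.
Qed.

(* For [x > 0], the transformed cost is the supremum of its affine minorants,
   since [u * ell (x / u)] is the supremum over [M] of [M * x - u * (expR M - 1)]. *)
Lemma minorant_sup (x : R) (y : \bar R) : (0 < x)%R ->
  (forall a b, minorant a b -> (a + b * x)%:E <= y) -> F x <= y.
Proof.
move=> x0 h; apply: ge_ereal_sup => _ [u /= u0 <-].
have := C_ge0 (ltW (divr_gt0 u0 g0)); case E : (C (u / g)) => [c| |]// c0.
  pose M := ln (x / u).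
  have xu : (0 < x / u)%R by rewrite divr_gt0.
  have := h (- (u * (expR M - 1)) - g * c)%R M; rewrite -EFinM -EFinB.
  rewrite (_ : (_ + M * x)%R = (u * ell (x / u) - g * c)%R); last first.
    by rewrite /M lnK// /ell; field; rewrite lt0r_neq0.
  apply=> z z0; apply: (@le_trans _ _ ((u * ell (z / u))%:E - g%:E * C (u / g)%R)).
    by rewrite E -EFinM -EFinB lee_fin; have := ell_young M z0 u0; lra.
  by apply: ereal_sup_ubound; exists u.
by rewrite gt0_muley ?lte_fin//= leNye.
Qed.

(** Joint convexity of the perspective [z * F (w / z)] in [(z, w)]: an affine minorant [a + b * x]
    becomes the linear function [a * z + b * w]. *)
Lemma transformed_cost_perspective (z u v x y : R) (t : R) :
  (0 <= t <= 1)%R -> (0 <= u)%R -> (0 <= v)%R -> (0 <= x)%R -> (0 <= y)%R ->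
  (z = t * u + (1 - t) * v)%R -> (0 < z)%R -> (0 < t * (u * x) + (1 - t) * (v * y))%R ->
  z%:E * F ((t * (u * x) + (1 - t) * (v * y)) / z)%R <=
  t%:E * (u%:E * F x) + (1 - t)%:E * (v%:E * F y).
Proof.
move=> /andP[t0 t1] u0 v0 x0 y0 zE z0 w0; set w := (t * _ + _)%R.
have t1' : (0 <= 1 - t)%R by lra.
rewrite -lee_pdivlMl//; apply: minorant_sup; first by rewrite divr_gt0.
move=> a b mab; rewrite lee_pdivlMl//.
have -> : z%:E * (a + b * (w / z))%:E = (t * (u * (a + b * x)))%:E + ((1 - t) * (v * (a + b * y)))%:E.
  rewrite -EFinM -EFinD; congr _%:E.
  have -> : (z * (a + b * (w / z)) = z * a + b * w)%R by field; rewrite lt0r_neq0.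
  by rewrite zE /w; ring.
rewrite !EFinM; apply: leeD; (apply: lee_wpmul2l; first by rewrite lee_fin);
  (apply: lee_wpmul2l; first by rewrite lee_fin); exact: mab.
Qed.

(** Sublevel sets are intervals: at an intermediate point every affine minorant is at most its value
    at one of the two ends. *)
Lemma measurable_transformed_cost :
  measurable_fun (`[0%R, +oo[ : set (mR R)) F.
Proof.
move=> mD; apply: (measurability _ (ErealGenInftyO.measurableE R)) => // _ [_ [x ->] <-].
apply: is_interval_measurable => q q' [/= + hq] [/= + hq'] z /andP[qz zq'].
rewrite !in_itv/= !andbT => q0 q'0.
have z0 := le_trans q0 qz; split => //.
have [<-//|qz'] := eqVneq q z; have [->//|zq''] := eqVneq z q'.
have qltz : (q < z)%R by rewrite lt_neqAle qz' qz.
have zltq : (z < q')%R by rewrite lt_neqAle zq'' zq'.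
have zp : (0 < z)%R by exact: le_lt_trans qltz.
move: hq hq'; rewrite /= !in_itv/= => hq hq'.
apply: (@le_lt_trans _ _ (maxe (F q) (F q'))); last by rewrite gt_max hq.
apply: minorant_sup => // a b mab; rewrite le_max.
have [b0|b0] := leP 0%R b.
  apply/orP; right; apply: le_trans (mab q' q'0); rewrite lee_fin lerD2l.
  by rewrite ler_wpM2l// ltW.
apply/orP; left; apply: le_trans (mab q q0); rewrite lee_fin lerD2l.
by rewrite ler_wnM2l// ltW.
Qed.

End transformed_cost_theory.

(** * Growth of the original cost and the upper bound on the transformed cost *)

Section cost_growth.
Context (R : realType) (C : R -> \bar R).
Hypothesis cC : convex_cost C.
Hypothesis C1 : C 1 = 0%E.
Local Open Scope ereal_scope.

Let C0 u : (0 <= u)%R -> 0 <= C u. Proof. by case: cC => + _; apply. Qed.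

Let quot (u h : R) := (h^-1)%:E * (C (u + h)%R - C u).

Let three_points (v u w : R) : (0 <= v)%R -> (v < u)%R -> (u < w)%R -> C u \is a fin_num ->
  (w - v)%:E * C u <= (w - u)%:E * C v + (u - v)%:E * C w.
Proof.
move=> v0 vu uw fu; have d0 : (0 < w - v)%R by lra.
have d1 : (0 <= (w - u) / (w - v) <= 1)%R.
  by rewrite divr_ge0/= ?ler_pdivrMr//; lra.
have w0 : (0 <= w)%R by lra.
have := cC.2 v w _ v0 w0 d1.
have -> : ((w - u) / (w - v) * v + (1 - (w - u) / (w - v)) * w = u)%R by field; rewrite lt0r_neq0.
have -> : (1 - (w - u) / (w - v) = (u - v) / (w - v))%R by field; rewrite lt0r_neq0.
move=> h; have := lee_wpmul2l (ltW (d0 : (0 < (w - v)%:E))) h.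
rewrite ge0_muleDr ?mule_ge0 ?lee_fin ?C0//; [|by rewrite divr_ge0 ; lra|by rewrite divr_ge0; lra].
rewrite !muleA -!EFinM !mulrA ![((w - v) * _)%R]mulrC -!mulrA.
by rewrite !divff ?lt0r_neq0// !mulr1.
Qed.

Lemma cost_finite u : (0 <= u <= 1)%R -> C u \is a fin_num -> forall v, (u <= v <= 1)%R -> C v \is a fin_num.
Proof.
move=> /andP[u0 u1] fu v /andP[uv v1]; have v0 := le_trans u0 uv.
rewrite ge0_fin_numE ?C0//.
have [->|vn] := eqVneq v 1%R; first by rewrite C1 ltry.
have d0 : (0 < 1 - u)%R by have : (v < 1)%R; [rewrite lt_neqAle vn v1|lra].
have d1 : (0 <= (1 - v) / (1 - u) <= 1)%R.
  by rewrite divr_ge0/= ?ler_pdivrMr//; lra.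
have := cC.2 u 1%R _ u0 ler01 d1.
have -> : ((1 - v) / (1 - u) * u + (1 - (1 - v) / (1 - u)) * 1 = v)%R by field; rewrite lt0r_neq0.
rewrite C1 mule0 adde0 => /le_lt_trans; apply.
by rewrite -(fineK fu) -EFinM ltry.
Qed.

Let quot_mono u : (0 <= u)%R -> C u \is a fin_num -> forall h k, (0 < h)%R -> (h <= k)%R ->
  quot u h <= quot u k.
Proof.
move=> u0 fu h k h0 hk; have k0 : (0 < k)%R by lra.
have [->|hn] := eqVneq h k; first by [].
have hk' : (h < k)%R by rewrite lt_neqAle hn.
rewrite /quot; have := C0 (ltW (ltr_wpDl u0 k0)); case Ek : (C (u + k)) => [ck| |]// _; last first.
  by rewrite addye ?gt0_muley ?leey// ?lte_fin ?invr_gt0// -(fineK fu).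
have uk1 : (u < u + h)%R by lra.
have uk2 : (u + h < u + k)%R by lra.
have fh : C (u + h) \is a fin_num.
  rewrite ge0_fin_numE ?C0//; last lra.
  have d1 : (0 <= (k - h) / k <= 1)%R by rewrite divr_ge0/= ?ler_pdivrMr//; lra.
  have uk0 : (0 <= u + k)%R by lra.
  have := cC.2 u (u + k)%R _ u0 uk0 d1.
  have -> : ((k - h) / k * u + (1 - (k - h) / k) * (u + k) = u + h)%R by field; rewrite lt0r_neq0.
  move=> /le_lt_trans; apply; rewrite Ek -(fineK fu) -!EFinM -EFinD; exact: ltry.
have := three_points u0 uk1 uk2 fh.
rewrite Ek -(fineK fu) -(fineK fh); set ch := fine _; set cu := fine _.
rewrite -!EFinB -!EFinM -!EFinD !lee_fin => h1.
rewrite [leLHS]mulrC [leRHS]mulrC ler_pdivrMr// mulrAC ler_pdivlMr//; nra.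
Qed.

Let quot_lim u : (0 <= u)%R -> C u \is a fin_num ->
  lim (quot u h @[h --> 0^'+]) = ereal_inf (quot u @` `]0%R, +oo[%classic).
Proof.
move=> u0 fu; apply/cvg_lim => //.
apply: (@nondecreasing_at_right_cvge _ _ _ +oo%O) => // h k; rewrite !in_itv/= !andbT => h0 k0 hk.
exact: quot_mono.
Qed.

Lemma cost_derive_le u h : (0 <= u)%R -> C u \is a fin_num -> (0 < h)%R ->
  cost_derive C u <= (h^-1)%:E * (C (u + h)%R - C u).
Proof.
move=> u0 fu h0; rewrite /cost_derive fu quot_lim//.
by apply: ereal_inf_lbound; exists h => //=; rewrite in_itv/= h0.
Qed.

Lemma cost_derive_ge v u : (0 <= v)%R -> (v < u)%R -> C u \is a fin_num -> C v \is a fin_num ->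
  ((fine (C u) - fine (C v)) / (u - v))%:E <= cost_derive C u.
Proof.
move=> v0 vu fu fv; have u0 : (0 <= u)%R by lra.
rewrite /cost_derive fu quot_lim//; apply: le_ereal_inf_tmp => _ [h /= + <-].
rewrite in_itv/= andbT => h0; rewrite /quot.
have := C0 (addr_ge0 u0 (ltW h0)); case Eh : (C (u + h)) => [ch| |]// _; last first.
  by rewrite addye ?gt0_muley ?leey// ?lte_fin ?invr_gt0// -(fineK fu).
have uh : (u < u + h)%R by lra.
have := three_points v0 vu uh fu.
rewrite Eh -(fineK fu) -(fineK fv); set cv := fine (C v); set cu := fine (C u).
rewrite -!EFinB -!EFinM -!EFinD !lee_fin => h1 /=.
have d0 : (0 < u - v)%R by lra.
rewrite [leRHS]mulrC ler_pdivrMr// mulrAC ler_pdivlMr//; nra.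
Qed.

End cost_growth.

Section cost_growth_bounds.
Context (R : realType) (C : R -> \bar R).
Hypothesis cC : convex_cost C.
Hypothesis C1 : C 1 = 0%E.
Local Open Scope ereal_scope.

Let C0 u : (0 <= u)%R -> 0 <= C u. Proof. by case: cC => + _; apply. Qed.

(** The bound is half of [(2 * u) ^ (- p)], written as an exponential. The derivative at [2 * u] is
    at most [- (2 * u) ^ (- (p + 1))], and by convexity the slope of the chord from [u] to [2 * u]
    is no larger. *)
Lemma cost_near0 (p : R) : (0 < p)%R ->
  (fun u : R => (u `^ (p + 1))%:E * cost_derive C u) @ 0^'+ --> -oo ->
  exists2 u1 : R, (0 < u1 <= 1)%R &
    forall u, (0 < u < u1)%R -> (2^-1 * expR (- p * ln (2 * u)))%:E <= C u.
Proof.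
move=> p0 /cvgeNyPle/(_ (-1)%R)[dl /= dl0 hd].
exists (Num.min dl 1 / 2)%R.
  by rewrite divr_gt0 ?lt_min ?dl0//= ler_pdivrMr// mul1r ge_min; apply/orP; right; lra.
move=> u /andP[u0 uu1].
have u2 : (0 < 2 * u)%R by rewrite mulr_gt0.
have : (2 * u < Num.min dl 1)%R by move: uu1; rewrite ltr_pdivlMr// mulrC.
rewrite lt_min => /andP[ud u12].
have := C0 (ltW u0); case Eu : (C u) => [c| |]// c0; last by rewrite leey.
have fu : C u \is a fin_num by rewrite Eu.
have f2u : C (2 * u) \is a fin_num.
  by apply: (cost_finite cC C1 (u := u)) => //; apply/andP; split; lra.
have h1 : ((2 * u) `^ (p + 1))%:E * cost_derive C (2 * u) <= (-1)%:E.
  by apply: hd => //=; rewrite sub0r normrN gtr0_norm.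
have u2u : (u < 2 * u)%R by lra.
have h2 := cost_derive_ge cC (ltW u0) u2u f2u fu.
have pw : (0 < (2 * u) `^ (p + 1))%R by rewrite powR_gt0.
have := le_trans (lee_wpmul2l (ltW (pw : (0%:E < _%:E))) h2) h1.
rewrite -EFinM !lee_fin Eu /= => h3.
have C2 : (0 <= fine (C (2 * u)))%R by rewrite fine_ge0// C0// ltW.
have -> : expR (- p * ln (2 * u)) = (2 * u / (2 * u) `^ (p + 1))%R.
  rewrite powRD; last by apply/implyP => _; rewrite gt_eqF.
  rewrite powRr1 ?ltW// /powR gt_eqF// mulNr expRN.
  by field; rewrite !lt0r_neq0// expR_gt0.
have d0 : (0 < 2 * u - u)%R by lra.
have h4 : ((2 * u) `^ (p + 1) * ((2 * u - u)^-1 * (c - fine (C (2 * u)))) >= 1)%R.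
  by move: h3; rewrite [((_ - c) / _)%R]mulrC; lra.
have h5 : (u <= (2 * u) `^ (p + 1) * (c - fine (C (2 * u))))%R.
  have := ler_wpM2r (ltW u0) h4; rewrite mul1r => /le_trans; apply.
  by rewrite le_eqVlt; apply/orP; left; apply/eqP; field; rewrite lt0r_neq0//; lra.
have h6 : (u / (2 * u) `^ (p + 1) <= c - fine (C (2 * u)))%R.
  by rewrite ler_pdivrMr// mulrC.
have -> : (2^-1 * (2 * u / (2 * u) `^ (p + 1)) = u / (2 * u) `^ (p + 1))%R.
  by field; rewrite lt0r_neq0.
lra.
Qed.

(** By convexity [C (2 * u) - C u >= u * C' u >= u - eps * ln 2] for large [u]. Each doubling loses
    [eps * ln 2], in total [eps] times the logarithm of the ratio; the constant [2 * u2] makes the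
    bound trivial on the first doubling. *)
Lemma cost_nearoo (eps : R) : (0 < eps)%R ->
  0 <= limf_einf (fun u : R => u%:E * cost_derive C u - u%:E) (+oo%R : set_system R) ->
  exists2 u2 : R, (1 <= u2)%R &
    forall u, (u2 < u)%R -> (u - 2 * u2 - eps * (ln u - ln u2))%:E <= C u.
Proof.
move=> e0; rewrite limf_einfE => hs.
have eN : ((- (eps * ln 2))%:E < ereal_sup [set ereal_inf ((fun u : R => u%:E * cost_derive C u - u%:E) @` V)
    | V in (+oo%R : set_system R)]).
  apply: lt_le_trans hs; rewrite lte_fin oppr_lt0 mulr_gt0// ln_gt0//; lra.
have [_ [V [M [_ hM]] <-] hV] := ereal_sup_gt eN.
pose u2 : R := Num.max M 1%R.
have u21 : (1 <= u2)%R by rewrite le_max lexx orbT.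
exists u2 => // .
have hd u : (u2 < u)%R -> (- (eps * ln 2))%:E <= u%:E * cost_derive C u - u%:E.
  move=> uu; apply: le_trans (ltW hV) _; apply: ereal_inf_lbound; exists u => //.
  by apply: hM; apply: le_lt_trans uu; rewrite le_max lexx.
have ln20 : (0 < ln 2 :> R)%R by rewrite ln_gt0//; lra.
have step u : (u2 < u)%R -> C (2 * u) \is a fin_num -> C u + (u - eps * ln 2)%:E <= C (2 * u).
  move=> uu f2; have u0 : (0 < u)%R by lra.
  have fu : C u \is a fin_num.
    have uu1 : (0 <= 2 * u)%R by lra.
    have d0 : (0 < 2 * u - 1)%R by lra.
    have d1 : (0 <= u / (2 * u - 1) <= 1)%R by rewrite divr_ge0 ?ler_pdivrMr//; lra.
    have := cC.2 1%R (2 * u)%R _ ler01 uu1 d1.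
    have -> : (u / (2 * u - 1) * 1 + (1 - u / (2 * u - 1)) * (2 * u) = u)%R.
      by field; rewrite lt0r_neq0.
    rewrite C1 mule0 add0e -(fineK f2) -EFinM => h.
    by rewrite ge0_fin_numE ?C0 ?ltW//; apply: le_lt_trans h (ltry _).
  have := cost_derive_le cC (ltW u0) fu u0; have := hd u uu.
  rewrite (_ : u + u = 2 * u)%R; last by ring.
  rewrite -(fineK f2) -(fineK fu) -EFinB -EFinM; case: (cost_derive C u) => [c| |]//.
    rewrite -EFinM -EFinB !lee_fin => h1 h2.
    have := ler_wpM2l (ltW u0) h2; rewrite mulrA divff ?lt0r_neq0// mul1r; lra.
  by rewrite gt0_muleNy ?lte_fin.
have ind (k : nat) : forall u, (u2 < u <= 2 ^+ k * (2 * u2))%R ->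
    (u - 2 * u2 - eps * (ln u - ln u2))%:E <= C u.
  have base u : (u2 < u <= 2 * u2)%R -> (u - 2 * u2 - eps * (ln u - ln u2))%:E <= C u.
    move=> /andP[h1 h2]; have u0 : (0 <= u)%R by lra.
    apply: le_trans (C0 u0); rewrite lee_fin.
    have : (0 <= eps * (ln u - ln u2))%R by rewrite mulr_ge0 ?ltW// subr_gt0 ltr_ln ?posrE//; lra.
    lra.
  elim: k => [|k ih] u; first by rewrite expr0 mul1r; exact: base.
  move=> /andP[h1 h2]; have [h3|h3] := leP u (2 * u2)%R; first by apply: base; rewrite h1.
  have u0 : (0 <= u)%R by lra.
  have := C0 u0; case Eu : (C u) => [c| |]// c0; last by rewrite leey.
  have h4 : (u2 < u / 2)%R by rewrite ltr_pdivlMr// mulrC.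
  have h5 : (u / 2 <= 2 ^+ k * (2 * u2))%R by rewrite ler_pdivrMr//; move: h2; rewrite exprS; lra.
  have := ih (u / 2)%R; rewrite h4 h5 => /(_ isT) h6.
  have := step _ h4; have -> : (2 * (u / 2) = u)%R by field.
  rewrite Eu => /(_ isT) h7; apply: le_trans h7.
  have -> : ln u = (ln (u / 2) + ln 2)%R.
    by rewrite -lnM ?posrE//; [congr ln; field|lra].
  apply: le_trans (leeD2r _ h6); rewrite -EFinD lee_fin; lra.
move=> u uu; have u20 : (0 < 2 * u2)%R by lra.
apply: (ind (Num.truncn (u / (2 * u2))).+1); rewrite uu/= -ler_pdivrMr//.
by apply/ltW/(lt_trans (truncnS_gt _)); rewrite -natrX ltr_nat ltn_expl.
Qed.

End cost_growth_bounds.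

Section cost_upper_bound.
Context (R : realType) (g : R) (C : R -> \bar R).
Hypothesis g0 : 0 < g.
Hypothesis cC : convex_cost C.
Hypothesis C1 : C 1 = 0%E.
Hypothesis B1 : exists2 p : R, 0 < p &
  (fun u : R => ((u `^ (p + 1))%:E * cost_derive C u)%E) @ 0^'+ --> -oo%E.
Hypothesis B2 : (0 <= limf_einf (fun u : R => u%:E * cost_derive C u - u%:E)
  (+oo%R : set_system R))%E.

Local Ltac glra := clear - g0 cC C1 B1 B2; intros; lra.

(** The supremum is split by the size of [u / g]: for small values the blow-up of [C] beats
    [- q * ln u], for large ones [g * C] cancels the term [u] up to a logarithm. Here [q * ln q] is
    bounded by a multiple of [q * sqrt q]; with this power [x * F (w / x)] is of order [1 / sqrt x],
    integrable along a segment leaving the boundary. *)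
Lemma transformed_cost_le (c : R) : 0 < c -> exists2 A : R, 0 <= A &
  forall q, c <= q -> (transformed_cost g C q <= (A * (1 + q * Num.sqrt q))%:E)%E.
Proof.
move=> c0; have [p p0 /(cost_near0 cC C1 p0)[u1 /andP[u10 u11] h1]] := B1.
(* With this loss the logarithm given up by [g * C] is [c * ln u] up to constants, which
   [- q * ln u] compensates for [q >= c]. *)
have eps0 : 0 < c / g by rewrite divr_gt0.
have [u2 u21 h2] := cost_nearoo cC C1 eps0 B2.
pose Y1 : R := `|ln (g / 2)|; pose Y2 : R := `|ln (p * g / 2)| / p.
pose Y3 : R := `|ln (g * u1)|; pose Y4 : R := `|ln g|; pose Y5 : R := g * u2.
pose D : R := Y1 + Y2 + Y3 + Y4 + 2 * Y5 + g.
have gp := g0.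
have p1 : 0 <= p^-1 by rewrite invr_ge0 ltW.
have nn : [/\ 0 <= Y1, 0 <= Y2, 0 <= Y3, 0 <= Y4 & 0 <= Y5].
  by split; [exact: normr_ge0|exact: mulr_ge0|exact: normr_ge0|exact: normr_ge0|exact: (mulr_ge0 (ltW g0) (le_trans ler01 u21))].
have [n1 n2 n3 n4 n5] := nn.
have [d1 d2 d3 d4 [d5 d6]] : [/\ Y1 + Y2 <= D, Y3 <= D, Y4 <= D, g <= D & Y5 <= D /\ 2 * Y5 <= D].
  by rewrite /D; split; last split; lra.
exists (2 + 2 / p + 2 * D).
  have : 0 <= 2 / p by rewrite divr_ge0 ?ltW.
  by rewrite /D; lra.
move=> q cq; have q0 : 0 < q by lra.
have sq0 : 0 < Num.sqrt q by rewrite sqrtr_gt0.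
have sq2 : Num.sqrt q * Num.sqrt q = q by rewrite -expr2 sqr_sqrtr// ltW.
set s := Num.sqrt q in sq0 sq2 *.
have lnq : ln q <= 2 * s.
  by rewrite -sq2 lnM ?posrE//; have := ln_sublinear sq0; lra.
have qs0 : 0 < q * s by rewrite mulr_gt0.
have q1 : q <= 1 + q * s by nra.
have qlnq : q * ln q <= 2 * (q * s) by have := ler_wpM2l (ltW q0) lnq; lra.
have D0 : 0 <= D by rewrite /D; lra.
have Dq : D * q <= D * (1 + q * s) by rewrite ler_wpM2l.
have D1 : D <= D * (1 + q * s) by rewrite ler_peMr//; lra.
have pq : q * ln q / p <= (2 / p) * (q * s).
  by rewrite mulrAC [2 / p * _]mulrAC; rewrite -!mulrA [_ * p^-1]mulrC ![_^-1 * _]mulrC !mulrA ler_wpM2r//; lra.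
have ps : 0 <= (2 / p) * (q * s) by apply: mulr_ge0; [apply: mulr_ge0|exact: ltW].
suff main : (transformed_cost g C q <= (q * ln q + Num.max 0 (q * ln q / p) + D * q + D)%:E)%E.
  apply: (le_trans main); rewrite lee_fin.
  have : Num.max 0 (q * ln q / p) <= 2 / p * (q * s) by rewrite ge_max ps.
  have : 0 <= 2 / p by rewrite divr_ge0 ?ltW.
  lra.
apply: ge_ereal_sup => _ [u /= u0 <-].
have ug : 0 < u / g by rewrite divr_gt0.
have mx0 : 0 <= Num.max 0 (q * ln q / p) by rewrite le_max lexx.
have mx1 : q * ln q / p <= Num.max 0 (q * ln q / p) by rewrite le_max lexx orbT.
have := cC.1 _ (ltW ug); case EC : (C (u / g)) => [x| |]// x0; last first.
  by rewrite gt0_muley ?lte_fin//= leNye.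
rewrite -EFinM -EFinB lee_fin; move: x0; rewrite lee_fin => x0.
have -> : u * ell (q / u) = q * ln q - q * ln u - q + u.
  by rewrite /ell ln_div ?posrE//; field; rewrite lt0r_neq0.
have bnd (a y : R) : `|a| <= y -> q * (- a) <= y * q /\ q * a <= y * q.
  have := ler_norm a; have := ler_norm (- a); rewrite normrN => a1 a2 h.
  by rewrite [y * q]mulrC; split; rewrite ler_wpM2l ?(ltW q0)//; move: a1 a2 h; glra.
have gx0 : 0 <= g * x by apply: mulr_ge0 => //; exact: ltW.
have Dn y z : 0 <= z -> D = y + z -> y * q <= D * q.
  by move=> z0 ->; rewrite mulrDl lerDl mulr_ge0// ltW.
have [uu1|uu1] := ltP (u / g) u1.
  have := h1 (u / g); rewrite ug uu1 EC lee_fin => /(_ isT) hx.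
  set y := - p * ln (2 * (u / g)) in hx.
  (* [g / 2 * expR y] has the slope [q / p] at [ln B], and [- q * ln u] is [q / p * y] up to a
     multiple of [q]; the tangent there absorbs it. *)
  pose B := (q / p) / (g / 2).
  have B0 : 0 < B by rewrite !divr_gt0.
  have hy : (q / p) * (1 + y - ln B) <= g / 2 * expR y.
    have -> : expR y = B * expR (y - ln B) by rewrite expRB lnK ?posrE//; field; rewrite lt0r_neq0.
    have -> : g / 2 * (B * expR (y - ln B)) = q / p * expR (y - ln B).
      by rewrite /B; field; rewrite !lt0r_neq0.
    by rewrite ler_wpM2l ?divr_ge0 ?(ltW q0) ?(ltW p0)// -addrA expR_ge1Dx.
  have lnBE : ln B = ln q - ln (p * g / 2).
    by rewrite -ln_div ?posrE ?divr_gt0 ?mulr_gt0//; congr ln; rewrite /B; field; rewrite !lt0r_neq0.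
  have lnuE : ln u = - y / p + ln (g / 2).
    have -> : - y / p = ln (2 * (u / g)) by rewrite /y; field; rewrite lt0r_neq0.
    have e1 : 0 < 2 * (u / g) by rewrite mulr_gt0.
    have e2 : 0 < g / 2 by rewrite divr_gt0.
    by rewrite -lnM ?posrE//; congr (ln _); field; rewrite lt0r_neq0.
  have gxe : g / 2 * expR y <= g * x by have := ler_wpM2l (ltW g0) hx; glra.
  have k1 : q / p * (1 + y - ln B) = q / p + q / p * y - q * ln q / p + q * (ln (p * g / 2) / p).
    by rewrite lnBE; field; rewrite lt0r_neq0.
  have k2 : q * ln u = - (q / p * y) + q * ln (g / 2) by rewrite lnuE; field; rewrite lt0r_neq0.
  have [k3 _] := bnd (ln (g / 2)) Y1 (lexx _).
  have hY2 : `|ln (p * g / 2) / p| <= Y2 by rewrite /Y2 normrM (ger0_norm p1).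
  have [k4 _] := bnd _ _ hY2.
  have qp0 : 0 <= q / p by apply: mulr_ge0 => //; exact: ltW.
  have ug1 : u <= g by move: uu1; rewrite ltr_pdivrMr// => /ltW/le_trans; apply; rewrite ger_pMl.
  have k5 : Y1 * q + Y2 * q <= D * q.
    by rewrite -mulrDl ler_wpM2r ?(ltW q0).
  rewrite k2; lra.
have [uu2|uu2] := leP (u / g) u2.
  have lnu : ln (g * u1) <= ln u.
    by rewrite ler_ln ?posrE ?mulr_gt0//; move: uu1; rewrite ler_pdivlMr// mulrC.
  have := ler_wpM2l (ltW q0) lnu; have [k3 _] := bnd (ln (g * u1)) Y3 (lexx _).
  have k5 : Y3 * q <= D * q by rewrite ler_wpM2r ?(ltW q0).
  have ug2 : u <= Y5 by move: uu2; rewrite ler_pdivrMr// mulrC.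
  lra.
have := h2 _ uu2; rewrite EC lee_fin => hx.
have lnE : ln (u / g) = ln u - ln g by rewrite ln_div ?posrE.
have lnu : 0 <= ln (u / g) by rewrite ln_ge0// (le_trans u21)// ltW.
have lnu2 : 0 <= ln u2 by rewrite ln_ge0.
have := ler_wpM2l (ltW g0) hx.
have -> : g * (u / g - 2 * u2 - c / g * (ln (u / g) - ln u2)) =
    u - 2 * Y5 - c * (ln (u / g) - ln u2) by rewrite /Y5; field; rewrite lt0r_neq0.
rewrite lnE in lnu * => hgx.
have k1 : c * (ln u - ln g) <= q * (ln u - ln g) by rewrite ler_wpM2r.
have k2 : 0 <= c * ln u2 by rewrite mulr_ge0// ltW.
have [k3 _] := bnd (ln g) Y4 (lexx _).
have k5 : Y4 * q <= D * q by rewrite ler_wpM2r ?(ltW q0).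
lra.
Qed.

End cost_upper_bound.

(** * Measurability and integrals on the line *)

Section eps_delta.
Context (R : realType).

Lemma measurable_fun_eps_delta (f : R -> R) :
  (forall t, 0 <= t -> forall e, 0 < e -> exists2 dl, 0 < dl &
     forall s, 0 <= s -> `|s - t| < dl -> `|f s - f t| < e) ->
  measurable_fun (halfline R) f.
Proof.
move=> h; apply: (@subspace_continuous_measurable_fun _ `[0, +oo[%classic f) => //.
apply/subspace_continuousP => t; rewrite /= in_itv/= andbT => t0.
apply/cvgrPdist_lt => e e0; have [dl dl0 hd] := h t t0 e e0.
near=> s; rewrite distrC; apply: hd.
  have : `[0, +oo[%classic s by near: s; exact: withinT.
  by rewrite /= in_itv/= andbT.
near: s; apply: (@cvg_within _ (nbhs t)); exists dl => // s /=.
by rewrite distrC.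
Unshelve. all: by end_near. Qed.

Lemma lebesgue_measure_shift (t : R) (A : set (mR R)) : measurable A ->
  leb [set s : mR R | A (t + s)] = leb A.
Proof.
move=> mA; pose phi (s : mR R) : mR R := t + s.
have mphi : measurable_fun setT phi by apply: measurable_funD.
have -> : [set s : mR R | A (t + s)] = phi @^-1` A by [].
suff h : forall B, ocitv B -> leb B = pushforward leb phi B.
  exact/esym/(lebesgue_measure_unique h).
move=> _ [[a b] /= _ <-]; rewrite /pushforward.
rewrite (_ : phi @^-1` _ = `](a - t), (b - t)]%classic).
  rewrite !lebesgue_measure_itv/= !lte_fin ltrD2r; case: ifPn => // _.
  by rewrite -!EFinB; congr _%:E; ring.
by apply/seteqP; split => s; rewrite /phi /= !in_itv/= ltrBlDl lerBrDl.
Qed.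

Lemma ge0_integral_shift (t : R) (D : set (mR R)) (f : R -> \bar R) :
  measurable D -> measurable_fun D f -> (forall s, D s -> 0 <= f s)%E ->
  (\int[leb]_(s in D) f s =
   \int[leb]_(s in [set s | D (t + s)%R]) f (t + s)%R)%E.
Proof.
move=> mD mf f0; pose phi (s : mR R) : mR R := t + s.
have mphi : measurable_fun setT phi by apply: measurable_funD.
transitivity (\int[pushforward leb phi]_(s in D) f s)%E.
  apply: eq_measure_integral => A mA _; rewrite /pushforward.
  by rewrite -[RHS]/(leb [set s : mR R | A (t + s)]) lebesgue_measure_shift.
rewrite ge0_integral_pushforward// => s; rewrite inE; exact: f0.
Qed.

(** The fundamental theorem on compact subintervals, then monotone convergence: [g] may be singular
    at both ends. *)
Lemma integral_derivative_le (G g : R -> R) (lam c0 c1 : R) : 0 < lam ->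
  (forall x, 0 < x < lam -> is_derive x 1 G (g x)) ->
  (forall x, 0 < x < lam -> {for x, continuous g}) ->
  (forall x, 0 < x < lam -> 0 <= g x) ->
  (forall x, 0 < x < lam -> c0 <= G x <= c1) ->
  measurable_fun `]0, lam[ g /\
  (\int[leb]_(s in `]0%R, lam[) (g s)%:E <= (c1 - c0)%:E)%E.
Proof.
move=> l0 dG cg g0 Gb.
(* The shift by 3 keeps [a k] below [lam - a k]. *)
pose a k : R := lam / k.+3%:R.
pose D k : set (mR R) := `[a k, lam - a k]%classic.
have a0 k : 0 < a k by rewrite divr_gt0.
have a2 k : a k < lam - a k.
  rewrite ltrBrDl -[X in X < _]mulr1 -mulrDl -mulrA (_ : (lam + lam) * _ = lam * (2 / k.+3%:R)); last by field.
  by rewrite -[ltRHS]mulr1 ltr_pM2l// ltr_pdivrMr// mul1r ltr_nat.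
have Dlam k x : D k x -> 0 < x < lam.
  rewrite /D /= in_itv/= => /andP[h1 h2]; rewrite (lt_le_trans (a0 k) h1)/=.
  by rewrite (le_lt_trans h2)// gtrBl.
have UD : `]0, lam[%classic = \bigcup_k D k.
  apply/seteqP; split => x; last first.
    by move=> [k _ /Dlam]; rewrite /= in_itv.
  rewrite /= in_itv/= => /andP[x0 xl].
  pose y := Num.min x (lam - x).
  have y0 : 0 < y by rewrite lt_min x0 subr_gt0.
  exists (Num.truncn (lam / y)).+1 => //.
  have ay : a (Num.truncn (lam / y)).+1 <= y.
    rewrite /a ler_pdivrMr// mulrC -ler_pdivrMr// ltW//.
    apply: (lt_le_trans (truncnS_gt (lam / y))); rewrite ler_nat.
    exact: (leq_trans (leqnSn _) (leq_trans (leqnSn _) (leqnSn _))).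
  move: ay; rewrite le_min => /andP[h1 h2]; rewrite /D /= in_itv/= h1 /=; lra.
have mg : measurable_fun `]0, lam[ g.
  apply: open_continuous_measurable_fun => //.
  by move=> x; rewrite inE/= in_itv/=; exact: cg.
have mgD k : measurable_fun (D k) g.
  apply: measurable_funS mg => // x /Dlam; by rewrite /= in_itv.
split => //; rewrite UD.
have nd : nondecreasing_seq D.
  apply/nondecreasing_seqP => k; apply/subsetPset => x; rewrite /D /= !in_itv/=.
  have : a k.+1 <= a k by rewrite /a ler_pM2l// lef_pV2 ?posrE// ler_nat.
  by move=> h /andP[h1 h2]; apply/andP; split; lra.
have cv : (\int[leb]_(s in D k) (g s)%:E @[k --> \oo] -->
    \int[leb]_(s in \bigcup_k D k) (g s)%:E)%E.
  apply: ge0_nondecreasing_set_cvg_integral => //.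
  - by move=> k; exact: measurable_itv.
  - by move=> k; apply/measurable_EFinP; exact: mgD.
  - by move=> k s /Dlam/g0; rewrite lee_fin.
rewrite -(cvg_lim _ cv)//; apply: lime_le; first by apply/cvg_ex; eexists; exact: cv.
apply: nearW => k.
have cG x : 0 < x < lam -> {for x, continuous G}.
  move=> /dG d; apply: differentiable_continuous; apply/derivable1_diffP; by case: d.
have ak : 0 < a k < lam by rewrite a0 /=; have := a2 k; have := a0 k; lra.
have bk : 0 < lam - a k < lam by apply/andP; split; have := a2 k; have := a0 k; lra.
rewrite (@continuous_FTC2 _ g G)//.
- rewrite -EFinB lee_fin; have /andP[h1 h2] := Gb _ ak; have /andP[h3 h4] := Gb _ bk; lra.
- apply: continuous_in_subspaceT => x; rewrite inE => /Dlam; exact: cg.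
- split.
  + move=> x; rewrite in_itv/= => /andP[h1 h2]; have : 0 < x < lam.
      by apply/andP; split; have := a2 k; have := a0 k; lra.
    by move=> /dG[].
  + by apply: cvg_at_right_filter; exact: cG.
  + by apply: cvg_at_left_filter; exact: cG.
- move=> x; rewrite in_itv/= => /andP[h1 h2]; have : 0 < x < lam.
    by apply/andP; split; have := a2 k; have := a0 k; lra.
  by move=> /dG d; rewrite derive1E derive_val.
Qed.

Lemma integral_invsqrt_le (lam : R) : 0 < lam ->
  let g s := (Num.sqrt s)^-1 + (Num.sqrt (lam - s))^-1 in
  measurable_fun `]0, lam[ g /\
  (\int[leb]_(s in `]0%R, lam[) (g s)%:E <= (4 * Num.sqrt lam)%:E)%E.
Proof.
move=> l0 g; pose G s := 2 * Num.sqrt s - 2 * Num.sqrt (lam - s).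
have -> : 4 * Num.sqrt lam = 2 * Num.sqrt lam - (- 2 * Num.sqrt lam) by ring.
apply: (@integral_derivative_le G) => // x /andP[x0 xl].
- have lx : 0 < lam - x by rewrite subr_gt0.
  have dl : is_derive x (1 : R) (fun s : R => lam - s) (0 - 1) by exact: is_deriveB.
  have d1 := is_derive1_sqrt x0.
  have d2 := @is_derive1_comp _ Num.sqrt (fun s : R => lam - s) x _ _ (is_derive1_sqrt lx) dl.
  have d3 : is_derive x (1 : R) G (2 *: (2 * Num.sqrt x)^-1 - 2 *: ((2 * Num.sqrt (lam - x))^-1 * (0 - 1))).
    have e1 : is_derive x (1 : R) (fun s : R => 2 * Num.sqrt s) (2 *: (2 * Num.sqrt x)^-1).
      exact: is_deriveZ.
    have e2 : is_derive x (1 : R) (fun s : R => 2 * Num.sqrt (lam - s))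
        (2 *: ((2 * Num.sqrt (lam - x))^-1 * (0 - 1))).
      exact: is_deriveZ.
    exact: is_deriveB.
  apply: is_derive_eq d3 _.
  have s1 : Num.sqrt x != 0 by rewrite gt_eqF// sqrtr_gt0.
  have s2 : Num.sqrt (lam - x) != 0 by rewrite gt_eqF// sqrtr_gt0.
  rewrite /g /GRing.scale/=; field; by rewrite s1 s2.
- apply: cvgD; apply: cvgV; rewrite ?gt_eqF ?sqrtr_gt0 ?subr_gt0//.
    exact: sqrt_continuous.
  apply: (@continuous_comp _ _ _ (fun s : R => lam - s) Num.sqrt).
    by apply: cvgB => //; exact: cvg_cst.
  exact: sqrt_continuous.
- by rewrite addr_ge0// invr_ge0 sqrtr_ge0.
- have s1 : Num.sqrt x <= Num.sqrt lam by rewrite ler_wsqrtr// ltW.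
  have s2 : Num.sqrt (lam - x) <= Num.sqrt lam by rewrite ler_wsqrtr//; lra.
  have := sqrtr_ge0 x; have := sqrtr_ge0 (lam - x); rewrite /G => h1 h2.
  by apply/andP; split; lra.
Qed.

End eps_delta.

(** * Costs and flows up to a time; shifting and concatenation *)

Section horizon.
Context (R : realType).
Implicit Types (t u : R) (T : \bar R).

Definition horizon T : set (mR R) := [set t : R | 0 <= t /\ (t%:E < T)%E].

Lemma horizon_fin t : horizon t%:E = `[0, t[%classic.
Proof. by apply/seteqP; split => s; rewrite /horizon /= in_itv/= lte_fin => /andP. Qed.

Lemma horizon_sub T : horizon T `<=` `[0, +oo[%classic.
Proof. by move=> s [s0 _]; rewrite /= in_itv/= s0. Qed.

Lemma measurable_horizon T : measurable (horizon T).
Proof.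
case: T => [t| |].
- by rewrite horizon_fin; exact: measurable_itv.
- rewrite (_ : horizon _ = `[0, +oo[%classic); first exact: measurable_itv.
  by apply/seteqP; split => s; rewrite /horizon /= in_itv/= andbT ?ltry // => -[].
- rewrite (_ : horizon _ = set0) //.
  by apply/seteqP; split => s // [_]; rewrite ltNge leNye.
Qed.

Lemma horizonS T T' : (T <= T')%E -> horizon T `<=` horizon T'.
Proof. by move=> TT s [s0 sT]; split => //; exact: lt_le_trans TT. Qed.

Lemma horizon_shift t T : 0 <= t ->
  [set s | 0 <= s /\ horizon (t%:E + T)%E (t + s)] = horizon T.
Proof.
move=> t0; apply/seteqP; split => s.
  by move=> [s0 [_]]; rewrite EFinD lteD2lE// => sT; split.
by move=> [s0 sT]; split => //; split; [exact: addr_ge0|rewrite EFinD lteD2lE].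
Qed.

Lemma measurable_shift dd (T' : measurableType dd) (phi : R -> T') t : 0 <= t ->
  measurable_fun (halfline R) phi ->
  measurable_fun (halfline R) (fun s => phi (t + s)).
Proof.
move=> t0 mphi.
apply: (@measurable_comp _ _ _ (mR R) (mR R) T' `[0, +oo[%classic phi
  `[0, +oo[%classic (fun s : mR R => (t + s : mR R))) => //.
  by move=> _ /= [s +  <-]; rewrite /= !in_itv/= !andbT => s0; exact: addr_ge0.
exact: measurable_funD.
Qed.

Lemma ge0_integral_horizon (phi : R -> \bar R) t T : 0 <= t -> (0 <= T)%E ->
  measurable_fun (halfline R) phi ->
  (forall s, 0 <= s -> (0 <= phi s)%E) ->
  (\int[leb]_(s in horizon (t%:E + T)) phi s =
   \int[leb]_(s in horizon t%:E) phi s +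
   \int[leb]_(s in horizon T) phi (t + s)%R)%E.
Proof.
move=> t0 T0 mphi phi0.
pose D := horizon (t%:E + T)%E `&` `[t, +oo[%classic.
have mD : measurable D by apply: measurableI; [exact: measurable_horizon|exact: measurable_itv].
have DE : horizon (t%:E + T)%E = horizon t%:E `|` D.
  apply/seteqP; split => s.
    move=> [s0 sT]; have [st|ts] := ltP s t; first by left; split => //; rewrite lte_fin.
    by right; split; [split|rewrite /= in_itv/= ts].
  case=> [[s0]|[//]]; rewrite lte_fin => st; split => //.
  by apply: lt_le_trans (leeDl _ T0); rewrite lte_fin.
rewrite DE ge0_integral_setU//.
- congr (_ + _)%E; rewrite (@ge0_integral_shift _ t D)//.
  + congr (integral _ _ _); apply/seteqP; split => s.
      rewrite /D /= in_itv/= andbT => -[h ts].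
      have s0 : 0 <= s by move: ts; rewrite lerDl.
      by rewrite -(horizon_shift T t0).
    by rewrite -(horizon_shift T t0) /D /= in_itv/= andbT => -[s0 h]; split => //; rewrite lerDl.
  + by apply: measurable_funS mphi => // s [/horizon_sub].
  + by move=> s [[s0 _] _]; exact: phi0.
- exact: measurable_horizon.
- apply: measurable_funS mphi => // s [/horizon_sub //|[/horizon_sub//]].
- by move=> s [[s0 _]|[[s0 _] _]]; exact: phi0.
- apply/disj_setPS => s [[_]]; rewrite lte_fin => st [_]; rewrite /= in_itv/= andbT.
  by rewrite leNgt st.
Qed.

Lemma integral_horizonS (phi : R -> \bar R) T T' : (T <= T')%E ->
  measurable_fun (halfline R) phi ->
  (forall s, 0 <= s -> (0 <= phi s)%E) ->
  (\int[leb]_(s in horizon T) phi s <=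
   \int[leb]_(s in horizon T') phi s)%E.
Proof.
move=> TT mphi phi0; apply: ge0_subset_integral; try exact: measurable_horizon.
- by apply: measurable_funS mphi => //; exact: horizon_sub.
- by move=> s [s0 _]; exact: phi0.
- exact: horizonS.
Qed.

Lemma integral_horizon_ge0 (phi : R -> \bar R) T : (forall s, 0 <= s -> (0 <= phi s)%E) ->
  (0 <= \int[leb]_(s in horizon T) phi s)%E.
Proof. by move=> phi0; apply: integral_ge0 => s [s0 _]; exact: phi0. Qed.

End horizon.

Local Notation "'\Int_' ( s < t ) F" := (\int[leb]_(s in horizon t%:E) F)%E
  (at level 36, F at level 36, s, t at level 50) : ereal_scope.

Section flux.
Context (R : realType).
Implicit Types (f g : R -> R) (t u : R).

Definition rate f := [/\ measurable_fun (halfline R) f,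
  forall s, 0 <= s -> 0 <= f s &
  forall t, 0 <= t -> (\Int_(s < t) (f s)%:E < +oo)%E].

Definition flow f t : R := \int[leb]_(s in `[0, t[) f s.

Lemma rate_measurable f : rate f ->
  measurable_fun (halfline R) (EFin \o f).
Proof. by move=> [mf _ _]; apply/measurable_EFinP. Qed.

Lemma flowE f t : rate f -> 0 <= t ->
  (\Int_(s < t) (f s)%:E = (flow f t)%:E)%E.
Proof.
move=> [mf f0 fi] t0; rewrite /flow /Rintegral -horizon_fin fineK//.
rewrite ge0_fin_numE ?fi//; apply: integral_horizon_ge0 => s s0; by rewrite lee_fin f0.
Qed.

Lemma rate_integrable f t : rate f -> 0 <= t ->
  leb.-integrable `[0, t] (EFin \o f).
Proof.
move=> rf t0; have [mf f0 fi] := rf; apply/integrableP; split.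
  apply/measurable_EFinP; apply: measurable_funS mf => // s; rewrite /= !in_itv/=.
  by case/andP=> ->.
apply: (@le_lt_trans _ _ (\int[leb]_(s in horizon (t + 1)%:E) (f s)%:E)%E);
  last by apply: fi; rewrite addr_ge0.
have -> : (\int[leb]_(s in `[0%R, t]) `|(EFin \o f) s| =
    \int[leb]_(s in `[0%R, t]) (f s)%:E)%E.
  by apply: eq_integral => s; rewrite inE/= in_itv/= => /andP[s0 _]; rewrite ger0_norm// f0.
apply: ge0_subset_integral => //.
- exact: measurable_horizon.
- by apply: measurable_funS (rate_measurable rf) => //; exact: horizon_sub.
- by move=> s [s0 _]; rewrite lee_fin f0.
- move=> s; rewrite /horizon/= in_itv/= => /andP[s0 st]; split => //.
  by rewrite lte_fin; apply: le_lt_trans st _; rewrite ltrDl.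
Qed.

Lemma integrable_rate f :
  measurable_fun (halfline R) f ->
  (forall s, 0 <= s -> 0 <= f s) ->
  (forall t, 0 <= t -> leb.-integrable `[0, t] (EFin \o f)) -> rate f.
Proof.
move=> mf f0 fi; split => // t t0; have /integrableP[m1 l1] := fi t t0.
apply: le_lt_trans l1.
have -> : (\int[leb]_(s in `[0%R, t]) `|(EFin \o f) s| =
    \int[leb]_(s in `[0%R, t]) (f s)%:E)%E.
  by apply: eq_integral => s; rewrite inE/= in_itv/= => /andP[s0 _]; rewrite ger0_norm// f0.
apply: ge0_subset_integral => //.
- exact: measurable_horizon.
- by move=> s; rewrite /= in_itv/= => /andP[s0 _]; rewrite lee_fin f0.
- by rewrite horizon_fin => s; rewrite /= !in_itv/= => /andP[-> /ltW].
Qed.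

Lemma flow_ge0 f t : rate f -> 0 <= t -> 0 <= flow f t.
Proof.
move=> rf t0; rewrite -lee_fin -flowE//; have [_ f0 _] := rf.
by apply: integral_horizon_ge0 => s s0; rewrite lee_fin f0.
Qed.

Lemma rate_shift f t : rate f -> 0 <= t -> rate (fun s => f (t + s)).
Proof.
move=> rf t0; have [mf f0 fi] := rf; split.
- exact: measurable_shift.
- by move=> s s0; rewrite f0// addr_ge0.
- move=> u u0; have := fi _ (addr_ge0 t0 u0).
  rewrite EFinD (@ge0_integral_horizon _ (EFin \o f))//.
  + by apply: le_lt_trans; rewrite leeDr// (flowE rf)// lee_fin flow_ge0.
  + exact: rate_measurable.
Qed.

Lemma flowD f t u : rate f -> 0 <= t -> 0 <= u ->
  flow f (t + u) = flow f t + flow (fun s => f (t + s)) u.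
Proof.
move=> rf t0 u0; apply: EFin_inj; rewrite EFinD -!flowE//; first last.
- exact: addr_ge0.
- exact: rate_shift.
rewrite EFinD (@ge0_integral_horizon _ (EFin \o f))//.
- exact: rate_measurable.
- by have [_ f0 _] := rf => s s0; rewrite lee_fin f0.
Qed.

Lemma flow_cvg f t : rate f -> 0 <= t ->
  flow f s @[s --> within `[0, +oo[%classic (nbhs t)] --> flow f t.
Proof.
move=> rf t0; have t1 : 0 <= t + 1 by exact: addr_ge0.
have := @parameterized_integral_continuous _ 0 (t + 1) f t1 (rate_integrable rf t1).
move=> /subspace_continuousP/(_ t); rewrite /= in_itv/= t0/= lerDl ler01 => /(_ isT).
have E s : 0 <= s -> parameterized_integral leb 0 s f = flow f s.
  move=> s0; rewrite /parameterized_integral /flow [RHS]Rintegral_itv_bndo_bndc//.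
  apply: integrableS (rate_integrable rf s0) => //.
  by move=> x /=; rewrite !in_itv/= => /andP[-> /ltW].
rewrite /from_subspace E// => h.
have h1 : \forall s \near t, s < t + 1 by apply: lt_nbhsl; rewrite ltrDl.
move: h => /cvgrPdist_lt h; apply/cvgrPdist_lt => e e0; have {h} := h e e0.
rewrite !near_withinE; move: h1; apply: filterS2 => s s1 + s0.
move: s0; rewrite /= !in_itv/= andbT => s0; rewrite s0 (ltW s1) => /(_ isT).
by rewrite E.
Qed.

End flux.

Section cat.
Context (R : realType).

Definition cat_fun (T : Type) (t : R) (f g : R -> T) (s : R) : T :=
  if s < t then f s else g (s - t).

Lemma cat_fun_shift (T : Type) t (f g : R -> T) s : 0 <= s -> cat_fun t f g (t + s) = g s.
Proof. by move=> s0; rewrite /cat_fun ltNge lerDl s0/= addrAC subrr add0r. Qed.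

Lemma cat_fun_lt (T : Type) t (f g : R -> T) s : s < t -> cat_fun t f g s = f s.
Proof. by rewrite /cat_fun => ->. Qed.

Lemma measurable_cat_fun dd (T : measurableType dd) t (f g : R -> T) : 0 <= t ->
  measurable_fun (halfline R) f ->
  measurable_fun (halfline R) g ->
  measurable_fun (halfline R) (cat_fun t f g).
Proof.
move=> t0 mf mg.
have -> : `[0, +oo[%classic = (`[0, t[%classic `|` `[t, +oo[%classic : set (mR R)).
  apply/seteqP; split => s; rewrite /= !in_itv/= !andbT.
    by move=> s0; rewrite s0; have [st|ts] := ltP s t; [left|right].
  by case=> [/andP[]//|]; exact: le_trans.
apply/measurable_funU => //; split.
  apply: (@eq_measurable_fun _ _ _ _ _ f).
    by move=> s; rewrite inE/= in_itv/= => /andP[_ st]; rewrite cat_fun_lt.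
  apply: measurable_funS mf => // s; by rewrite /= !in_itv/= => /andP[->].
apply: (@eq_measurable_fun _ _ _ _ _ (g \o (fun s => s - t))).
  by move=> s; rewrite inE/= in_itv/= andbT => ts; rewrite /cat_fun ltNge ts.
apply: (@measurable_comp _ _ _ (mR R) (mR R) T `[0, +oo[%classic g
  `[t, +oo[%classic (fun s : mR R => (s - t : mR R))) => //.
  by move=> _ /= [s +  <-]; rewrite /= !in_itv/= !andbT => s0; rewrite subr_ge0.
exact: measurable_funB.
Qed.

Lemma integral_cat_fun t (phi psi : R -> \bar R) T : 0 <= t -> (0 <= T)%E ->
  measurable_fun (halfline R) phi ->
  measurable_fun (halfline R) psi ->
  (forall s, 0 <= s -> (0 <= phi s)%E) -> (forall s, 0 <= s -> (0 <= psi s)%E) ->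
  (\int[leb]_(s in horizon (t%:E + T)) cat_fun t phi psi s =
   \Int_(s < t) phi s +
   \int[leb]_(s in horizon T) psi s)%E.
Proof.
move=> t0 T0 m1 m2 p1 p2; rewrite ge0_integral_horizon//.
- congr (_ + _)%E; apply: eq_integral => s; rewrite inE => -[s0].
    by rewrite lte_fin => st; rewrite cat_fun_lt.
  by move=> _; rewrite cat_fun_shift.
- exact: measurable_cat_fun.
- move=> s s0; rewrite /cat_fun; case: ifPn => [_|]; first exact: p1.
  by rewrite -leNgt => ts; apply: p2; rewrite subr_ge0.
Qed.

Lemma rate_cat t (f g : R -> R) : 0 <= t -> rate f -> rate g -> rate (cat_fun t f g).
Proof.
move=> t0 rf rg; have [mf f0 fi] := rf; have [mg g0 gi] := rg; split.
- exact: measurable_cat_fun.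
- move=> s s0; rewrite /cat_fun; case: ifPn => [_|]; first exact: f0.
  by rewrite -leNgt => ts; apply: g0; rewrite subr_ge0.
- move=> u u0.
  have E : (fun s => (cat_fun t f g s)%:E) = cat_fun t (EFin \o f) (EFin \o g).
    by apply/funext => s; rewrite /cat_fun; case: ifP.
  have mf' := rate_measurable rf; have mg' := rate_measurable rg.
  rewrite E; apply: (@le_lt_trans _ _
    (\int[leb]_(s in horizon (t%:E + u%:E)) cat_fun t (EFin \o f) (EFin \o g) s)%E).
    apply: integral_horizonS; first by rewrite leeDr.
      exact: measurable_cat_fun.
    move=> s s0; rewrite /cat_fun; case: ifPn => [_|]; first by rewrite lee_fin f0.
    by rewrite -leNgt => ts; rewrite lee_fin g0// subr_ge0.
  by rewrite integral_cat_fun// lte_add_pinfty ?fi ?gi.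
Qed.

Lemma flow_cat_le t (f g : R -> R) u : u <= t -> flow (cat_fun t f g) u = flow f u.
Proof.
move=> ut; rewrite /flow /Rintegral; congr fine; apply: eq_integral => s.
by rewrite inE/= in_itv/= => /andP[_ su]; rewrite cat_fun_lt// (lt_le_trans su).
Qed.

Lemma flow_eq (f g : R -> R) u : (forall s, 0 <= s < u -> f s = g s) -> flow f u = flow g u.
Proof.
move=> fg; rewrite /flow /Rintegral; congr fine; apply: eq_integral => s.
by rewrite inE/= in_itv/= => su; rewrite fg.
Qed.

Lemma flow_cat_ge t (f g : R -> R) u : 0 <= t -> t <= u -> rate f -> rate g ->
  flow (cat_fun t f g) u = flow f t + flow g (u - t).
Proof.
move=> t0 tu rf rg; have -> : u = t + (u - t) by ring.
rewrite flowD ?subr_ge0//; last exact: rate_cat.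
rewrite flow_cat_le//; congr (_ + _); rewrite (_ : t + (u - t) - t = u - t); last by ring.
by apply: flow_eq => s /andP[s0 _]; rewrite cat_fun_shift.
Qed.

End cat.

(** * Controlled paths, their shifts and concatenations *)

Section path.
Context (R : realType) (d : nat) (gamma : 'I_d -> 'I_d -> R).
Notation jump := (jumps gamma).
Implicit Types (m : 'rV[R]_d) (mu : R -> 'rV[R]_d) (q : edge d -> R -> R).
Notation S := (@prob_simplex R d).

Definition flux mu q (e : edge d) (s : R) : R := mu s ord0 e.1 * q e s.

Lemma path_rate m mu q e : controlled_path gamma m mu q -> jump e -> rate (flux mu q e).
Proof.
move=> [[_ hS] hq hi _] je; apply: integrable_rate.
- have -> : `[0, +oo[%classic = \bigcup_(n : nat) (`[0, n%:R]%classic : set (mR R)).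
    apply/seteqP; split => s; rewrite /= in_itv/=.
      rewrite andbT => s0; exists (Num.truncn s).+1 => //=.
      by rewrite in_itv/= s0/= ltW// truncnS_gt.
    by move=> [n _]; rewrite /= in_itv/= andbT => /andP[].
  apply/measurable_fun_bigcup => // n; apply/measurable_EFinP.
  by have /integrableP[] := hi e je n%:R (ler0n _ _).
- move=> s s0; apply: mulr_ge0; first by have [] := hS s s0.
  by have [_] := hq e je; apply.
- exact: hi.
Qed.

Definition path_eq m mu q := forall t, 0 <= t ->
  mu t = m + \sum_(e | jump e) flow (flux mu q e) t *: jump_vector R e.

Lemma path_eqP m mu q : controlled_path gamma m mu q -> path_eq m mu q.
Proof. by case. Qed.

Lemma path_eq_cvg m mu q : (forall e, jump e -> rate (flux mu q e)) -> path_eq m mu q ->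
  forall t : R, 0 <= t -> mu s @[s --> within `[0, +oo[%classic (nbhs t)] --> mu t.
Proof.
move=> hr hE t t0; rewrite hE//.
have H : m + \sum_(e | jump e) flow (flux mu q e) s *: jump_vector R e
    @[s --> within `[0, +oo[%classic (nbhs t)] -->
    m + \sum_(e | jump e) flow (flux mu q e) t *: jump_vector R e.
  apply: cvgD; first exact: cvg_cst.
  apply: cvg_big => //; first exact: add_continuous.
  by move=> e je; apply: cvgZr_tmp; apply: flow_cvg; [exact: hr|].
apply: cvg_trans H; apply: near_eq_cvg; rewrite near_withinE; apply: nearW => s.
by rewrite /= in_itv/= andbT => s0; rewrite -hE.
Qed.

Lemma path_eq_cadlag m mu q : (forall e, jump e -> rate (flux mu q e)) ->
  path_eq m mu q -> cadlag mu.
Proof.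
move=> hr hE; have h := path_eq_cvg hr hE; split => t t0.
  apply: cvg_trans (h t t0) => A; rewrite /nbhs/= /within/=.
  apply: filterS => s hA ts; apply: hA.
  by rewrite in_itv/= andbT (le_trans t0)// ltW.
apply/cvg_ex; exists (mu t); apply: cvg_trans (h t (ltW t0)) => A; rewrite /nbhs/= /within/=.
have : \forall s \near t, 0 < s by exact: lt_nbhsr.
apply: filterS2 => s s0 hA _; apply: hA.
by rewrite in_itv/= andbT ltW.
Qed.

Lemma controlled_pathI m mu q :
  (forall t, 0 <= t -> S (mu t)) ->
  (forall e, jump e -> measurable_fun (halfline R) (q e)) ->
  (forall e t, jump e -> 0 <= t -> 0 <= q e t) ->
  (forall e, jump e -> rate (flux mu q e)) ->
  path_eq m mu q -> controlled_path gamma m mu q.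
Proof.
move=> hS mq q0 hr hE; split => //.
- by split=> //; exact: path_eq_cadlag hr hE.
- by move=> e je; split; [exact: mq|move=> t; exact: q0].
- by move=> e je T T0; exact: rate_integrable (hr e je) T0.
Qed.

Lemma path_eps m mu q : controlled_path gamma m mu q ->
  forall t : R, 0 <= t -> forall e : R, 0 < e -> exists2 dl : R, 0 < dl &
   forall s : R, 0 <= s -> `|s - t| < dl -> forall x, `|mu s ord0 x - mu t ord0 x| < e.
Proof.
move=> hp t t0 e e0; have hr := path_rate hp.
have /cvg_ballP/(_ e e0) := path_eq_cvg (fun e je => hr e je) (path_eqP hp) t0.
rewrite near_withinE => -[dl /= dl0 hd]; exists dl => // s s0 st x.
have := hd s; rewrite /= distrC => /(_ st); rewrite in_itv/= andbT => /(_ s0) h.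
by case: h => _ h; rewrite distrC; exact: h.
Qed.

Lemma path_S m mu q t : controlled_path gamma m mu q -> 0 <= t -> S (mu t).
Proof. by move=> [[_ h] _ _ _]; exact: h. Qed.

Lemma path_coord_measurable m mu q x : controlled_path gamma m mu q ->
  measurable_fun (halfline R) (fun s => mu s ord0 x).
Proof.
move=> hp; apply: measurable_fun_eps_delta => t t0 e e0.
by have [dl dl0 h] := path_eps hp t0 e0; exists dl => // s s0 st; exact: h.
Qed.

Lemma path_shift m mu q t : controlled_path gamma m mu q -> 0 <= t ->
  controlled_path gamma (mu t) (fun s => mu (t + s)) (fun e s => q e (t + s)).
Proof.
move=> hp t0; have [_ hq _ hE] := hp; apply: controlled_pathI.
- by move=> s s0; apply: path_S hp _; exact: addr_ge0.
- by move=> e je; apply: measurable_shift => //; have [] := hq e je.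
- by move=> e s je s0; have [_] := hq e je; apply; exact: addr_ge0.
- by move=> e je; exact: rate_shift (path_rate hp je) t0.
- move=> u u0; rewrite (path_eqP hp)// ?addr_ge0// (path_eqP hp t0) -addrA -big_split/=.
  congr (_ + _); apply: eq_bigr => e je; rewrite -scalerDl; congr (_ *: _).
  by rewrite (flowD (path_rate hp je)).
Qed.

Lemma path_cat m mu1 q1 mu2 q2 t : controlled_path gamma m mu1 q1 -> 0 <= t ->
  controlled_path gamma (mu1 t) mu2 q2 ->
  controlled_path gamma m (cat_fun t mu1 mu2) (fun e => cat_fun t (q1 e) (q2 e)).
Proof.
move=> h1 t0 h2; have [_ hq1 _ _] := h1; have [_ hq2 _ _] := h2.
have E e : flux (cat_fun t mu1 mu2) (fun e => cat_fun t (q1 e) (q2 e)) e =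
    cat_fun t (flux mu1 q1 e) (flux mu2 q2 e).
  by apply/funext => s; rewrite /flux /cat_fun; case: ifP.
have r1 := path_rate h1; have r2 := path_rate h2.
have st s : s < t = false -> 0 <= s - t by move=> /negbT; rewrite -leNgt subr_ge0.
apply: controlled_pathI.
- move=> s s0; rewrite /cat_fun; case: ifPn => [_|ts]; first exact: path_S h1 s0.
  by apply: path_S h2 _; apply: st; exact/negbTE.
- by move=> e je; apply: measurable_cat_fun => //; [have [] := hq1 e je|have [] := hq2 e je].
- move=> e s je s0; rewrite /cat_fun; case: ifPn => [_|ts].
    by have [_] := hq1 e je; apply.
  by have [_] := hq2 e je; apply; apply: st; exact/negbTE.
- by move=> e je; rewrite E; exact: rate_cat t0 (r1 e je) (r2 e je).
- move=> u u0; rewrite {1}/cat_fun; case: ifPn => [ut|]; last rewrite -leNgt => tu.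
    rewrite (path_eqP h1)//; congr (_ + _); apply: eq_bigr => e je; congr (_ *: _).
    by rewrite E flow_cat_le// ltW.
  rewrite (path_eqP h2) ?subr_ge0// (path_eqP h1)// -addrA -big_split/=.
  congr (_ + _); apply: eq_bigr => e je; rewrite -scalerDl; congr (_ *: _).
  by rewrite E (flow_cat_ge t0 tu (r1 e je) (r2 e je)).
Qed.

End path.

Definition simplex_continuous (R : realType) (d : nat) (r : 'rV[R]_d -> R) :=
  forall m, prob_simplex m -> forall e : R, 0 < e -> exists2 dl : R, 0 < dl &
    forall m', prob_simplex m' -> (forall x, `|m' ord0 x - m ord0 x| < dl) -> `|r m' - r m| < e.

(** * Fluxes with a prescribed displacement; the simplex *)

Section fluxes.
Context (R : realType) (d : nat) (gamma : 'I_d -> 'I_d -> R).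
Notation jump := (jumps gamma).

Lemma path_flux x (p : seq 'I_d) : path (fun a b => 0 < gamma a b) x p ->
  exists2 f : edge d -> R, (forall e, 0 <= f e) &
  \sum_(e | jump e) f e *: jump_vector R e = delta_mx ord0 (last x p) - delta_mx ord0 x.
Proof.
elim: p x => [x _|z p ih x /= /andP[xz /ih [f f0 fE]]].
  by exists (fun=> 0) => //=; rewrite subrr big1// => e _; rewrite scale0r.
exists (fun e => f e + (e == (x, z))%:R); first by move=> e; rewrite addr_ge0.
under eq_bigr do rewrite scalerDl; rewrite big_split/= fE.
rewrite (bigD1 (x, z))//= eqxx scale1r big1 ?addr0; last first.
  by move=> e /andP[_ /negbTE ->]; rewrite scale0r.
by rewrite /jump_vector/= addrA subrK.
Qed.

Lemma sum_eq_index (y : 'I_d) : \sum_x ((x == y)%:R : R) = 1.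
Proof. by rewrite (bigD1 y)//= eqxx big1 ?addr0// => i /negbTE ->. Qed.

(** One unit is sent along every jump, and what is missing to [u] is routed through the state [x0]
    along paths of positive rates. The lower bound 1 keeps the controls away from 0, where the upper
    bound on the cost does not reach. *)
Lemma flux_exists (x0 : 'I_d) : (forall x y, connect (fun a b => 0 < gamma a b) x y) ->
  exists2 W : R, 1 <= W & forall u : 'rV[R]_d, \sum_x u ord0 x = 0 -> (forall x, `|u ord0 x| <= 2) ->
  exists2 w : edge d -> R, (forall e, 1 <= w e <= W) &
    \sum_(e | jump e) w e *: jump_vector R e = u.
Proof.
move=> hc.
have /choice[f hf] : forall xy : edge d, exists f : edge d -> R, (forall e, 0 <= f e) /\
  \sum_(e | jump e) f e *: jump_vector R e = delta_mx ord0 xy.2 - delta_mx ord0 xy.1.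
  move=> [x y]; have /connectP[p hp ->] := hc x y.
  by have [f f0 fE] := path_flux hp; exists f.
pose u0 : 'rV[R]_d := \sum_(e | jump e) jump_vector R e.
pose T : R := \sum_e \sum_x (f (x0, x) e + f (x, x0) e).
pose B : R := 2 + \sum_x `|u0 ord0 x|.
have B0 : 0 <= B by rewrite addr_ge0// sumr_ge0.
have T0 : 0 <= T.
  by apply: sumr_ge0 => e _; apply: sumr_ge0 => x _; rewrite addr_ge0 ?(hf _).1.
exists (1 + B * T); first by rewrite lerDl mulr_ge0.
move=> u us u2.
have u0s : \sum_x u0 ord0 x = 0.
  under eq_bigr do rewrite /u0 summxE; rewrite exchange_big/= big1// => e _.
  rewrite /jump_vector; under eq_bigr do rewrite !mxE eqxx/=.
  by rewrite sumrB !sum_eq_index subrr.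
pose v x : R := u ord0 x - u0 ord0 x.
have vB x : `|v x| <= B.
  rewrite /v (le_trans (ler_normB _ _))// lerD// (bigD1 x)//= lerDl.
  by rewrite sumr_ge0.
have vs : \sum_x v x = 0 by rewrite /v sumrB us u0s subrr.
pose g e := \sum_x (Num.max (v x) 0 * f (x0, x) e + Num.max (- v x) 0 * f (x, x0) e).
have max0 (z : R) : 0 <= Num.max z 0 by rewrite le_max lexx orbT.
exists (fun e => 1 + g e).
  move=> e; rewrite lerDl lerD2l; apply/andP; split.
    by apply: sumr_ge0 => x _; rewrite addr_ge0// mulr_ge0 ?(hf _).1.
  rewrite (@le_trans _ _ (B * \sum_x (f (x0, x) e + f (x, x0) e)))//.
    rewrite mulr_sumr; apply: ler_sum => x _; rewrite mulrDr.
    by apply: lerD; apply: ler_wpM2r; rewrite ?(hf _).1// ge_max B0 andbT;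
      rewrite (le_trans _ (vB x))// ?ler_norm// -normrN ler_norm.
  rewrite ler_wpM2l// /T (bigD1 e)//= lerDl; apply: sumr_ge0 => e' _.
  by apply: sumr_ge0 => x _; rewrite addr_ge0 ?(hf _).1.
under eq_bigr do rewrite scalerDl scale1r; rewrite big_split/= -/u0.
have -> : \sum_(e | jump e) g e *: jump_vector R e =
    \sum_x v x *: (delta_mx ord0 x - delta_mx ord0 x0 : 'rV[R]_d).
  rewrite /g; under eq_bigr do rewrite scaler_suml; rewrite exchange_big/=.
  apply: eq_bigr => x _.
  rewrite (eq_bigr (fun e => Num.max (v x) 0 *: (f (x0, x) e *: jump_vector R e) +
    Num.max (- v x) 0 *: (f (x, x0) e *: jump_vector R e))); last first.
    by move=> e _; rewrite scalerDl !scalerA.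
  rewrite big_split/= -!scaler_sumr (hf (x0, x)).2 (hf (x, x0)).2/=.
  rewrite -[X in _ + _ *: X]opprB scalerN -scalerBl; congr (_ *: _).
  have [h|h] := leP 0 (v x).
    by rewrite max_r ?oppr_le0// subr0.
  by rewrite max_l ?oppr_ge0 ?(ltW h)// sub0r opprK.
rewrite (eq_bigr (fun x => v x *: (delta_mx ord0 x : 'rV[R]_d) - v x *: delta_mx ord0 x0)); last first.
  by move=> x _; rewrite scalerBr.
rewrite sumrB -scaler_suml vs scale0r subr0; apply/rowP => y.
rewrite mxE [X in _ + X]summxE (bigD1 y)//= big1 ?addr0.
  by rewrite !mxE !eqxx mulr1 /v addrC subrK.
by move=> x xy; rewrite !mxE/= eq_sym (negbTE xy) mulr0.
Qed.

End fluxes.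

Section simplex.
Context (R : realType) (d : nat).
Notation S := (@prob_simplex R d).
Implicit Types a b m : 'rV[R]_d.

Lemma simplex_ge0 m x : S m -> 0 <= m ord0 x.
Proof. by case=> + _; apply. Qed.

Lemma simplex_le1 m x : S m -> m ord0 x <= 1.
Proof. by move=> [m0 <-]; rewrite (bigD1 x)//= lerDl sumr_ge0. Qed.

Lemma simplex_convex t a b : 0 <= t <= 1 -> S a -> S b -> S ((1 - t) *: a + t *: b).
Proof.
move=> /andP[t0 t1] [a0 a1] [b0 b1]; split.
  by move=> x; rewrite !mxE addr_ge0// mulr_ge0// subr_ge0.
under eq_bigr do rewrite !mxE.
by rewrite big_split/= -!mulr_sumr a1 b1 !mulr1 subrK.
Qed.

Lemma simplex_dim m : S m -> (0 < d)%N.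
Proof.
move=> [_]; case: {m}d m => // m; rewrite big_ord0 => /eqP.
by rewrite eq_sym oner_eq0.
Qed.

Definition uniform_point : 'rV[R]_d := const_mx d%:R^-1.

Lemma uniform_simplex : (0 < d)%N -> S uniform_point.
Proof.
move=> d0; split=> [x|]; first by rewrite mxE invr_ge0.
under eq_bigr do rewrite mxE.
by rewrite sumr_const card_ord -[LHS]mulr_natl mulfV// pnatr_eq0 -lt0n.
Qed.

End simplex.

Section dot.
Context (R : realType) (d : nat) (gamma : 'I_d -> 'I_d -> R).
Notation jump := (jumps gamma).

Lemma dot_jump_sum (p : 'I_d -> R) (w : edge d -> R) :
  \sum_x p x * (\sum_(e | jump e) w e *: jump_vector R e) ord0 x =
  \sum_(e | jump e) w e * (p e.2 - p e.1).
Proof.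
under eq_bigr do rewrite summxE mulr_sumr; rewrite exchange_big/=; apply: eq_bigr => e _.
rewrite (eq_bigr (fun x => w e * (p x * (x == e.2)%:R) - w e * (p x * (x == e.1)%:R))); last first.
  by move=> x _; rewrite !mxE/=; ring.
have H y : \sum_x p x * (x == y)%:R = p y.
  by rewrite (bigD1 y)//= eqxx mulr1 big1 ?addr0// => x /negbTE ->; rewrite mulr0.
by rewrite sumrB -!mulr_sumr !H mulrBr.
Qed.

Lemma jump_vector_le1 (e : edge d) x : `|jump_vector R e ord0 x| <= 1.
Proof.
have b01 (b : bool) : 0 <= (b%:R : R) <= 1 by case: b; rewrite lexx ler01.
have /andP[h1 h2] := b01 (x == e.1); have /andP[h3 h4] := b01 (x == e.2).
by rewrite !mxE/= ler_norml; apply/andP; split; lra.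
Qed.

End dot.

Section averages.
Context (R : realType).

Lemma rate_cst (c : R) : 0 <= c -> rate (fun=> c).
Proof.
move=> c0; split => // t t0; rewrite horizon_fin integral_cst//= lebesgue_measure_itv/= lte_fin.
by case: ifPn => _; rewrite ?mule0// -EFinB -EFinM ltry.
Qed.

Lemma flow_cst (c t : R) : 0 <= c -> 0 <= t -> flow (fun=> c) t = c * t.
Proof.
move=> c0 t0; apply: EFin_inj; rewrite -flowE//; last exact: rate_cst.
rewrite horizon_fin integral_cst//= lebesgue_measure_itv/= lte_fin.
case: ifPn => [_|]; first by rewrite -EFinB subr0.
by rewrite -leNgt => t0'; rewrite mule0 (_ : t = 0) ?mulr0//; apply/eqP; rewrite eq_le t0 t0'.
Qed.

Lemma le_flow (f g : R -> R) t : rate f -> rate g -> 0 <= t ->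
  (forall s, 0 <= s < t -> f s <= g s) -> flow f t <= flow g t.
Proof.
move=> rf rg t0 fg; rewrite -lee_fin -!flowE//; have [_ f0 _] := rf; have [_ g0 _] := rg.
apply: ge0_le_integral => //; try exact: measurable_horizon.
- by move=> s [s0 _]; rewrite lee_fin f0.
- by apply: measurable_funS (rate_measurable rf) => //; exact: horizon_sub.
- by apply: measurable_funS (rate_measurable rg) => //; exact: horizon_sub.
- by move=> s [s0 st]; rewrite lee_fin fg// s0 -lte_fin.
Qed.

End averages.

Definition total_rate (R : realType) (d : nat) (gamma : 'I_d -> 'I_d -> R) : R :=
  \sum_e `|gamma e.1 e.2|.

Lemma sum_jumps_cst_le (R : realType) (d : nat) (gamma : 'I_d -> 'I_d -> R) (c : R) : 0 <= c ->
  \sum_(e | jumps gamma e) c <= #|{: edge d}|%:R * c.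
Proof.
move=> c0; rewrite mulr_natl -sumr_const big_mkcond/=; apply: ler_sum => e _.
by case: ifP.
Qed.

Definition close (R : realType) (d : nat) (e : R) (m m' : 'rV[R]_d) :=
  forall x, `|m ord0 x - m' ord0 x| <= e.

Section close.
Context (R : realType) (d : nat).
Implicit Types (m : 'rV[R]_d) (e : R).

Lemma closeC e m m' : close e m m' -> close e m' m.
Proof. by move=> h x; rewrite distrC. Qed.

Lemma close_trans e e' m1 m2 m3 : close e m1 m2 -> close e' m2 m3 -> close (e + e') m1 m3.
Proof.
move=> h1 h2 x; rewrite (_ : _ - _ = (m1 ord0 x - m2 ord0 x) + (m2 ord0 x - m3 ord0 x)); last by ring.
by apply: le_trans (ler_normD _ _) _; apply: lerD.
Qed.

Lemma close_le e e' m m' : e <= e' -> close e m m' -> close e' m m'.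
Proof. by move=> ee h x; apply: le_trans (h x) ee. Qed.

Lemma nbhs_close m e : 0 < e -> nbhs m [set m' | close e m' m].
Proof.
move=> e0; apply/nbhs_ballP; exists e => //= m' [_ h] x.
by apply/ltW; rewrite distrC; exact: h.
Qed.

Lemma closeW (A : set 'rV[R]_d) m : nbhs m A -> exists2 e, 0 < e & forall m', close e m' m -> A m'.
Proof.
move=> /nbhs_ballP[e /= e0 h]; exists (e / 2); first by rewrite divr_gt0.
move=> m' hm; apply: h; split => // i x; rewrite ord1 /ball/= distrC.
by apply: le_lt_trans (hm x) _; lra.
Qed.

End close.

(** * Compactness of the simplex and geometry of the target *)

Section topology.
Context (R : realType) (d : nat).
Notation S := (@prob_simplex R d).
Implicit Types (m : 'rV[R]_d) (r : 'rV[R]_d -> R) (K : set 'rV[R]_d).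

Lemma closed_close (A : set 'rV[R]_d) :
  (forall m, (forall e : R, 0 < e -> exists2 m', A m' & close e m' m) -> A m) -> closed A.
Proof.
move=> h m hm; apply: h => e e0.
by have [m' [am' hm']] := hm _ (nbhs_close m e0); exists m'.
Qed.

Lemma simplex_compact : compact S.
Proof.
have cB : compact [set m : 'rV[R]_d | forall x, `[0, 1]%classic (m ord0 x)].
  by apply: (@rV_compact R d (fun=> `[0, 1]%classic)) => _; exact: segment_compact.
apply: (subclosed_compact _ cB); last first.
  by move=> m hm x; rewrite /= in_itv/= simplex_ge0// simplex_le1.
apply: closed_close => m hm; split.
  move=> x; rewrite leNgt; apply/negP => mx.
  have e0 : 0 < - m ord0 x / 2 by lra.
  have [m' hS /(_ x)] := hm _ e0; rewrite ler_norml => /andP[_ h2].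
  have := simplex_ge0 x hS; lra.
apply/eqP; rewrite -subr_eq0 -normr_eq0 eq_le normr_ge0 andbT; apply/ler_addgt0Pl => e e0.
have e1 : 0 < e / (d.+1)%:R by rewrite divr_gt0.
have [m' hS hc] := hm _ e1; rewrite addr0 -hS.2 -sumrB.
apply: le_trans (ler_norm_sum _ _ _) _.
apply: (@le_trans _ _ (\sum_(x < d) e / (d.+1)%:R)).
  by apply: ler_sum => x _; rewrite distrC; exact: hc.
rewrite sumr_const card_ord -[leLHS]mulr_natl mulrC -mulrA ler_piMr ?(ltW e0)//.
by rewrite mulrC ler_pdivrMr// mul1r ler_nat.
Qed.

(** Compactness as it is used below: a property monotone in its radius that holds locally with some
    radius holds with a common one. *)
Lemma compact_eventually (A : set 'rV[R]_d) (P : R -> 'rV[R]_d -> Prop) : compact A ->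
  (forall e e' m, 0 < e' <= e -> P e m -> P e' m) ->
  (forall m, A m -> exists e dl : R, [/\ 0 < e, 0 < dl & forall m', A m' -> close dl m' m -> P e m']) ->
  exists2 e : R, 0 < e & forall m, A m -> P e m.
Proof.
move=> /compact_near_coveringP cA mono loc.
have H : \forall e \near 0^'+, A `<=` (fun m => A m -> P e m).
  apply: (cA R 0^'+ (fun e m => A m -> P e m)) => m am.
  have [e [dl [e0 dl0 h]]] := loc m am.
  exists ([set m' | close dl m' m], [set e' | 0 < e' <= e]) => /=.
    split; first exact: nbhs_close.
    near=> e'; apply/andP; split; near: e'; [exact: nbhs_right_gt|exact: nbhs_right_le].
  move=> [m' e'] /= [hm' he'] am'; apply: mono he' _; exact: h.
have [e [e0 he]] : exists e : R, 0 < e /\ A `<=` (fun m => A m -> P e m).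
  by apply: (@filter_ex _ 0^'+); near=> e; split; near: e; [exact: nbhs_right_gt|exact: H].
by exists e => // m am; exact: he.
Unshelve. all: by end_near. Qed.

Lemma continuous_simplex r : {within S, continuous r} -> simplex_continuous r.
Proof.
move=> /subspace_continuousP rc m hm e e0.
have /cvgrPdist_lt/(_ e e0) := rc m hm; rewrite near_withinE => /closeW[dl dl0 h].
exists dl => // m' hm' hc; rewrite distrC; apply: h => // x; exact/ltW/hc.
Qed.

Lemma simplex_bounded r : simplex_continuous r -> exists M : R, forall m, S m -> r m <= M.
Proof.
move=> rc.
have [||e e0 h] := @compact_eventually S (fun e m => r m <= e^-1) simplex_compact.
- by move=> e e' m /andP[e0 ee] h; apply: le_trans h _; rewrite lef_pV2// posrE// (lt_le_trans e0).
- move=> m hm; have [dl dl0 h] := rc m hm 1 ltr01.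
  exists (`|r m| + 1)^-1, (dl / 2); split; rewrite ?invr_gt0 ?ltr_wpDl ?divr_gt0//.
  move=> m' hm' hc; rewrite invrK.
  have /ltW : `|r m' - r m| < 1.
    by apply: h => // x; apply: le_lt_trans (hc x) _; lra.
  have := ler_norm (r m); rewrite ler_norml => h1 /andP[_ h2]; lra.
- by exists e^-1.
Qed.

Lemma simplex_uniform r : simplex_continuous r -> forall w : R, 0 < w -> exists2 dl : R, 0 < dl &
  forall m m', S m -> S m' -> close dl m m' -> `|r m - r m'| <= w.
Proof.
move=> rc w w0.
have [||dl dl0 h] := @compact_eventually S
  (fun e m => forall m', S m' -> close e m' m -> `|r m' - r m| <= w) simplex_compact.
- move=> e e' m /andP[_ ee] h m' hm' hc; apply: h => //; exact: close_le hc.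
- move=> m hm; have w2 : 0 < w / 2 by rewrite divr_gt0.
  have [dl dl0 h] := rc m hm _ w2.
  exists (dl / 4), (dl / 4); split; rewrite ?divr_gt0// => m1 hm1 c1 m2 hm2 c2.
  have h1 : `|r m1 - r m| < w / 2 by apply: h => // x; apply: le_lt_trans (c1 x) _; lra.
  have h2 : `|r m2 - r m| < w / 2.
    by apply: h => // x; apply: le_lt_trans (close_trans c2 c1 x) _; lra.
  rewrite (_ : r m2 - r m1 = (r m2 - r m) - (r m1 - r m)); last by ring.
  apply: le_trans (ler_normB _ _) _; lra.
- by exists dl => // m m' hm hm'; exact: h.
Qed.

End topology.

Section target.
Context (R : realType) (d : nat) (K : set 'rV[R]_d).
Notation S := (@prob_simplex R d).
Implicit Types (m : 'rV[R]_d).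
Hypothesis KS : K `<=` S.
Hypothesis Kreg : K = closure (interior (K : set (subspace S))).

Lemma target_closed : closed (K : set (subspace S)) ->
  forall z, S z -> ~ K z -> exists2 e : R, 0 < e & forall m, S m -> close e m z -> ~ K m.
Proof.
move=> cK z hz nz; apply: contrapT => H; apply: nz; apply: cK => B.
rewrite /nbhs/= -nbhs_subspace_in// /within/= => /closeW[e e0 h].
apply: contrapT => H2; apply: H; exists e => // m hm hc km; apply: H2.
by exists m; split => //; exact: h.
Qed.

(** The shrunk target. Since [K] is the closure of its interior, every point of [K] is near a core
    point once [dl] is small ([target_core_uniform]). *)
Definition target_core (dl : R) : set 'rV[R]_d :=
  [set m | S m /\ forall m', S m' -> close dl m' m -> K m'].

Lemma target_core_dense k e : K k -> 0 < e ->
  exists2 k', close e k' k & exists2 dl : R, 0 < dl & target_core dl k'.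
Proof.
move=> kk e0; have hk := KS kk; move: (kk); rewrite {1}Kreg => /(_ [set m | S m /\ close e m k]).
have nB : nbhs (k : subspace S) [set m | S m /\ close e m k].
  rewrite /nbhs/= -nbhs_subspace_in// /within/=.
  by apply: filterS (nbhs_close k e0) => m hm sm.
move=> /(_ nB) [k' [ik' [sk' hc]]]; exists k' => //.
move: ik'; rewrite /interior/= /nbhs/= -nbhs_subspace_in// /within/= => /closeW[dl dl0 h].
by exists dl => //; split => // m' hm' hc'; exact: h.
Qed.

Lemma target_compact : closed (K : set (subspace S)) -> compact K.
Proof.
move=> cK; apply: (subclosed_compact _ (@simplex_compact R d)) => //.
apply: closed_close => m hm.
have sm : S m.
  have /compact_closed : compact S by exact: simplex_compact.
  move=> /(_ _) cS; apply: cS; first exact: norm_hausdorff.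
  move=> B /closeW[e e0 h]; have [m' km' hc] := hm e e0; exists m'; split; [exact: KS|exact: h].
apply: contrapT => nk; have [e e0 h] := target_closed cK sm nk.
by have [m' km' hc] := hm e e0; exact: (h m' (KS km') hc).
Qed.

Lemma target_core_uniform : closed (K : set (subspace S)) -> forall e : R, 0 < e ->
  exists2 dl : R, 0 < dl & forall k, K k -> exists2 k', close e k' k & target_core dl k'.
Proof.
move=> cK e e0.
have [||dl dl0 h] := @compact_eventually R d K
  (fun dl k => exists2 k', close e k' k & target_core dl k') (target_compact cK).
- move=> dl dl' m /andP[_ dd] [k' hc [sk' h]]; exists k' => //; split => // m' hm' hc'.
  apply: h => //; exact: close_le hc'.
- move=> k kk; have e2 : 0 < e / 2 by rewrite divr_gt0.
  have [k' hc [dl dl0 hk']] := target_core_dense kk e2.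
  exists dl, (e / 2); split => // m' km' hc'; exists k' => //.
  by rewrite [e]splitr; apply: close_trans hc (closeC hc').
- by exists dl.
Qed.

(** For [0 < dl] these are the compact sets off [K] on which the positive lower bound of the running
    cost is taken. *)
Lemma away_compact (dl : R) :
  compact [set m | S m /\ forall k, K k -> exists x, dl <= `|m ord0 x - k ord0 x|].
Proof.
apply: (subclosed_compact _ (@simplex_compact R d)); last by move=> m [].
apply: closed_close => m hm.
have sm : S m.
  have /compact_closed : compact S by exact: simplex_compact.
  move=> /(_ _) cS; apply: cS; first exact: norm_hausdorff.
  move=> B /closeW[e e0 h]; have [m' [sm' _] hc] := hm e e0; exists m'; split => //; exact: h.
split => // k kk; apply: contrapT => H.
have H' x : `|m ord0 x - k ord0 x| < dl by rewrite ltNge; apply/negP => h; apply: H; exists x.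
pose e := \big[Num.min/1]_x ((dl - `|m ord0 x - k ord0 x|) / 2).
have e0 : 0 < e by apply: lt_bigmin => // x _; rewrite divr_gt0// subr_gt0.
have eh x : e <= (dl - `|m ord0 x - k ord0 x|) / 2 by exact: bigmin_le_cond.
have [m' [sm' /(_ k kk)[x hx]] hc] := hm e e0.
have := hc x; have := eh x; have := H' x.
have := ler_normD (m' ord0 x - m ord0 x) (m ord0 x - k ord0 x).
rewrite (_ : m' ord0 x - m ord0 x + _ = m' ord0 x - k ord0 x); last by ring.
lra.
Qed.

End target.

(** * Quadratic penalties and convolutions on the simplex *)

Section quadratic.
Context (R : realType) (d : nat).
Notation S := (@prob_simplex R d).
Implicit Types (m z c h : 'rV[R]_d) (f g : 'rV[R]_d -> R).

Definition sqdist z c : R := \sum_x (z ord0 x - c ord0 x) ^+ 2.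

Lemma sqdist_ge0 z c : 0 <= sqdist z c.
Proof. by apply: sumr_ge0 => x _; exact: sqr_ge0. Qed.

Lemma sqdistxx z : sqdist z z = 0.
Proof. by rewrite /sqdist big1// => x _; rewrite subrr expr0n. Qed.

Lemma sqdist_coord z c (s : R) : 0 <= s -> sqdist z c <= s ^+ 2 -> close s z c.
Proof.
move=> s0 h x; rewrite -(ler_pXn2r (_ : 0 < 2)%N)// ?nnegrE// real_normK ?num_real//.
by apply: le_trans h; rewrite /sqdist (bigD1 x)//= lerDl; apply: sumr_ge0 => y _; exact: sqr_ge0.
Qed.

Lemma sqdist_shiftr z c h : sqdist z (c + h) =
  sqdist z c - \sum_x 2 * (z ord0 x - c ord0 x) * h ord0 x + \sum_x h ord0 x ^+ 2.
Proof.
by rewrite /sqdist -sumrB -big_split/=; apply: eq_bigr => x _; rewrite mxE; ring.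
Qed.

Lemma sqdist_expand z z' c : sqdist z' c =
  sqdist z c + \sum_x 2 * (z ord0 x - c ord0 x) * (z' ord0 x - z ord0 x) + sqdist z' z.
Proof.
by rewrite /sqdist -big_split/= -big_split/=; apply: eq_bigr => x _; ring.
Qed.

Lemma jump_vector_dot (p : 'I_d -> R) (e : edge d) :
  \sum_x p x * jump_vector R e ord0 x = p e.2 - p e.1.
Proof.
rewrite (eq_bigr (fun x => p x * (x == e.2)%:R - p x * (x == e.1)%:R)); last first.
  by move=> x _; rewrite !mxE/=; ring.
have H y : \sum_x p x * (x == y)%:R = p y.
  by rewrite (bigD1 y)//= eqxx mulr1 big1 ?addr0// => x /negbTE ->; rewrite mulr0.
by rewrite sumrB !H.
Qed.

Lemma jump_vector_sq (e : edge d) : \sum_x jump_vector R e ord0 x ^+ 2 <= d%:R.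
Proof.
rewrite -[leRHS]mulr1 -[in leRHS](card_ord d) mulr_natl -sumr_const.
apply: ler_sum => x _; rewrite -real_normK ?num_real// expr_le1//.
exact: jump_vector_le1.
Qed.

(** Chooses one small scale meeting finitely many smallness conditions at once, each a pair of a
    coefficient and its positive bound. *)
Lemma small_factor (s : seq (R * R)) : all (fun p => 0 < p.2) s ->
  exists2 t : R, 0 < t & all (fun p => t * p.1 <= p.2) s.
Proof.
elim: s => [_|[a c] s ih /= /andP[c0 hs]]; first by exists 1.
have [t t0 ht] := ih hs; have a1 : 0 < `|a| + 1 by rewrite ltr_wpDl.
pose u := Num.min t (c / (`|a| + 1)).
have u0 : 0 < u by rewrite lt_min t0 divr_gt0.
exists u => //=; apply/andP; split.
  apply: (@le_trans _ _ (u * (`|a| + 1))); first by rewrite ler_pM2l// ler_wpDr// ler_norm.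
  by rewrite -ler_pdivlMr// ge_min lexx orbT.
apply/allP => p ps; have := allP ht p ps; have := ltW (allP hs p ps).
have [p1 _|/ltW p1 p2 _] := leP 0 p.1.
  by apply: le_trans; rewrite ler_wpM2r// ge_min lexx.
by apply: le_trans p2; rewrite mulr_ge0_le0// ltW.
Qed.

Lemma simplex_continuous_cst (a : R) : simplex_continuous (fun _ : 'rV[R]_d => a).
Proof. by move=> m _ e e0; exists 1 => // m' _ _; rewrite subrr normr0. Qed.

Lemma simplex_continuous_add f g : simplex_continuous f -> simplex_continuous g ->
  simplex_continuous (fun m => f m + g m).
Proof.
move=> cf cg m hm e e0; have e2 : 0 < e / 2 by rewrite divr_gt0.
have [d1 d10 h1] := cf m hm _ e2; have [d2 d20 h2] := cg m hm _ e2.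
exists (Num.min d1 d2); first by rewrite lt_min d10.
move=> m' hm' hx.
have /(h1 _ hm') a1 : forall x, `|m' ord0 x - m ord0 x| < d1.
  by move=> x; have := hx x; rewrite lt_min => /andP[].
have /(h2 _ hm') a2 : forall x, `|m' ord0 x - m ord0 x| < d2.
  by move=> x; have := hx x; rewrite lt_min => /andP[].
rewrite (_ : _ - _ = (f m' - f m) + (g m' - g m)); last by ring.
apply: le_lt_trans (ler_normD _ _) _; lra.
Qed.

Lemma simplex_continuous_scale f (a : R) : simplex_continuous f ->
  simplex_continuous (fun m => a * f m).
Proof.
move=> cf m hm e e0; have a1 : 0 < `|a| + 1 by rewrite ltr_wpDl.
have [dl dl0 h] := cf m hm _ (divr_gt0 e0 a1); exists dl => // m' hm' hx.
rewrite -mulrBr normrM; apply: (@le_lt_trans _ _ ((`|a| + 1) * `|f m' - f m|)).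
  by rewrite ler_wpM2r// lerDl.
by rewrite mulrC -ltr_pdivlMr//; exact: h.
Qed.

Lemma simplex_continuous_sum (f : 'I_d -> 'rV[R]_d -> R) :
  (forall x, simplex_continuous (f x)) -> simplex_continuous (fun m => \sum_x f x m).
Proof.
move=> cf.
have H (s : seq 'I_d) : simplex_continuous (fun m => \sum_(x <- s) f x m).
  elim: s => [|x s ih].
    rewrite (_ : (fun m => _) = fun=> 0); first exact: simplex_continuous_cst.
    by apply/funext => m; rewrite big_nil.
  rewrite (_ : (fun m => _) = fun m => f x m + \sum_(x <- s) f x m); last first.
    by apply/funext => m; rewrite big_cons.
  exact: simplex_continuous_add.
by have := H (index_enum 'I_d).
Qed.

Lemma simplex_continuous_sqdist c : simplex_continuous (fun z => sqdist z c).
Proof.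
apply: simplex_continuous_sum => x m hm e e0.
have k0 : 0 < 2 + 2 * `|c ord0 x| by have := normr_ge0 (c ord0 x); lra.
exists (e / (2 + 2 * `|c ord0 x|)); first exact: divr_gt0.
move=> m' hm' hx.
rewrite (_ : _ - _ = (m' ord0 x - m ord0 x) * (m' ord0 x + m ord0 x - 2 * c ord0 x)); last by ring.
rewrite normrM; apply: (@le_lt_trans _ _ (`|m' ord0 x - m ord0 x| * (2 + 2 * `|c ord0 x|))).
  rewrite ler_wpM2l//; apply: le_trans (ler_normB _ _) _; rewrite normrM (ger0_norm (_ : 0 <= 2 :> R))// lerD2r.
  rewrite ger0_norm ?addr_ge0 ?simplex_ge0//.
  have := simplex_le1 x hm; have := simplex_le1 x hm'; lra.
by rewrite -ltr_pdivlMr.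
Qed.

Lemma simplex_continuous_dist1 c : simplex_continuous (fun z => \sum_x `|c ord0 x - z ord0 x|).
Proof.
apply: simplex_continuous_sum => x m hm e e0; exists e => // m' hm' hx.
apply: le_lt_trans (hx x); rewrite -[in leRHS]normrN.
apply: le_trans (ler_dist_dist _ _) _.
by rewrite (_ : c ord0 x - m' ord0 x - _ = - (m' ord0 x - m ord0 x)) ?lexx//; ring.
Qed.

Lemma mul_sqrt_le (B e a : R) : 0 <= B -> 0 < e -> a <= (e / (B + 1)) ^+ 2 ->
  B * Num.sqrt a <= e.
Proof.
move=> B0 e0 ae; have B1 : 0 < B + 1 by rewrite ltr_wpDl.
apply: (@le_trans _ _ (B * (e / (B + 1)))).
  by rewrite ler_wpM2l// -[leRHS]gtr0_norm ?divr_gt0// -sqrtr_sqr ler_wsqrtr.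
by rewrite mulrCA ger_pMr// ler_pdivrMr// mul1r lerDl.
Qed.

Lemma holder_simplex_continuous f (B : R) : 0 <= B ->
  (forall m m' lam, S m -> S m' -> 0 < lam <= 1 -> close lam m m' ->
        f m <= B * Num.sqrt lam + f m') -> simplex_continuous f.
Proof.
move=> B0 h m hm e e0; have B1 : 0 < B + 1 by rewrite ltr_wpDl.
pose lam : R := Num.min 1 ((e / 2 / (B + 1)) ^+ 2).
have l0 : 0 < lam by rewrite lt_min ltr01 exprn_gt0// !divr_gt0.
have l1 : lam <= 1 by rewrite ge_min lexx.
have sl : B * Num.sqrt lam <= e / 2 by apply: mul_sqrt_le; rewrite ?divr_gt0// ge_min lexx orbT.
exists lam => // m' hm' hx.
have c1 : close lam m' m by move=> x; exact/ltW/hx.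
have l01 : 0 < lam <= 1 by rewrite l0.
have := h _ _ _ hm hm' l01 (closeC c1); have := h _ _ _ hm' hm l01 c1.
by rewrite ltr_norml => h1 h2; apply/andP; split; lra.
Qed.

Lemma simplex_argmin f : S !=set0 -> simplex_continuous f ->
  exists2 z, S z & forall z', S z' -> f z <= f z'.
Proof.
move=> [s0 hs0] cf; apply: contrapT => H.
have cNf : simplex_continuous (fun m => -1 * f m) by exact: simplex_continuous_scale.
have [M hM] := simplex_bounded cNf.
pose A := [set f z | z in S].
have hA : has_inf A.
  split; first by exists (f s0), s0.
  by exists (- M) => _ [z hz <-]; have := hM z hz; lra.
have [||e e0 he] := @compact_eventually R d S (fun e m => inf A + e <= f m) (@simplex_compact R d).
- by move=> e e' m /andP[_ ee]; apply: le_trans; rewrite lerD2l.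
- move=> m hm; have gm : inf A < f m.
    rewrite lt_neqAle; apply/andP; split; last by apply: ge_inf; [exact: hA.2|exists m].
    apply/eqP => E; apply: H; exists m => // z' hz'; rewrite -E.
    by apply: ge_inf; [exact: hA.2|exists z'].
  have e0 : 0 < (f m - inf A) / 2 by rewrite divr_gt0// subr_gt0.
  have [dl dl0 hd] := cf m hm _ e0; exists ((f m - inf A) / 2), (dl / 2); split => //; first by rewrite divr_gt0.
  move=> m' hm' hc; have : `|f m' - f m| < (f m - inf A) / 2.
    by apply: hd => // x; apply: le_lt_trans (hc x) _; lra.
  by rewrite ltr_norml => /andP[h1 h2]; lra.
- have [_ [z hz <-]] := inf_adherent e0 hA.
  by rewrite ltNge he.
Qed.

Lemma simplex_inf_convolution (phi : 'rV[R]_d -> 'rV[R]_d -> R) : S !=set0 ->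
  (forall m, simplex_continuous (phi m)) ->
  exists f : 'rV[R]_d -> R, forall m,
    (exists2 z, S z & f m = phi m z) /\ forall z, S z -> f m <= phi m z.
Proof.
move=> S0 cp; have /choice[f hf] : forall m, exists a,
    (exists2 z, S z & a = phi m z) /\ forall z, S z -> a <= phi m z.
  by move=> m; have [z hz h] := simplex_argmin S0 (cp m); exists (phi m z); split => //; exists z.
by exists f.
Qed.

End quadratic.

(** * The barrier near the boundary *)

Section boundary.
Context (R : realType) (d : nat) (gamma : 'I_d -> 'I_d -> R).
Notation jump := (jumps gamma).
Notation S := (@prob_simplex R d).
Implicit Types m : 'rV[R]_d.

(** If the source of each jump is bounded by [R0] times the square root of its target, smallness
    spreads backwards along the path. The real number [n] is a perturbation, later the mesh of the
    grid. *)
Lemma path_backward_small (R0 : R) x (p : seq 'I_d) : 0 < R0 ->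
  path (fun a b => 0 < gamma a b) x p -> forall tau : R, 0 < tau -> exists2 rho : R, 0 < rho &
    forall m n, (forall a, jump a -> m ord0 a.1 < R0 * Num.sqrt (m ord0 a.2 + n)) ->
      n <= rho -> m ord0 (last x p) < rho -> m ord0 x < tau.
Proof.
move=> R00; elim: p x => [x _ tau t0|y p ih x /= /andP[xy /ih {}ih] tau t0].
  by exists tau.
(* Half of the square is left to the next coordinate, half to the perturbation. *)
pose s : R := (tau / R0) ^+ 2 / 2.
have q0 : 0 < tau / R0 by exact: divr_gt0.
have s0 : 0 < s by rewrite divr_gt0// exprn_gt0.
have [rho rho0 h] := ih s s0.
exists (Num.min rho s); first by rewrite lt_min rho0.
move=> m n hm; rewrite le_min => /andP[n1 n2]; rewrite lt_min => /andP[m1 _].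
have my := h m n hm n1 m1.
have := hm (x, y) xy => /= /lt_le_trans; apply.
rewrite mulrC -ler_pdivlMr// -[leRHS]ger0_norm ?(ltW q0)// -sqrtr_sqr ler_wsqrtr//.
have : (tau / R0) ^+ 2 = s + s by rewrite /s; field; rewrite gt_eqF.
lra.
Qed.

(* If no jump had a source much heavier than the square root of its target,
   smallness of one coordinate would propagate backwards to all of them. *)
Lemma heavy_jump (R0 : R) : 0 < R0 -> (forall x y, connect (fun a b => 0 < gamma a b) x y) ->
  exists2 rho : R, 0 < rho & forall m n y, S m -> n <= rho -> m ord0 y < rho ->
    exists2 a, jump a & R0 * Num.sqrt (m ord0 a.2 + n) <= m ord0 a.1.
Proof.
move=> R00 hc; have [d0|d0] := posnP d.
  by exists 1 => // m n y; move: (ltn_ord y); rewrite {2}d0.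
(* The level [1 / d] is contradictory: coordinates that are all below it cannot sum to 1. *)
have di : 0 < (d%:R^-1 : R) by rewrite invr_gt0 ltr0n.
have /choice[rho hrho] : forall xy : edge d, exists rho : R, 0 < rho /\
    forall m n, (forall a, jump a -> m ord0 a.1 < R0 * Num.sqrt (m ord0 a.2 + n)) ->
      n <= rho -> m ord0 xy.2 < rho -> m ord0 xy.1 < d%:R^-1.
  move=> [x y]; have /connectP[p hp ->] := hc x y.
  by have [rho rho0 h] := path_backward_small R00 hp di; exists rho.
have m0 : 0 < \big[Num.min/1]_xy rho xy by apply: lt_bigmin => // xy _; exact: (hrho xy).1.
have mle xy : \big[Num.min/1]_xy rho xy <= rho xy by exact: bigmin_le_cond.
exists (\big[Num.min/1]_xy rho xy) => // m n y hm hn hy.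
apply: contrapT => H.
have H' a : jump a -> m ord0 a.1 < R0 * Num.sqrt (m ord0 a.2 + n).
  by move=> ja; rewrite ltNge; apply/negP => h; apply: H; exists a.
have small x : m ord0 x < d%:R^-1.
  apply: ((hrho (x, y)).2 m n H') => /=.
    exact: le_trans hn (mle _).
  exact: lt_le_trans hy (mle _).
have : \sum_x m ord0 x < \sum_(x < d) (d%:R^-1 : R).
  rewrite (bigD1 y)//= [ltRHS](bigD1 y)//=; apply: ltr_leD; first exact: small.
  by apply: ler_sum => x _; exact/ltW/small.
by rewrite hm.2 sumr_const card_ord -[ltRHS]mulr_natl divff ?ltxx// pnatr_eq0 -lt0n d0.
Qed.

(** The square root has infinite slope at 0, so jumps into a nearly empty state lower the barrier
    arbitrarily fast, yet the barrier is bounded and a small multiple of it is a small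
    perturbation. *)
Definition barrier m : R := \sum_x (1 - Num.sqrt (m ord0 x)).

Lemma barrier_bounds m : S m -> 0 <= barrier m <= d%:R.
Proof.
move=> hm; apply/andP; split.
  by apply: sumr_ge0 => x _; rewrite subr_ge0 -[leRHS]sqrtr1 ler_wsqrtr// simplex_le1.
rewrite -[leRHS]mulr1 -[in leRHS](card_ord d) mulr_natl -sumr_const.
by apply: ler_sum => x _; rewrite gerBl sqrtr_ge0.
Qed.

Lemma barrier_jump m (k : R) a : a.1 != a.2 ->
  barrier (m + k *: jump_vector R a) - barrier m =
  (Num.sqrt (m ord0 a.1) - Num.sqrt (m ord0 a.1 - k)) +
  (Num.sqrt (m ord0 a.2) - Num.sqrt (m ord0 a.2 + k)).
Proof.
move=> aN; rewrite /barrier -sumrB (bigD1 a.1)//= (bigD1 a.2) 1?eq_sym//= big1; last first.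
  move=> x /andP[x1 x2]; rewrite !mxE/= (negbTE x1) (negbTE x2) subrr mulr0 addr0.
  by rewrite subrr.
rewrite addr0; congr (_ + _).
  rewrite !mxE/= eqxx (negbTE aN) sub0r mulrN1; ring.
rewrite !mxE/= eqxx eq_sym (negbTE aN) subr0 mulr1; ring.
Qed.

(** The mass [u] of the source absorbs the singularity of the root at 0. For [u <= k] the default
    value 0 of the root of a negative number enters. *)
Lemma sqrt_drop (u k : R) : 0 <= u <= 1 -> 0 < k -> u * (k^-1 * (Num.sqrt u - Num.sqrt (u - k))) <= 1.
Proof.
move=> /andP[u0 u1] k0; have su0 := sqrtr_ge0 u.
have [uk|ku] := leP u k.
  rewrite (ler0_sqrtr (_ : u - k <= 0)) ?subr_le0// subr0 mulrA.
  have h1 : u / k <= 1 by rewrite ler_pdivrMr// mul1r.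
  have h2 : Num.sqrt u <= 1 by rewrite -[leRHS]sqrtr1 ler_wsqrtr.
  rewrite -[leRHS]mulr1; apply: ler_pM => //; by rewrite divr_ge0// ltW.
have up : 0 < u by exact: lt_trans ku.
have s0 : 0 < Num.sqrt u by rewrite sqrtr_gt0.
set s' := Num.sqrt (u - k); have s'0 : 0 <= s' := sqrtr_ge0 _.
have E : (Num.sqrt u - s') * (Num.sqrt u + s') = k.
  by rewrite -subr_sqr !sqr_sqrtr ?(ltW up) ?subr_ge0 ?(ltW ku)//; ring.
have p0 : 0 < Num.sqrt u + s' by rewrite ltr_pwDl.
have -> : Num.sqrt u - s' = k / (Num.sqrt u + s') by rewrite -E mulfK// gt_eqF.
rewrite (_ : u * _ = u / (Num.sqrt u + s')); last by field; rewrite !gt_eqF.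
rewrite ler_pdivrMr// mul1r.
apply: (@le_trans _ _ (Num.sqrt u)); last by rewrite lerDl.
rewrite -{1}(sqr_sqrtr u0) expr2 ler_piMl//.
by rewrite -[leRHS]sqrtr1 ler_wsqrtr.
Qed.

Lemma sqrt_gain (u k : R) : 0 <= u -> 0 < k ->
  k^-1 * (Num.sqrt u - Num.sqrt (u + k)) <= - (2 * Num.sqrt (u + k))^-1.
Proof.
move=> u0 k0; have s0 : 0 < Num.sqrt (u + k) by rewrite sqrtr_gt0 ltr_wpDl.
have su : Num.sqrt u <= Num.sqrt (u + k) by rewrite ler_wsqrtr// lerDl ltW.
have su0 := sqrtr_ge0 u.
have E : (Num.sqrt (u + k) - Num.sqrt u) * (Num.sqrt (u + k) + Num.sqrt u) = k.
  by rewrite -subr_sqr !sqr_sqrtr ?addr_ge0 ?(ltW k0)//; ring.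
have p0 : 0 < Num.sqrt (u + k) + Num.sqrt u by rewrite ltr_pwDl.
have -> : Num.sqrt u - Num.sqrt (u + k) = - (k / (Num.sqrt (u + k) + Num.sqrt u)).
  by rewrite -[X in - (X / _)]E mulfK ?gt_eqF// opprB.
rewrite mulrN lerN2 mulrA mulVf ?gt_eqF// mul1r lef_pV2 ?posrE ?mulr_gt0//; lra.
Qed.

(** Each jump raises the barrier at rate at most [gamma], while the heavy jump [a0] gains [R0 / 2]
    times its rate, because its source outweighs the root of its target. *)
Lemma barrier_drift m n : (0 < n)%N -> S m -> (forall a, jump a -> a.1 != a.2) ->
  forall a0, jump a0 -> forall R0 : R, 0 <= R0 ->
  R0 * Num.sqrt (m ord0 a0.2 + n%:R^-1) <= m ord0 a0.1 ->
  generator n gamma barrier m (fun a => gamma a.1 a.2) <= total_rate gamma - gamma a0.1 a0.2 * R0 / 2.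
Proof.
move=> n0 hm gN a0 j0 R0 R00 hR; rewrite /generator.
have k0 : 0 < (n%:R^-1 : R) by rewrite invr_gt0 ltr0n.
have mx0 x := simplex_ge0 x hm.
pose loss a : R := m ord0 a.1 * (2 * Num.sqrt (m ord0 a.2 + n%:R^-1))^-1.
have loss0 a : 0 <= loss a by rewrite mulr_ge0 ?mx0// invr_ge0 mulr_ge0 ?sqrtr_ge0.
have term a : jump a ->
   m ord0 a.1 * gamma a.1 a.2 * n%:R * (barrier (m + n%:R^-1 *: jump_vector R a) - barrier m) <=
   gamma a.1 a.2 * (1 - loss a).
  move=> ja; rewrite barrier_jump ?gN//.
  have g0 : 0 <= gamma a.1 a.2 by exact: ltW.
  have := @sqrt_drop (m ord0 a.1) n%:R^-1; rewrite mx0 simplex_le1// => /(_ isT k0).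
  have := sqrt_gain (mx0 a.2) k0; rewrite !invrK.
  set A := Num.sqrt _ - _; set B := Num.sqrt _ - Num.sqrt (_ + _) => h1 h2.
  have -> : m ord0 a.1 * gamma a.1 a.2 * n%:R * (B + A) =
    gamma a.1 a.2 * (m ord0 a.1 * (n%:R * B) + m ord0 a.1 * (n%:R * A)) by ring.
  rewrite ler_wpM2l// lerD//.
  by rewrite /loss -mulrN ler_wpM2l.
rewrite (bigD1 a0)//=; apply: (@le_trans _ _ (gamma a0.1 a0.2 * (1 - loss a0) +
    \sum_(a | jump a && (a != a0)) gamma a.1 a.2)).
  apply: lerD; first exact: term.
  apply: ler_sum => a /andP[ja _]; apply: le_trans (term a ja) _.
  by rewrite ler_piMr ?gerBl//; exact: ltW.
have h : \sum_(a | jump a) gamma a.1 a.2 <= total_rate gamma.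
  rewrite /total_rate [leRHS](bigID (jump))/= -[leLHS]addr0; apply: lerD.
    by apply: ler_sum => e _; exact: ler_norm.
  exact: sumr_ge0.
rewrite (bigD1 a0)//= in h.
have hl : R0 / 2 <= loss a0.
  have s0 : 0 < Num.sqrt (m ord0 a0.2 + n%:R^-1) by rewrite sqrtr_gt0 ltr_wpDl.
  rewrite /loss ler_pdivlMr ?mulr_gt0//; apply: le_trans hR.
  by rewrite le_eqVlt; apply/orP; left; apply/eqP; field.
have : gamma a0.1 a0.2 * (R0 / 2) <= gamma a0.1 a0.2 * loss a0.
  by rewrite ler_wpM2l//; exact: ltW.
rewrite mulrBr mulr1; lra.
Qed.

End boundary.

(** Some point [m'] outside [K] is within [dl] of [z], possibly at distance exactly [dl]. Moved
    slightly towards [z] it still avoids [K], as [K] is closed, and leaves the room [s * dl] to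
    perturb [z]. *)
Lemma target_core_separated (R : realType) (d : nat) (K : set 'rV[R]_d) (dl : R) z :
  closed (K : set (subspace (@prob_simplex R d))) -> 0 < dl -> prob_simplex z ->
  ~ target_core K dl z ->
  exists2 e : R, 0 < e & forall m, prob_simplex m -> close e m z -> ~ target_core K dl m.
Proof.
move=> cK dl0 hz nc.
have [m' [hm' hc' nk]] : exists m', [/\ prob_simplex m', close dl m' z & ~ K m'].
  apply: contrapT => H; apply: nc; split => // m' hm' hc'; apply: contrapT => nk.
  by apply: H; exists m'.
have [e e0 he] := target_closed cK hm' nk.
pose s : R := Num.min 1 e.
have s0 : 0 < s by rewrite lt_min ltr01.
have s1 : s <= 1 by rewrite ge_min lexx.
have se : s <= e by rewrite ge_min lexx orbT.
exists (s * dl); first exact: mulr_gt0.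
move=> m hm hcm [_ hcore].
pose m2 : 'rV[R]_d := (1 - s) *: m' + s *: z.
have hm2 : prob_simplex m2 by apply: simplex_convex; rewrite ?(ltW s0).
have m2x x : m2 ord0 x = (1 - s) * m' ord0 x + s * z ord0 x by rewrite !mxE.
apply: (he m2 hm2).
  move=> x; rewrite m2x (_ : _ - _ = s * (z ord0 x - m' ord0 x)); last by ring.
  rewrite normrM (gtr0_norm s0); apply: le_trans se; rewrite ler_piMr ?(ltW s0)//.
  have := simplex_ge0 x hz; have := simplex_le1 x hz.
  have := simplex_ge0 x hm'; have := simplex_le1 x hm'.
  by rewrite ler_norml => h1 h2 h3 h4; apply/andP; split; lra.
apply: hcore => // x.
have -> : m2 ord0 x - m ord0 x = (1 - s) * (m' ord0 x - z ord0 x) + (z ord0 x - m ord0 x).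
  by rewrite m2x; ring.
apply: le_trans (ler_normD _ _) _; rewrite normrM ger0_norm ?subr_ge0//.
have h1 : (1 - s) * `|m' ord0 x - z ord0 x| <= (1 - s) * dl.
  by apply: ler_wpM2l; [rewrite subr_ge0|exact: hc'].
have := hcm x; rewrite distrC => h2.
have : (1 - s) * dl + s * dl = dl by ring.
lra.
Qed.

(** * The deterministic problem: dynamic programming *)

Section control_problem.
Context (R : realType) (d : nat) (gamma : 'I_d -> 'I_d -> R)
  (C : edge d -> R -> \bar R).
Notation jump := (jumps gamma).
Notation S := (@prob_simplex R d).
Notation F e := (transformed_cost (gamma e.1 e.2) (C e)).
Hypothesis hc : forall x y, connect (fun a b => 0 < gamma a b) x y.
Hypothesis cC : forall e, jump e -> convex_cost (C e).
Hypothesis C1 : forall e, jump e -> C e 1 = 0%E.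
Hypothesis hB : assumptionB gamma C.
Hypothesis gd : forall x, gamma x x <= 0.

Let mF e : jump e ->
  measurable_fun (halfline R) (F e).
Proof. by move=> je; apply: measurable_transformed_cost => //; exact: cC. Qed.

Let F0 e x : jump e -> 0 <= x -> (0 <= F e x)%E.
Proof. by move=> je; apply: transformed_cost_ge0 => //; exact: C1. Qed.

Let gN a : jump a -> a.1 != a.2.
Proof.
by move=> ja; apply/eqP => h; move: ja; rewrite /jumps h; have := gd a.2; rewrite leNgt => /negPf ->.
Qed.

Section dynamic_programming.
Implicit Types (m : 'rV[R]_d) (mu : R -> 'rV[R]_d) (q : edge d -> R -> R)
  (K : set 'rV[R]_d) (r : 'rV[R]_d -> R).

Definition path_cost r mu q (s : R) : \bar R := running_cost gamma C r (mu s) (fun e => q e s).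

Section fixed_cost.
Context (r : 'rV[R]_d -> R).
Hypothesis rc : simplex_continuous r.
Hypothesis r0 : forall m, S m -> 0 <= r m.

Lemma running_cost_ge0 m (q : edge d -> R) : S m -> (forall e, jump e -> 0 <= q e) ->
  (0 <= running_cost gamma C r m q)%E.
Proof.
move=> hS q0; apply: adde_ge0; last by rewrite lee_fin r0.
apply: sume_ge0 => e je; apply: mule_ge0; last by apply: F0 => //; exact: q0.
by rewrite lee_fin; have [] := hS.
Qed.

Lemma path_cost_ge0 m mu q s : controlled_path gamma m mu q -> 0 <= s ->
  (0 <= path_cost r mu q s)%E.
Proof.
move=> hp s0; apply: running_cost_ge0; first exact: path_S hp s0.
by move=> e je; have [_ hq _ _] := hp; have [_] := hq e je; apply.
Qed.

Lemma path_running_measurable m mu q : controlled_path gamma m mu q ->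
  measurable_fun (halfline R) (fun s => r (mu s)).
Proof.
move=> hp; apply: measurable_fun_eps_delta => t t0 e e0.
have [dl dl0 hd] := rc (path_S hp t0) e0; have [dl' dl'0 hd'] := path_eps hp t0 dl0.
exists dl' => // s s0 st; apply: hd; first exact: path_S hp s0.
exact: hd'.
Qed.

Lemma path_cost_measurable m mu q : controlled_path gamma m mu q ->
  measurable_fun (halfline R) (path_cost r mu q).
Proof.
move=> hp; have [_ hq _ _] := hp; apply: emeasurable_funD; last first.
  apply/measurable_EFinP; exact: path_running_measurable hp.
rewrite (_ : (fun s => _) = fun s => (\sum_e if jump e then
    (mu s ord0 e.1)%:E * F e (q e s) else 0)%E); last first.
  by apply/funext => s; rewrite big_mkcond.
apply: emeasurable_sum => e; have [je|je] := boolP (jump e); last exact: measurable_cst.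
apply: emeasurable_funM; first by apply/measurable_EFinP; exact: path_coord_measurable hp.
have [mq q0] := hq e je.
apply: (@measurable_comp _ _ _ (mR R) (mR R) _ `[0, +oo[%classic (F e)
  `[0, +oo[%classic (q e)) => //; last exact: mF.
by move=> _ /= [s +  <-]; rewrite /= !in_itv/= !andbT => s0; exact: q0.
Qed.

Lemma total_costE K mu q : total_cost gamma C r K mu q =
  (\int[leb]_(s in horizon (hitting_time K mu)) path_cost r mu q s)%E.
Proof. by []. Qed.

Lemma hitting_time_ge0 K mu : (0 <= hitting_time K mu)%E.
Proof. by apply: le_ereal_inf_tmp => _ [s [s0 _] <-]; rewrite lee_fin. Qed.

Lemma total_cost_ge0 K m mu q : controlled_path gamma m mu q ->
  (0 <= total_cost gamma C r K mu q)%E.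
Proof. by move=> hp; apply: integral_horizon_ge0 => s; exact: path_cost_ge0 hp. Qed.

Lemma value_ge0 K m : (0 <= value gamma C r K m)%E.
Proof. by apply: le_ereal_inf_tmp => _ [mu [q [hp ->]]]; exact: total_cost_ge0 hp. Qed.

Lemma value_le_total K m mu q : controlled_path gamma m mu q ->
  (value gamma C r K m <= total_cost gamma C r K mu q)%E.
Proof. by move=> hp; apply: ereal_inf_lbound; exists mu, q. Qed.

Lemma hitting_time_cat K mu1 mu2 t : 0 <= t ->
  (hitting_time K (cat_fun t mu1 mu2) <= t%:E + hitting_time K mu2)%E.
Proof.
move=> t0; rewrite -leeBlDl//; apply: le_ereal_inf_tmp => _ [s [s0 ks] <-].
rewrite leeBlDl// -EFinD; apply: ereal_inf_lbound; exists (t + s) => //.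
by split; [exact: addr_ge0|rewrite cat_fun_shift].
Qed.

Lemma path_cost_cat mu1 q1 mu2 q2 t :
  path_cost r (cat_fun t mu1 mu2) (fun e => cat_fun t (q1 e) (q2 e)) =
  cat_fun t (path_cost r mu1 q1) (path_cost r mu2 q2).
Proof. by apply/funext => s; rewrite /path_cost /cat_fun; case: ifP. Qed.

(** Concatenation with an arbitrary continuation. Hitting [K] before [t] only shortens the integral,
    since costs are nonnegative. *)
Lemma value_le_cost K m mu q t : controlled_path gamma m mu q -> 0 <= t ->
  (value gamma C r K m <=
   \Int_(s < t) path_cost r mu q s + value gamma C r K (mu t))%E.
Proof.
move=> hp t0; set I := integral _ _ _.
have I0 : (0 <= I)%E by apply: integral_horizon_ge0 => s; exact: path_cost_ge0 hp.
have [Ifin|] := boolP (I \is a fin_num); last first.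
  rewrite ge0_fin_numE// -leNgt leye_eq => /eqP ->; rewrite addye ?leey// gt_eqF//.
  by apply: lt_le_trans (value_ge0 _ _); exact: ltNyr.
rewrite -leeBlDl//; apply: le_ereal_inf_tmp => _ [mu2 [q2 [hp2 ->]]].
rewrite leeBlDl//; apply: le_trans (value_le_total K (path_cat hp t0 hp2)) _.
rewrite !total_costE path_cost_cat; have h2 := hitting_time_ge0 K mu2.
have m1 := path_cost_measurable hp; have m2 := path_cost_measurable hp2.
have p1 s : 0 <= s -> (0 <= path_cost r mu q s)%E by exact: path_cost_ge0 hp.
have p2 s : 0 <= s -> (0 <= path_cost r mu2 q2 s)%E by exact: path_cost_ge0 hp2.
rewrite -integral_cat_fun//; apply: integral_horizonS.
- exact: hitting_time_cat.
- exact: measurable_cat_fun.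
- move=> s s0; rewrite /cat_fun; case: ifPn => [_|]; first exact: p1.
  by rewrite -leNgt => ts; apply: p2; rewrite subr_ge0.
Qed.

(** The converse half of dynamic programming: the shifted path competes for the value at [mu t],
    provided that [K] has not been hit before. *)
Lemma total_cost_ge K m mu q t : controlled_path gamma m mu q -> 0 <= t ->
  (forall s, 0 <= s -> s < t -> ~ K (mu s)) ->
  (\Int_(s < t) path_cost r mu q s + value gamma C r K (mu t) <=
   total_cost gamma C r K mu q)%E.
Proof.
move=> hp t0 nK; pose mu' s := mu (t + s); pose q' e s := q e (t + s).
have hp' := path_shift hp t0.
have pc : (forall s : R, 0 <= s -> (0 <= path_cost r mu q s)%E) by move=> s; exact: path_cost_ge0 hp.
have mc := path_cost_measurable hp.
apply: (@le_trans _ _ (\Int_(s < t) path_cost r mu q s +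
  total_cost gamma C r K mu' q'))%E.
  by rewrite leeD2l//; exact: value_le_total hp'.
have -> : total_cost gamma C r K mu' q' =
    (\int[leb]_(s in horizon (hitting_time K mu')) path_cost r mu q (t + s)%R)%E by [].
rewrite -ge0_integral_horizon//; last exact: hitting_time_ge0.
apply: integral_horizonS => //; apply: le_ereal_inf_tmp => _ [s [s0 ks] <-].
have ts : t <= s by rewrite leNgt; apply/negP => st; exact: (nK s).
rewrite -leeBrDl// -EFinB; apply: ereal_inf_lbound; exists (s - t) => //.
by split; [rewrite subr_ge0|rewrite /mu' addrC subrK].
Qed.

Lemma not_hit K mu s : 0 <= s -> (s%:E < hitting_time K mu)%E -> ~ K (mu s).
Proof. by move=> s0; rewrite ltNge => /negP + ks; apply; apply: ereal_inf_lbound; exists s. Qed.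

(** [K] is an arbitrary set here, open neighbourhoods of the target included, so that the hitting
    time need not be attained. *)
Lemma hitting_time_near K m mu q (t e : R) : controlled_path gamma m mu q ->
  hitting_time K mu = t%:E -> 0 < e ->
  exists s, [/\ 0 <= s, K (mu s) & forall x, `|mu s ord0 x - mu t ord0 x| < e].
Proof.
move=> hp ht e0; have t0 : 0 <= t by rewrite -lee_fin -ht hitting_time_ge0.
have [dl dl0 hd] := path_eps hp t0 e0.
have hfin : (hitting_time K mu \is a fin_num)%E by rewrite ht.
have [_ [s [s0 ks] <-]] := lb_ereal_inf_adherent dl0 hfin; rewrite -/(hitting_time K mu) ht -EFinD lte_fin => sd.
exists s; split => //; apply: hd => //.
have ts : t <= s by rewrite -lee_fin -ht; apply: ereal_inf_lbound; exists s.
by rewrite ger0_norm ?subr_ge0// ltrBlDl.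
Qed.

Lemma constant_path m : S m -> controlled_path gamma m (fun=> m) (fun _ _ => 0).
Proof.
move=> hS; have E e : flux (fun=> m) (fun _ _ => 0) e = (fun=> 0).
  by apply/funext => s; rewrite /flux mulr0.
have Z : rate (fun=> 0 : R).
  by split => // t t0; rewrite integral0.
apply: controlled_pathI => //.
- by move=> e je; rewrite E.
- move=> t t0; rewrite big1 ?addr0// => e _; rewrite E /flow /Rintegral integral0//.
  by rewrite scale0r.
Qed.

Lemma value_target K m : S m -> K m -> value gamma C r K m = 0%E.
Proof.
move=> hS km; apply/eqP; rewrite eq_le value_ge0 andbT.
apply: le_trans (value_le_total K (constant_path hS)) _; rewrite total_costE.
have -> : hitting_time K (fun=> m) = 0%E.
  apply/eqP; rewrite eq_le hitting_time_ge0 andbT.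
  by apply: ereal_inf_lbound; exists 0.
by rewrite horizon_fin set_itvco0 integral_set0.
Qed.

End fixed_cost.

End dynamic_programming.

(** * Straight lines and Hoelder continuity of the value *)

Lemma rate_flow_indic (w tau : R) : 0 <= w -> 0 <= tau ->
  rate (fun s => w * \1_(`]0, tau[%classic : set (mR R)) s) /\
  forall t, 0 <= t -> flow (fun s => w * \1_(`]0, tau[%classic : set (mR R)) s) t =
    w * Num.min t tau.
Proof.
move=> w0 tau0.
have m1 : measurable (`]0, tau[%classic : set (mR R)) by exact: measurable_itv.
have I t : 0 <= t -> (\int[leb]_(s in horizon t%:E)
    (w * \1_(`]0, tau[%classic : set (mR R)) s)%:E = (w * Num.min t tau)%:E)%E.
  move=> t0; under eq_integral do rewrite EFinM.
  rewrite ge0_integralZl//; first last.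
  - apply/measurable_EFinP; exact: measurable_indic.
  - exact: measurable_horizon.
  rewrite integral_indic//; last exact: measurable_horizon.
  rewrite EFinM; congr (_ * _)%E.
  rewrite (_ : _ `&` _ = `]0, (Num.min t tau)[%classic :> set (mR R)).
    have lE : leb (`]0, (Num.min t tau)[%classic : set R) = (if (0 < Num.min t tau)%R then (Num.min t tau)%:E else 0)%E.
      by rewrite lebesgue_measure_itv/= lte_fin; case: ifPn => //; rewrite -EFinB subr0.
    rewrite [LHS]lE; case: ifPn => //.
    by rewrite -leNgt ge_min => h; congr _%:E; apply/eqP; rewrite eq_le ge_min le_min t0 tau0 h.
  apply/seteqP; split => s; rewrite horizon_fin /= !in_itv/= lt_min.
    by move=> [/andP[-> ->] /andP[_ ->]].
  by move=> /andP[s0 /andP[st stau]]; rewrite s0 stau (ltW s0) st.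
split.
  split.
  - by apply: measurable_funM => //; exact: measurable_indic.
  - by move=> s s0; rewrite mulr_ge0.
  - by move=> t t0; rewrite I// ltry.
move=> t t0; rewrite /flow /Rintegral -horizon_fin I//.
Qed.

(** Constant fluxes [w] drive the state along a segment. The controls [w / lin s] may be singular at
    both ends, so they are switched on only on the open interval, and [g] dominates their cost
    there. *)
Lemma segment_value_le (r : 'rV[R]_d -> R) K (a : 'rV[R]_d) (w : edge d -> R) (tau t c : R) (g : R -> R) :
  simplex_continuous r -> (forall m, S m -> 0 <= r m) ->
  (forall e, jump e -> 0 < w e) ->
  let lin s := a + s *: \sum_(e | jump e) w e *: jump_vector R e in
  0 <= t <= tau -> (forall s, 0 <= s <= tau -> S (lin s)) ->
  (forall s x, 0 < s < tau -> 0 < lin s ord0 x) ->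
  measurable_fun `]0, t[ g ->
  (forall s, 0 < s < t ->
    (running_cost gamma C r (lin s) (fun e => (w e / lin s ord0 e.1)%R) <= (g s)%:E)%E) ->
  (\int[leb]_(s in `]0%R, t[) (g s)%:E <= c%:E)%E ->
  (value gamma C r K a <= c%:E + value gamma C r K (lin t))%E.
Proof.
move=> rc r0 w0 lin /andP[t0 ttau] hS hp mg hg gc.
have tau0 := le_trans t0 ttau.
have m0t : measurable (`]0, tau[%classic : set (mR R)) by exact: measurable_itv.
pose mu s := lin (Num.min s tau).
pose q e := (fun s => w e / lin s ord0 e.1) \_ (`]0, tau[%classic : set (mR R)).
have qE e s : q e s = if s \in `]0, tau[ then w e / lin s ord0 e.1 else 0.
  by rewrite /q patchE mem_setE.
have fluxE e : jump e -> flux mu q e = (fun s => w e * \1_(`]0, tau[%classic : set (mR R)) s).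
  move=> je; apply/funext => s; rewrite /flux qE indicE mem_setE in_itv/=.
  case: ifPn => [/andP[s1 s2]|_]; last by rewrite !mulr0.
  by rewrite /mu min_l ?(ltW s2)// mulrCA divff ?mulr1// gt_eqF// hp// s1 s2.
have linx s x : lin s ord0 x = a ord0 x + s * (\sum_(e | jump e) w e *: jump_vector R e) ord0 x.
  by rewrite /lin !mxE.
have RF e (je : jump e) := rate_flow_indic (ltW (w0 e je)) tau0.
have cp : controlled_path gamma a mu q.
  apply: controlled_pathI.
  - by move=> s s0; apply: hS; rewrite le_min s0 tau0 ge_min lexx orbT.
  - move=> e je; apply: (@measurable_funS _ _ _ _ setT) => //.
    apply/(measurable_restrictT _ _).1; first exact: m0t.
    apply: open_continuous_measurable_fun => //.
    move=> s; rewrite inE/= in_itv/= => s0; apply: cvgM; first exact: cvg_cst.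
    apply: cvgV; first by rewrite gt_eqF// hp.
    under eq_fun do rewrite linx; rewrite linx.
    by apply: cvgD; [exact: cvg_cst|apply: cvgM => //; exact: cvg_cst].
  - move=> e s je s0; rewrite qE; case: ifPn => // /[!in_itv]/= h.
    by apply: divr_ge0; [exact/ltW/w0|exact/ltW/hp].
  - by move=> e je; rewrite fluxE//; have [] := RF e je.
  - move=> s s0; rewrite /mu /lin; congr (_ + _); rewrite scaler_sumr.
    apply: eq_bigr => e je; rewrite fluxE// (RF e je).2// scalerA mulrC.
    by [].
have mut : mu t = lin t by rewrite /mu min_l.
rewrite -mut; apply: le_trans (value_le_cost rc r0 K cp t0) _.
apply: leeD => //; apply: le_trans gc.
have mc := path_cost_measurable rc cp.
rewrite horizon_fin -integral_itv_obnd_cbnd; last first.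
  apply: measurable_funS mc => // s; rewrite /= !in_itv/= andbT => /andP[s0 _]; exact: ltW.
apply: ge0_le_integral => //.
- by move=> s; rewrite /= in_itv/= => /andP[s0 _]; apply: (path_cost_ge0 r0 cp); exact: ltW.
- apply: measurable_funS mc => // s; rewrite /= !in_itv/= andbT => /andP[s0 _]; exact: ltW.
- by apply/measurable_EFinP.
- move=> s; rewrite /= in_itv/= => hs; apply: le_trans (hg s hs); case/andP: hs => s0 st.
  have stau := lt_le_trans st ttau.
  rewrite /path_cost /mu min_l ?(ltW stau)// /running_cost.
  rewrite [X in (X + _ <= _)%E](eq_bigr (fun e : edge d => (lin s ord0 e.1)%:E * F e (w e / lin s ord0 e.1)%R)%E)//.
  by move=> e je; rewrite qE in_itv/= s0 stau.
Qed.

Lemma cost_bound (c : R) : 0 < c -> exists2 A : R, 0 <= A &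
  forall e q, jump e -> c <= q -> (F e q <= (A * (1 + q * Num.sqrt q))%:E)%E.
Proof.
move=> c0.
have /choice[A hA] : forall e, exists A : R, 0 <= A /\ (jump e -> forall q, c <= q ->
    (F e q <= (A * (1 + q * Num.sqrt q))%:E)%E).
  move=> e; have [je|je] := boolP (jump e); last by exists 0.
  have [B1 B2] := hB je.
  have [A A0 h] := transformed_cost_le je (cC je) (C1 je) B1 B2 c0.
  by exists A.
exists (\sum_e A e); first by apply: sumr_ge0 => e _; exact: (hA e).1.
move=> e q je cq; apply: le_trans ((hA e).2 je q cq) _; rewrite lee_fin ler_wpM2r//.
  by rewrite addr_ge0// mulr_ge0 ?sqrtr_ge0// (le_trans (ltW c0)).
by rewrite (bigD1 e)//= lerDl; apply: sumr_ge0 => e' _; exact: (hA e').1.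
Qed.

Lemma perspective_cost_le (A W w x h : R) : 0 <= A -> 1 <= w <= W -> 0 < x <= 1 ->
  x * (A * (1 + w / x * Num.sqrt (w / x))) <= A * (1 + W * Num.sqrt W / Num.sqrt x).
Proof.
move=> A0 /andP[w1 wW] /andP[x0 x1]; have w0 : 0 < w by exact: lt_le_trans w1.
rewrite mulrCA ler_wpM2l// mulrDr mulr1 lerD//.
rewrite mulrA mulrCA divff ?gt_eqF// mulr1 sqrtrM ?(ltW w0)// sqrtrV ?(ltW x0)// mulrA.
rewrite ler_wpM2r ?invr_ge0 ?sqrtr_ge0//; apply: ler_pM => //; rewrite ?(ltW w0)// ?sqrtr_ge0//.
by rewrite ler_wsqrtr.
Qed.

(** The cost density is of order [1 / sqrt] of the coordinates, which are at least
    [min s (lam - s) / d], so its integral over a segment of duration [lam] is of order [sqrt lam]: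
    the origin of the Hoelder exponent 1/2. *)
Lemma straight_line_value_le (M : R) : (0 < d)%N -> exists2 B : R, 0 <= B &
  forall (r : 'rV[R]_d -> R) K (a b : 'rV[R]_d) (lam : R),
  simplex_continuous r -> (forall m, S m -> 0 <= r m <= M) ->
  S a -> S b -> 0 < lam <= 1 -> (forall x, `|b ord0 x - a ord0 x| <= 2 * lam) ->
  (forall s x, 0 < s < lam ->
     Num.min s (lam - s) / d%:R <= a ord0 x + s / lam * (b ord0 x - a ord0 x)) ->
  (value gamma C r K a <= (B * Num.sqrt lam)%:E + value gamma C r K b)%E.
Proof.
move=> d0; have [W W1 hW] := flux_exists (Ordinal d0) hc.
have [A A0 hA] := cost_bound ltr01.
have W0 : 0 <= W by exact: le_trans W1.
pose D : R := 1 + W * Num.sqrt W * Num.sqrt d%:R.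
have D1 : 1 <= D by rewrite lerDl !mulr_ge0 ?sqrtr_ge0.
pose B : R := `|M| + #|{: edge d}|%:R * (A * D).
have B0 : 0 <= B by rewrite addr_ge0// !mulr_ge0// (le_trans _ D1).
exists (B * 4); first by rewrite mulr_ge0.
move=> r K a b lam rc rM hSa hSb /andP[l0 l1] ab hlow.
pose u : 'rV[R]_d := lam^-1 *: (b - a).
have us : \sum_x u ord0 x = 0.
  rewrite (eq_bigr (fun x => lam^-1 * (b ord0 x - a ord0 x))); last by move=> x _; rewrite !mxE.
  by rewrite -mulr_sumr sumrB hSa.2 hSb.2 subrr mulr0.
have u2 x : `|u ord0 x| <= 2.
  rewrite !mxE normrM gtr0_norm ?invr_gt0// mulrC ler_pdivrMr//; exact: ab.
have [w hw wu] := hW u us u2.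
have w0 e : 0 < w e by case/andP: (hw e) => + _; exact: lt_le_trans.
have l00 : lam != 0 by rewrite gt_eqF.
have linE s : a + s *: u = (1 - s / lam) *: a + (s / lam) *: b.
  by rewrite /u scalerA scalerBr scalerBl scale1r -addrA [- _ + _]addrC.
have linx s x : (a + s *: u) ord0 x = a ord0 x + s / lam * (b ord0 x - a ord0 x).
  by rewrite !mxE mulrA.
have linS s : 0 <= s <= lam -> S (a + s *: u).
  move=> /andP[s0 sl]; rewrite linE; apply: simplex_convex => //.
  by rewrite divr_ge0 ?(ltW l0)//= ler_pdivrMr// mul1r.
have d0' : 0 < (d%:R : R) by rewrite ltr0n.
have hmin s : 0 < s < lam -> 0 < Num.min s (lam - s) by move=> /andP[s0 sl]; rewrite lt_min s0 subr_gt0.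
have linp s x : 0 < s < lam -> 0 < (a + s *: u) ord0 x.
  move=> sl; rewrite linx; apply: lt_le_trans (hlow s x sl); exact: divr_gt0 (hmin s sl) _.
have -> : b = a + lam *: u by rewrite linE divff// subrr scale0r add0r scale1r.
pose g s : R := (Num.sqrt s)^-1 + (Num.sqrt (lam - s))^-1.
have [mg Ig] := integral_invsqrt_le l0.
have r0 m : S m -> 0 <= r m by move=> /rM/andP[].
rewrite -wu; apply: (@segment_value_le r K a w lam lam (B * 4 * Num.sqrt lam) (fun s => B * g s)) => //; rewrite ?wu//.
- by rewrite lexx (ltW l0).
- exact: measurable_funM.
- move=> s sl; have m0 := hmin s sl; set h := Num.min s _ in m0.
  have hS : S (a + s *: u) by apply: linS; case/andP: sl => /ltW -> /ltW.
  have h1 : 1 <= (Num.sqrt h)^-1.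
    rewrite invf_ge1 ?sqrtr_gt0// -[leRHS]sqrtr1 ler_wsqrtr// ge_min.
    by case/andP: sl => _ /ltW sl; rewrite (le_trans sl).
  have hg : (Num.sqrt h)^-1 <= g s.
    have [hh|/ltW hh] := leP s (lam - s); rewrite /h /g.
      by rewrite min_l// lerDl invr_ge0 sqrtr_ge0.
    by rewrite min_r// lerDr invr_ge0 sqrtr_ge0.
  have E e : jump e ->
      (((a + s *: u) ord0 e.1)%:E * F e (w e / (a + s *: u) ord0 e.1)%R <= (A * D * (Num.sqrt h)^-1)%:E)%E.
    move=> je; set y := (a + s *: u) ord0 e.1.
    have y0 : 0 < y by exact: linp.
    have y1 : y <= 1 by exact: simplex_le1 hS.
    have [w1 wW] := andP (hw e).
    have wy : 1 <= w e / y by rewrite ler_pdivlMr// mul1r (le_trans y1).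
    apply: le_trans (lee_wpmul2l _ (hA e _ je wy)) _; first by rewrite lee_fin ltW.
    rewrite -EFinM lee_fin; apply: le_trans (perspective_cost_le 0 A0 (hw e) _) _.
      by rewrite y0.
    rewrite -(mulrA A D); apply: ler_wpM2l => //; rewrite /D mulrDl mul1r; apply: lerD => //.
    rewrite -(mulrA (W * _)); apply: ler_wpM2l; first by rewrite mulr_ge0 ?sqrtr_ge0.
    have hy : h / d%:R <= y by rewrite /y linx; exact: hlow.
    rewrite -sqrtrV ?(ltW y0)// -sqrtrV ?(ltW m0)// -sqrtrM ?ler0n// ler_wsqrtr//.
    by rewrite -[leRHS]invrK invfM invrK lef_pV2 ?posrE// ?mulr_gt0 ?invr_gt0// mulrC.
  rewrite /running_cost.
  have -> : (B * g s)%:E = ((#|{: edge d}|%:R * (A * D) * g s)%:E + (`|M| * g s)%:E)%E.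
    by rewrite -EFinD -mulrDl addrC.
  have g1 : 1 <= g s by exact: le_trans hg.
  apply: leeD; last first.
    rewrite lee_fin; apply: (@le_trans _ _ (`|M| * 1)); last by rewrite ler_wpM2l.
    by rewrite mulr1 (le_trans _ (ler_norm M))//; case/andP: (rM _ hS).
  apply: (@le_trans _ _ (\sum_(e : edge d) (A * D * (Num.sqrt h)^-1)%:E)%E).
    rewrite big_mkcond; apply: lee_sum => e _; case: ifPn => je; first exact: E.
    by rewrite lee_fin !mulr_ge0// ?(le_trans _ D1)// (le_trans _ h1).
  rewrite sumEFin lee_fin sumr_const -[leLHS]mulr_natl -(mulrA _ (A * D)).
  apply: ler_wpM2l => //; apply: ler_wpM2l => //.
  by rewrite mulr_ge0// (le_trans _ D1).
- rewrite (_ : (\int[leb]_(s in `]0%R, lam[) (B * g s)%:E)%E =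
    (B%:E * \int[leb]_(s in `]0%R, lam[) (g s)%:E)%E).
    by rewrite -[B * 4]/(B * 4) -mulrA EFinM; apply: lee_wpmul2l.
  under eq_integral do rewrite EFinM; rewrite ge0_integralZl//.
    by apply/measurable_EFinP.
  by move=> s _; rewrite lee_fin addr_ge0// invr_ge0 sqrtr_ge0.
Qed.

(** Two segments through a point [c] mixed with weight [lam] with the uniform point: its coordinates
    are at least [lam / d], so both segments leave the boundary linearly. [B] depends on [r] and [K]
    only through [M], as both are perturbed later. *)
Lemma value_holder (M : R) : (0 < d)%N -> exists2 B : R, 0 <= B &
  forall (r : 'rV[R]_d -> R) K (m m' : 'rV[R]_d) (lam : R),
  simplex_continuous r -> (forall m, S m -> 0 <= r m <= M) ->
  S m -> S m' -> 0 < lam <= 1 -> (forall x, `|m ord0 x - m' ord0 x| <= lam) ->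
  (value gamma C r K m <= (B * Num.sqrt lam)%:E + value gamma C r K m')%E.
Proof.
move=> d0; have [B B0 hBd] := straight_line_value_le M d0.
exists (B + B); first exact: addr_ge0.
move=> r K m m' lam rc rM hS hS' /andP[l0 l1] mm'.
pose c : 'rV[R]_d := (1 - lam) *: ((1 - 2^-1) *: m + 2^-1 *: m') + lam *: uniform_point R d.
have hmid : S ((1 - 2^-1) *: m + 2^-1 *: m').
  by apply: simplex_convex => //; apply/andP; split; lra.
have hc' : S c by apply: simplex_convex => //; [rewrite (ltW l0)|exact: uniform_simplex].
have d1 : 0 <= (d%:R^-1 : R) <= 1.
  by rewrite invr_ge0 ler0n invf_le1 ?ltr0n// ler1n.
have cx x : c ord0 x = (1 - lam) * ((m ord0 x + m' ord0 x) / 2) + lam * d%:R^-1.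
  by rewrite !mxE; field; rewrite pnatr_eq0 -lt0n.
have clow x : lam * d%:R^-1 <= c ord0 x.
  rewrite cx lerDr mulr_ge0 ?subr_ge0// divr_ge0// addr_ge0//; exact: simplex_ge0.
have aux (u v : R) : 0 <= u <= 1 -> 0 <= v <= 1 -> `|u - v| <= lam ->
    `|(1 - lam) * ((u + v) / 2) + lam * d%:R^-1 - u| <= 2 * lam.
  move=> /andP[u0 u1] /andP[v0 v1] uv.
  have -> : (1 - lam) * ((u + v) / 2) + lam * d%:R^-1 - u =
    (1 - lam) * ((v - u) / 2) + lam * (d%:R^-1 - u) by field; rewrite pnatr_eq0 -lt0n.
  case/andP: d1 => d2 d3.
  rewrite distrC in uv.
  apply: (le_trans (ler_normD _ _)).
  rewrite !normrM (gtr0_norm l0) (@ger0_norm _ (1 - lam)) ?subr_ge0//.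
  have h1 : `|d%:R^-1 - u| <= 1 by rewrite ler_norml; apply/andP; split; lra.
  rewrite (ger0_norm (_ : 0 <= 2^-1 :> R))//.
  have h2 : (1 - lam) * (`|v - u| * 2^-1) <= lam.
    rewrite (@le_trans _ _ (1 * (`|v - u| * 2^-1)))//.
      by rewrite ler_wpM2r// ?mulr_ge0//; lra.
    have := normr_ge0 (v - u); lra.
  have h3 : lam * `|d%:R^-1 - u| <= lam by rewrite ger_pMr.
  lra.
have b01 (z : 'rV[R]_d) x : S z -> 0 <= z ord0 x <= 1.
  by move=> hz; rewrite simplex_ge0// simplex_le1.
have lam0 : lam != 0 by rewrite gt_eqF.
apply: le_trans (hBd r K m c lam rc rM hS hc' _ _ _) _.
- by rewrite l0.
- by move=> x; rewrite cx; apply: aux; rewrite ?b01.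
- move=> s x /andP[s0 sl].
  rewrite (@le_trans _ _ (s / d%:R))//; first by rewrite ler_wpM2r ?invr_ge0// ge_min lexx.
  have -> : m ord0 x + s / lam * (c ord0 x - m ord0 x) =
    (1 - s / lam) * m ord0 x + s / lam * c ord0 x by ring.
  have sl1 : s / lam <= 1 by rewrite ler_pdivrMr// mul1r ltW.
  rewrite (@le_trans _ _ (s / lam * c ord0 x))//; last first.
    by rewrite lerDr mulr_ge0 ?subr_ge0// simplex_ge0.
  rewrite (@le_trans _ _ (s / lam * (lam * d%:R^-1)))//; first by rewrite mulrA divfK.
  by rewrite ler_wpM2l// divr_ge0// ltW.
rewrite mulrDl EFinD -addeA; apply: leeD => //.
apply: (hBd r K c m' lam rc rM hc' hS').
- by rewrite l0.
- move=> x; rewrite cx distrC [m ord0 x + _]addrC; apply: aux; rewrite ?b01//.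
  by rewrite distrC.
- move=> s x /andP[s0 sl].
  rewrite (@le_trans _ _ ((lam - s) / d%:R))//; first by rewrite ler_wpM2r ?invr_ge0// ge_min lexx orbT.
  have -> : c ord0 x + s / lam * (m' ord0 x - c ord0 x) =
    (1 - s / lam) * c ord0 x + s / lam * m' ord0 x by ring.
  have sl1 : s / lam <= 1 by rewrite ler_pdivrMr// mul1r ltW.
  rewrite (@le_trans _ _ ((1 - s / lam) * c ord0 x))//; last first.
    by rewrite lerDl mulr_ge0 ?simplex_ge0// divr_ge0// ltW.
  rewrite (@le_trans _ _ ((1 - s / lam) * (lam * d%:R^-1)))//.
    rewrite le_eqVlt (_ : (1 - s / lam) * (lam * d%:R^-1) = (lam - s) / d%:R) ?eqxx//.
    by field; rewrite lam0 pnatr_eq0 -lt0n d0.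
  by rewrite ler_wpM2l// subr_ge0.
Qed.

(** * Time averages along paths and the viscosity inequalities *)

Section cost.
Context (r : 'rV[R]_d -> R) (K : set 'rV[R]_d).
Hypothesis rc : simplex_continuous r.
Hypothesis r0 : forall m, S m -> 0 <= r m.

Section path_averages.
Variables (z : 'rV[R]_d) (mu : R -> 'rV[R]_d) (q : edge d -> R -> R).
Hypothesis hp : controlled_path gamma z mu q.

Definition edge_cost e s : \bar R := ((mu s ord0 e.1)%:E * F e (q e s))%E.

Let mu0 s x : 0 <= s -> 0 <= mu s ord0 x.
Proof. by move=> s0; apply: simplex_ge0; exact: path_S hp s0. Qed.

Let q0 e s : jump e -> 0 <= s -> 0 <= q e s.
Proof. by move=> je s0; have [_ hq _ _] := hp; have [_] := hq e je; apply. Qed.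

Lemma edge_cost_ge0 e s : jump e -> 0 <= s -> (0 <= edge_cost e s)%E.
Proof. by move=> je s0; rewrite mule_ge0 ?lee_fin ?mu0// F0// q0. Qed.

Lemma edge_cost_measurable e : jump e ->
  measurable_fun (halfline R) (edge_cost e).
Proof.
move=> je; apply: emeasurable_funM; first by apply/measurable_EFinP; exact: path_coord_measurable hp.
have [_ hq _ _] := hp; have [mq _] := hq e je.
apply: (@measurable_comp _ _ _ (mR R) (mR R) _ `[0, +oo[%classic (F e)
  `[0, +oo[%classic (q e)) => //; last exact: mF.
by move=> _ /= [s +  <-]; rewrite /= !in_itv/= !andbT => s0; exact: q0.
Qed.

Lemma path_cost_integral t : 0 <= t ->
  (\Int_(s < t) path_cost r mu q s =
   \sum_(e | jump e) \Int_(s < t) edge_cost e s +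
   \Int_(s < t) (r (mu s))%:E)%E.
Proof.
move=> t0; have mh := @measurable_horizon R t%:E.
have mr := path_running_measurable rc hp.
have mE : measurable_fun (horizon t%:E) (fun s => \sum_(e | jump e) edge_cost e s)%E.
  rewrite (_ : (fun s => _) = fun s => (\sum_e if jump e then edge_cost e s else 0)%E); last first.
    by apply/funext => s; rewrite big_mkcond.
  apply: emeasurable_sum => e; have [je|je] := boolP (jump e); last exact: measurable_cst.
  by apply: measurable_funS (edge_cost_measurable je) => //; exact: horizon_sub.
have E0 s : horizon t%:E s -> (0 <= \sum_(e | jump e) edge_cost e s)%E.
  by move=> [s0 _]; apply: sume_ge0 => e je; exact: edge_cost_ge0.
transitivity (\Int_(s < t) (\sum_(e | jump e) edge_cost e s + (r (mu s))%:E))%E.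
  by [].
rewrite ge0_integralD//; last 2 first.
- by move=> s [s0 _]; rewrite lee_fin r0//; exact: path_S hp s0.
- by apply/measurable_EFinP; apply: measurable_funS mr => //; exact: horizon_sub.
congr (_ + _)%E.
transitivity (\Int_(s < t) \sum_e (if jump e then edge_cost e s else 0))%E.
  by apply: eq_integral => s _; rewrite big_mkcond.
rewrite ge0_integral_sum//; first last.
- by move=> e s [s0 _]; case: ifPn => // je; exact: edge_cost_ge0.
- move=> e; have [je|je] := boolP (jump e); last exact: measurable_cst.
  by apply: measurable_funS (edge_cost_measurable je) => //; exact: horizon_sub.
rewrite [RHS]big_mkcond; apply: eq_bigr => e _; case: ifPn => // _.
by rewrite integral0.
Qed.

Lemma coord_rate x : rate (fun s => mu s ord0 x).
Proof.
split; first exact: path_coord_measurable hp.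
  by move=> s s0; exact: mu0.
move=> t t0; have [_ _ /(_ t t0)] := @rate_cst R 1 ler01.
apply: le_lt_trans; apply: ge0_le_integral => //; try exact: measurable_horizon.
- by move=> s [s0 _]; rewrite lee_fin mu0.
- apply/measurable_EFinP; apply: measurable_funS (path_coord_measurable x hp) => //; exact: horizon_sub.
- by move=> s [s0 _]; rewrite lee_fin simplex_le1//; exact: path_S hp s0.
Qed.

Lemma coord_flow_sum t : 0 <= t -> \sum_x flow (fun s => mu s ord0 x) t = t.
Proof.
move=> t0; apply: EFin_inj; rewrite -sumEFin.
rewrite (eq_bigr (fun x => \Int_(s < t) (mu s ord0 x)%:E)%E); last first.
  by move=> x _; rewrite flowE//; exact: coord_rate.
rewrite -ge0_integral_sum//; first last.
- by move=> x s [s0 _]; rewrite lee_fin mu0.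
- by move=> x; apply: measurable_funS (rate_measurable (coord_rate x)) => //; exact: horizon_sub.
- exact: measurable_horizon.
rewrite (eq_integral (fun=> 1%:E)).
  by rewrite (flowE (rate_cst ler01))// flow_cst// mul1r.
by move=> s; rewrite inE => -[s0 _]; rewrite sumEFin; have [_ ->] := path_S hp s0.
Qed.

(** Jensen's inequality for the perspective cost, stated through minorants: [a * mu_x + b * flux] is
    linear and passes through the time integral, also where the averaged mass is 0. *)
Lemma averaged_minorant e (a b c t : R) : jump e -> 0 <= t ->
  minorant (gamma e.1 e.2) (C e) a b ->
  (\Int_(s < t) edge_cost e s <= c%:E)%E ->
  a * flow (fun s => mu s ord0 e.1) t + b * flow (flux mu q e) t <= c.
Proof.
move=> je t0 hm hle; have mh := @measurable_horizon R t%:E.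
have I (f : R -> R) : rate f -> leb.-integrable (horizon t%:E) (EFin \o f).
  move=> rf; apply: integrableS (rate_integrable rf t0) => //.
  by rewrite horizon_fin => s; rewrite /= !in_itv/= => /andP[-> /ltW].
have i1 := I _ (coord_rate e.1); have i2 := I _ (path_rate hp je).
have m3 : measurable_fun (horizon t%:E) (edge_cost e).
  by apply: measurable_funS (edge_cost_measurable je) => //; exact: horizon_sub.
have i3 : leb.-integrable (horizon t%:E) (edge_cost e).
  apply/integrableP; split => //.
  have -> : (\Int_(s < t) `|edge_cost e s| =
      \Int_(s < t) edge_cost e s)%E; last first.
    exact: le_lt_trans hle (ltry _).
  apply: eq_integral; by move=> s; rewrite inE => -[s0 _]; rewrite gee0_abs// edge_cost_ge0.
have j1 := integrableZl mh a i1; have j2 := integrableZl mh b i2.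
rewrite -lee_fin; apply: le_trans hle; rewrite EFinD !EFinM.
rewrite -(flowE (coord_rate e.1) t0) -(flowE (path_rate hp je) t0).
rewrite -(integralZl mh i1) -(integralZl mh i2) -integralD//.
apply: le_integral => //; first exact: integrableD.
move=> s; rewrite inE => -[s0 _]; rewrite /edge_cost /= -!EFinM -EFinD.
have -> : a * mu s ord0 e.1 + b * flux mu q e s = mu s ord0 e.1 * (a + b * q e s).
  by rewrite /flux; ring.
by rewrite EFinM; apply: lee_wpmul2l; [rewrite lee_fin mu0|apply: hm; exact: q0].
Qed.

(** The minorant of slope [M] bounds the flow by [c / M] plus a multiple of the elapsed time:
    superlinearity keeps paths of bounded cost from moving far in a short time. *)
Lemma flow_bound (c M t : R) e : jump e -> 0 <= t -> 0 <= M ->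
  (\Int_(s < t) edge_cost e s <= c%:E)%E ->
  M * flow (flux mu q e) t <= c + total_rate gamma * expR M * flow (fun s => mu s ord0 e.1) t.
Proof.
move=> je t0 M0 hle; have := averaged_minorant je t0 (minorant_exp je (C1 je) M) hle.
set f := flow (fun s => _) t; set g := flow _ t.
have f0 : 0 <= f by apply: flow_ge0 => //; exact: coord_rate.
have : gamma e.1 e.2 * (expR M - 1) * f <= total_rate gamma * expR M * f.
  rewrite ler_wpM2r//; apply: ler_pM.
  - exact: ltW.
  - by rewrite subr_ge0 -expR0 ler_expR.
  - by rewrite /total_rate (bigD1 e)//= ler_wpDr ?ler_norm// sumr_ge0.
  - by rewrite lerBlDr lerDl.
lra.
Qed.

Lemma coord_flow_le x t : 0 <= t -> flow (fun s => mu s ord0 x) t <= t.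
Proof.
move=> t0; rewrite -[leRHS]mul1r -flow_cst//; apply: le_flow => //.
- exact: coord_rate.
- exact: rate_cst.
- by move=> s /andP[s0 _]; apply: simplex_le1; exact: path_S hp s0.
Qed.

Lemma edge_cost_le (c t : R) e : jump e -> 0 <= t ->
  (\Int_(s < t) path_cost r mu q s <= c%:E)%E ->
  (\Int_(s < t) edge_cost e s <= c%:E)%E.
Proof.
move=> je t0; apply: le_trans; rewrite path_cost_integral// (bigD1 e)//= -addeA leeDl//.
rewrite adde_ge0//.
  by apply: sume_ge0 => e' /andP[je' _]; apply: integral_horizon_ge0 => s s0; exact: edge_cost_ge0.
by apply: integral_horizon_ge0 => s s0; rewrite lee_fin r0//; exact: path_S hp s0.
Qed.

Lemma path_displacement t x : 0 <= t ->
  `|mu t ord0 x - z ord0 x| <= \sum_(e | jump e) flow (flux mu q e) t.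
Proof.
move=> t0.
have -> : mu t ord0 x = z ord0 x + (\sum_(e | jump e) flow (flux mu q e) t *: jump_vector R e) ord0 x.
  by rewrite {1}(path_eqP hp t0) mxE.
rewrite addrC addKr summxE.
apply: le_trans (ler_norm_sum _ _ _) _; apply: ler_sum => e je; rewrite mxE normrM.
have f0 : 0 <= flow (flux mu q e) t by apply: flow_ge0 => //; exact: path_rate hp je.
by rewrite (ger0_norm f0) -[leRHS]mulr1 ler_wpM2l// jump_vector_le1.
Qed.

Lemma path_stays (B M rho t : R) : 0 <= B -> 1 <= M -> 0 < rho -> 0 <= t ->
  (total_cost gamma C r K mu q <= B%:E)%E ->
  (forall m, S m -> (forall x, `|m ord0 x - z ord0 x| <= rho) -> ~ K m) ->
  #|{: edge d}|%:R * ((B + total_rate gamma * expR M * t) / M) <= rho / 2 ->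
  forall s, 0 <= s <= t -> (forall x, `|mu s ord0 x - z ord0 x| <= rho / 2) /\ ~ K (mu s).
Proof.
move=> B0 M1 rho0 t0 hT hK hM.
have M0 : 0 < M by exact: lt_le_trans M1.
have G0 : 0 <= total_rate gamma by apply: sumr_ge0.
have near u : 0 <= u <= t -> (forall s, 0 <= s -> s < u -> ~ K (mu s)) ->
    forall x, `|mu u ord0 x - z ord0 x| <= rho / 2.
  move=> /andP[u0 ut] nK x; apply: le_trans (path_displacement x u0) _; apply: le_trans hM.
  have hle : (\Int_(s < u) path_cost r mu q s <= B%:E)%E.
    apply: le_trans hT; apply: le_trans (total_cost_ge rc r0 hp u0 nK).
    by rewrite leeDl// (value_ge0 r0).
  rewrite mulr_natl -sumr_const big_mkcond/=; apply: ler_sum => e _.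
  have b0 : 0 <= (B + total_rate gamma * expR M * t) / M.
    by rewrite divr_ge0 ?(ltW M0)// addr_ge0// !mulr_ge0// expR_ge0.
  case: ifPn => // je; rewrite ler_pdivlMr// mulrC.
  apply: le_trans (flow_bound je u0 (ltW M0) (edge_cost_le je u0 hle)) _.
  rewrite lerD2l ler_wpM2l// ?mulr_ge0 ?expR_ge0//.
  exact: le_trans (coord_flow_le _ u0) ut.
(* The cost bounds the flow only before [K] is hit, which calls for a continuity argument: until [O]
   is reached the path stays within [rho / 2] of [z], hence away from [O], so it does not reach [O]
   before [t]. *)
pose O : set 'rV[R]_d := [set m | K m \/ exists x, rho < `|m ord0 x - z ord0 x|].
have tO : (t%:E <= hitting_time O mu)%E.
  rewrite leNgt; apply/negP => lt.
  have [tau tauE] : exists tau, hitting_time O mu = tau%:E.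
    exists (fine (hitting_time O mu)); rewrite fineK// ge0_fin_numE ?hitting_time_ge0//.
    exact: lt_le_trans lt (leey _).
  have tau0 : 0 <= tau by rewrite -lee_fin -tauE hitting_time_ge0.
  have taut : tau <= t by rewrite -lee_fin -tauE ltW.
  have ntau : forall x, `|mu tau ord0 x - z ord0 x| <= rho / 2.
    apply: near; first by rewrite tau0.
    move=> s s0 st ks; have : (s%:E < hitting_time O mu)%E by rewrite tauE lte_fin.
    by move=> /(not_hit s0); apply; left.
  have rho4 : 0 < rho / 2 by rewrite divr_gt0.
  have [s [s0 [ks|[x hx]] hs]] := hitting_time_near hp tauE rho4.
    apply: (hK (mu s) (path_S hp s0) _ ks) => x.
    rewrite (_ : _ - _ = (mu s ord0 x - mu tau ord0 x) + (mu tau ord0 x - z ord0 x)); last by ring.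
    apply: le_trans (ler_normD _ _) _; have := hs x; have := ntau x; lra.
  move: hx; rewrite (_ : _ - _ = (mu s ord0 x - mu tau ord0 x) + (mu tau ord0 x - z ord0 x)); last by ring.
  have := ler_normD (mu s ord0 x - mu tau ord0 x) (mu tau ord0 x - z ord0 x).
  have := hs x; have := ntau x; lra.
move=> s /andP[s0 st].
have nK u : 0 <= u -> u < s -> ~ K (mu u).
  move=> u0 us ku; have : (u%:E < hitting_time O mu)%E.
    by apply: lt_le_trans tO; rewrite lte_fin (lt_le_trans us).
  by move=> /(not_hit u0); apply; left.
have h := near s _ nK; split; first by apply: h; rewrite s0.
apply: hK; first exact: path_S hp s0.
by move=> x; apply: le_trans (h _ x) _; [rewrite s0|lra].
Qed.

End path_averages.

Section viscosity.
Variable v : 'rV[R]_d -> R.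
Hypothesis vE : forall m, S m -> value gamma C r K m = (v m)%:E.

Lemma transformed_cost_fin e q : jump e -> 0 < q -> F e q \is a fin_num.
Proof.
move=> je q0; have [A A0 h] := cost_bound q0.
rewrite ge0_fin_numE ?F0 ?(ltW q0)//; exact: le_lt_trans (h e q je (lexx _)) (ltry _).
Qed.

Lemma perspective_line e (x u w t0 s : R) : jump e -> 0 < x -> 0 < x + t0 * u -> 0 < w ->
  0 < t0 -> 0 <= s <= t0 ->
  ((x + s * u)%:E * F e (w / (x + s * u))%R <=
   (x * fine (F e (w / x)) + s / t0 * ((x + t0 * u) * fine (F e (w / (x + t0 * u)))))%:E)%E.
Proof.
move=> je x0 y0 w0 t00 /andP[s0 st]; set y := x + t0 * u in y0 *.
have k0 : 0 <= s / t0 by rewrite divr_ge0// ltW.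
have k1 : s / t0 <= 1 by rewrite ler_pdivrMr// mul1r.
have zE : x + s * u = (1 - s / t0) * x + (1 - (1 - s / t0)) * y.
  by rewrite /y; field; rewrite gt_eqF.
have wE : w = (1 - s / t0) * (x * (w / x)) + (1 - (1 - s / t0)) * (y * (w / y)).
  by field; rewrite !gt_eqF.
have z0 : 0 < x + s * u.
  rewrite zE; have [->|sn] := eqVneq s 0; first by rewrite mul0r subr0 subrr mul1r mul0r addr0.
  by rewrite ltr_wpDl ?mulr_ge0 ?subr_ge0 ?(ltW x0)// mulr_gt0// opprB addrC subrK divr_gt0// lt0r sn.
rewrite {1}wE; apply: le_trans (transformed_cost_perspective je (cC je) _ _ _ _ _ zE z0 _) _.
- by rewrite subr_ge0 k1 gerBl.
- exact: ltW.
- exact: ltW.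
- by rewrite divr_ge0 ?ltW.
- by rewrite divr_ge0 ?ltW.
- by rewrite -wE.
have e1 := fineK (transformed_cost_fin je (divr_gt0 w0 x0)).
have e2 := fineK (transformed_cost_fin je (divr_gt0 w0 y0)).
rewrite -e1 -e2 -!EFinM -EFinD lee_fin; apply: lerD; last by rewrite opprB addrC subrK lexx.
rewrite -[leRHS]mul1r ler_wpM2r ?gerBl// mulr_ge0 ?(ltW x0)// fine_ge0// F0// divr_ge0 ?ltW//.
Qed.

(** The test function touches [v] from above at an interior point. Fluxes [w] held constant for a
    short time bound [v z] by the cost and [v] at the end of the segment; a negative Hamiltonian [E]
    would contradict the touching. *)
Lemma value_subsolution (z : 'rV[R]_d) (w : edge d -> R) (p : 'I_d -> R) (b : R) :
  S z -> (forall x, 0 < z ord0 x) -> (forall e, jump e -> 0 < w e) -> 0 <= b ->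
  (forall z', S z' -> v z' <= v z + \sum_x p x * (z' ord0 x - z ord0 x) +
     b * \sum_x (z' ord0 x - z ord0 x) ^+ 2) ->
  (0 <= running_cost gamma C r z (fun e => (w e / z ord0 e.1)%R) +
    (\sum_(e | jump e) w e * (p e.2 - p e.1))%:E)%E.
Proof.
move=> hz z0 w0 b0 hv.
pose u := \sum_(e | jump e) w e *: jump_vector R e.
pose G0 e : R := z ord0 e.1 * fine (F e (w e / z ord0 e.1)).
have G0E e : jump e -> ((z ord0 e.1)%:E * F e (w e / z ord0 e.1)%R)%E = (G0 e)%:E.
  by move=> je; rewrite /G0 EFinM fineK// transformed_cost_fin// divr_gt0// w0.
rewrite /running_cost (eq_bigr _ G0E) sumEFin -!EFinD lee_fin.
rewrite -dot_jump_sum -/u leNgt; apply/negP => neg.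
set E := _ + _ in neg.
have us : \sum_x u ord0 x = 0.
  have := dot_jump_sum gamma (fun=> 1) w; rewrite -/u [RHS]big1 => [h|e _]; last by rewrite subrr mulr0.
  by rewrite -[RHS]h; apply: eq_bigr => x _; rewrite mul1r.
have linx s x : (z + s *: u) ord0 x = z ord0 x + s * u ord0 x by rewrite mxE [X in _ + X]mxE.
pose U : R := 1 + \sum_x `|u ord0 x|.
have U0 : 0 < U by rewrite ltr_pwDl// sumr_ge0.
have uU x : `|u ord0 x| <= U.
  rewrite /U (bigD1 x)//= addrCA lerDl addr_ge0// sumr_ge0//.
(* The coordinates lie in [[0, 1]], so their product is a positive lower bound of each. *)
have [z1 z10 zz1] : exists2 z1 : R, 0 < z1 & forall x, z1 <= z ord0 x.
  exists (\prod_x z ord0 x); first exact: prodr_gt0.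
  move=> x; rewrite (bigD1 x)//= ler_piMr ?(ltW (z0 x))//.
  by apply: prodr_ile1 => y _; rewrite (ltW (z0 y)) (simplex_le1 _ hz).
pose t0 : R := z1 / (2 * U).
have t00 : 0 < t0 by rewrite divr_gt0// mulr_gt0.
have linp s x : 0 <= s <= t0 -> 0 < (z + s *: u) ord0 x.
  move=> /andP[s0 st]; rewrite linx.
  have : `|s * u ord0 x| <= z1 / 2.
    rewrite normrM (ger0_norm s0) (@le_trans _ _ (t0 * U))//; first by rewrite ler_pM.
    by rewrite /t0 invfM mulrA divfK// gt_eqF.
  rewrite ler_norml => /andP[h _]; have := zz1 x; lra.
have linS s : 0 <= s <= t0 -> S (z + s *: u).
  move=> hs; split; first by move=> x; exact/ltW/linp.
  under eq_bigr do rewrite linx; by rewrite big_split/= -mulr_sumr us mulr0 addr0; case: hz.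
pose G1 e : R := (z + t0 *: u) ord0 e.1 * fine (F e (w e / (z + t0 *: u) ord0 e.1)).
have G10 e : jump e -> 0 <= G1 e.
  move=> je; have h : 0 < (z + t0 *: u) ord0 e.1 by apply: linp; rewrite lexx (ltW t00).
  by rewrite mulr_ge0 ?(ltW h)// fine_ge0// F0// divr_ge0 ?ltW ?w0.
(* The oscillation of [r] and the second order terms each take at most [om], which leaves
   [E / 2 < 0]. *)
pose om : R := - E / 4.
have om0 : 0 < om by rewrite /om; lra.
have [dl dl0 hdl] := rc hz om0.
pose G := \sum_(e | jump e) G1 e.
have Gp : 0 <= G by apply: sumr_ge0 => e je; exact: G10.
pose Q : R := G / t0 + b * \sum_x u ord0 x ^+ 2.
have Q0 : 0 <= Q.
  apply: addr_ge0; first by rewrite divr_ge0 ?(ltW t00).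
  apply: mulr_ge0 => //; apply: sumr_ge0 => x _; exact: sqr_ge0.
(* Short enough for the segment to stay interior, for [r] to vary by at most [om], and for the error
   [t * Q] to be at most [om]. *)
pose t : R := Num.min t0 (Num.min (dl / (2 * U)) (om / (Q + 1))).
have Q1 : 0 < Q + 1 by rewrite ltr_wpDl.
have t_gt0 : 0 < t by rewrite !lt_min t00 (divr_gt0 om0 Q1) andbT divr_gt0// mulr_gt0.
have tt0 : t <= t0 by rewrite ge_min lexx.
have tdl : t <= dl / (2 * U) by rewrite !ge_min lexx orbT.
have tQ : t * Q <= om.
  apply: (@le_trans _ _ (om / (Q + 1) * (Q + 1))); last by rewrite divfK// gt_eqF// ltr_wpDl.
  apply: ler_pM => //; [exact: ltW|by rewrite !ge_min lexx !orbT|by rewrite lerDl].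
have rlin s : 0 <= s <= t -> r (z + s *: u) <= r z + om.
  move=> /andP[s0 st]; have hs : 0 <= s <= t0 by rewrite s0 (le_trans st).
  have /ltW : `|r (z + s *: u) - r z| < om.
    apply: hdl; first exact: linS.
    move=> x; rewrite linx addrC addKr normrM (ger0_norm s0).
    apply: (@le_lt_trans _ _ (dl / (2 * U) * U)); first by apply: ler_pM => //; exact: le_trans st _.
    rewrite invfM mulrA divfK ?gt_eqF//; lra.
  by rewrite ler_norml => /andP[_]; rewrite lerBlDl addrC.
pose c : R := \sum_(e | jump e) G0 e + t / t0 * G + (r z + om).
have c0 : 0 <= c.
  have rz := r0 hz.
  rewrite addr_ge0//; last by rewrite addr_ge0// ltW.
  rewrite addr_ge0//; last by rewrite mulr_ge0// divr_ge0 ?ltW.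
  apply: sumr_ge0 => e je; rewrite mulr_ge0 ?(ltW (z0 _))// fine_ge0// F0// divr_ge0// ltW ?w0//.
have H : (value gamma C r K z <= (c * t)%:E + value gamma C r K (z + t *: u))%E.
  apply: (@segment_value_le r K z w t0 t (c * t) (fun=> c)) => //.
  - by rewrite (ltW t_gt0).
  - by move=> s x /andP[s0 st]; apply: linp; rewrite (ltW s0) ltW.
  - move=> s /andP[s0 st]; have hs : 0 <= s <= t0 by rewrite (ltW s0) (le_trans (ltW st)).
    rewrite /running_cost /c EFinD; apply: leeD; last by rewrite lee_fin rlin// (ltW s0) ltW.
    apply: (@le_trans _ _ (\sum_(e | jump e) (G0 e + s / t0 * G1 e)%:E)%E).
      apply: lee_sum => e je; have := @perspective_line e (z ord0 e.1) (u ord0 e.1) (w e) t0 s je.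
      have h1 : 0 < (z + t0 *: u) ord0 e.1 by apply: linp; rewrite lexx (ltW t00).
      rewrite /G0 /G1 !linx in h1 *; apply => //; exact: w0.
    rewrite sumEFin lee_fin big_split/= lerD2l -mulr_sumr ler_wpM2r//.
    by rewrite ler_wpM2r ?invr_ge0 ?ltW.
  - rewrite integral_cst//= lebesgue_measure_itv/= lte_fin t_gt0 -EFinB subr0.
    by rewrite EFinM.
rewrite vE// vE in H; last by apply: linS; rewrite (ltW t_gt0).
have zt : S (z + t *: u) by apply: linS; rewrite (ltW t_gt0).
have {H} := H; rewrite -EFinD lee_fin => H.
have := hv _ zt.
have -> : \sum_x p x * ((z + t *: u) ord0 x - z ord0 x) = t * \sum_x p x * u ord0 x.
  by rewrite mulr_sumr; apply: eq_bigr => x _; rewrite linx; ring.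
have -> : \sum_x ((z + t *: u) ord0 x - z ord0 x) ^+ 2 = t * (t * \sum_x u ord0 x ^+ 2).
  by rewrite mulrA mulr_sumr; apply: eq_bigr => x _; rewrite linx; ring.
move=> H2.
have : 0 <= t * (E + om + t * Q).
  have -> : t * (E + om + t * Q) = c * t + t * (\sum_x p x * u ord0 x) + b * (t * (t * \sum_x u ord0 x ^+ 2)).
    by rewrite /E /Q /c; field; rewrite gt_eqF.
  lra.
rewrite pmulr_rge0// => H3; move: om0 H3 tQ; rewrite /om; lra.
Qed.

Local Ltac glra := clear - hc cC C1 hB gd mF F0 gN rc r0 vE; intros; lra.

Lemma total_flow_le (A X Et PW BW BW' tt rzt MW w : R) : A + rzt + X <= tt + BW' ->
  MW <= A + Et -> - PW <= X -> 0 <= rzt -> BW' <= BW -> MW = PW + BW + w -> w <= tt + Et.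
Proof. lra. Qed.

(** No optimal path is assumed to exist. A nearly optimal one is followed for a short time [t], and
    [m], [w], [c] are the time averages of its state, fluxes and edge costs. The cost bound is kept
    in the form of minorants, which makes sense where [m] vanishes. *)
Lemma value_supersolution (z : 'rV[R]_d) (p : 'I_d -> R) (b th rho' : R) :
  S z -> 0 <= b -> 0 < th -> 0 < rho' ->
  (exists2 rK : R, 0 < rK & forall m, S m -> (forall x, `|m ord0 x - z ord0 x| <= rK) -> ~ K m) ->
  (forall z', S z' -> v z + \sum_x p x * (z' ord0 x - z ord0 x) -
     b * \sum_x (z' ord0 x - z ord0 x) ^+ 2 <= v z') ->
  exists (m : 'rV[R]_d) (w c : edge d -> R),
    [/\ S m, forall x, `|m ord0 x - z ord0 x| <= rho',
        forall e, jump e -> 0 <= w e,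
        forall e, jump e -> forall a1 a2, minorant (gamma e.1 e.2) (C e) a1 a2 ->
          a1 * m ord0 e.1 + a2 * w e <= c e &
        \sum_(e | jump e) c e + r z +
          \sum_(e | jump e) w e * (p e.2 - p e.1) <= 3 * th].
Proof.
move=> hz b0 th0 rho'0 [rK rK0 hK] hv.
have [dl dl0 hdl] := rc hz th0.
pose P : R := \sum_x `|p x|.
have P0 : 0 <= P by apply: sumr_ge0.
have pP x : `|p x| <= P by rewrite /P (bigD1 x)//= lerDl sumr_ge0.
pose bd : R := b * d%:R.
have bd0 : 0 <= bd by rewrite mulr_ge0.
(* A slope exceeding by 1 what the linear and the quadratic part of the test function can take: one
   copy of the total flow [W] remains and is bounded. *)
pose M' : R := 2 * P + bd + 1.
have M'0 : 0 <= M' by rewrite /M'; lra.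
pose Gam : R := total_rate gamma.
have G0 : 0 <= Gam by apply: sumr_ge0.
pose Nn : R := #|{: edge d}|%:R.
have N0 : 0 <= Nn by rewrite ler0n.
(* The resulting a priori bound on the total flow per unit of time; the last term in [rho] makes the
   quadratic error at most [th * t]. *)
pose Wc : R := 2 * th + Nn * (Gam * expR M').
have E0 : 0 <= Nn * (Gam * expR M') by rewrite !mulr_ge0 ?expR_ge0.
have Wc0 : 0 <= Wc by rewrite /Wc; lra.
have bW : 0 < bd * Wc + 1 by rewrite ltr_wpDl// mulr_ge0.
pose rho : R := Num.min (Num.min rK (dl / 2)) (Num.min (Num.min rho' 1) (th / (bd * Wc + 1))).
have rho0 : 0 < rho by rewrite !lt_min rK0 rho'0 ltr01 !divr_gt0.
have [rho1 rho2 rho3 rho4 rho5] : [/\ rho <= rK, rho <= dl / 2, rho <= rho', rho <= 1 & rho <= th / (bd * Wc + 1)].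
  by split; rewrite !ge_min lexx ?orbT.
have vz0 : 0 <= v z by rewrite -lee_fin -vE// (value_ge0 r0).
pose B : R := v z + th.
have B0 : 0 <= B by rewrite addr_ge0// ltW.
(* Of the displacement [rho / 2] that [path_stays] allows, a slope [M] of this size spends at most
   [rho / 4] on the cost [B]; the choice of [t] takes care of the rest. *)
pose M : R := 1 + 4 * Nn * B / rho.
have M1 : 1 <= M by rewrite lerDl divr_ge0 ?(ltW rho0)// !mulr_ge0.
have M0 : 0 < M by exact: lt_le_trans M1.
pose H : R := Nn * (Gam * expR M).
have H0 : 0 <= H by rewrite !mulr_ge0 ?expR_ge0.
have H1 : 0 < 4 * (H + 1) by lra.
pose t : R := Num.min 1 (rho / (4 * (H + 1))).
have t0 : 0 < t by rewrite lt_min ltr01 divr_gt0.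
have t1 : t <= 1 by rewrite ge_min lexx.
have tH : t * H <= rho / 4.
  have : t * (4 * (H + 1)) <= rho by rewrite -ler_pdivlMr// ge_min lexx orbT.
  move: t0; glra.
have vfin : (ereal_inf [set c | exists mu q, controlled_path gamma z mu q /\
    c = total_cost gamma C r K mu q] \is a fin_num)%E.
  by rewrite -/(value gamma C r K z) vE.
(* The defect of optimality is [t * th], since the inequality will be divided by [t]. *)
have [_ [mu [q [hp ->]]]] := lb_ereal_inf_adherent (mulr_gt0 t0 th0) vfin.
rewrite -/(value gamma C r K z) vE// -EFinD => /ltW hT.
have hTB : (total_cost gamma C r K mu q <= B%:E)%E.
  by apply: le_trans hT _; rewrite lee_fin lerD2l ler_piMl// ltW.
have hM : Nn * ((B + total_rate gamma * expR M * t) / M) <= rho / 2.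
  rewrite mulrA ler_pdivrMr// mulrDr -/Gam (_ : Nn * (Gam * expR M * t) = t * H); last by rewrite /H; ring.
  have h1 : Nn * B <= rho / 4 * M - rho / 4.
    by rewrite /M le_eqVlt; apply/orP; left; apply/eqP; field; rewrite gt_eqF.
  have : rho / 4 <= rho / 4 * M by rewrite ler_peMr// divr_ge0// ltW.
  have : 0 <= rho / 4 by rewrite divr_ge0// ltW.
  move: h1 tH; glra.
have hKr m : S m -> (forall x, `|m ord0 x - z ord0 x| <= rho) -> ~ K m.
  by move=> hm h; apply: hK => // x; exact: le_trans (h x) rho1.
have stay := path_stays hp B0 M1 rho0 (ltW t0) hTB hKr hM.
have t0' := ltW t0.
have st s : 0 <= s <= t -> forall x, `|mu s ord0 x - z ord0 x| <= rho / 2 by move=> /stay[].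
have hI := total_cost_ge rc r0 hp t0' (fun s s0 st' => (stay s (introT andP (conj s0 (ltW st')))).2).
have mut : S (mu t) by exact: path_S hp t0'.
move: (le_trans hI hT); rewrite (vE mut) => hI'.
have hpc : (\Int_(s < t) path_cost r mu q s <= B%:E)%E.
  apply: le_trans hTB; apply: le_trans hI; rewrite leeDl//.
  exact: (value_ge0 r0).
pose ce e : R := fine (\Int_(s < t) edge_cost mu q e s).
have ecE e : jump e -> (\Int_(s < t) edge_cost mu q e s = (ce e)%:E)%E.
  move=> je; rewrite /ce fineK// ge0_fin_numE.
    exact: le_lt_trans (edge_cost_le hp je t0' hpc) (ltry _).
  by apply: integral_horizon_ge0 => s s0; exact: (edge_cost_ge0 hp).
pose ir : \bar R := (\Int_(s < t) (r (mu s))%:E)%E.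
have mr : measurable_fun (horizon t%:E) (fun s => (r (mu s))%:E).
  apply/measurable_EFinP.
  by apply: measurable_funS (path_running_measurable rc hp) => //; exact: horizon_sub.
have hir : ((r z * t)%:E <= ir + (th * t)%:E)%E.
  have h1 := flowE (rate_cst (r0 hz)) t0'; have h2 := flowE (rate_cst (ltW th0)) t0'.
  rewrite -(flow_cst (r0 hz) t0') -(flow_cst (ltW th0) t0') -h1 -h2 -ge0_integralD//; last 2 first.
  - by move=> s [s0 _]; rewrite lee_fin r0//; exact: path_S hp s0.
  - by move=> s _; rewrite lee_fin ltW.
  2: exact: measurable_horizon.
  apply: ge0_le_integral => //.
  - exact: measurable_horizon.
  - by move=> s _; rewrite lee_fin r0.
  - by apply: emeasurable_funD => //; exact: measurable_cst.
  - move=> s [s0 st']; rewrite -EFinD lee_fin.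
    have : `|r (mu s) - r z| < th.
      apply: hdl; first exact: path_S hp s0.
      move=> x; apply: (@le_lt_trans _ _ (rho / 2)); last by move: rho2 dl0; glra.
      by apply: st; rewrite s0 -lee_fin ltW.
    by rewrite ltr_norml => /andP[+ _]; glra.
pose fl e := flow (flux mu q e) t.
have fl0 e : jump e -> 0 <= fl e by move=> je; apply: flow_ge0 => //; exact: path_rate hp je.
pose W : R := \sum_(e | jump e) fl e.
have W0 : 0 <= W by apply: sumr_ge0.
have disp := path_displacement hp _ t0'.
have dotE : \sum_x p x * (mu t ord0 x - z ord0 x) = \sum_(e | jump e) fl e * (p e.2 - p e.1).
  rewrite -dot_jump_sum; apply: eq_bigr => x _; congr (_ * _).
  have -> : mu t ord0 x = z ord0 x + (\sum_(e | jump e) fl e *: jump_vector R e) ord0 x.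
    by rewrite {1}(path_eqP hp t0') mxE.
  by rewrite addrC addKr.
have sqE : b * \sum_x (mu t ord0 x - z ord0 x) ^+ 2 <= bd * (rho / 2 * W).
  rewrite /bd -mulrA ler_wpM2l//.
  have -> : d%:R * (rho / 2 * W) = \sum_(x < d) (rho / 2 * W) by rewrite sumr_const card_ord -[RHS]mulr_natl.
  apply: ler_sum => x _; rewrite -real_normK ?num_real// expr2; apply: ler_pM => //.
  by apply: st; rewrite t0' lexx.
have main : \sum_(e | jump e) ce e + r z * t + \sum_(e | jump e) fl e * (p e.2 - p e.1)
    <= 2 * th * t + bd * (rho / 2 * W).
  have irfin : ir \is a fin_num.
    rewrite ge0_fin_numE; last by apply: integral_horizon_ge0 => s s0; rewrite lee_fin r0//; exact: path_S hp s0.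
    apply: le_lt_trans (ltry B); apply: le_trans hpc.
    rewrite (path_cost_integral hp t0') leeDr// sume_ge0// => e je.
    by apply: integral_horizon_ge0 => s s0; exact: (edge_cost_ge0 hp).
  move: hI'; rewrite (path_cost_integral hp t0') -/ir (eq_bigr _ ecE) sumEFin.
  move: hir; rewrite -(fineK irfin) -!EFinD !lee_fin => h1 h2.
  move: h1 h2 sqE (hv _ mut); rewrite dotE; glra.
have cW e : jump e -> M' * fl e <= ce e + Gam * expR M' * t.
  move=> je; have := flow_bound hp je t0' M'0 (_ : (_ <= (ce e)%:E)%E).
  rewrite ecE// => /(_ (lexx _)) h; apply: le_trans h _; rewrite lerD2l ler_wpM2l//.
    by rewrite mulr_ge0 ?expR_ge0.
  exact: coord_flow_le hp _ _ t0'.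
have cWs : M' * W <= \sum_(e | jump e) ce e + Nn * (Gam * expR M') * t.
  rewrite mulr_sumr; apply: le_trans (ler_sum _ cW) _; rewrite big_split/= lerD2l.
  have h : 0 <= Gam * expR M' * t by rewrite !mulr_ge0 ?expR_ge0.
  rewrite -(mulrA Nn); exact: sum_jumps_cst_le.
have pW : - (2 * P) * W <= \sum_(e | jump e) fl e * (p e.2 - p e.1).
  rewrite mulr_sumr; apply: ler_sum => e je; rewrite mulrC ler_wpM2l ?fl0//.
  have := pP e.1; have := pP e.2; rewrite !ler_norml => /andP[+ _] /andP[_]; glra.
have rz0 : 0 <= r z * t by rewrite mulr_ge0// r0.
have rW0 : 0 <= rho * W by rewrite mulr_ge0// ltW.
have bdW : bd * (rho / 2 * W) <= bd * W.
  rewrite ler_wpM2l// -[leRHS]mul1r ler_wpM2r//; move: rho0 rho4; glra.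
have WWc : W <= Wc * t.
  rewrite /Wc mulrDl; apply: (@total_flow_le _ _ _ (2 * P * W) (bd * W) _ _ _ _ _ main cWs) => //.
    by rewrite -mulNr.
  by rewrite /M'; ring.
have last : bd * (rho / 2 * W) <= th * t.
  apply: (@le_trans _ _ (bd * (rho * (Wc * t)))).
    rewrite ler_wpM2l//; apply: ler_pM => //; last by move: rho0; glra.
    by rewrite divr_ge0// ltW.
  have -> : bd * (rho * (Wc * t)) = (bd * Wc * rho) * t by ring.
  by rewrite ler_wpM2r//; move: rho5 (ltW rho0); rewrite ler_pdivlMr//; glra.
have tn : t != 0 by rewrite gt_eqF.
exists (\row_x (flow (fun s => mu s ord0 x) t / t)), (fun e => fl e / t), (fun e => ce e / t); split.
- split=> [x|]; first by rewrite mxE divr_ge0// flow_ge0//; exact: (coord_rate hp).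
  under eq_bigr do rewrite mxE.
  by rewrite -mulr_suml (coord_flow_sum hp t0') divff.
- move=> x; rewrite mxE; apply: le_trans rho3; rewrite ler_norml lerBlDr lerBrDr.
  have cr := coord_rate hp x; have z0 := simplex_ge0 x hz.
  have hs s : 0 <= s < t -> z ord0 x - rho <= mu s ord0 x <= rho + z ord0 x.
    move=> /andP[s0 st']; have /st/(_ x) : 0 <= s <= t by rewrite s0 ltW.
    by move: rho0; rewrite ler_norml => rho0' /andP[h1 h2]; apply/andP; split; move: rho0' h1 h2; glra.
  rewrite ler_pdivlMr// ler_pdivrMr//; apply/andP; split.
    have [h|h] := leP 0 (- rho + z ord0 x).
      rewrite -(flow_cst h t0'); apply: le_flow => //; first exact: rate_cst.
      by move=> s /hs/andP[+ _]; glra.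
    apply: (@le_trans _ _ 0); last exact: flow_ge0.
    by rewrite mulr_le0_ge0// ltW.
  have h : 0 <= rho + z ord0 x by rewrite addr_ge0// ltW.
  rewrite -(flow_cst h t0'); apply: le_flow => //; first exact: rate_cst.
  by move=> s /hs/andP[].
- by move=> e je; rewrite divr_ge0// fl0.
- move=> e je a1 a2 hm; rewrite mxE.
  have := averaged_minorant hp je t0' hm (_ : (_ <= (ce e)%:E)%E).
  rewrite ecE// => /(_ (lexx _)) h.
  by rewrite !mulrA -mulrDl ler_pM2r// invr_gt0.
- have -> : \sum_(e | jump e) fl e / t * (p e.2 - p e.1) =
      (\sum_(e | jump e) fl e * (p e.2 - p e.1)) / t.
    by rewrite mulr_suml; apply: eq_bigr => e _; ring.
  rewrite -mulr_suml -(ler_pM2r t0) !mulrDl !divfK//; move: main last; glra.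
Qed.

End viscosity.
End cost.

(** * Perturbing the running cost and the target *)

Section approximation.

Definition rvalue r K (m : 'rV[R]_d) : R := fine (value gamma C r K m).

Definition regular_value (B : R) r K :=
  [/\ forall m, S m -> value gamma C r K m = (rvalue r K m)%:E,
      forall m, S m -> 0 <= rvalue r K m <= B,
      forall m, K m -> rvalue r K m = 0 &
      forall m m' lam, S m -> S m' -> 0 < lam <= 1 -> close lam m m' ->
        rvalue r K m <= B * Num.sqrt lam + rvalue r K m'].

Lemma value_regular (M : R) : exists2 B : R, 0 <= B &
  forall (r : 'rV[R]_d -> R) K,
  simplex_continuous r -> (forall m, S m -> 0 <= r m <= M) -> K `<=` S -> K !=set0 ->
  regular_value B r K.
Proof.
have [d0|d0] := posnP d.
  exists 0 => // r K rc rM KS [k kk]; have := simplex_dim (KS _ kk).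
  by move=> dd; move: (dd); rewrite {1}d0.
have [B B0 hB'] := value_holder M d0.
exists B => // r K rc rM KS [k kk]; have r0 m : S m -> 0 <= r m by move=> /rM/andP[].
have vk m : K m -> value gamma C r K m = 0%E.
  by move=> km; apply: (value_target r0) => //; exact: KS.
(* Any two points of the simplex are within distance 1, so the Hoelder bound with [lam = 1], taken
   to a point of [K], bounds the value. *)
have vB m : S m -> (value gamma C r K m <= B%:E)%E.
  move=> hm; have := hB' r K m k 1 rc rM hm (KS _ kk).
  rewrite sqrtr1 mulr1 (vk k kk) adde0; apply; first by rewrite ltr01 lexx.
  move=> x; have := simplex_ge0 x hm; have := simplex_le1 x hm.
  have := simplex_ge0 x (KS _ kk); have := simplex_le1 x (KS _ kk).
  by rewrite ler_norml => h1 h2 h3 h4; apply/andP; split; lra.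
have v0 m : (0 <= value gamma C r K m)%E by exact: (value_ge0 r0).
have vE m : S m -> value gamma C r K m = (rvalue r K m)%:E.
  move=> hm; rewrite /rvalue fineK// ge0_fin_numE//; exact: le_lt_trans (vB m hm) (ltry _).
split => //.
- by move=> m hm; rewrite -!lee_fin -vE// v0 vB.
- by move=> m km; rewrite /rvalue vk.
- move=> m m' lam hm hm' l01 hc'; rewrite -lee_fin EFinD -!vE//; exact: hB'.
Qed.

Lemma simplex_continuousD r (c : R) : simplex_continuous r ->
  simplex_continuous (fun m : 'rV[R]_d => r m + c).
Proof.
move=> rc m hm e e0; have [dl dl0 h] := rc m hm e e0; exists dl => // m' hm' hx.
by rewrite (_ : _ - _ = r m' - r m); [exact: h|ring].
Qed.

Lemma path_costD r (c : R) m mu q t : simplex_continuous r -> (forall m, S m -> 0 <= r m) ->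
  0 <= c -> 0 <= t -> controlled_path gamma m mu q ->
  (\Int_(s < t) path_cost (fun m => r m + c)%R mu q s =
   \Int_(s < t) path_cost r mu q s + (c * t)%:E)%E.
Proof.
move=> rc r0 c0 t0 hp.
have E s : path_cost (fun m => r m + c)%R mu q s = (path_cost r mu q s + c%:E)%E.
  by rewrite /path_cost /running_cost EFinD addeA.
rewrite -(flow_cst c0 t0) -(flowE (rate_cst c0) t0) -ge0_integralD//.
- by apply: eq_integral => s _; exact: E.
- exact: measurable_horizon.
- by move=> s [s0 _]; exact: (path_cost_ge0 r0 hp).
- by apply: measurable_funS (path_cost_measurable rc hp) => //; exact: horizon_sub.
Qed.

Lemma path_cost_time_le r (c : R) m mu q t : simplex_continuous r -> (forall m, S m -> 0 <= r m) ->
  0 <= c -> 0 <= t -> controlled_path gamma m mu q ->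
  (forall s, 0 <= s -> s < t -> c <= r (mu s)) ->
  ((c * t)%:E <= \Int_(s < t) path_cost r mu q s)%E.
Proof.
move=> rc r0 c0 t0 hp hr; rewrite -(flow_cst c0 t0) -(flowE (rate_cst c0) t0).
apply: ge0_le_integral => //.
- exact: measurable_horizon.
- by apply: measurable_funS (path_cost_measurable rc hp) => //; exact: horizon_sub.
- move=> s [s0 st]; rewrite lte_fin in st.
  rewrite /path_cost /running_cost; apply: (@le_trans _ _ (r (mu s))%:E); first by rewrite lee_fin hr.
  rewrite leeDr//; apply: sume_ge0 => e je; have [_ hq _ _] := hp.
  rewrite mule_ge0 ?F0//; last by have [_] := hq e je; apply.
  by rewrite lee_fin; apply: simplex_ge0; exact: path_S hp s0.
Qed.

Variables (r : 'rV[R]_d -> R) (K : set 'rV[R]_d).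
Hypothesis rc : simplex_continuous r.
Hypothesis r0 : forall m, S m -> 0 <= r m.
Hypothesis KS : K `<=` S.
Hypothesis cK : closed (K : set (subspace S)).
Hypothesis Kreg : K = closure (interior (K : set (subspace S))).
Hypothesis K0 : K !=set0.
Hypothesis rK : forall A : set 'rV[R]_d, compact A -> A `<=` S `\` K ->
     exists2 c : R, 0 < c & forall m, A m -> c <= r m.

(** A nearly optimal path is followed until it comes close to [K]. This takes at most the time [T1],
    so the surcharge costs at most [kap * T1]; the remaining way into the core is short and paid by
    Hoelder continuity. [B] has to be uniform because [kap] and [dl] are chosen after it. *)
Lemma shifted_value_le (e : R) : 0 < e -> exists kap dl : R,
  [/\ 0 < kap <= 1, 0 < dl, target_core K dl !=set0 &
    forall m, S m -> rvalue (fun m => r m + kap) (target_core K dl) m <= rvalue r K m + e].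
Proof.
move=> e0; have [M rM] := simplex_bounded rc.
have [B B0 hV] := value_regular (M + 1).
pose lam : R := Num.min 1 ((e / 4 / (B + 1)) ^+ 2).
have lam0 : 0 < lam by rewrite lt_min ltr01 exprn_gt0// !divr_gt0// ltr_wpDl.
have lam1 : lam <= 1 by rewrite ge_min lexx.
have Bs : B * Num.sqrt lam <= e / 4 by apply: mul_sqrt_le; rewrite ?divr_gt0// ge_min lexx orbT.
have l2 : 0 < lam / 2 by rewrite divr_gt0.
have [dl dl0 hdl] := target_core_uniform KS Kreg cK l2.
have l4 : 0 < lam / 4 by rewrite divr_gt0.
have [|cs cs0 hcs] := rK (@away_compact R d K (lam / 4)).
  move=> m [hm h]; split => // km; have [x] := h m km; rewrite subrr normr0; lra.
pose T1 : R := (B + e + 1) / cs.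
have T10 : 0 < T1 by rewrite divr_gt0// ltr_wpDl// addr_ge0// ltW.
pose kap : R := Num.min 1 (e / (4 * T1)).
have kap0 : 0 < kap by rewrite lt_min ltr01 divr_gt0// mulr_gt0.
have kap1 : kap <= 1 by rewrite ge_min lexx.
have kT : kap * T1 <= e / 4.
  rewrite -ler_pdivlMr// (_ : e / 4 / T1 = e / (4 * T1)) ?ge_min ?lexx ?orbT//.
  by rewrite [in RHS]invfM mulrA.
pose K' := target_core K dl.
have K'0 : K' !=set0 by have [k kk] := K0; have [k' _ hk'] := hdl k kk; exists k'.
exists kap, dl; split => //; first by rewrite kap0.
move=> m hm; pose r' m' := r m' + kap.
have rc' := simplex_continuousD kap rc : simplex_continuous r'.
have r0' m' : S m' -> 0 <= r' m' by move=> h; rewrite addr_ge0 ?r0// ltW.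
have [vE vB v0 _] := hV r K rc (fun m hm => introT andP (conj (r0 hm) (le_trans (rM m hm) (ler_wpDr ler01 (lexx M))))) KS K0.
have [uE uB u0 uH] : regular_value B r' K'.
  apply: hV => //; last by move=> k [].
  by move=> m' hm'; rewrite r0'//= lerD// rM.
have vfin : (ereal_inf [set c | exists mu q, controlled_path gamma m mu q /\
    c = total_cost gamma C r K mu q] \is a fin_num)%E.
  by rewrite -/(value gamma C r K m) vE.
have e4 : 0 < e / 4 by rewrite divr_gt0.
have [_ [mu [q [hp ->]]]] := lb_ereal_inf_adherent e4 vfin.
rewrite -/(value gamma C r K m) vE// -EFinD => /ltW hT.
(* A neighbourhood of the target: outside it compactness gives [r >= cs], which bounds the time
   spent there. *)
pose O : set 'rV[R]_d := [set m' | exists2 k, K k & forall x, `|m' ord0 x - k ord0 x| < lam / 4].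
have KO : K `<=` O by move=> k kk; exists k => // x; rewrite subrr normr0.
have nO s : 0 <= s -> (s%:E < hitting_time O mu)%E -> ~ K (mu s) /\ cs <= r (mu s).
  move=> s0 /(not_hit s0) no; split; first by move=> ks; apply: no; exact: KO.
  apply: hcs; split; first exact: path_S hp s0.
  move=> k kk; apply: contrapT => H; apply: no; exists k => // x.
  by rewrite ltNge; apply/negP => h; apply: H; exists x.
have tb t : 0 <= t -> (t%:E <= hitting_time O mu)%E ->
    (\Int_(s < t) path_cost r mu q s + value gamma C r K (mu t) <=
      (rvalue r K m + e / 4)%:E)%E /\ t <= T1.
  move=> t0 tO; have lt s : s < t -> (s%:E < hitting_time O mu)%E.
    by move=> st; apply: lt_le_trans tO; rewrite lte_fin.
  have h1 := total_cost_ge rc r0 hp t0 (fun s s0 st => (nO s s0 (lt s st)).1).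
  have h2 := le_trans h1 hT; split => //.
  have h3 := path_cost_time_le rc r0 (ltW cs0) t0 hp (fun s s0 st => (nO s s0 (lt s st)).2).
  rewrite /T1 ler_pdivlMr// mulrC -lee_fin; apply: le_trans h3 _.
  apply: (@le_trans _ _ (rvalue r K m + e / 4)%:E).
    by apply: le_trans h2; rewrite leeDl// (value_ge0 r0).
  by rewrite lee_fin; have /andP[_ h] := vB m hm; lra.
have [tau tauE] : exists tau, hitting_time O mu = tau%:E.
  have h0 := hitting_time_ge0 O mu.
  exists (fine (hitting_time O mu)); rewrite fineK// ge0_fin_numE// ltNge; apply/negP.
  rewrite leye_eq => /eqP hO; have T11 : 0 <= T1 + 1 by rewrite addr_ge0// ltW.
  have hO1 : ((T1 + 1)%:E <= hitting_time O mu)%E by rewrite hO leey.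
  have [_] := tb _ T11 hO1; lra.
have tau0 : 0 <= tau by rewrite -lee_fin -tauE hitting_time_ge0.
have hO2 : (tau%:E <= hitting_time O mu)%E by rewrite tauE.
have [h1 tauT] := tb tau tau0 hO2.
have [s [s0 [k kk hk] hs]] := hitting_time_near hp tauE l4.
have [k' hk' ck'] := hdl k kk.
have smt := path_S hp tau0.
have ut : rvalue r' K' (mu tau) <= e / 4.
  have := uH (mu tau) k' lam smt ck'.1; rewrite lam0 lam1 => /(_ isT) h.
  apply: le_trans (h _) _; last by rewrite u0// addr0.
  have -> : lam = (lam / 4 + lam / 4) + lam / 2 by lra.
  apply: close_trans (closeC hk'); apply: (@close_trans _ _ _ _ _ (mu s)).
    by apply: closeC => x; exact/ltW/hs.
  by move=> x; exact/ltW/hk.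
have := value_le_cost rc' r0' K' hp tau0.
rewrite (path_costD rc r0 (ltW kap0) tau0 hp) uE// uE//.
set I := integral _ _ _ in h1 * => hU.
rewrite -lee_fin; apply: le_trans hU _.
have kt : kap * tau <= e / 4 by apply: le_trans kT; rewrite ler_wpM2l// ltW.
apply: (@le_trans _ _ (I + (e / 4)%:E + (e / 4)%:E)%E).
  by apply: leeD; [apply: leeD => //; rewrite lee_fin|rewrite lee_fin].
have I1 : (I <= (rvalue r K m + e / 4)%:E)%E.
  by apply: le_trans h1; rewrite leeDl// (value_ge0 r0).
apply: (@le_trans _ _ ((rvalue r K m + e / 4)%:E + (e / 4)%:E + (e / 4)%:E)%E).
  by apply: leeD => //; apply: leeD.
by rewrite -!EFinD lee_fin; lra.
Qed.

End approximation.

Local Ltac glra := clear - hc cC C1 hB gd mF F0 gN; intros; lra.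

(** * Real-valued edge costs and the discrete subsolution *)

Definition rcost e (q : R) : R := fine (F e q).

Lemma rcostE e q : jump e -> 0 < q -> F e q = (rcost e q)%:E.
Proof. by move=> je q0; rewrite /rcost fineK//; exact: (transformed_cost_fin). Qed.

Lemma rcost_ge0 e q : jump e -> 0 < q -> 0 <= rcost e q.
Proof.
by move=> je q0; rewrite -lee_fin -rcostE//; apply: transformed_cost_ge0 => //; [exact: C1|exact: ltW].
Qed.

Lemma rcost_ge e M q : jump e -> 0 < q -> M * q - gamma e.1 e.2 * (expR M - 1) <= rcost e q.
Proof.
by move=> je q0; rewrite -lee_fin -rcostE//; apply: transformed_cost_ge => //; [exact: C1|exact: ltW].
Qed.

Lemma rcost_perspective e (l z u v x y : R) : jump e -> 0 <= l <= 1 -> 0 <= u -> 0 <= v ->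
  0 < x -> 0 < y -> z = (1 - l) * u + l * v -> 0 < z -> 0 < (1 - l) * (u * x) + l * (v * y) ->
  z * rcost e (((1 - l) * (u * x) + l * (v * y)) / z) <=
    (1 - l) * (u * rcost e x) + l * (v * rcost e y).
Proof.
move=> je /andP[l0 l1] u0 v0 x0 y0 zE z0 w0.
have h := transformed_cost_perspective je (cC je) (_ : 0 <= 1 - l <= 1) u0 v0 (ltW x0) (ltW y0)
  (_ : z = (1 - l) * u + (1 - (1 - l)) * v) z0 (_ : 0 < (1 - l) * (u * x) + (1 - (1 - l)) * (v * y)).
rewrite (_ : 1 - (1 - l) = l) in h; last by ring.
have {h} := h _ zE w0; rewrite subr_ge0 l1 gerBl l0 => /(_ isT).
by rewrite !rcostE ?divr_gt0// -!EFinM -EFinD lee_fin.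
Qed.

Lemma running_costE r (m : 'rV[R]_d) q : (forall e, jump e -> 0 < q e) ->
  running_cost gamma C r m q = (\sum_(e | jump e) m ord0 e.1 * rcost e (q e) + r m)%:E.
Proof.
move=> q0; rewrite /running_cost EFinD -sumEFin; congr (_ + _)%E.
by apply: eq_bigr => e je; rewrite rcostE ?q0// EFinM.
Qed.

Definition natural_cost : R := \sum_(e | jump e) rcost e (gamma e.1 e.2).

Lemma natural_cost_ge0 : 0 <= natural_cost.
Proof. by apply: sumr_ge0 => e je; exact: rcost_ge0. Qed.

Lemma total_rate_ge0 : 0 <= total_rate gamma.
Proof. by apply: sumr_ge0. Qed.

Lemma jump_rate_sum_le : \sum_(e | jump e) gamma e.1 e.2 <= total_rate gamma.
Proof.
rewrite /total_rate [leRHS](bigID (jump))/= -[leLHS]addr0; apply: lerD.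
  by apply: ler_sum => e _; exact: ler_norm.
exact: sumr_ge0.
Qed.

Lemma subsolution_sum (Z rz' W X' lX P2 Y kg bq g rm lq lGE e' : R) : 0 <= Z + rz' + W ->
  Z <= X' - lX + P2 -> W <= Y + kg -> Y - bq <= g -> rz' <= rm + e' / 4 -> bq <= lq ->
  lq <= lX + lGE -> kg <= e' / 4 -> P2 + lGE <= e' / 4 -> 0 < e' -> 0 <= X' + rm + g + e'.
Proof. lra. Qed.

(** The optimizer satisfies [z = (1 - l) * m + l * xi] with [xi] positive. The control [q] at [m],
    mixed with the natural rates at [xi], gives fluxes at [z] whose cost is bounded by perspective
    convexity, and [value_subsolution] applies to them. *)
Lemma discrete_subsolution r K (B e : R) : simplex_continuous r -> (forall m, S m -> 0 <= r m) ->
  S !=set0 -> 0 <= B -> 0 < e ->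
  regular_value B r K ->
  exists (f : 'rV[R]_d -> R) (n0 : nat),
    (forall m, S m -> rvalue r K m - e <= f m <= rvalue r K m + e) /\
    forall n m q, (n0 < n)%N -> S m -> (forall a, jump a -> 0 < q a) ->
      (0 <= running_cost gamma C r m q + (generator n gamma f m q)%:E + e%:E)%E.
Proof.
move=> rc r0 S0 B0 e0 [vE vB _ vH]; set v := rvalue r K in vE vB vH *.
have d0 : (0 < d)%N by case: S0 => m /simplex_dim.
have dR : 0 < (d%:R : R) by rewrite ltr0n.
have cv : simplex_continuous v := holder_simplex_continuous B0 vH.
have e4 : 0 < e / 4 by rewrite divr_gt0.
have [dl dl0 hdl] := simplex_uniform rc e4.
pose Gam := total_rate gamma; have G0 : 0 <= Gam := total_rate_ge0.
pose Phi := natural_cost; have P0 : 0 <= Phi := natural_cost_ge0.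
have k10 : 0 < 64 * d%:R * Gam + 64 by rewrite ltr_wpDl// ?ltr0n// mulr_ge0// mulr_ge0// ler0n.
(* [k] is the distance of the optimizer in units of [t]. As [l] is a multiple of [k * t] and the
   penalty is [t ^ (- 2)], the product of [l] and the gradient is of order [k ^ 2] for every [t], so
   [k] is fixed first. *)
pose k : R := Num.min 1 (e / (64 * d%:R * Gam + 64)).
have k0 : 0 < k by rewrite lt_min ltr01 divr_gt0.
have k1 : k <= 1 by rewrite ge_min lexx.
have kk : k ^+ 2 <= k by rewrite expr2 ler_piMl// ltW.
have kG : 16 * d%:R * k ^+ 2 * Gam <= e / 4.
  have h1 : k * (64 * d%:R * Gam + 64) <= e by rewrite -ler_pdivlMr// ge_min lexx orbT.
  have h2 : 16 * d%:R * Gam * k ^+ 2 <= 16 * d%:R * Gam * k by rewrite ler_wpM2l// !mulr_ge0.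
  lra.
have B1 : 0 < B + 1 by rewrite ltr_wpDl.
pose sB := Num.sqrt (B + 1).
pose E1 := expR (1 : R).
(* In this order: the radius of the first localization, the modulus at that radius, the size of [l],
   the cost of mixing with weight [l], and [2 * l] against the moduli of [r] and of the value. *)
have [|t t0] := @small_factor R [:: (sB, 1); (sB, (k ^+ 2 / (B + 1)) ^+ 2); (2 * d%:R * k, 4^-1);
  (2 * d%:R * k * (2 * Phi + Gam * E1), e / 4); (2 * (2 * d%:R * k), dl);
  (2 * (2 * d%:R * k), (e / (B + 1)) ^+ 2)].
  by rewrite /= ltr01 invr_gt0 ltr0n e4 dl0 !exprn_gt0 ?divr_gt0 ?exprn_gt0.
rewrite /= => /and5P[t1 t2 l4 lP /and3P[ldl lB _]].
pose l := t * (2 * d%:R * k); rewrite mulrCA -/l in ldl; rewrite mulrCA -/l in lB.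
rewrite -/l in l4; rewrite mulrA -/l in lP.
have l0 : 0 < l by rewrite !mulr_gt0.
have l1 : l <= 1 by lra.
pose b : R := (t ^+ 2)^-1.
have b0 : 0 < b by rewrite invr_gt0 exprn_gt0.
have sB0 : 0 < sB by rewrite sqrtr_gt0.
have hold (z z' : 'rV[R]_d) (a : R) : S z -> S z' -> 0 < a <= 1 -> a <= (e / (B + 1)) ^+ 2 -> close a z z' ->
    v z <= v z' + e.
  move=> hz hz' ha ae cl; apply: le_trans (vH z z' a hz hz' ha cl) _; rewrite addrC lerD2l.
  exact: mul_sqrt_le.
pose T (m : 'rV[R]_d) : 'rV[R]_d := (1 - l) *: m + l *: uniform_point R d.
have TS m : S m -> S (T m).
  by move=> hm; apply: simplex_convex; rewrite ?(ltW l0)//; exact: uniform_simplex.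
have [f' hf'] := @simplex_inf_convolution R d (fun m z => b * sqdist z (T m) + -1 * v z) S0
  (fun m => simplex_continuous_add (simplex_continuous_scale _ (simplex_continuous_sqdist _))
     (simplex_continuous_scale _ cv)).
pose f m := - f' m.
have f_ge m z : S z -> v z - b * sqdist z (T m) <= f m.
  by move=> hz; have := (hf' m).2 z hz; rewrite /f; glra.
have f_ex m : exists2 z, S z & f m = v z - b * sqdist z (T m).
  by have [z hz h] := (hf' m).1; exists z => //; rewrite /f h; glra.
have Tclose m : S m -> close l (T m) m.
  move=> hm x; rewrite !mxE (_ : _ - _ = l * (d%:R^-1 - m ord0 x)); last by ring.
  rewrite normrM (ger0_norm (ltW l0)) ler_piMr ?(ltW l0)//.
  have h1 : 0 <= (d%:R^-1 : R) <= 1 by rewrite invr_ge0 ler0n invf_le1// ler1n.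
  have := simplex_ge0 x hm; have := simplex_le1 x hm; case/andP: h1 => h1 h2.
  by move: h1 h2; rewrite ler_norml => h1 h2 h3 h4; apply/andP; split; move: h1 h2 h3 h4; glra.
have l2d : l / (2 * d%:R) = t * k by rewrite /l; field; rewrite gt_eqF.
(* The maximizer is first located at distance [t * sB] of [T m]; the modulus of
   continuity of the value then improves this to [l / (2 d)]. *)
have near m z : S m -> S z -> f m = v z - b * sqdist z (T m) -> close (l / (2 * d%:R)) z (T m).
  move=> hm hz hfz; have := f_ge m _ (TS m hm); rewrite sqdistxx mulr0 subr0 hfz => h1.
  have tb (a : R) : b * sqdist z (T m) <= a -> sqdist z (T m) <= t ^+ 2 * a.
    by rewrite /b mulrC ler_pdivrMr ?exprn_gt0// mulrC.
  have c1 : close (t * sB) z (T m).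
    apply: sqdist_coord; first by rewrite mulr_ge0 ?ltW.
    rewrite exprMn sqr_sqrtr ?(ltW B1)//; apply: tb.
    have /andP[_ h2] := vB z hz; have /andP[h3 _] := vB _ (TS m hm).
    by move: h1 h2 h3; glra.
  have ts1 : 0 < t * sB <= 1 by rewrite mulr_gt0.
  have h2 := vH z (T m) _ hz (TS m hm) ts1 c1.
  have h3 : B * Num.sqrt (t * sB) <= k ^+ 2 by apply: mul_sqrt_le => //; exact: exprn_gt0.
  rewrite l2d; apply: sqdist_coord; first by rewrite mulr_ge0 ?ltW.
  rewrite exprMn; apply: tb; move: h1 h2 h3; glra.
have l2dl : l / (2 * d%:R) <= l.
  have d1 : 1 <= (d%:R : R) by rewrite ler1n.
  rewrite ler_pdivrMr ?mulr_gt0// ler_peMr ?(ltW l0)//; lra.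
have near2 m z : S m -> S z -> f m = v z - b * sqdist z (T m) -> close (2 * l) z m.
  move=> hm hz hfz; rewrite (_ : 2 * l = l + l); last by ring.
  by apply: close_trans (Tclose m hm); apply: close_le l2dl _; exact: near.
have l2 : 0 < 2 * l <= 1 by rewrite mulr_gt0//=; move: l4; glra.
exists f, (Num.truncn (b * d%:R / l)); split.
  move=> m hm; have [z hz hfz] := f_ex m; apply/andP; split.
    have h := f_ge m _ (TS m hm); rewrite sqdistxx mulr0 subr0 in h.
    have ll : 0 < l <= 1 by rewrite l0.
    have := hold m (T m) l hm (TS m hm) ll _ (closeC (Tclose m hm)).
    have le2 : l <= (e / (B + 1)) ^+ 2 by move: lB l0; glra.
    by move=> /(_ le2); move: h; glra.
  have := hold z m _ hz hm l2 lB (near2 m z hm hz hfz).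
  have : 0 <= b * sqdist z (T m) by rewrite mulr_ge0 ?sqdist_ge0// ltW.
  rewrite hfz; glra.
move=> n m q nn hm q0; have [z hz hfz] := f_ex m.
have bn : b * d%:R / n%:R <= l.
  have n0 : 0 < (n%:R : R) by rewrite ltr0n; case: n nn.
  have : b * d%:R / l < n%:R.
    by apply: lt_le_trans (truncnS_gt _) _; rewrite ler_nat.
  by rewrite ltr_pdivrMr// ler_pdivrMr// [n%:R * l]mulrC => /ltW.
have n0 : 0 < (n%:R : R) by rewrite ltr0n; case: n nn {bn}.
have hnear := near m z hm hz hfz.
pose p x : R := 2 * b * (z ord0 x - T m ord0 x).
(* The solution of [z = (1 - l) * m + l * xi]; since [z] is within [l / (2 * d)] of [T m], its
   coordinates are at least [1 / (2 * d)]. *)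
pose xi x : R := d%:R^-1 + (z ord0 x - T m ord0 x) / l.
have Tx x : T m ord0 x = (1 - l) * m ord0 x + l * d%:R^-1 by rewrite !mxE.
have zx x : z ord0 x = (1 - l) * m ord0 x + l * xi x.
  by rewrite /xi Tx; field; rewrite !gt_eqF.
have d1 : (d%:R^-1 : R) <= 1 by rewrite invf_le1// ler1n.
have xib x : 0 < xi x <= 2.
  have := hnear x; rewrite -(ler_pM2r (_ : 0 < l^-1)) ?invr_gt0//.
  have -> : l / (2 * d%:R) / l = d%:R^-1 / 2 by field; rewrite !gt_eqF.
  rewrite -[X in _ * X <= _](gtr0_norm (_ : 0 < l^-1)) ?invr_gt0// -normrM ler_norml => /andP[h1 h2].
  have h3 : 0 < (d%:R^-1 : R) by rewrite invr_gt0.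
  by rewrite /xi; apply/andP; split; move: h1 h2 h3 d1; glra.
have lp x : l * `|p x| <= 4 * d%:R * k ^+ 2.
  rewrite /p normrM (gtr0_norm (_ : 0 < 2 * b)) ?mulr_gt0//.
  apply: (@le_trans _ _ (l * (2 * b * (l / (2 * d%:R))))).
    by rewrite ler_wpM2l ?(ltW l0)// ler_wpM2l ?mulr_ge0 ?(ltW b0)//.
  rewrite l2d /b /l le_eqVlt; apply/orP; left; apply/eqP; field; rewrite gt_eqF//.
pose w e' : R := (1 - l) * (m ord0 e'.1 * q e') + l * (xi e'.1 * gamma e'.1 e'.2).
have mx0 x := simplex_ge0 x hm.
have l1' : 0 <= 1 - l by rewrite subr_ge0.
have w0 a : jump a -> 0 < w a.
  move=> ja; have /andP[xi0 _] := xib a.1; rewrite ltr_wpDl ?mulr_ge0 ?mulr_gt0//.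
  exact/ltW/q0.
have z0 x : 0 < z ord0 x.
  by rewrite zx; have /andP[xi0 _] := xib x; rewrite ltr_wpDl ?mulr_ge0 ?mulr_gt0.
have HJB : (0 <= running_cost gamma C r z (fun a => (w a / z ord0 a.1)%R) +
    (\sum_(a | jump a) w a * (p a.2 - p a.1))%:E)%E.
  apply: (value_subsolution rc r0 vE hz z0 w0 (ltW b0)) => z' hz'.
  have := f_ge m z' hz'; rewrite hfz (sqdist_expand z z').
  have -> : \sum_x p x * (z' ord0 x - z ord0 x) =
      b * \sum_x 2 * (z ord0 x - T m ord0 x) * (z' ord0 x - z ord0 x).
    by rewrite mulr_sumr; apply: eq_bigr => x _; rewrite /p; ring.
  rewrite -/(sqdist z' z); glra.
rewrite running_costE in HJB; last by move=> a ja; rewrite divr_gt0 ?w0.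
rewrite running_costE// -!EFinD !lee_fin in HJB *.
(* The optimizer [z] of [m] is kept as a competitor at the neighbours, so the increments of [f] are
   at least those of the quadratic. *)
have gen : \sum_(a | jump a) m ord0 a.1 * q a * ((1 - l) * (p a.2 - p a.1) - b * d%:R / n%:R)
    <= generator n gamma f m q.
  apply: ler_sum => a ja; rewrite -(mulrA _ n%:R); apply: ler_wpM2l.
    by rewrite mulr_ge0// ltW// q0.
  set m' := m + _.
  have h := f_ge m' z hz.
  have Tm' : T m' = T m + ((1 - l) / n%:R) *: jump_vector R a.
    by rewrite /T /m' scalerDr scalerA addrAC.
  rewrite Tm' sqdist_shiftr in h.
  set J := jump_vector R a in h.
  have s1 : \sum_x 2 * (z ord0 x - T m ord0 x) * (((1 - l) / n%:R) *: J) ord0 x =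
      (1 - l) / n%:R / b * (p a.2 - p a.1).
    rewrite -jump_vector_dot mulr_sumr; apply: eq_bigr => x _.
    by rewrite [(_ *: J) _ _]mxE /p -/J; field; rewrite !gt_eqF.
  have s2 : \sum_x (((1 - l) / n%:R) *: J) ord0 x ^+ 2 <= d%:R / n%:R ^+ 2.
    rewrite (eq_bigr (fun x => ((1 - l) / n%:R) ^+ 2 * J ord0 x ^+ 2)); last first.
      by move=> x _; rewrite mxE exprMn.
    rewrite -mulr_sumr mulrC exprMn exprVn mulrA ler_pdivrMr ?exprn_gt0// divfK ?expf_neq0 ?gt_eqF//.
    rewrite -[leRHS]mulr1; apply: ler_pM => //.
    - by apply: sumr_ge0 => x _; exact: sqr_ge0.
    - exact: sqr_ge0.
    - exact: jump_vector_sq.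
    - by rewrite expr_le1//; move: l0; glra.
  rewrite s1 in h; rewrite -ler_pdivrMl//.
  have -> : n%:R^-1 * ((1 - l) * (p a.2 - p a.1) - b * d%:R / n%:R) =
      b * ((1 - l) / n%:R / b * (p a.2 - p a.1)) - b * (d%:R / n%:R ^+ 2).
    by field; rewrite !gt_eqF.
  have h2 : b * \sum_x (((1 - l) / n%:R) *: J) ord0 x ^+ 2 <= b * (d%:R / n%:R ^+ 2).
    by rewrite ler_wpM2l// ltW.
  rewrite hfz; move: h h2; glra.
pose Q := \sum_(a | jump a) m ord0 a.1 * q a.
pose X := \sum_(a | jump a) m ord0 a.1 * rcost a (q a).
have Q0 : 0 <= Q by apply: sumr_ge0 => a ja; rewrite mulr_ge0// ltW// q0.
(* The second order error is proportional to the jump intensity [Q], which is unbounded over all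
   controls; the minorant of slope 1 bounds it by the cost itself. *)
have QX : Q <= X + Gam * E1.
  apply: (@le_trans _ _ (\sum_(a | jump a) (m ord0 a.1 * rcost a (q a) + gamma a.1 a.2 * E1))).
    apply: ler_sum => a ja; have := rcost_ge 1 ja (q0 a ja); rewrite mul1r -/E1 => h.
    have h2 : m ord0 a.1 * (q a - gamma a.1 a.2 * (E1 - 1)) <= m ord0 a.1 * rcost a (q a).
      by rewrite ler_wpM2l.
    have g0 : 0 < gamma a.1 a.2 by [].
    have E11 : 1 <= E1 by rewrite /E1 -expR0 ler_expR.
    have h3 : m ord0 a.1 * (gamma a.1 a.2 * (E1 - 1)) <= gamma a.1 a.2 * E1.
      apply: (@le_trans _ _ (gamma a.1 a.2 * (E1 - 1))).
        rewrite ler_piMl ?simplex_le1// mulr_ge0 ?(ltW g0)//; move: E11; glra.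
      by rewrite ler_wpM2l ?(ltW g0)//; glra.
    rewrite mulrBr in h2; move: h2 h3; glra.
  by rewrite big_split/= lerD2l -mulr_suml ler_wpM2r ?expR_ge0// jump_rate_sum_le.
have X1 : \sum_(a | jump a) z ord0 a.1 * rcost a (w a / z ord0 a.1) <= (1 - l) * X + 2 * l * Phi.
  rewrite /X /Phi /natural_cost !mulr_sumr -big_split/=; apply: ler_sum => a ja.
  have /andP[xi0 xi2] := xib a.1.
  have l01 : 0 <= l <= 1 by rewrite (ltW l0).
  apply: le_trans (rcost_perspective ja l01 (mx0 _) (ltW xi0) (q0 a ja) ja (zx a.1) (z0 _) (w0 a ja)) _.
  rewrite lerD2l (mulrC 2 l) -(mulrA l 2); apply: ler_wpM2l; first exact: ltW.
  by apply: ler_wpM2r => //; exact: rcost_ge0.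
have X2 : \sum_(a | jump a) w a * (p a.2 - p a.1) <=
    (1 - l) * (\sum_(a | jump a) m ord0 a.1 * q a * (p a.2 - p a.1)) + 16 * d%:R * k ^+ 2 * Gam.
  apply: (@le_trans _ _ (\sum_(a | jump a) ((1 - l) * (m ord0 a.1 * q a * (p a.2 - p a.1)) +
      16 * d%:R * k ^+ 2 * gamma a.1 a.2))).
    apply: ler_sum => a ja; rewrite /w mulrDl -[X in X + _ <= _]mulrA lerD2l.
    have /andP[xi0 xi2] := xib a.1; have g0 : 0 < gamma a.1 a.2 by [].
    have h1 : l * (p a.2 - p a.1) <= 2 * (4 * d%:R * k ^+ 2).
      have := lp a.1; have := lp a.2.
      have : l * p a.2 <= l * `|p a.2| by rewrite ler_wpM2l ?(ltW l0)// ler_norm.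
      have : - (l * p a.1) <= l * `|p a.1| by rewrite -mulrN ler_wpM2l ?(ltW l0)// -normrN ler_norm.
      rewrite mulrBr; glra.
    have -> : l * (xi a.1 * gamma a.1 a.2) * (p a.2 - p a.1) = gamma a.1 a.2 * (xi a.1 * (l * (p a.2 - p a.1))) by ring.
    rewrite [leRHS]mulrC; apply: ler_wpM2l; first exact: ltW.
    have k20 : 0 <= 8 * d%:R * k ^+ 2 by rewrite !mulr_ge0 ?sqr_ge0 ?(ltW k0).
    apply: (@le_trans _ _ (xi a.1 * (2 * (4 * d%:R * k ^+ 2)))).
      by apply: ler_wpM2l => //; exact: ltW.
    apply: (@le_trans _ _ (2 * (2 * (4 * d%:R * k ^+ 2)))); last by glra.
    by apply: ler_wpM2r => //; move: k20; glra.
  rewrite big_split/= -!mulr_sumr lerD2l; apply: ler_wpM2l; last exact: jump_rate_sum_le.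
  by rewrite !mulr_ge0 ?sqr_ge0 ?(ltW k0).
have gen2 : (1 - l) * (\sum_(a | jump a) m ord0 a.1 * q a * (p a.2 - p a.1)) - b * d%:R / n%:R * Q
    <= generator n gamma f m q.
  apply: le_trans gen; rewrite /Q !mulr_sumr -sumrB le_eqVlt; apply/orP; left; apply/eqP.
  by apply: eq_bigr => a _; ring.
have rz : r z <= r m + e / 4.
  have := hdl z m hz hm (close_le ldl (near2 m z hm hz hfz)).
  by rewrite ler_norml => /andP[_]; glra.
have bQ : b * d%:R / n%:R * Q <= l * Q by rewrite ler_wpM2r.
have lQ : l * Q <= l * X + l * (Gam * E1) by rewrite -mulrDr ler_wpM2l// ltW.
rewrite -/X; apply: (@subsolution_sum _ _ _ X (l * X) (2 * l * Phi) _ _ _ _ _ _ _ e HJB _ X2 gen2 rz bQ lQ kG _ e0).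
  by rewrite -[X in X - _]mul1r -mulrBl.
by move: lP; rewrite mulrDr (mulrCA l 2) mulrA.
Qed.

(** * The discrete supersolution *)

Notation Gam := (total_rate gamma).
Notation Phi := natural_cost.

Definition to_center (l : R) (z : 'rV[R]_d) := (1 - l) *: z + l *: uniform_point R d.

Lemma to_centerE l z x : to_center l z ord0 x = (1 - l) * z ord0 x + l * d%:R^-1.
Proof. by rewrite !mxE. Qed.

Lemma add_scale_coord (m v : 'rV[R]_d) (k : R) x : (m + k *: v) ord0 x = m ord0 x + k * v ord0 x.
Proof. by rewrite mxE [X in _ + X]mxE. Qed.

Lemma scale_sub_coord (z z' : 'rV[R]_d) (k : R) x :
  (k *: (z' - z)) ord0 x = k * (z' ord0 x - z ord0 x).
Proof. by rewrite !mxE. Qed.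

Lemma inv_dim_bounds : (0 < d)%N -> 0 < (d%:R^-1 : R) <= 1.
Proof. by move=> d0; rewrite invr_gt0 ltr0n d0 invf_le1 ?ltr0n// ler1n. Qed.

Lemma minorant00 a : jump a -> minorant (gamma a.1 a.2) (C a) 0 0.
Proof. by move=> ja x x0; rewrite mul0r addr0; apply: transformed_cost_ge0 => //; exact: C1. Qed.

(** Perspective convexity between the averaged data at [mb], known only through minorants and
    possibly with [mb = 0], and the natural rate at [xi]. *)
Lemma mixed_cost_le a (l mb xi w c mx : R) : jump a -> 0 < l < 1 -> 0 < xi ->
  mx = (1 - l) * mb + l * xi -> 0 < mx -> 0 <= w ->
  (forall a1 a2, minorant (gamma a.1 a.2) (C a) a1 a2 -> a1 * mb + a2 * w <= c) ->
  mx * rcost a (((1 - l) * w + l * (xi * gamma a.1 a.2)) / mx) <=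
    (1 - l) * c + l * (xi * rcost a (gamma a.1 a.2)).
Proof.
move=> ja /andP[l0 l1] xi0 mxE' mx0 w0 hm; have g0 : 0 < gamma a.1 a.2 by [].
set q := _ / mx; have q0 : 0 < q.
  by rewrite divr_gt0// ltr_wpDl ?mulr_gt0// mulr_ge0// subr_ge0 ltW.
rewrite mulrC -ler_pdivlMr// -lee_fin -(rcostE ja q0).
apply: (minorant_sup ja (cC ja) q0) => a1 a2 h.
rewrite lee_fin ler_pdivlMr//.
have -> : (a1 + a2 * q) * mx = (1 - l) * (a1 * mb + a2 * w) + l * (xi * (a1 + a2 * gamma a.1 a.2)).
  by rewrite mulrDl -(mulrA a2) /q divfK ?gt_eqF// mxE'; ring.
apply: lerD; first by apply: ler_wpM2l; [rewrite subr_ge0 ltW|exact: hm].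
apply: ler_wpM2l; first exact: ltW.
apply: ler_wpM2l; first exact: ltW.
by rewrite -lee_fin -(rcostE ja g0); apply: h; exact: ltW.
Qed.

(** The transport runs in the opposite direction: the averages [mb] near the optimizer [z] are mixed
    with the natural rates so as to sit exactly at the given point, [m = (1 - l) * mb + l * xi]. The
    second bound controls the total jump rate, which multiplies the second order error. *)
Lemma interior_control r K (u : 'rV[R]_d -> R) (b l kap : R) (m z : 'rV[R]_d) :
  simplex_continuous r -> (forall m, S m -> 0 <= r m) ->
  (forall m, S m -> value gamma C r K m = (u m)%:E) ->
  0 < l -> l <= 2^-1 -> 0 < b -> 0 < kap -> S m -> S z ->
  close (l / (4 * d%:R)) m (to_center l z) ->
  (exists2 e : R, 0 < e & forall m, S m -> close e m z -> ~ K m) ->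
  (forall z', S z' -> u z + b * sqdist m (to_center l z) <= u z' + b * sqdist m (to_center l z')) ->
  exists q : edge d -> R, [/\ forall a, 0 < q a,
    \sum_(a | jump a) m ord0 a.1 * rcost a (q a) + r z +
      \sum_(a | jump a) m ord0 a.1 * q a *
        (2 * b * (m ord0 a.2 - to_center l z ord0 a.2) - 2 * b * (m ord0 a.1 - to_center l z ord0 a.1))
      <= kap / 4 + l * (2 * Phi) + 2 * b * l ^+ 2 / d%:R * Gam &
    \sum_(a | jump a) m ord0 a.1 * q a <= kap + Gam * expR (4 * b + 1) + 2 * Gam].
Proof.
move=> rc r0 uE l0 l12 b0 k0 hm hz hcl sepK opt.
have d0 : (0 < d)%N by exact: simplex_dim hm.
have dR : 0 < (d%:R : R) by rewrite ltr0n.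
have /andP[di0 di1] := inv_dim_bounds d0.
have l1 : l < 1 by lra.
have l1' : 0 < 1 - l by lra.
pose P x : R := 2 * b * (m ord0 x - to_center l z ord0 x).
pose p x : R := (1 - l) * P x.
(* The error [3 * th] of [value_supersolution] is then [kap / 4]. *)
have th0 : 0 < kap / 12 by rewrite divr_gt0.
(* Two deviations of this size, of [m] from the centre and of [mb] from [z], leave the coordinates
   of [xi] at least [1 / (2 * d)]. *)
have rho0 : 0 < l / (4 * d%:R) by rewrite divr_gt0// mulr_gt0.
have test z' : S z' -> u z + \sum_x p x * (z' ord0 x - z ord0 x) - b * \sum_x (z' ord0 x - z ord0 x) ^+ 2 <= u z'.
  move=> hz'; have := opt z' hz'.
  have -> : to_center l z' = to_center l z + (1 - l) *: (z' - z).
    by rewrite /to_center scalerBr [RHS]addrC addrA subrK.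
  rewrite (sqdist_shiftr m (to_center l z)).
  have -> : \sum_x 2 * (m ord0 x - to_center l z ord0 x) * ((1 - l) *: (z' - z)) ord0 x =
      (\sum_x p x * (z' ord0 x - z ord0 x)) / b.
    rewrite mulr_suml; apply: eq_bigr => x _; rewrite scale_sub_coord /p /P.
    by field; rewrite gt_eqF.
  have h2 : \sum_x ((1 - l) *: (z' - z)) ord0 x ^+ 2 <= \sum_x (z' ord0 x - z ord0 x) ^+ 2.
    apply: ler_sum => x _; rewrite scale_sub_coord exprMn.
    by rewrite ler_piMl ?sqr_ge0// expr_le1// ?(ltW l1')// gerBl ltW.
  have h3 := ler_wpM2l (ltW b0) h2.
  have h4 (X : R) : b * (X / b) = X by rewrite mulrC divfK// gt_eqF.
  rewrite mulrDr mulrBr h4; lra.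
have [mb [w [c [hmb mbz w0 cmin hmain]]]] :=
  value_supersolution rc r0 uE hz (ltW b0) th0 rho0 sepK test.
pose xi x : R := (m ord0 x - (1 - l) * mb ord0 x) / l.
have mxE' x : m ord0 x = (1 - l) * mb ord0 x + l * xi x.
  by rewrite /xi; field; rewrite gt_eqF.
have xib x : 0 < xi x <= 2.
  have h1 := hcl x; have h2 := mbz x.
  have -> : xi x = d%:R^-1 + ((m ord0 x - to_center l z ord0 x) / l + (1 - l) * ((z ord0 x - mb ord0 x) / l)).
    by rewrite /xi to_centerE; field; rewrite !gt_eqF.
  have li : 0 < l^-1 by rewrite invr_gt0.
  have E : l / (4 * d%:R) / l = d%:R^-1 / 4 by field; rewrite !gt_eqF.
  have a1 : `|(m ord0 x - to_center l z ord0 x) / l| <= d%:R^-1 / 4.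
    by rewrite normrM (gtr0_norm li) -E ler_pM2r.
  have a2 : `|(1 - l) * ((z ord0 x - mb ord0 x) / l)| <= d%:R^-1 / 4.
    rewrite !normrM (gtr0_norm li) (gtr0_norm l1') -E.
    apply: (@le_trans _ _ (1 * (l / (4 * d%:R) / l))); last by rewrite mul1r.
    apply: ler_pM => //; first exact: ltW.
      by rewrite mulr_ge0// ltW.
      by rewrite gerBl ltW.
    by rewrite ler_pM2r// distrC.
  move: a1 a2; rewrite !ler_norml => /andP[a1 a2] /andP[a3 a4].
  by apply/andP; split; lra.
have mb0 x := simplex_ge0 x hmb.
have mx0 x : 0 < m ord0 x.
  have /andP[h _] := xib x; rewrite mxE'; apply: ltr_wpDl; last exact: mulr_gt0.
  by apply: mulr_ge0 => //; exact: ltW.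
pose vp a : R := (1 - l) * w a + l * (xi a.1 * gamma a.1 a.2).
have vp0 a : jump a -> 0 < vp a.
  move=> ja; have /andP[h _] := xib a.1; have g0 : 0 < gamma a.1 a.2 by [].
  apply: ltr_wpDl; last exact: mulr_gt0 l0 (mulr_gt0 h g0).
  by apply: mulr_ge0; [exact: ltW|exact: w0].
(* The value 1 off the jumps only secures positivity. *)
exists (fun a => if jump a then vp a / m ord0 a.1 else 1).
have mqE a : jump a ->
    m ord0 a.1 * (if jump a then vp a / m ord0 a.1 else 1) = vp a.
  by move=> ja; rewrite ja mulrC divfK// gt_eqF.
have l01 : 0 < l < 1 by rewrite l0.
have Gam0 : 0 <= Gam := total_rate_ge0.
have Gs := jump_rate_sum_le.
have c0 a : jump a -> 0 <= c a.
  by move=> ja; have := cmin a ja 0 0 (minorant00 ja); rewrite !mul0r addr0.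
pose cs := \sum_(a | jump a) c a.
pose W := \sum_(a | jump a) w a.
pose D := \sum_(a | jump a) w a * (p a.2 - p a.1).
have W0 : 0 <= W by apply: sumr_ge0.
have cs0 : 0 <= cs by apply: sumr_ge0.
have PB x : `|P x| <= 2 * b.
  rewrite /P normrM (gtr0_norm (_ : 0 < 2 * b)) ?mulr_gt0// ler_piMr ?mulr_ge0 ?(ltW b0)//.
  apply: le_trans (hcl x) _; rewrite ler_pdivrMr ?mulr_gt0// mul1r.
  have : 1 <= (d%:R : R) by rewrite ler1n.
  by lra.
have pB x : `|p x| <= 2 * b.
  rewrite /p normrM (gtr0_norm l1'); apply: le_trans (PB x).
  by rewrite ler_piMl// gerBl ltW.
have DW : - (4 * b * W) <= D.
  rewrite /W -mulNr mulr_sumr; apply: ler_sum => a ja; rewrite mulrC; apply: ler_wpM2l; first exact: w0.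
  have := pB a.1; have := pB a.2; rewrite !ler_norml => /andP[h1 h2] /andP[h3 h4].
  by move: h1 h2 h3 h4; glra.
have M0 : 0 <= 4 * b + 1 by lra.
(* The slope exceeds by 1 the bound [4 * b] on the differences of [p], which leaves one copy of [W]
   to be estimated. *)
have cW : (4 * b + 1) * W <= cs + Gam * expR (4 * b + 1).
  apply: (@le_trans _ _ (\sum_(a | jump a) (c a + gamma a.1 a.2 * expR (4 * b + 1)))).
    rewrite mulr_sumr; apply: ler_sum => a ja.
    have := cmin a ja _ _ (minorant_exp ja (C1 ja) (4 * b + 1)).
    have g0 : 0 < gamma a.1 a.2 by [].
    have e1 : 0 <= expR (4 * b + 1) - 1 by rewrite subr_ge0 -[X in X <= _]expR0 ler_expR.
    have : gamma a.1 a.2 * (expR (4 * b + 1) - 1) * mb ord0 a.1 <= gamma a.1 a.2 * (expR (4 * b + 1) - 1).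
      by rewrite ler_piMr ?simplex_le1// mulr_ge0// ltW.
    by lra.
  by rewrite big_split/= lerD2l -mulr_suml; apply: ler_wpM2r; rewrite ?expR_ge0.
have WB : W <= kap + Gam * expR (4 * b + 1).
  have rz := r0 z hz.
  have aux (bW W' cs' GE D' rz' : R) : cs' + rz' + D' <= 3 * (kap / 12) -> 4 * bW + W' <= cs' + GE ->
    - (4 * bW) <= D' -> 0 <= rz' -> W' <= kap + GE by move: th0; glra.
  apply: (aux (b * W) _ cs _ D (r z)) => //; last by rewrite mulrA.
  by move: cW; rewrite mulrDl mul1r -mulrA.
split.
- by move=> a; case: ifPn => // ja; rewrite divr_gt0// vp0.
- have X1 : \sum_(a | jump a) m ord0 a.1 * rcost a (if jump a then vp a / m ord0 a.1 else 1)
      <= cs + l * (2 * Phi).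
    rewrite /natural_cost !mulr_sumr -big_split/=; apply: ler_sum => a ja; rewrite ja.
    have /andP[xi0 xi2] := xib a.1.
    apply: le_trans (mixed_cost_le ja l01 xi0 (mxE' a.1) (mx0 _) (w0 a ja) (cmin a ja)) _.
    apply: lerD; first by rewrite ler_piMl ?c0// gerBl ltW.
    apply: ler_wpM2l; first exact: ltW.
    by apply: ler_wpM2r => //; exact: (rcost_ge0).
  have X2 : \sum_(a | jump a) m ord0 a.1 * (if jump a then vp a / m ord0 a.1 else 1) * (P a.2 - P a.1)
      <= D + 2 * b * l ^+ 2 / d%:R * Gam.
    apply: (@le_trans _ _ (\sum_(a | jump a) (w a * (p a.2 - p a.1) + 2 * b * l ^+ 2 / d%:R * gamma a.1 a.2))).
      apply: ler_sum => a ja; rewrite mqE// /vp mulrDl.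
      have -> : (1 - l) * w a * (P a.2 - P a.1) = w a * (p a.2 - p a.1) by rewrite /p; ring.
      rewrite lerD2l; have /andP[xi0 xi2] := xib a.1; have g0 : 0 < gamma a.1 a.2 by [].
      have lP x : `|l * P x| <= b * l ^+ 2 / (2 * d%:R).
        rewrite normrM (gtr0_norm l0) /P normrM (gtr0_norm (_ : 0 < 2 * b)) ?mulr_gt0//.
        apply: (@le_trans _ _ (l * (2 * b * (l / (4 * d%:R))))).
          by apply: ler_wpM2l; [exact: ltW|apply: ler_wpM2l; [rewrite mulr_ge0 ?(ltW b0)|exact: hcl]].
        by rewrite le_eqVlt; apply/orP; left; apply/eqP; field; rewrite gt_eqF.
      have h1 : l * P a.2 - l * P a.1 <= b * l ^+ 2 / d%:R.
        have := lP a.1; have := lP a.2; rewrite !ler_norml => /andP[_ h1] /andP[h2 _].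
        have -> : b * l ^+ 2 / d%:R = b * l ^+ 2 / (2 * d%:R) + b * l ^+ 2 / (2 * d%:R) by field; rewrite gt_eqF.
        by move: h1 h2; glra.
      have -> : l * (xi a.1 * gamma a.1 a.2) * (P a.2 - P a.1) = gamma a.1 a.2 * (xi a.1 * (l * P a.2 - l * P a.1)) by ring.
      rewrite [leRHS]mulrC; apply: ler_wpM2l; first exact: ltW.
      apply: (@le_trans _ _ (xi a.1 * (b * l ^+ 2 / d%:R))); first by apply: ler_wpM2l => //; exact: ltW.
      rewrite (_ : 2 * b * l ^+ 2 / d%:R = 2 * (b * l ^+ 2 / d%:R)); last by rewrite !mulrA.
      apply: ler_wpM2r => //.
      by apply: divr_ge0 => //; apply: mulr_ge0; [exact: ltW|exact: sqr_ge0].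
    rewrite big_split/= -mulr_sumr lerD2l; apply: ler_wpM2l => //.
    by rewrite divr_ge0// !mulr_ge0 ?sqr_ge0 ?(ltW l0) ?(ltW b0).
  move: hmain; rewrite -/cs -/D => hmain.
  have aux (X Y cs' D' lp bl rz' : R) : X <= cs' + lp -> Y <= D' + bl -> cs' + rz' + D' <= 3 * (kap / 12) ->
    X + rz' + Y <= kap / 4 + lp + bl by glra.
  exact: aux X1 X2 hmain.
- rewrite (eq_bigr vp); last by move=> a ja; rewrite mqE.
  apply: (@le_trans _ _ (\sum_(a | jump a) (w a + 2 * gamma a.1 a.2))).
    apply: ler_sum => a ja; have /andP[xi0 xi2] := xib a.1; have g0 : 0 < gamma a.1 a.2 by [].
    apply: lerD; first by rewrite ler_piMl ?w0// gerBl ltW.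
    apply: (@le_trans _ _ (1 * (xi a.1 * gamma a.1 a.2))).
      by apply: ler_wpM2r; [rewrite mulr_ge0 ?(ltW xi0) ?(ltW g0)|exact: ltW].
    by rewrite mul1r; apply: ler_wpM2r => //; exact: ltW.
  rewrite big_split/= -mulr_sumr; apply: lerD => //.
  by apply: ler_wpM2l.
Qed.

(** The natural rates have bounded cost and move the Lipschitz function [G] at a bounded rate; the
    drift [- A * gm * R0 / 2] of the barrier outweighs both when [R0] is large. *)
Lemma boundary_control r (M L A R0 gm : R) (G : 'rV[R]_d -> R) n m :
  (0 < n)%N -> S m -> (forall m, S m -> r m <= M) -> 0 <= L -> 0 <= A -> 0 <= R0 ->
  (forall a, jump a -> gm <= gamma a.1 a.2) ->
  (forall m', G m' <= G m + L * \sum_x `|m' ord0 x - m ord0 x|) ->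
  (exists2 a, jump a & R0 * Num.sqrt (m ord0 a.2 + n%:R^-1) <= m ord0 a.1) ->
  Phi + M + Gam * (L * d%:R) + A * (Gam - gm * R0 / 2) <= 0 ->
  \sum_(a | jump a) m ord0 a.1 * rcost a (gamma a.1 a.2) + r m +
    generator n gamma (fun m' => G m' + A * barrier m') m (fun a => gamma a.1 a.2) <= 0.
Proof.
move=> n0 hm rM L0 A0 R00 hgm GL [a0 ja0 ha0] hneg.
have nR : 0 < (n%:R : R) by rewrite ltr0n.
have X1 : \sum_(a | jump a) m ord0 a.1 * rcost a (gamma a.1 a.2) <= Phi.
  by apply: ler_sum => a ja; rewrite ler_piMl ?simplex_le1//; exact: (rcost_ge0).
have X2 : generator n gamma (fun m' => G m' + A * barrier m') m (fun a => gamma a.1 a.2) <=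
    Gam * (L * d%:R) + A * generator n gamma (@barrier R d) m (fun a => gamma a.1 a.2).
  rewrite /generator mulr_sumr; apply: (@le_trans _ _ (\sum_(a | jump a)
     (gamma a.1 a.2 * (L * d%:R) + A * (m ord0 a.1 * gamma a.1 a.2 * n%:R *
        (barrier (m + n%:R^-1 *: jump_vector R a) - barrier m))))); last first.
    rewrite big_split/= lerD2r -mulr_suml; apply: ler_wpM2r; first by rewrite mulr_ge0.
    exact: jump_rate_sum_le.
  apply: ler_sum => a ja; set m' := m + _.
  have h := GL m'.
  have h2 : \sum_x `|m' ord0 x - m ord0 x| <= n%:R^-1 * d%:R.
    rewrite -[in leRHS](card_ord d) mulrC mulr_natl -sumr_const; apply: ler_sum => x _.
    have -> : m' ord0 x - m ord0 x = n%:R^-1 * jump_vector R a ord0 x.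
      by rewrite /m' add_scale_coord addrC addKr.
    rewrite normrM (gtr0_norm (_ : 0 < n%:R^-1)) ?invr_gt0// ler_piMr ?invr_ge0//.
    exact: jump_vector_le1.
  have h3 : G m' - G m <= L * (n%:R^-1 * d%:R).
    have := ler_wpM2l L0 h2; by lra.
  have g0 : 0 < gamma a.1 a.2 by [].
  have -> : m ord0 a.1 * gamma a.1 a.2 * n%:R * (G m' + A * barrier m' - (G m + A * barrier m)) =
    m ord0 a.1 * (gamma a.1 a.2 * (n%:R * (G m' - G m))) +
    A * (m ord0 a.1 * gamma a.1 a.2 * n%:R * (barrier m' - barrier m)) by ring.
  rewrite lerD2r.
  have h4 : n%:R * (G m' - G m) <= L * d%:R.
    have -> : L * d%:R = n%:R * (L * (n%:R^-1 * d%:R)) by field; rewrite gt_eqF.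
    by apply: ler_wpM2l.
  apply: (@le_trans _ _ (m ord0 a.1 * (gamma a.1 a.2 * (L * d%:R)))).
    apply: ler_wpM2l; first exact: simplex_ge0.
    by apply: ler_wpM2l => //; exact: ltW.
  by rewrite ler_piMl ?simplex_le1// mulr_ge0 ?(ltW g0)// mulr_ge0.
have X3 := barrier_drift n0 hm gN ja0 R00 ha0.
have X4 : A * generator n gamma (@barrier R d) m (fun a => gamma a.1 a.2) <= A * (Gam - gm * R0 / 2).
  apply: ler_wpM2l => //; apply: le_trans X3 _.
  have : gm * R0 <= gamma a0.1 a0.2 * R0 by apply: ler_wpM2r => //; exact: hgm.
  by lra.
have X5 := rM m hm.
by lra.
Qed.

(** The value is only Hoelder, whereas the barrier compensates Lipschitz terms. The slope
    [L = B / dl] makes competitors farther than [dl] too expensive in the inf-convolution, and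
    nearer ones change [u] by at most [e]. *)
Lemma lipschitz_minorant (u : 'rV[R]_d -> R) (B e : R) : S !=set0 -> simplex_continuous u ->
  0 <= B -> (forall m, S m -> 0 <= u m <= B) -> 0 < e ->
  exists2 L : R, 0 <= L & exists G : 'rV[R]_d -> R,
   [/\ forall m, 0 <= G m,
       forall m, S m -> G m <= u m <= G m + e,
       forall m z, S z -> G m <= u z + L * \sum_x `|m ord0 x - z ord0 x| &
       forall m m', G m' <= G m + L * \sum_x `|m' ord0 x - m ord0 x|].
Proof.
move=> S0 cu B0 uB e0; have [dl dl0 hdl] := simplex_uniform cu e0.
pose L := B / dl; have L0 : 0 <= L by rewrite divr_ge0// ltW.
have dist0 (m z : 'rV[R]_d) : 0 <= \sum_x `|m ord0 x - z ord0 x| by apply: sumr_ge0.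
have [G hG] := simplex_inf_convolution S0
  (fun m => simplex_continuous_add cu (simplex_continuous_scale L (simplex_continuous_dist1 m))).
exists L => //; exists G; split.
- move=> m; have [[z hz ->] _] := hG m; have /andP[h _] := uB z hz.
  by rewrite addr_ge0// mulr_ge0.
- move=> m hm; apply/andP; split.
    have := (hG m).2 m hm; rewrite big1 ?mulr0 ?addr0// => x _.
    by rewrite subrr normr0.
  have [[z hz ->] _] := hG m.
  have [hcl|hcl] := pselect (close dl m z).
    have := hdl m z hm hz hcl; rewrite ler_norml => /andP[_ h].
    have : 0 <= L * \sum_x `|m ord0 x - z ord0 x| by rewrite mulr_ge0.
    lra.
  have [x hx] : exists x, dl < `|m ord0 x - z ord0 x|.
    apply: contrapT => H; apply: hcl => x; rewrite leNgt; apply/negP => h; apply: H; by exists x.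
  have h1 : dl <= \sum_x `|m ord0 x - z ord0 x|.
    by apply: (le_trans (ltW hx)); rewrite (bigD1 x)//= lerDl sumr_ge0.
  have h2 : B <= L * \sum_x `|m ord0 x - z ord0 x|.
    by rewrite /L mulrAC ler_pdivlMr// ler_wpM2l.
  have /andP[_ h3] := uB m hm; have /andP[h4 _] := uB z hz.
  lra.
- by move=> m z hz; exact: (hG m).2.
- move=> m m'; have [[z hz ->] _] := hG m; apply: le_trans ((hG m').2 z hz) _.
  rewrite -addrA lerD2l -mulrDr; apply: ler_wpM2l => //.
  rewrite -big_split/=; apply: ler_sum => x _.
  rewrite (_ : m' ord0 x - z ord0 x = (m ord0 x - z ord0 x) + (m' ord0 x - m ord0 x)); last by ring.
  exact: ler_normD.
Qed.

Lemma jump_min_rate : exists2 gm : R, 0 < gm & forall a, jump a -> gm <= gamma a.1 a.2.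
Proof.
exists (\big[Num.min/1]_(a | jump a) gamma a.1 a.2); last first.
  by move=> a ja; exact: bigmin_le_cond.
by apply: lt_bigmin.
Qed.

Lemma close_to_center l (z : 'rV[R]_d) : S z -> 0 < l -> close l (to_center l z) z.
Proof.
move=> hz l0 x; have /andP[h1 h2] := inv_dim_bounds (simplex_dim hz).
rewrite to_centerE (_ : _ - _ = l * (d%:R^-1 - z ord0 x)); last by ring.
rewrite normrM (gtr0_norm l0) ler_piMr ?(ltW l0)//.
have := simplex_ge0 x hz; have := simplex_le1 x hz.
by rewrite ler_norml => h3 h4; apply/andP; split; lra.
Qed.

Lemma from_center l (m : 'rV[R]_d) : S m -> 0 < l <= 2^-1 -> (forall x, l <= m ord0 x) ->
  exists2 z, S z & to_center l z = m /\ close (2 * l) m z.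
Proof.
move=> hm /andP[l0 l2] lm; have /andP[h1 h2] := inv_dim_bounds (simplex_dim hm).
have l1 : 0 < 1 - l by lra.
pose z : 'rV[R]_d := (1 - l)^-1 *: (m - l *: uniform_point R d).
have zx x : z ord0 x = (1 - l)^-1 * (m ord0 x - l * d%:R^-1) by rewrite !mxE.
exists z.
  split=> [x|].
    rewrite zx mulr_ge0 ?invr_ge0 ?(ltW l1)// subr_ge0 (le_trans _ (lm x))//.
    by rewrite ler_piMr// ltW.
  under eq_bigr do rewrite zx; rewrite -mulr_sumr sumrB hm.2 sumr_const card_ord -[_ *+ d]mulr_natl.
  have -> : d%:R * (l * d%:R^-1) = l by field; rewrite pnatr_eq0 -lt0n; exact: simplex_dim hm.
  by rewrite mulVf// gt_eqF.
split; first by apply/rowP => x; rewrite to_centerE zx mulrA divff ?gt_eqF// mul1r subrK.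
move=> x; rewrite zx.
have -> : m ord0 x - (1 - l)^-1 * (m ord0 x - l * d%:R^-1) = l * (1 - l)^-1 * (d%:R^-1 - m ord0 x).
  by field; rewrite ?pnatr_eq0 -?lt0n ?(simplex_dim hm) ?(gt_eqF l1).
rewrite normrM.
have h3 : `|d%:R^-1 - m ord0 x| <= 1.
  have := simplex_ge0 x hm; have := simplex_le1 x hm.
  by rewrite ler_norml => h3 h4; apply/andP; split; lra.
have h4 : `|l * (1 - l)^-1| <= 2 * l.
  rewrite ger0_norm; last by rewrite divr_ge0 ?(ltW l0) ?(ltW l1).
  rewrite ler_pdivrMr//; have : l * l <= l * 2^-1 by apply: ler_wpM2l; rewrite ?(ltW l0).
  lra.
by rewrite -[leRHS]mulr1; apply: ler_pM.
Qed.

Lemma simplex_continuous_to_center l (m : 'rV[R]_d) : l < 1 ->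
  simplex_continuous (fun z => sqdist m (to_center l z)).
Proof.
move=> l1; have l10 : 1 - l != 0 by rewrite subr_eq0 gt_eqF.
pose c : 'rV[R]_d := (1 - l)^-1 *: (m - l *: uniform_point R d).
have -> : (fun z => sqdist m (to_center l z)) = (fun z => (1 - l) ^+ 2 * sqdist z c).
  apply/funext => z; rewrite mulr_sumr; apply: eq_bigr => x _; rewrite to_centerE -exprMn.
  have -> : c ord0 x = (1 - l)^-1 * (m ord0 x - l * d%:R^-1) by rewrite !mxE.
  by rewrite mulrBr mulVKf//; ring.
exact/simplex_continuous_scale/simplex_continuous_sqdist.
Qed.

Lemma supersolution_scale (x y z w kap : R) :
  x <= y -> w = 1024 * y + 1024 * z -> w <= kap -> 0 < z -> 128 * x <= kap / 8.
Proof. lra. Qed.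

Lemma supersolution_sum (X Pq g' bq lp bl rz rm kap : R) : X + (rz + kap) + Pq <= kap / 4 + lp + bl ->
      g' <= Pq + bq -> bq <= kap / 8 -> rm <= rz + kap / 8 -> lp <= kap / 8 -> bl <= kap / 8 ->
      0 < kap -> X + rm + g' <= 0.
Proof. lra. Qed.

(** [h] is the minimum of the inf-convolution [f] and of the lifted Lipschitz function [g] with the
    barrier. Where [f < g], this inequality bounds the penalty and an interior control exists;
    elsewhere some coordinate is small and the natural rates are used. The increments of [h] are at
    most those of whichever function is active. *)
Lemma discrete_supersolution r K (kap dl B M e : R) :
  simplex_continuous r -> (forall m, S m -> 0 <= r m <= M) -> 0 < kap -> 0 < dl ->
  closed (K : set (subspace S)) ->
  S !=set0 -> 0 <= B -> 0 < e ->
  let u := rvalue (fun m => r m + kap) (target_core K dl) in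
  regular_value B (fun m => r m + kap) (target_core K dl) ->
  exists n0 : nat, forall n, (n0 < n)%N -> exists (h : 'rV[R]_d -> R) (Q : 'rV[R]_d -> edge d -> R),
    [/\ forall m, S m -> 0 <= h m <= u m + e, forall m a, 0 < Q m a &
      forall m, S m -> ~ K m ->
        (running_cost gamma C r m (Q m) + (generator n gamma h m (Q m))%:E <= 0)%E].
Proof.
move=> rc rM kap0 dl0 cK S0 B0 e0 u [uE uB _ uH]; rewrite -/u in uE uB uH.
have d0 : (0 < d)%N by case: S0 => m /simplex_dim.
have dR : 0 < (d%:R : R) by rewrite ltr0n.
have d1 : 1 <= (d%:R : R) by rewrite ler1n.
have r0 m : S m -> 0 <= r m by move=> /rM/andP[].
have r0' m : S m -> 0 <= r m + kap by move=> h; rewrite addr_ge0 ?r0// ltW.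
have M0 : 0 <= M by case: S0 => m /rM/andP[]; exact: le_trans.
have cu : simplex_continuous u := holder_simplex_continuous B0 uH.
have G0 : 0 <= Gam := total_rate_ge0.
have P0 : 0 <= Phi := natural_cost_ge0.
have k80 : 0 < kap / 8 by rewrite divr_gt0.
have [dlr dlr0 hdlr] := simplex_uniform rc k80.
have dG0 : 0 <= d%:R * Gam by rewrite mulr_ge0.
have k10 : 0 < 1024 * (d%:R * Gam) + 1024 by lra.
pose k : R := Num.min 1 (Num.min (e / 3) (kap / (1024 * (d%:R * Gam) + 1024))).
have k0 : 0 < k by rewrite !lt_min ltr01 !divr_gt0.
have k1 : k <= 1 by rewrite ge_min lexx.
have ke : k <= e / 3 by rewrite !ge_min lexx orbT.
pose e1 : R := k ^+ 2.
have e10 : 0 < e1 by rewrite exprn_gt0.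
have e1k : e1 <= k by rewrite /e1 expr2 ler_piMl// ltW.
have kG : 128 * (d%:R * e1 * Gam) <= kap / 8.
  have h1 : k * (1024 * (d%:R * Gam) + 1024) <= kap by rewrite -ler_pdivlMr// !ge_min lexx !orbT.
  have h2 : d%:R * Gam * e1 <= d%:R * Gam * k by apply: ler_wpM2l.
  have -> : d%:R * e1 * Gam = d%:R * Gam * e1 by ring.
  have h3 : k * (1024 * (d%:R * Gam) + 1024) = 1024 * (d%:R * Gam * k) + 1024 * k by ring.
  exact: supersolution_scale h2 h3 h1 k0.
have [L L0 [G [Gp Gu Gz GL]]] := lipschitz_minorant S0 cu B0 uB e10.
(* The barrier is at most [d], so its contribution is at most [e1]. *)
pose A : R := e1 / d%:R.
have A0 : 0 < A by rewrite divr_gt0.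
have [gm gm0 hgm] := jump_min_rate.
pose Y : R := Phi + M + Gam * (L * d%:R) + A * Gam.
have Y0 : 0 <= Y.
  have h1 : 0 <= Gam * (L * d%:R) by rewrite !mulr_ge0.
  have h2 : 0 <= A * Gam by rewrite mulr_ge0// ltW.
  by rewrite /Y !addr_ge0.
(* With this [R0] the left-hand side of [hneg] equals [- (A * gm / 2)]. *)
pose R0 : R := 2 * Y / (A * gm) + 1.
have Ag : 0 < A * gm by exact: mulr_gt0.
have R00 : 0 < R0 by rewrite ltr_wpDl// divr_ge0 ?(ltW Ag)// mulr_ge0.
have hneg : Phi + M + Gam * (L * d%:R) + A * (Gam - gm * R0 / 2) <= 0.
  have -> : Phi + M + Gam * (L * d%:R) + A * (Gam - gm * R0 / 2) = - (A * gm / 2).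
    by rewrite /R0 /Y; field; rewrite !gt_eqF.
  by rewrite oppr_le0 divr_ge0// ltW.
have [rho rho0 hrho] := heavy_jump R00 hc.
pose sB := Num.sqrt (B + 3).
have B3 : 0 < B + 3 by rewrite ltr_wpDl.
have sB0 : 0 < sB by rewrite sqrtr_gt0.
have B1 : 0 < B + 1 by rewrite ltr_wpDl.
pose cl : R := 8 * d%:R * k.
have cl0 : 0 < cl by rewrite !mulr_gt0.
(* The scale [t] comes after the tolerance [k], the Lipschitz constant [L] and the width [rho] of
   the boundary layer, none of which depends on it; the mesh is chosen after [t]. *)
have [|t t0] := @small_factor R [:: (cl, 2^-1); (cl, rho); (2 * cl, (e1 / 2 / (B + 1)) ^+ 2);
  (L * d%:R * (sB + cl), e1); (2 * cl, dl); (2 * cl, dlr); (cl * (2 * Phi), kap / 8)].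
  by rewrite /= invr_gt0 ltr0n rho0 e10 dl0 dlr0 k80 !(exprn_gt0, divr_gt0).
rewrite /= !(mulrCA t 2) !(mulrA t cl); pose l := t * cl; rewrite -/l.
move=> /and5P[l2 lrho lB lL /and4P[ldl ldlr lP _]].
have {}lL : L * d%:R * (t * sB + l) <= e1 by rewrite /l -mulrDr mulrCA.
have l0 : 0 < l by exact: mulr_gt0.
have l1 : l < 1 by apply: le_lt_trans l2 _; rewrite invf_lt1// ltr1n.
pose b : R := (t ^+ 2)^-1.
have b0 : 0 < b by rewrite invr_gt0 exprn_gt0.
have bl2 : 2 * b * l ^+ 2 / d%:R * Gam <= kap / 8.
  apply: le_trans kG; rewrite le_eqVlt; apply/orP; left; apply/eqP.
  by rewrite /b /l /cl /e1; field; rewrite !gt_eqF.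
have l4d : l / (4 * d%:R) = t * (2 * k) by rewrite /l /cl; field; rewrite gt_eqF.
have [f hf] := @simplex_inf_convolution R d (fun m z => u z + b * sqdist m (to_center l z)) S0
  (fun m => simplex_continuous_add cu (simplex_continuous_scale b
    (simplex_continuous_to_center m l1))).
(* Away from the boundary [f <= u + e1 / 2] and [u <= G + e1], so the lift [2 * e1] puts [g] above
   [f] there. *)
pose g m := G m + A * barrier m + 2 * e1.
pose W : R := kap + Gam * expR (4 * b + 1) + 2 * Gam.
have W0 : 0 <= W by rewrite !addr_ge0 ?mulr_ge0 ?expR_ge0// ltW.
exists (maxn (Num.truncn (8 * b * d%:R * W / kap)) (Num.truncn rho^-1)) => n.
rewrite gtn_max => /andP[n1 n2].
have n0 : (0 < n)%N by case: n n1 {n2}.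
have nR : 0 < (n%:R : R) by rewrite ltr0n.
have nrho : n%:R^-1 <= rho.
  rewrite -[leRHS]invrK lef_pV2 ?posrE ?invr_gt0// ltW//.
  by apply: lt_le_trans (truncnS_gt _) _; rewrite ler_nat.
have nW : b * d%:R / n%:R * W <= kap / 8.
  have : 8 * b * d%:R * W / kap < n%:R.
    by apply: lt_le_trans (truncnS_gt _) _; rewrite ler_nat.
  rewrite ltr_pdivrMr// => h; rewrite mulrAC ler_pdivrMr//; move: h; glra.
pose h m := Num.min (f m) (g m).
have barB m : S m -> 0 <= A * barrier m <= e1.
  move=> /barrier_bounds/andP[h1 h2]; rewrite mulr_ge0 ?(ltW A0)//=.
  rewrite (_ : e1 = A * d%:R); last by rewrite /A divfK// gt_eqF.
  by rewrite ler_wpM2l// ltW.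
have f0 m : S m -> 0 <= f m.
  move=> hm; have [[z hz ->] _] := hf m; have /andP[h1 _] := uB z hz.
  by rewrite addr_ge0// mulr_ge0 ?sqdist_ge0// ltW.
have hbound m : S m -> 0 <= h m <= u m + e.
  move=> hm; have /andP[b1 b2] := barB m hm; have /andP[g1 g2] := Gu m hm; have g3 := Gp m.
  rewrite /h le_min f0//= ge_min; apply/andP; split; first by move: b1 g3 e10; rewrite /g; glra.
  by apply/orP; right; move: b2 g1 e1k ke; rewrite /g; glra.
have step m : S m -> ~ K m -> exists q : edge d -> R, (forall a, 0 < q a) /\
    (running_cost gamma C r m q + (generator n gamma h m q)%:E <= 0)%E.
  move=> hm nK; have [fg|gf] := ltP (f m) (g m).
    have [[z hz fE] _] := hf m.
    have /andP[gb1 gb2] := barB m hm; have /andP[gu1 gu2] := Gu m hm.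
    have /andP[um0 umB] := uB m hm; have /andP[uz0 uzB] := uB z hz.
    have tb (a : R) : b * sqdist m (to_center l z) <= a -> sqdist m (to_center l z) <= t ^+ 2 * a.
      by rewrite /b mulrC ler_pdivrMr ?exprn_gt0// mulrC.
    have c1 : close (t * sB) m (to_center l z).
      apply: sqdist_coord; first by rewrite mulr_ge0 ?ltW.
      rewrite exprMn sqr_sqrtr ?(ltW B3)//; apply: tb; move: fg gb2 gu1 umB uz0 e1k k1; rewrite fE /g; glra.
    have c2 := close_trans c1 (close_to_center hz l0).
    have s1 : L * \sum_x `|m ord0 x - z ord0 x| <= e1.
      apply: le_trans lL; rewrite -mulrA; apply: ler_wpM2l => //.
      rewrite -[in leRHS](card_ord d) mulr_natl -sumr_const; apply: ler_sum => x _; exact: c2.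
    (* [f < g] means that the penalty is at most [G m + 3 * e1 - u z], and the Lipschitz bound on
       [G] makes this at most [4 * e1]. *)
    have c3 : close (l / (4 * d%:R)) m (to_center l z).
      rewrite l4d; apply: sqdist_coord; first by rewrite !mulr_ge0 ?ltW.
      rewrite exprMn; apply: tb.
      have -> : (2 * k) ^+ 2 = 4 * e1 by rewrite /e1; ring.
      have := Gz m z hz; move: fg gb2 s1; rewrite fE /g; glra.
    have c4 : close (2 * l) m z.
      rewrite (_ : 2 * l = l + l); last by ring.
      apply: close_trans (close_to_center hz l0); apply: close_le c3.
      rewrite ler_pdivrMr ?mulr_gt0// ler_peMr ?(ltW l0)//; move: d1; glra.
    have nz : ~ target_core K dl z.
      move=> [_ hcore]; apply: nK; apply: hcore => //; exact: close_le ldl c4.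
    have sep := target_core_separated cK dl0 hz nz.
    have opt z' : S z' -> u z + b * sqdist m (to_center l z) <= u z' + b * sqdist m (to_center l z').
      by move=> hz'; rewrite -fE; exact: (hf m).2.
    have [q [q0 q1 q2]] := interior_control (simplex_continuousD kap rc) r0' uE l0 l2 b0 kap0 hm hz c3 sep opt.
    exists q; split => //; rewrite (running_costE)// -EFinD lee_fin.
    have gen : generator n gamma h m q <= \sum_(a | jump a) m ord0 a.1 * q a *
        (2 * b * (m ord0 a.2 - to_center l z ord0 a.2) - 2 * b * (m ord0 a.1 - to_center l z ord0 a.1))
        + b * d%:R / n%:R * \sum_(a | jump a) m ord0 a.1 * q a.
      rewrite mulr_sumr -big_split/=; apply: ler_sum => a ja; set m' := m + _.
      have hm1 : h m = f m by rewrite /h min_l// ltW.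
      have hm2 : h m' <= u z + b * sqdist m' (to_center l z).
        by rewrite /h ge_min (hf m').2.
      have E : sqdist m' (to_center l z) = sqdist m (to_center l z) +
          n%:R^-1 * (2 * (m ord0 a.2 - to_center l z ord0 a.2) - 2 * (m ord0 a.1 - to_center l z ord0 a.1))
          + n%:R^-1 ^+ 2 * \sum_x jump_vector R a ord0 x ^+ 2.
        rewrite (sqdist_expand m m'); congr (_ + _ + _).
          rewrite -(jump_vector_dot (fun x => 2 * (m ord0 x - to_center l z ord0 x))) mulr_sumr.
          by apply: eq_bigr => x _; rewrite /m' (add_scale_coord m); ring.
        rewrite mulr_sumr; apply: eq_bigr => x _; rewrite /m' add_scale_coord; ring.
      have js := jump_vector_sq R a.
      have key : n%:R * (h m' - h m) <= (2 * b * (m ord0 a.2 - to_center l z ord0 a.2) -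
          2 * b * (m ord0 a.1 - to_center l z ord0 a.1)) + b * d%:R / n%:R.
        rewrite -ler_pdivlMl// hm1 fE.
        have -> : n%:R^-1 * (2 * b * (m ord0 a.2 - to_center l z ord0 a.2) -
            2 * b * (m ord0 a.1 - to_center l z ord0 a.1) + b * d%:R / n%:R) =
          b * (n%:R^-1 * (2 * (m ord0 a.2 - to_center l z ord0 a.2) - 2 * (m ord0 a.1 - to_center l z ord0 a.1)))
          + b * (n%:R^-1 ^+ 2 * d%:R) by field; rewrite gt_eqF.
        have h3 : b * (n%:R^-1 ^+ 2 * \sum_x jump_vector R a ord0 x ^+ 2) <= b * (n%:R^-1 ^+ 2 * d%:R).
          by apply: ler_wpM2l; [exact: ltW|apply: ler_wpM2l => //; exact: sqr_ge0].
        move: hm2 h3; rewrite E !mulrDr; glra.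
      rewrite -(mulrA _ n%:R) [b * d%:R / n%:R * _]mulrC -mulrDr; apply: ler_wpM2l => //.
      by rewrite mulr_ge0 ?simplex_ge0// ltW.
    have bW : b * d%:R / n%:R * (\sum_(a | jump a) m ord0 a.1 * q a) <= kap / 8.
      apply: le_trans nW; apply: ler_wpM2l => //.
      by rewrite divr_ge0// mulr_ge0// ltW.
    have rmz : r m <= r z + kap / 8.
      have := hdlr m z hm hz (close_le ldlr c4); rewrite ler_norml => /andP[_]; glra.
    exact: supersolution_sum q1 gen bW rmz lP bl2 kap0.
  (* Otherwise [m] is itself the centre of a nearby [z], which competes without penalty and forces
     [f < g]. *)
  have [y hy] : exists y, m ord0 y < rho.
    apply: contrapT => H.
    have lm x : l <= m ord0 x.
      by apply: le_trans lrho _; rewrite leNgt; apply/negP => hx; apply: H; exists x.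
    have l02 : 0 < l <= 2^-1 by rewrite l0.
    have [z hz [zE zc]] := from_center hm l02 lm.
    have h1 : f m <= u z by have := (hf m).2 z hz; rewrite zE sqdistxx mulr0 addr0.
    have l21 : 0 < 2 * l <= 1 by rewrite mulr_gt0//= -ler_pdivlMl// mulr1.
    have h2 := uH z m (2 * l) hz hm l21 (closeC zc).
    have h3 : B * Num.sqrt (2 * l) <= e1 / 2 by apply: mul_sqrt_le => //; exact: divr_gt0.
    have /andP[gb1 gb2] := barB m hm; have /andP[gu1 gu2] := Gu m hm.
    move: gf; rewrite leNgt => /negP; apply; move: h1 h2 h3 gb1 gu2 e10; rewrite /g; glra.
  exists (fun a => if jump a then gamma a.1 a.2 else 1); split.
    by move=> a; case: ifPn.
  have hq a : jump a -> 0 < (if jump a then gamma a.1 a.2 else 1) by move=> ja; rewrite ja.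
  rewrite (running_costE)// -EFinD lee_fin.
  have h1 := boundary_control n0 hm (fun m hm => (andP (rM m hm)).2) L0 (ltW A0) (ltW R00) hgm
    (GL m) (hrho m n%:R^-1 y hm nrho hy) hneg.
  apply: le_trans h1.
  have -> : \sum_(a | jump a) m ord0 a.1 * rcost a (if jump a then gamma a.1 a.2 else 1) =
    \sum_(a | jump a) m ord0 a.1 * rcost a (gamma a.1 a.2).
    by apply: eq_bigr => a ->.
  rewrite lerD2l; apply: ler_sum => a ja; rewrite ja; set m' := m + _.
  apply: ler_wpM2l; first by rewrite !mulr_ge0 ?simplex_ge0// ltW.
  have hm1 : h m = g m by rewrite /h min_r.
  have hm2 : h m' <= g m' by rewrite /h ge_min lexx orbT.
  move: hm2; rewrite hm1 /g; glra.
have /choice[Q hQ] : forall m, exists q : edge d -> R, (forall a, 0 < q a) /\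
    (S m -> ~ K m -> (running_cost gamma C r m q + (generator n gamma h m q)%:E <= 0)%E).
  move=> m; have [[hm nK]|hn] := pselect (S m /\ ~ K m).
    by have [q [q0 hq]] := step m hm nK; exists q.
  by exists (fun=> 1); split => // hm nK; exfalso; apply: hn.
exists h, Q; split => //; first by move=> m; exact: (hQ m).1.
by move=> m; exact: (hQ m).2.
Qed.

(** * Convergence of the values *)

Section convergence.

Variables (r : 'rV[R]_d -> R) (K : set 'rV[R]_d).
Hypothesis rc : simplex_continuous r.
Hypothesis r0 : forall m, S m -> 0 <= r m.
Hypothesis KS : K `<=` S.
Hypothesis cK : closed (K : set (subspace S)).
Hypothesis K0 : K !=set0.
Hypothesis rK : forall A : set 'rV[R]_d, compact A -> A `<=` S `\` K ->
  exists2 c : R, 0 < c & forall m, A m -> c <= r m.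
Notation v := (rvalue r K).

Lemma grid_cost_lower n : (0 < n)%N ->
  exists2 c : R, 0 < c & forall m : 'rV[R]_d, prob_grid n m -> ~ K m -> c <= r m.
Proof.
move=> n0; have [||c c0 hc'] := rK (A := [set m | prob_grid n m /\ ~ K m]).
- apply: finite_compact.
  apply: (@sub_finite_set _ _ [set pt R j | j in [set: state d n]]).
    by move=> m [/(grid_pt n0) [j <-] _]; exists j.
  exact/finite_image/finite_finset.
- by move=> m [[hm _] nK].
by exists c => // m hm nK; exact: hc'.
Qed.

(** The lower bound wants a function that vanishes on [K], and no error term. Lowering
    [(1 - kap) * f] by [c0] and truncating at 0 settles the first. Where the truncation is inactive,
    the value is at least [c0 / 2], so the point is away from [K] and the saved
    [kap * r >= kap * cs] pays the error. *)
Lemma value_n_lower_bound (B e : R) : 0 <= B -> 0 < e ->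
  regular_value B r K ->
  exists n0 : nat, forall n (disp : measure_display) (T : measurableType disp)
    (P : probability T R) (N : edge d -> T -> noise R) m,
    (n0 < n)%N -> poisson_noise n gamma P N -> prob_grid n m ->
    ((v m - e)%:E <= value_n n gamma C r K P N m)%E.
Proof.
move=> B0 e0 reg; have [vE vB vK vH] := reg.
have S0 : S !=set0 by case: K0 => k /KS; exists k.
have B1 : 0 < B + 1 by rewrite ltr_wpDl.
pose c0 := e / 4; have c00 : 0 < c0 by rewrite divr_gt0.
pose kap : R := Num.min 2^-1 (e / (4 * (B + 1))).
have kap0 : 0 < kap by rewrite lt_min invr_gt0 ltr0n divr_gt0// mulr_gt0.
have kap1 : kap <= 2^-1 by rewrite ge_min lexx.
have kapB : kap * B <= e / 4.
  have h1 : kap * (4 * (B + 1)) <= e by rewrite -ler_pdivlMr ?mulr_gt0// ge_min lexx orbT.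
  lra.
(* Within [lam] of [K] the value is below [c0 / 2], by Hoelder continuity. *)
pose lam : R := Num.min 1 ((c0 / 4 / (B + 1)) ^+ 2).
have lam0 : 0 < lam by rewrite lt_min ltr01 exprn_gt0// !divr_gt0.
have lam1 : lam <= 1 by rewrite ge_min lexx.
have lamB : B * Num.sqrt lam < c0 / 2.
  apply: (@le_lt_trans _ _ (c0 / 4)); last by lra.
  by apply: mul_sqrt_le; rewrite ?divr_gt0// ge_min lexx orbT.
have [|cs cs0 hcs] := rK (@away_compact R d K lam).
- by move=> m [hm far]; split => // Km; have [x] := far m Km; rewrite subrr normr0 leNgt lam0.
pose e' : R := Num.min (c0 / 2) (kap * cs).
have e'0 : 0 < e' by rewrite lt_min divr_gt0// mulr_gt0.
have e'c : e' <= c0 / 2 by rewrite ge_min lexx.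
have e'k : e' <= kap * cs by rewrite ge_min lexx orbT.
have [f [n0 [fv fH]]] := discrete_subsolution rc r0 S0 B0 e'0 reg.
pose g m := Num.max ((1 - kap) * f m - c0) 0.
have g0 m : 0 <= g m by rewrite le_max lexx orbT.
exists n0 => n disp T P N m nn HN gm.
have n1 : (0 < n)%N by case: n nn {HN gm}.
have [c cp hcr] := grid_cost_lower n1.
apply: (@le_trans _ _ (g m)%:E).
  have /andP[h1 _] := fv m gm.1; have /andP[h2 h3] := vB m gm.1.
  rewrite lee_fin le_max; apply/orP; left.
  have h4 : (1 - kap) * (v m - e') <= (1 - kap) * f m by apply: ler_wpM2l => //; lra.
  have h5 : kap * v m <= kap * B by apply: ler_wpM2l => //; exact: ltW.
  have h6 : 0 <= kap * e' by rewrite mulr_ge0// ltW.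
  have h7 : (1 - kap) * (v m - e') = v m - e' - kap * v m + kap * e' by ring.
  rewrite /c0 in e'c *; lra.
apply: (value_n_ge HN n1 gd mF F0 (fun m hm => r0 hm.1) cp) => //.
- move=> m' gm' Km'; apply: max_r; have /andP[_ h1] := fv m' gm'.1.
  rewrite vK// add0r in h1.
  have h2 : (1 - kap) * f m' <= (1 - kap) * e' by apply: ler_wpM2l => //; lra.
  have h3 : 0 <= kap * e' by rewrite mulr_ge0// ltW.
  have h4 : (1 - kap) * e' = e' - kap * e' by ring.
  lra.
move=> m' x gm' nK x0; rewrite (running_costE)// -EFinD lee_fin.
set X := \sum_(a | _) _.
have X0 : 0 <= X.
  by apply: sumr_ge0 => a ja; rewrite mulr_ge0 ?(simplex_ge0 _ gm'.1)//; exact: (rcost_ge0 ja (x0 a ja)).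
have w0 a : jump a -> 0 <= m' ord0 a.1 * x a * n%:R.
  by move=> ja; rewrite !mulr_ge0 ?(simplex_ge0 _ gm'.1)// ltW// x0.
have [gp|gz] := ltP 0 (g m'); last first.
  have gE : g m' = 0 by apply/eqP; rewrite eq_le gz g0.
  rewrite !addr_ge0 ?(r0 gm'.1)//; apply: sumr_ge0 => a ja.
  by rewrite mulr_ge0 ?w0// gE subr0.
have gE : g m' = (1 - kap) * f m' - c0.
  by move: gp; rewrite /g lt_max ltxx orbF => h; rewrite max_l// ltW.
have fc : c0 < f m'.
  have f0 : 0 <= f m'.
    rewrite leNgt; apply/negP => fn; have : (1 - kap) * f m' < 0 by rewrite pmulr_rlt0//; lra.
    by move: gp c00; rewrite gE; lra.
  have : 0 <= kap * f m' by rewrite mulr_ge0// ltW.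
  by move: gp; rewrite gE mulrBl mul1r; lra.
have vc : c0 / 2 <= v m' by have /andP[_ h] := fv m' gm'.1; lra.
have rcs : cs <= r m'.
  apply: hcs; split; first exact: gm'.1.
  move=> k Kk; apply: contrapT => H.
  have cl : close lam m' k.
    by move=> y; rewrite leNgt; apply/negP => /ltW h; apply: H; exists y.
  have lam01 : 0 < lam <= 1 by rewrite lam0.
  by have := vH m' k lam gm'.1 (KS Kk) lam01 cl; rewrite (vK k Kk); lra.
have gen : (1 - kap) * generator n gamma f m' x <= generator n gamma g m' x.
  rewrite /generator mulr_sumr; apply: ler_sum => a ja.
  rewrite mulrCA; apply: ler_wpM2l; first exact: w0.
  have : (1 - kap) * f (m' + n%:R^-1 *: jump_vector R a) - c0 <= g (m' + n%:R^-1 *: jump_vector R a).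
    by rewrite le_max lexx.
  by rewrite gE mulrBr; lra.
have := fH n m' x nn gm'.1 x0; rewrite (running_costE)// -!EFinD lee_fin -/X => h1.
have h2 : 0 <= (1 - kap) * (X + r m' + generator n gamma f m' x + e').
  by rewrite mulr_ge0//; lra.
have h3 : kap * cs <= kap * r m' by apply: ler_wpM2l => //; exact: ltW.
have h4 : 0 <= kap * X by rewrite mulr_ge0// ltW.
have h5 : 0 <= kap * e' by rewrite mulr_ge0// ltW.
rewrite !mulrDr !mulrBl !mul1r in h2 gen.
lra.
Qed.

Hypothesis Kreg : K = closure (interior (K : set (subspace S))).

Lemma value_n_upper_bound (e : R) : 0 < e ->
  exists n0 : nat, forall n (disp : measure_display) (T : measurableType disp)
    (P : probability T R) (N : edge d -> T -> noise R) m,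
    (n0 < n)%N -> poisson_noise n gamma P N -> prob_grid n m ->
    (value_n n gamma C r K P N m <= (v m + e)%:E)%E.
Proof.
move=> e0; have e2 : 0 < e / 2 by rewrite divr_gt0.
have S0 : S !=set0 by case: K0 => k /KS; exists k.
have [M rM] := simplex_bounded rc.
have [kap [dl [/andP[kap0 kap1] dl0 core0 hcore]]] :=
  shifted_value_le rc r0 KS cK Kreg K0 rK e2.
have [B B0 hreg] := value_regular (M + 1).
have rM1 m : S m -> 0 <= r m + kap <= M + 1.
  by move=> hm; rewrite addr_ge0 ?r0 ?(ltW kap0)// lerD ?rM.
have coreS : target_core K dl `<=` S by move=> m [].
have reg := hreg _ _ (simplex_continuousD kap rc) rM1 coreS core0.
have rM0 m : S m -> 0 <= r m <= M by move=> hm; rewrite r0 ?rM.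
have [n0 hn0] := discrete_supersolution rc rM0 kap0 dl0 cK S0 B0 e2 reg.
exists n0 => n disp T P N m nn HN gm.
have n1 : (0 < n)%N by case: n nn {HN gm}.
have [h [Q [hb Q0 hQ]]] := hn0 n nn.
have /andP[_ h1] := hb m gm.1; have h2 := hcore m gm.1.
apply: (@le_trans _ _ (h m)%:E); last by rewrite lee_fin; lra.
apply: (value_n_le HN n1 gd mF F0 (fun m hm => r0 hm.1) (Q := Q)) => //.
- by move=> m' [hm' _]; have /andP[] := hb m' hm'.
- by move=> m' [hm' _] nK; exact: hQ.
Qed.

End convergence.

End control_problem.

Lemma prob_grid_vertex (R : realType) (d n : nat) (x : 'I_d) :
  prob_grid n (delta_mx ord0 x : 'rV[R]_d).
Proof.
split=> [|y]; last by rewrite mxE eqxx/= -natrM rpred_nat.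
split=> [y|]; first by rewrite mxE ler0n.
by rewrite (bigD1 x)//= mxE !eqxx big1 ?addr0// => y yx; rewrite mxE (negPf yx) andbF.
Qed.

Lemma ereal_sup_abs_cvg0 (R : realType) (T : Type) (A : nat -> set T) (f : nat -> T -> \bar R) :
  (\forall n \near \oo, A n !=set0) ->
  (forall e : R, 0 < e -> \forall n \near \oo, forall x, A n x -> (`|f n x| <= e%:E)%E) ->
  ereal_sup [set `|f n x|%E | x in A n] @[n --> \oo] --> 0%E.
Proof.
move=> A0 fA.
have bounds (e : R) : 0 < e -> \forall n \near \oo,
    (0 <= ereal_sup [set `|f n x| | x in A n] <= e%:E)%E.
  move=> e0; near=> n.
  have [x Ax] : A n !=set0 by near: n.
  have fe : forall x, A n x -> (`|f n x| <= e%:E)%E by near: n; exact: fA.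
  apply/andP; split.
    by apply: (@le_trans _ _ `|f n x|%E) => //; apply: ereal_sup_ubound; exists x.
  by apply: ge_ereal_sup => _ [y Ay <-]; exact: fe.
apply/fine_cvgP; split.
  near=> n; have /andP[h1 h2] : (0 <= ereal_sup [set `|f n x| | x in A n] <= 1%:E)%E.
    by near: n; exact: bounds.
  by rewrite fin_numElt (lt_le_trans _ h1) ?ltNy0//= (le_lt_trans h2) ?ltry.
apply/cvgrPdist_le => e e0; near=> n.
have : (0 <= ereal_sup [set `|f n x| | x in A n] <= e%:E)%E by near: n; exact: bounds.
rewrite sub0r normrN /=; case: ereal_sup => [s| |] //=; last by rewrite normr0 ltW.
by rewrite !lee_fin => /andP[h1 h2]; rewrite ger0_norm.
Unshelve. all: by end_near.
Qed.

Theorem theorem4p4 (R : realType) (d : nat) (gamma : 'I_d -> 'I_d -> R)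
    (C : 'I_d * 'I_d -> R -> \bar R) (r : 'rV[R]_d -> R) (K : set 'rV[R]_d)
    (disp : nat -> measure_display)
    (Omega : forall n : nat, measurableType (disp n))
    (P : forall n : nat, probability (Omega n) R)
    (N : forall n : nat,
       'I_d * 'I_d -> Omega n -> {measure set (plane R) -> \bar R}) :
  ergodic_rates gamma ->
  (forall n : nat, (0 < n)%N -> poisson_noise n gamma (P n) (N n)) ->
  assumptionA gamma C r ->
  assumptionB gamma C ->
  K `<=` @prob_simplex R d ->
  closed (K : set (subspace (@prob_simplex R d))) ->
  K = closure (interior (K : set (subspace (@prob_simplex R d)))) ->
  K !=set0 ->
  (forall A : set 'rV[R]_d, compact A -> A `<=` @prob_simplex R d `\` K ->
     exists2 c : R, 0 < c & forall m, A m -> c <= r m) ->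
  (fun n : nat => ereal_sup
     [set `|value_n n gamma C r K (P n) (N n) m - value gamma C r K m|%E
     | m in @prob_grid R d n]) @ \oo --> 0%E.
Proof.
move=> [_ gd hc] HN [rcont r0 hA] hB KS cK Kreg K0 rK.
have cC e : jumps gamma e -> convex_cost (C e) by move=> /hA[].
have C1 e : jumps gamma e -> C e 1 = 0%E by move=> /hA[].
have rc := continuous_simplex rcont.
have [M rM] := simplex_bounded rc.
have [B B0 hreg] := value_regular hc cC C1 hB M.
have rM0 m : prob_simplex m -> 0 <= r m <= M by move=> hm; rewrite r0 ?rM.
have reg := hreg r K rc rM0 KS K0; have [vE _ _ _] := reg.
have d0 : (0 < d)%N by case: K0 => k /KS /simplex_dim.
apply: ereal_sup_abs_cvg0.
  by exists 0%N => // n _; exists (delta_mx ord0 (Ordinal d0)); exact: prob_grid_vertex.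
move=> e e0.
have [n1 h1] := value_n_lower_bound cC C1 hB gd rc r0 KS K0 rK B0 e0 reg.
have [n2 h2] := value_n_upper_bound hc cC C1 hB gd rc r0 KS cK K0 rK Kreg e0.
exists (maxn n1 n2).+1 => // n /=; rewrite gtn_max => /andP[nn1 nn2] m hm.
have n0 : (0 < n)%N by case: n nn1 {nn2 hm}.
have := h1 _ _ _ _ _ m nn1 (HN n n0) hm; have := h2 _ _ _ _ _ m nn2 (HN n n0) hm.
rewrite (vE m hm.1); case: (value_n _ _ _ _ _ _ _ _) => [x| |] //.
move=> ux lx; rewrite -EFinB abse_EFin; rewrite !lee_fin in ux lx *; rewrite ler_norml.
by apply/andP; split; lra.
Qed.
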